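(* For the continuous control problem described in the context, the following hold: (a) the operator $S:\mathcal Z\to\mathcal U$ is linear and bounded; (b) the admissible set $\mathcal Z_{\mathrm{ad}}$ is closed and convex in $\mathcal Z$, hence it is also weakly closed; (c) the functional $j:\mathcal Z\to\mathbb R$ is continuous and (strictly) convex, therefore it is also weakly lower semicontinuous; (d) the functional $j:\mathcal Z\to\mathbb R$ is coercive. Therefore the control problem ''minimize $j(z)$ subject to $z\in\mathcal Z_{\mathrm{ad}}$'' has a unique (weak) solution, i.e. there is exactly one $z\in\mathcal Z_{\mathrm{ad}}$ at which $j$ attains its minimum over $\mathcal Z_{\mathrm{ad}}$.
   Context: Setting. $\Omega\subset\mathbb R^d$ is a bounded Lipschitz domain with boundary $\Gamma$, partitioned into two non-overlapping relatively open sets $\Gamma_D,\Gamma_N$ ($\Gamma_D=\emptyset$ is allowed), and $T>0$. $A:B$ is the Frobenius product of matrices and $\mathbb R^{d\times d}_{\mathrm{sym}}$ the symmetric matrices. The coefficients $\mathcal C\in L^\infty(\Omega;\mathbb R^{(d\times d)\times(d\times d)})$, $\mathcal E\in L^\infty(\Omega;\mathbb R^{(d\times d)\times d})$, $\boldsymbol\kappa\in L^\infty(\Omega;\mathbb R^{d\times d}_{\mathrm{sym}})$ satisfy, a.e. in $\Omega$ and with constants $c_0,k_0>0$: $\mathcal CA\in\mathbb R^{d\times d}_{\mathrm{sym}}$ and $(\mathcal CA):B=A:(\mathcal CB)$ for all $A,B\in\mathbb R^{d\times d}$; $(\mathcal CA):A\ge c_0A:A$ for $A\in\mathbb R^{d\times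 d}_{\mathrm{sym}}$; $\mathcal E\mathbf b\in\mathbb R^{d\times d}_{\mathrm{sym}}$ and $(\boldsymbol\kappa\mathbf b)\cdot\mathbf b\ge k_0|\mathbf b|^2$ for $\mathbf b\in\mathbb R^d$. $\mathcal E^\top$ is defined by $(\mathcal E^\top A)\cdot\mathbf b=A:(\mathcal E\mathbf b)$. The density $\rho\in L^\infty(\Omega)$ is strictly positive ($\rho\ge\rho_0>0$ a.e.). $\boldsymbol\varepsilon(\mathbf u)=\frac12(\nabla\mathbf u+\nabla\mathbf u^\top)$. Spaces. $(\cdot,\cdot)_\Omega$, $\|\cdot\|_\Omega$, $\|\cdot\|_\Gamma$ are $L^2$ inner product/norms on $\Omega$, $\Gamma$; $\|\cdot\|_{1,\Omega}$ is the $H^1(\Omega)$ norm; $\gamma$ is the trace operator to $\Gamma$; $\langle\cdot,\cdot\rangle_\Gamma$ is the $H^{-1/2}(\Gamma)\times H^{1/2}(\Gamma)$ duality, extending the $L^2(\Gamma)$ product. $\mathbf H^1_D(\Omega)$ is the space of $\mathbf u\in H^1(\Omega)^d$ with zero trace on $\Gamma_D$ (all of $H^1(\Omega)^d$ if $\Gamma_D=\emptyset$). $\mathbf L^2_\rho(\Omega)$ is $L^2(\Omega)^d$ with inner product $(\cdot,\cdot)_\rho=(\rho\,\cdot,\cdot)_\Omega$ and norm $\|\cdot\|_\rho$; $\mathbf H^{-1}_D(\Omega)$ is the dual of $\mathbf H^1_D(\Omega)$ when $\mathbf L^2_\rho(\Omega)$ is identified with its dual, and $\langle\cdot,\cdot\rangle_\rho$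 is the corresponding duality product. $G:H^1(\Omega)\to\mathbb R$ is linear, bounded, with $G1\ne0$; $H^1_G(\Omega)=\{\psi\in H^1(\Omega):G\psi=0\}$. $L^2_0(\Gamma)=\{z\in L^2(\Gamma):\int_\Gamma z=0\}$. $\mathcal Z=\{z\in H^1(0,T;L^2_0(\Gamma)):z(0)=0\}$ is a Hilbert space with norm $\|z\|_{\mathcal Z}=\left(\int_0^T\|\dot z(\tau)\|_\Gamma^2\,\mathrm d\tau\right)^{1/2}$. $\mathcal U=C^0([0,T];\mathbf H^1_D(\Omega))$ with the (non-complete) norm $\left(\int_0^T\|\mathbf u(\tau)\|_{1,\Omega}^2\,\mathrm d\tau\right)^{1/2}$. State equation. With $a((\mathbf u,\psi),(\mathbf w,\varphi))=(\mathcal C\boldsymbol\varepsilon(\mathbf u)+\mathcal E\nabla\psi,\boldsymbol\varepsilon(\mathbf w))_\Omega+(-\mathcal E^\top\boldsymbol\varepsilon(\mathbf u)+\boldsymbol\kappa\nabla\psi,\nabla\varphi)_\Omega$, a solution with data $z\in\mathcal Z$ is a pair $\mathbf u\in C^0([0,T];\mathbf H^1_D(\Omega))\cap C^1([0,T];\mathbf L^2_\rho(\Omega))\cap C^2([0,T];\mathbf H^{-1}_D(\Omega))$, $\psi\in C^0([0,T];H^1_G(\Omega))$ such that for all $t\in[0,T]$ $$\langle\ddot{\mathbf u}(t),\mathbf w\rangle_\rho+a((\mathbf u(t),\psi(t)),(\mathbf w,\varphi))=-\langle z(t),\gamma\varphi\rangle_\Gamma\quad\forall(\mathbf w,\varphi)\in\mathbf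 H^1_D(\Omega)\times H^1_G(\Omega),$$ and $\mathbf u(0)=\mathbf 0$, $\dot{\mathbf u}(0)=\mathbf 0$. It has a unique solution, and $S:\mathcal Z\to\mathcal U$ is given by $Sz=\mathbf u$. Control problem. $\mathcal Z_{\mathrm{ad}}=\{z\in\mathcal Z: z_a\le z(t)\le z_b\text{ a.e. on }\Gamma,\ \forall t\in[0,T]\}$ with constants $z_a\le0\le z_b$; $\mathbf u_d\in\mathcal U$ is a given desired state with $\mathbf u_d(0)=\mathbf 0$; $\alpha>0$ is a constant; and $$j(z)=\frac12\int_0^T\|Sz(t)-\mathbf u_d(t)\|_\rho^2\,\mathrm dt+\frac\alpha2\int_0^T\|\dot z(t)\|_\Gamma^2\,\mathrm dt.$$ Coercive means $j(z)\to\infty$ as $\|z\|_{\mathcal Z}\to\infty$. *)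

(* Defs.v *)
From HB Require Import structures.
From mathcomp Require Import all_boot all_order all_algebra.
From mathcomp Require Import all_classical all_reals all_analysis.

Set Implicit Arguments.
Unset Strict Implicit.
Unset Printing Implicit Defensive.
Import Order.TTheory GRing.Theory Num.Theory.
Import numFieldNormedType.Exports.
Local Open Scope classical_set_scope.
Local Open Scope ring_scope.

(* Elements of function spaces are represented by actual functions; every space
   is a set [D] of functions together with a seminorm [N], and [v], [w] are the
   same element of the space when [N (v - w) = 0]. *)

Section euclidean.
Context (R : realType) (d : nat).

Definition dot (u v : 'rV[R]_d) : R := \sum_i u 0 i * v 0 i.

(* The library norm of ['rV_d] is the sup norm. *)
Definition enorm (u : 'rV[R]_d) : R := Num.sqrt (dot u u).

Definition frobenius (A B : 'M[R]_d) : R := \sum_i \sum_j A i j * B i j.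

Definition symmetric_mx (A : 'M[R]_d) : Prop := A^T = A.

Definition apply4 (C : 'I_d -> 'I_d -> 'I_d -> 'I_d -> R) (A : 'M[R]_d) : 'M[R]_d :=
  \matrix_(i, j) \sum_k \sum_l C i j k l * A k l.

Definition apply3 (E : 'I_d -> 'I_d -> 'I_d -> R) (b : 'rV[R]_d) : 'M[R]_d :=
  \matrix_(i, j) \sum_k E i j k * b 0 k.

(* dot (apply3_tr E A) b = frobenius A (apply3 E b) *)
Definition apply3_tr (E : 'I_d -> 'I_d -> 'I_d -> R) (A : 'M[R]_d) : 'rV[R]_d :=
  \row_k \sum_i \sum_j A i j * E i j k.

(* The matrix-vector product, for vectors stored as rows. *)
Definition apply2 (K : 'M[R]_d) (b : 'rV[R]_d) : 'rV[R]_d := b *m K^T.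

End euclidean.

Section measures.
Context (R : realType).

(* [mu_ext] over the discrete sigma-algebra: countable covers by arbitrary
   sets. *)
Definition all_sets (d : nat) := g_sigma_algebraType [set: set 'rV[R]_d].

Lemma all_sets_measurable d (A : set (all_sets d)) : measurable A.
Proof. exact: sub_gen_smallest. Qed.

Definition box d (a b : 'rV[R]_d) : set 'rV[R]_d :=
  [set x | forall i, a 0 i <= x 0 i <= b 0 i].

(* The volume of the smallest closed box containing [A] (+oo if there is none),
   so that the outer measure it generates is the Lebesgue one. *)
Definition box_volume d (A : set (all_sets d)) : \bar R :=
  if `[< A = set0 >] then 0%E else
  ereal_inf [set (\prod_i (p.2 0 i - p.1 0 i))%:E
    | p in [set p : 'rV[R]_d * 'rV[R]_d |
              (forall i, p.1 0 i <= p.2 0 i) /\ A `<=` box p.1 p.2]].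

Lemma box_volume0 d : @box_volume d set0 = 0%E.
Proof. by rewrite /box_volume; case: asboolP. Qed.

Lemma box_volume_ge0 d (A : set (all_sets d)) : (0 <= box_volume A)%E.
Proof.
rewrite /box_volume; case: asboolP => // _.
apply: le_ereal_inf_tmp => _ [[a b] /= [ab _] <-].
by rewrite lee_fin prodr_ge0// => i _; rewrite subr_ge0.
Qed.

Definition lebesgue_outer d (A : set 'rV[R]_d) : \bar R :=
  mu_ext (@box_volume d) A.

Lemma lebesgue_outer0 d : @lebesgue_outer d set0 = 0%E.
Proof. exact: (mu_ext0 (@box_volume0 d) (@box_volume_ge0 d)). Qed.

Lemma lebesgue_outer_ge0 d A : (0 <= @lebesgue_outer d A)%E.
Proof. exact: (mu_ext_ge0 (@box_volume_ge0 d)). Qed.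

Lemma le_lebesgue_outer d :
  {homo @lebesgue_outer d : A B / A `<=` B >-> (A <= B)%E}.
Proof. by move=> A B; exact: (@le_mu_ext _ (all_sets d) R (@box_volume d)). Qed.

Lemma lebesgue_outer_sigma_subadditive d : sigma_subadditive (@lebesgue_outer d).
Proof. exact: (mu_ext_sigma_subadditive (@box_volume_ge0 d)). Qed.

HB.instance Definition _ d := isOuterMeasure.Build R 'rV[R]_d (@lebesgue_outer d)
  (@lebesgue_outer0 d) (@lebesgue_outer_ge0 d) (@le_lebesgue_outer d)
  (@lebesgue_outer_sigma_subadditive d).

Definition lebesgue_outer_measure d : {outer_measure set 'rV[R]_d -> \bar R} :=
  @lebesgue_outer d.

Definition lebesgue_rV d :
    {measure set (caratheodory_type (lebesgue_outer_measure d)) -> \bar R} :=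
  lebesgue_outer_measure d.

Definition diameter d (A : set 'rV[R]_d) : \bar R :=
  ereal_sup [set (enorm (p.1 - p.2))%:E | p in A `*` A].

(* With this factor the s-dimensional Hausdorff measure is the s-dimensional
   surface measure: the volume of the unit ball of R^s over 2^s. *)
Definition hausdorff_factor (s : nat) : R :=
  fine (lebesgue_outer [set x : 'rV[R]_s | enorm x <= 1]) / 2 ^+ s.

Definition hausdorff_gauge d (s : nat) (delta : R) (A : set (all_sets d)) : \bar R :=
  if `[< A = set0 >] then 0%E else
  if (diameter A <= delta%:E)%E then
    (hausdorff_factor s * fine (diameter A) ^+ s)%:E
  else +oo%E.

Lemma hausdorff_gauge0 d s delta : @hausdorff_gauge d s delta set0 = 0%E.
Proof. by rewrite /hausdorff_gauge; case: asboolP. Qed.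

Lemma hausdorff_gauge_ge0 d s delta (A : set (all_sets d)) :
  (0 <= hausdorff_gauge s delta A)%E.
Proof.
rewrite /hausdorff_gauge; case: asboolP => // /eqP/set0P[x Ax].
case: ifPn => // _; rewrite lee_fin mulr_ge0 ?exprn_ge0//.
  by rewrite divr_ge0 ?exprn_ge0// fine_ge0// outer_measure_ge0.
apply/fine_ge0/ereal_sup_ubound; exists (x, x) => //=.
rewrite subrr /enorm /dot big1 ?sqrtr0// => i _.
by rewrite mxE mul0r.
Qed.

Definition hausdorff_outer d (s : nat) (A : set 'rV[R]_d) : \bar R :=
  ereal_sup [set mu_ext (@hausdorff_gauge d s delta) A | delta in [set e | 0 < e]].

Lemma hausdorff_outer0 d s : @hausdorff_outer d s set0 = 0%E.
Proof.
rewrite /hausdorff_outer (_ : [set _ | _ in _] = [set 0%E]) ?ereal_sup1//.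
apply/seteqP; split => [_ [e _ <-]|_ ->] /=.
  exact: (mu_ext0 (@hausdorff_gauge0 d s e) (@hausdorff_gauge_ge0 d s e)).
exists 1 => //=.
exact: (mu_ext0 (@hausdorff_gauge0 d s 1) (@hausdorff_gauge_ge0 d s 1)).
Qed.

Lemma hausdorff_outer_ge0 d s A : (0 <= @hausdorff_outer d s A)%E.
Proof.
apply: (le_trans (mu_ext_ge0 (@hausdorff_gauge_ge0 d s 1) A)).
by apply: ereal_sup_ubound; exists 1 => /=.
Qed.

Lemma le_hausdorff_outer d s :
  {homo @hausdorff_outer d s : A B / A `<=` B >-> (A <= B)%E}.
Proof.
move=> A B AB; apply: ge_ereal_sup => _ [e /= e0 <-].
apply: (le_trans (@le_mu_ext _ (all_sets d) R (@hausdorff_gauge d s e) _ _ AB)).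
by apply: ereal_sup_ubound; exists e.
Qed.

Lemma hausdorff_outer_sigma_subadditive d s :
  sigma_subadditive (@hausdorff_outer d s).
Proof.
move=> F; apply: ge_ereal_sup => _ [e /= e0 <-].
apply: (le_trans (mu_ext_sigma_subadditive (@hausdorff_gauge_ge0 d s e) F)).
apply: lee_nneseries => [k _ _|k _].
  exact: (mu_ext_ge0 (@hausdorff_gauge_ge0 d s e)).
by apply: ereal_sup_ubound; exists e.
Qed.

HB.instance Definition _ d s := isOuterMeasure.Build R 'rV[R]_d (@hausdorff_outer d s)
  (@hausdorff_outer0 d s) (@hausdorff_outer_ge0 d s) (@le_hausdorff_outer d s)
  (@hausdorff_outer_sigma_subadditive d s).

Definition hausdorff_outer_measure d s : {outer_measure set 'rV[R]_d -> \bar R} :=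
  @hausdorff_outer d s.

Definition hausdorff_measure d s :
    {measure set (caratheodory_type (hausdorff_outer_measure d s)) -> \bar R} :=
  hausdorff_outer_measure d s.

Definition surface_measure d := hausdorff_measure d d.-1.

End measures.

Section domains.
Context (R : realType) (d : nat).
Implicit Types Om : set 'rV[R]_d.

Definition boundary Om : set 'rV[R]_d := closure Om `\` interior Om.

(* Near each boundary point, and in the coordinates given by a unit vector [e]
   and its orthogonal complement, [Om] is the strict hypograph of a Lipschitz
   function. *)
Definition lipschitz_boundary Om : Prop :=
  forall x, boundary Om x ->
  exists (e : 'rV[R]_d) (zeta : 'rV[R]_d -> R) (L : R),
    [/\ enorm e = 1,
        forall a b, `|zeta a - zeta b| <= L * enorm (a - b) &
        \forall y \near x, Om y <-> dot y e < zeta (y - dot y e *: e)].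

Definition bounded_lipschitz_domain Om : Prop :=
  [/\ open Om, connected Om, Om !=set0, bounded_set Om & lipschitz_boundary Om].

Definition relatively_open (Y A : set 'rV[R]_d) : Prop :=
  exists2 O, open O & A = Y `&` O.

End domains.

Section seminormed.
Context (R : realType).

Definition bounded_functional (V : lmodType R) (D : set V) (N : V -> R)
    (l : V -> R) : Prop :=
  (forall a v w, D v -> D w -> l (a *: v + w) = a * l v + l w) /\
  exists M, forall v, D v -> `|l v| <= M * N v.

Definition dual_norm (V : lmodType R) (D : set V) (N : V -> R) (l : V -> R) : R :=
  sup [set `|l v| | v in [set v | D v /\ N v <= 1]].

Definition bounded_linear_operator (V W : lmodType R) (D : set V) (N : V -> R)
    (D' : set W) (N' : W -> R) (S : V -> W) : Prop :=
  [/\ forall v, D v -> D' (S v),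
      forall a v w, D v -> D w -> N' (S (a *: v + w) - (a *: S v + S w)) = 0 &
      exists M, forall v, D v -> N' (S v) <= M * N v].

Section topology.
Context (V : lmodType R) (D : set V) (N : V -> R).

Definition seminorm_closed (A : set V) : Prop :=
  forall v, D v ->
  (forall e, 0 < e -> exists2 a, A a & N (a - v) < e) -> A v.

(* A point of [D] all of whose basic weak neighbourhoods meet [A] is in [A]. *)
Definition weakly_closed (A : set V) : Prop :=
  forall v, D v ->
  (forall n (l : 'I_n -> V -> R) e,
     (forall i, bounded_functional D N (l i)) -> 0 < e ->
     exists2 a, A a & forall i, `|l i a - l i v| < e) -> A v.

Definition seminorm_continuous (f : V -> R) : Prop :=
  forall v, D v -> forall e, 0 < e -> exists2 del, 0 < del &
  forall w, D w -> N (w - v) < del -> `|f w - f v| < e.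

Definition weakly_lower_semicontinuous (f : V -> R) : Prop :=
  forall v, D v -> forall r, r < f v ->
  exists n (l : 'I_n -> V -> R) e,
    [/\ forall i, bounded_functional D N (l i), 0 < e &
        forall w, D w -> (forall i, `|l i w - l i v| < e) -> r < f w].

Definition strictly_convex (f : V -> R) : Prop :=
  forall v w t, D v -> D w -> N (v - w) != 0 -> 0 < t < 1 ->
  f (t *: v + (1 - t) *: w) < t * f v + (1 - t) * f w.

Definition coercive (f : V -> R) : Prop :=
  forall M, exists K, forall v, D v -> K < N v -> M < f v.

End topology.
End seminormed.

Section time.
Context (R : realType) (T : R) (V : lmodType R).
Local Notation leb := (@lebesgue_measure R).

Section classical.
Context (D : set V) (N : V -> R).

Definition C0_time (f : R -> V) : Prop :=
  (forall t, t \in `[0, T] -> D (f t)) /\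
  forall t, t \in `[0, T] -> forall e, 0 < e -> exists2 del, 0 < del &
  forall s, s \in `[0, T] -> `|s - t| < del -> N (f s - f t) < e.

Definition time_derivative (f f' : R -> V) : Prop :=
  forall t, t \in `[0, T] -> forall e, 0 < e -> exists2 del, 0 < del &
  forall s, s \in `[0, T] -> s != t -> `|s - t| < del ->
    N ((s - t)^-1 *: (f s - f t) - f' t) < e.

Definition C1_time (f f' : R -> V) : Prop :=
  [/\ C0_time f, C0_time f' & time_derivative f f'].

Definition C2_time (f f' f'' : R -> V) : Prop :=
  C1_time f f' /\ C1_time f' f''.

Definition simple_time (s : seq (set R * V)) (t : R) : V :=
  \sum_(p <- s) \1_(p.1) t *: p.2.

Definition strongly_measurable (f : R -> V) : Prop :=
  exists s : (seq (set R * V))^nat,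
    (forall n (k : 'I_(size (s n))),
       let p := tnth (in_tuple (s n)) k in measurable p.1 /\ D p.2) /\
    {ae leb, forall t, t \in `[0, T] ->
       (fun n => N (simple_time (s n) t - f t)) @ \oo --> (0 : R)}.

Definition L2_time (f : R -> V) : Prop :=
  [/\ forall t, t \in `[0, T] -> D (f t), strongly_measurable f &
      (\int[leb]_(t in `[0%R, T]) ((N (f t)) ^+ 2)%:E < +oo)%E].

End classical.

(* C^oo: all iterated directional derivatives are differentiable. *)
Definition smooth (E : normedModType R) (f : E -> R) : Prop :=
  forall (vs : seq E) (x : E), differentiable (foldr (fun v g => 'D_v g) f vs) x.

Definition test_function (E : normedModType R) (U : set E) (f : E -> R) : Prop :=
  smooth f /\
  exists K : set E, [/\ compact K, K `<=` U & forall x, ~ K x -> f x = 0].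

Section weak_derivative.
Context (D : set V) (N : V -> R) (ip : V -> V -> R).

(* Equality of the Bochner integrals of [eta' z] and [- eta g], tested against
   all elements of the Hilbert space. *)
Definition weak_time_derivative (z g : R -> V) : Prop :=
  L2_time D N g /\
  forall (eta : R -> R) x, test_function `]0, T[%classic eta -> D x ->
    \int[leb]_(t in `[0, T]) (ip (z t) x * 'D_1 eta t) =
    - \int[leb]_(t in `[0, T]) (ip (g t) x * eta t).

Definition H1_time (z : R -> V) : Prop :=
  L2_time D N z /\ exists g, weak_time_derivative z g.

Definition dt (z : R -> V) : R -> V := xget (fun=> 0) (weak_time_derivative z).

End weak_derivative.
End time.

Section L2.
Context (disp : measure_display) (X : measurableType disp) (R : realType).
Context (mu : {measure set X -> \bar R}) (D : set X).

Definition L2 (f : X -> R) : Prop :=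
  measurable_fun D f /\ (\int[mu]_(x in D) ((f x) ^+ 2)%:E < +oo)%E.

Definition Linfty (f : X -> R) : Prop :=
  measurable_fun D f /\ exists M, {ae mu, forall x, D x -> `|f x| <= M}.

Definition L2ip (f g : X -> R) : R := \int[mu]_(x in D) (f x * g x).

Definition L2norm (f : X -> R) : R := Num.sqrt (L2ip f f).

End L2.

Section sobolev.
Context (R : realType) (d : nat) (Om : set 'rV[R]_d).
Local Notation E := 'rV[R]_d.
Local Notation mu := (@lebesgue_rV R d).

Definition weak_gradient (v : E -> R) (g : E -> 'rV[R]_d) : Prop :=
  forall i, L2 mu Om (fun x => g x 0 i) /\
  forall eta : E -> R, test_function Om eta ->
    \int[mu]_(x in Om) (v x * 'D_(delta_mx 0 i) eta x) =
    - \int[mu]_(x in Om) (g x 0 i * eta x).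

Definition H1 (v : E -> R) : Prop :=
  L2 mu Om v /\ exists g, weak_gradient v g.

Definition grad (v : E -> R) : E -> 'rV[R]_d := xget (fun=> 0) (weak_gradient v).

Definition H1norm (v : E -> R) : R :=
  Num.sqrt (\int[mu]_(x in Om) ((v x) ^+ 2) +
            \int[mu]_(x in Om) dot (grad v x) (grad v x)).

Definition comp (u : E -> 'rV[R]_d) (i : 'I_d) : E -> R := fun x => u x 0 i.

Definition L2v (u : E -> 'rV[R]_d) : Prop := forall i, L2 mu Om (comp u i).

Definition H1normv (u : E -> 'rV[R]_d) : R :=
  Num.sqrt (\sum_i (H1norm (comp u i)) ^+ 2).

Definition jacobian (u : E -> 'rV[R]_d) (x : E) : 'M[R]_d :=
  \matrix_(i, j) grad (comp u i) x 0 j.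

Definition strain (u : E -> 'rV[R]_d) (x : E) : 'M[R]_d :=
  2^-1 *: (jacobian u x + (jacobian u x)^T).

Definition L2b (z : E -> R) : Prop := L2 (@surface_measure R d) (boundary Om) z.
Definition ipb (y z : E -> R) : R := L2ip (@surface_measure R d) (boundary Om) y z.
Definition normb (z : E -> R) : R := L2norm (@surface_measure R d) (boundary Om) z.

Definition L2b0 (z : E -> R) : Prop :=
  L2b z /\ \int[@surface_measure R d]_(x in boundary Om) z x = 0.

(* By density of the smooth functions in H^1 these properties determine the
   trace operator. *)
Definition trace_operator (gam : (E -> R) -> (E -> R)) : Prop :=
  bounded_linear_operator H1 H1norm L2b normb gam /\
  forall eta, smooth eta ->
    {ae @surface_measure R d, forall x, boundary Om x -> gam eta x = eta x}.

End sobolev.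

Record setting (R : realType) (d : nat) := Setting {
  Om : set 'rV[R]_d;
  GamD : set 'rV[R]_d;
  GamN : set 'rV[R]_d;
  Tf : R;
  Cc : 'rV[R]_d -> 'I_d -> 'I_d -> 'I_d -> 'I_d -> R;
  Ee : 'rV[R]_d -> 'I_d -> 'I_d -> 'I_d -> R;
  kappa : 'rV[R]_d -> 'M[R]_d;
  rho : 'rV[R]_d -> R;
  gam : ('rV[R]_d -> R) -> ('rV[R]_d -> R);
  GG : ('rV[R]_d -> R) -> R;
  dim_gt0 : (0 < d)%N;
  Om_lipschitz : bounded_lipschitz_domain Om;
  GamD_open : relatively_open (boundary Om) GamD;
  GamN_open : relatively_open (boundary Om) GamN;
  GamDN_disjoint : GamD `&` GamN = set0;
  GamDN_cover : boundary Om = closure GamD `|` closure GamN;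
  Tf_gt0 : 0 < Tf;
  Cc_Linfty : forall i j k l, Linfty (@lebesgue_rV R d) Om (fun x => Cc x i j k l);
  Ee_Linfty : forall i j k, Linfty (@lebesgue_rV R d) Om (fun x => Ee x i j k);
  kappa_Linfty : forall i j, Linfty (@lebesgue_rV R d) Om (fun x => kappa x i j);
  rho_Linfty : Linfty (@lebesgue_rV R d) Om rho;
  Cc_symmetric : {ae @lebesgue_rV R d, forall x, Om x -> forall A B,
    symmetric_mx (apply4 (Cc x) A) /\
    frobenius (apply4 (Cc x) A) B = frobenius A (apply4 (Cc x) B)};
  Cc_coercive : exists2 c0, 0 < c0 &
    {ae @lebesgue_rV R d, forall x, Om x -> forall A, symmetric_mx A ->
      c0 * frobenius A A <= frobenius (apply4 (Cc x) A) A};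
  Ee_symmetric : {ae @lebesgue_rV R d, forall x, Om x ->
    forall b, symmetric_mx (apply3 (Ee x) b)};
  kappa_symmetric : {ae @lebesgue_rV R d, forall x, Om x -> symmetric_mx (kappa x)};
  kappa_coercive : exists2 k0, 0 < k0 &
    {ae @lebesgue_rV R d, forall x, Om x -> forall b,
      k0 * dot b b <= dot (apply2 (kappa x) b) b};
  rho_gt0 : exists2 rho0, 0 < rho0 &
    {ae @lebesgue_rV R d, forall x, Om x -> rho0 <= rho x};
  gam_trace : trace_operator Om gam;
  GG_bounded : bounded_functional (H1 Om) (H1norm Om) GG;
  GG1_neq0 : GG (cst 1) != 0
}.

Section problem.
Context (R : realType) (d : nat) (P : setting R d).
Local Notation E := 'rV[R]_d.
Local Notation Om := (Om P).
Local Notation Gam := (boundary Om).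
Local Notation T := (Tf P).
Local Notation mu := (@lebesgue_rV R d).
Local Notation leb := (@lebesgue_measure R).

Definition H1D (u : E -> 'rV[R]_d) : Prop :=
  forall i, H1 Om (comp u i) /\
  {ae @surface_measure R d, forall x, GamD P x -> gam P (comp u i) x = 0}.

Definition H1G (psi : E -> R) : Prop := H1 Om psi /\ GG P psi = 0.

Definition ip_rho (u w : E -> 'rV[R]_d) : R :=
  \int[mu]_(x in Om) (rho P x * dot (u x) (w x)).

Definition norm_rho (u : E -> 'rV[R]_d) : R := Num.sqrt (ip_rho u u).

Definition HD' (l : (E -> 'rV[R]_d) -> R) : Prop :=
  bounded_functional H1D (H1normv Om) l.

Definition norm_HD' (l : (E -> 'rV[R]_d) -> R) : R := dual_norm H1D (H1normv Om) l.

Definition bilinear_form (u : E -> 'rV[R]_d) (psi : E -> R)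
    (w : E -> 'rV[R]_d) (phi : E -> R) : R :=
  \int[mu]_(x in Om)
     frobenius (apply4 (Cc P x) (strain Om u x) + apply3 (Ee P x) (grad Om psi x))
               (strain Om w x) +
  \int[mu]_(x in Om)
     dot (- apply3_tr (Ee P x) (strain Om u x) + apply2 (kappa P x) (grad Om psi x))
         (grad Om phi x).

(* [u1] is the time derivative of [u] in L^2_rho; [v1], [v2] are its first two
   time derivatives in the dual space, in which [u t] is [ip_rho (u t)]. For
   [z t] in L^2(Gam) the duality product is the L^2(Gam) product. *)
Definition solution (z : R -> E -> R) (u : R -> E -> 'rV[R]_d) (psi : R -> E -> R)
    : Prop :=
  exists (u1 : R -> E -> 'rV[R]_d) (v1 v2 : R -> (E -> 'rV[R]_d) -> R),
    [/\ C0_time T H1D (H1normv Om) u,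
        C1_time T (L2v Om) norm_rho u u1,
        C2_time T HD' norm_HD' (fun t => ip_rho (u t)) v1 v2 &
        C0_time T H1G (H1norm Om) psi] /\
    [/\ forall t, t \in `[0, T] -> forall w phi, H1D w -> H1G phi ->
          v2 t w + bilinear_form (u t) (psi t) w phi = - ipb Om (z t) (gam P phi),
        H1normv Om (u 0) = 0 &
        norm_rho (u1 0) = 0].

(* The elements of H^1(0,T; L^2_0(Gam)) are represented by their continuous
   representatives. *)
Definition Zspace (z : R -> E -> R) : Prop :=
  [/\ C0_time T (L2b0 Om) (normb Om) z,
      H1_time T (L2b0 Om) (normb Om) (ipb Om) z &
      normb Om (z 0) = 0].

Definition Zdt (z : R -> E -> R) : R -> E -> R :=
  dt T (L2b0 Om) (normb Om) (ipb Om) z.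

Definition Znorm (z : R -> E -> R) : R :=
  Num.sqrt (\int[leb]_(t in `[0, T]) ((normb Om (Zdt z t)) ^+ 2)).

Definition Uspace (u : R -> E -> 'rV[R]_d) : Prop := C0_time T H1D (H1normv Om) u.

Definition Unorm (u : R -> E -> 'rV[R]_d) : R :=
  Num.sqrt (\int[leb]_(t in `[0, T]) ((H1normv Om (u t)) ^+ 2)).

(* [S z] is the first component of the unique solution with data [z]. *)
Definition solution_operator (S : (R -> E -> R) -> (R -> E -> 'rV[R]_d)) : Prop :=
  forall z, Zspace z -> exists2 psi, solution z (S z) psi &
  forall u' psi', solution z u' psi' -> forall t, t \in `[0, T] ->
    H1normv Om (u' t - S z t) = 0 /\ H1norm Om (psi' t - psi t) = 0.

Definition Zad (za zb : R) (z : R -> E -> R) : Prop :=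
  Zspace z /\ forall t, t \in `[0, T] ->
    {ae @surface_measure R d, forall x, Gam x -> za <= z t x <= zb}.

Definition cost (S : (R -> E -> R) -> (R -> E -> 'rV[R]_d))
    (ud : R -> E -> 'rV[R]_d) (alpha : R) (z : R -> E -> R) : R :=
  2^-1 * \int[leb]_(t in `[0, T]) ((norm_rho (S z t - ud t)) ^+ 2) +
  alpha / 2 * \int[leb]_(t in `[0, T]) ((normb Om (Zdt z t)) ^+ 2).

End problem.

(* Main.v *)
(* No energy estimate is used. The pairs (z, M) for which z admits a solution
   bounded by M in all the norms of the definition are stable under linear
   combinations and, the spaces being complete, under absolutely convergent
   series; Baire's theorem, in the form of Zabreiko's lemma, turns the existence
   of solutions into a bound |Sz(t)| <= K |z|. The completeness of Z needs the
   boundary to be of finite measure, so that the zero mean passes to L2 limits;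
   this holds because the trace of the constant 1 is square integrable.
   The cost is a sum of squared Hilbert norms of affine images of z, so the
   parallelogram identity makes it uniformly convex, and minimizing sequences
   in the closed convex admissible set are Cauchy. *)
Require Import Defs.
From mathcomp Require Import all_boot all_order all_algebra.
From mathcomp Require Import all_classical all_reals all_analysis.
From mathcomp Require Import measurable_realfun ring lra.

Set Implicit Arguments.
Unset Strict Implicit.
Unset Printing Implicit Defensive.
Import Order.TTheory GRing.Theory Num.Theory.
Import numFieldNormedType.Exports.
Local Open Scope classical_set_scope.
Local Open Scope ring_scope.

(** * Seminorms and semi-inner products *)

(** Every space is a set of functions with a seminorm, and [grad] and [dt] are arbitrary choices of
    a weak derivative, so operators are linear only up to null elements. Their additivity rests on
    the uniqueness of weak derivatives, hence on the fundamental lemma of the calculus of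
    variations; this is the purpose of the cut-off functions and of the outer regularity of Lebesgue
    measure. On the line the sigma-algebra is the Borel one, so limits taken almost everywhere may
    fail to be measurable, and integration is developed for functions that agree almost everywhere
    with good ones. Completeness is tested on sequences with increments at most 2^-n, which yields
    explicit rates. Zabreiko's lemma is applied to a bound on u, psi and the time derivatives
    together, since the whole equation has to survive infinite sums. The trace of the constant 1 is
    available once 1 is known to lie in H^1; its weak gradient is 0 because derivatives of test
    functions have integral 0, a consequence of translation invariance. *)

Lemma half_exp_gt0 (R : realType) n : 0 < 2^-1 ^+ n :> R.
Proof. by rewrite exprn_gt0// invr_gt0. Qed.

Lemma half_exp_small (R : realType) (C e : R) : 0 < e ->
  exists n0, forall n, (n0 <= n)%N -> C * 2^-1 ^+ n < e.
Proof.
move=> e0.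
have c : (fun n => C * 2^-1 ^+ n) @ \oo --> (0 : R).
  rewrite -[X in _ --> X](mulr0 C); apply: cvgM; first exact: cvg_cst.
  by apply: cvg_expr; rewrite ger0_norm ?invr_ge0//; lra.
have /cvgrPdist_lt/(_ _ e0)[n0 _ H] := c.
exists n0 => n nn; have := H n nn; rewrite /= sub0r normrN.
by apply: le_lt_trans; exact: ler_norm.
Qed.

Section seminormed_space.
Context (R : realType) (V : lmodType R) (D : set V) (N : V -> R).

Definition seminormed : Prop :=
  [/\ D 0,
      forall a v w, D v -> D w -> D (a *: v + w),
      forall a v, D v -> N (a *: v) = `|a| * N v &
      forall v w, D v -> D w -> N (v + w) <= N v + N w].

(** Every Cauchy sequence has a subsequence with such increments, so this is ordinary completeness.
    The limit is determined only up to an element of seminorm 0. *)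
Definition seminorm_complete : Prop := forall v_ : nat -> V,
  (forall n, D (v_ n)) -> (forall n, N (v_ n.+1 - v_ n) <= 2^-1 ^+ n) ->
  exists2 v, D v & forall e, 0 < e ->
    exists n0, forall n, (n0 <= n)%N -> N (v_ n - v) < e.

Hypothesis sN : seminormed.

Lemma sn_D0 : D 0. Proof. by case: sN. Qed.

Lemma sn_Dlin a v w : D v -> D w -> D (a *: v + w).
Proof. by case: sN => _ + _ _; exact. Qed.

Lemma sn_DD v w : D v -> D w -> D (v + w).
Proof. by move=> Dv Dw; rewrite -[v]scale1r; exact: sn_Dlin. Qed.

Lemma sn_DZ a v : D v -> D (a *: v).
Proof. by move=> Dv; rewrite -[_ *: _]addr0; exact: sn_Dlin Dv sn_D0. Qed.

Lemma sn_DN v : D v -> D (- v).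
Proof. by move=> Dv; rewrite -scaleN1r; exact: sn_DZ. Qed.

Lemma sn_DB v w : D v -> D w -> D (v - w).
Proof. by move=> Dv Dw; apply: sn_DD => //; exact: sn_DN. Qed.

Lemma sn_Dsum I (r : seq I) (P : pred I) (f : I -> V) :
  (forall i, P i -> D (f i)) -> D (\sum_(i <- r | P i) f i).
Proof. by move=> Df; elim/big_ind: _ => //; [exact: sn_D0|exact: sn_DD]. Qed.

Lemma sn_Z a v : D v -> N (a *: v) = `|a| * N v.
Proof. by case: sN => _ _ + _; exact. Qed.

Lemma sn_tri v w : D v -> D w -> N (v + w) <= N v + N w.
Proof. by case: sN => _ _ _; exact. Qed.

Lemma sn_0 : N 0 = 0.
Proof. by rewrite -(scale0r 0) sn_Z ?normr0 ?mul0r//; exact: sn_D0. Qed.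

Lemma sn_opp v : D v -> N (- v) = N v.
Proof. by move=> Dv; rewrite -scaleN1r sn_Z// normrN normr1 mul1r. Qed.

Lemma sn_sym v w : D v -> D w -> N (v - w) = N (w - v).
Proof. by move=> Dv Dw; rewrite -opprB sn_opp//; exact: sn_DB. Qed.

Lemma sn_ge0 v : D v -> 0 <= N v.
Proof.
by move=> Dv; have := sn_tri Dv (sn_DN Dv); rewrite subrr sn_0 sn_opp//; lra.
Qed.

Lemma sn_dist u v w : D u -> D v -> D w -> N (u - w) <= N (u - v) + N (v - w).
Proof.
move=> Du Dv Dw; have -> : u - w = (u - v) + (v - w) by rewrite addrA subrK.
by apply: sn_tri; exact: sn_DB.
Qed.

Lemma sn_lip u v : D u -> D v -> `|N u - N v| <= N (u - v).
Proof.
move=> Du Dv; rewrite ler_norml; apply/andP; split.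
  have := sn_dist Dv Du sn_D0; rewrite !subr0 (sn_sym Dv Du); lra.
have := sn_dist Du Dv sn_D0; rewrite !subr0; lra.
Qed.

Lemma sn_null v w : D v -> D w -> N (v - w) = 0 -> N v = N w.
Proof.
move=> Dv Dw e; apply/eqP; rewrite -subr_eq0 -normr_eq0 eq_le normr_ge0 andbT.
by rewrite -e; exact: sn_lip.
Qed.

Lemma fast_cauchy v_ C : (forall n, D (v_ n)) ->
  (forall n, N (v_ n.+1 - v_ n) <= C * 2^-1 ^+ n) ->
  forall n m, (n <= m)%N -> N (v_ m - v_ n) <= 2 * C * 2^-1 ^+ n.
Proof.
move=> Dv H n m /subnK <-; set k := (m - n)%N.
(* The exact value of the geometric sum is the bound that passes through the induction on k. *)
suff : N (v_ (k + n)%N - v_ n) <= 2 * C * (2^-1 ^+ n - 2^-1 ^+ (k + n)).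
  move=> /le_trans; apply; have := half_exp_gt0 R (k + n).
  have C0 : 0 <= C.
    by have := H 0%N; rewrite expr0 mulr1; apply: le_trans; exact/sn_ge0/sn_DB.
  by move=> ?; apply: ler_wpM2l; [rewrite mulr_ge0|lra].
elim: k => [|k IH]; first by rewrite add0n !subrr sn_0 mulr0.
rewrite addSn; apply: le_trans (sn_dist _ (Dv (k + n)%N) _) _ => //.
have := H (k + n)%N; rewrite exprS; lra.
Qed.

Hypothesis cN : seminorm_complete.

(** Dividing by C brings the increments to the normalized form. The hypothesis yields bare
    convergence; the rate then comes from [fast_cauchy], by comparing v_ n with a far term of the
    sequence. *)
Lemma complete_fast v_ C : 0 < C -> (forall n, D (v_ n)) ->
  (forall n, N (v_ n.+1 - v_ n) <= C * 2^-1 ^+ n) ->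
  exists2 v, D v & forall n, N (v_ n - v) <= 2 * C * 2^-1 ^+ n.
Proof.
move=> C0 Dv H.
have [||v Dw vw] := @cN (fun n => C^-1 *: v_ n).
- by move=> n; exact: sn_DZ.
- move=> n; rewrite -scalerBr sn_Z; last exact: sn_DB.
  by rewrite gtr0_norm ?invr_gt0// ler_pdivrMl.
exists (C *: v); first exact: sn_DZ.
move=> n; apply/ler_addgt0Pl => e e0.
have [m0 Hm] := vw _ (divr_gt0 e0 C0).
have /(_ (leq_maxr _ _)) := Hm (maxn n m0).
rewrite -(ltr_pM2l C0) [C * (e / C)]mulrC divfK ?gt_eqF//.
rewrite -{1}(gtr0_norm C0) -sn_Z; last by apply: sn_DB => //; exact: sn_DZ.
rewrite scalerBr scalerA divff ?gt_eqF// scale1r => e1.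
apply: le_trans (sn_dist (Dv n) (Dv (maxn n m0)) (sn_DZ C Dw)) _.
rewrite addrC; apply: lerD; first exact: ltW.
by rewrite sn_sym//; apply: fast_cauchy => //; exact: leq_maxl.
Qed.

End seminormed_space.

(** Thinning out the sequence allows the smaller increments 4^-n; they leave room for the weight 8^n
    in [L2_time_complete]. *)
Lemma complete_of_quick (R : realType) (V : lmodType R) (D : set V) (N : V -> R) :
  seminormed D N ->
  (forall v_ : nat -> V, (forall n, D (v_ n)) ->
    (forall n, N (v_ n.+1 - v_ n) <= 4^-1 ^+ n) ->
    exists2 v, D v & forall e, 0 < e ->
      exists n0, forall n, (n0 <= n)%N -> N (v_ n - v) < e) ->
  seminorm_complete D N.
Proof.
move=> sN H v_ Dv Hv.
(* With odd indices two consecutive increments add up to (1/2 + 1/4) 4^-n, which is below 4^-n; with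
   even indices the factor would be 3/2. *)
have [||v Dw Hw] := H (fun n => v_ n.*2.+1) => //.
  move=> n; rewrite doubleS.
  apply: le_trans (sn_dist sN (Dv _) (Dv n.*2.+2) (Dv _)) _.
  have := Hv n.*2.+2; have := Hv n.*2.+1.
  rewrite !exprS -addnn exprD -exprMn -invfM -natrM.
  have : 0 < 4^-1 ^+ n :> R by rewrite exprn_gt0// invr_gt0.
  lra.
exists v => // e e0; have e20 : 0 < e / 2 by lra.
have [n1 Hn1] := Hw _ e20; have [n2 Hn2] := half_exp_small 2 e20.
exists (maxn n1 n2).*2.+1 => n nn.
have h1 : N (v_ n - v_ (maxn n1 n2).*2.+1) <= 2 * 2^-1 ^+ (maxn n1 n2).*2.+1.
  have := @fast_cauchy _ _ _ _ sN v_ 1 Dv; rewrite mulr1; apply => // k.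
  by rewrite mul1r.
have := Hn2 (maxn n1 n2).*2.+1; rewrite (leq_trans (leq_maxr n1 n2)); last first.
  by rewrite -addnn; apply: leqW; exact: leq_addr.
move=> /(_ isT) h2.
have := Hn1 _ (leq_maxl n1 n2); have := sn_dist sN (Dv n) (Dv (maxn n1 n2).*2.+1) Dw.
lra.
Qed.

Section semi_inner.
Context (R : realType) (V : lmodType R) (D : set V) (ip : V -> V -> R).

Definition semi_inner : Prop :=
  [/\ D 0,
      forall a v w, D v -> D w -> D (a *: v + w),
      forall a v w x, D v -> D w -> D x -> ip (a *: v + w) x = a * ip v x + ip w x,
      forall v w, D v -> D w -> ip v w = ip w v &
      forall v, D v -> 0 <= ip v v].

Definition ipnorm v := Num.sqrt (ip v v).

Hypothesis sip : semi_inner.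

Let D0 : D 0. Proof. by case: sip. Qed.
Let Dlin a v w : D v -> D w -> D (a *: v + w).
Proof. by case: sip => _ + _ _ _; exact. Qed.

Lemma ip_linl a v w x : D v -> D w -> D x -> ip (a *: v + w) x = a * ip v x + ip w x.
Proof. by case: sip => _ _ + _ _; exact. Qed.

Lemma ipC v w : D v -> D w -> ip v w = ip w v.
Proof. by case: sip => _ _ _ + _; exact. Qed.

Lemma ip_ge0 v : D v -> 0 <= ip v v.
Proof. by case: sip => _ _ _ _; exact. Qed.

Lemma ip_linr a v w x : D v -> D w -> D x -> ip x (a *: v + w) = a * ip x v + ip x w.
Proof.
by move=> Dv Dw Dx; rewrite ipC// ?ip_linl//; [congr (_ * _ + _); exact: ipC|exact: Dlin].
Qed.

Lemma ip0l x : D x -> ip 0 x = 0.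
Proof.
move=> Dx; have := ip_linl 0 D0 D0 Dx.
by rewrite scale0r add0r mul0r add0r; have := ip_linl 1 D0 D0 Dx; rewrite scale1r addr0; lra.
Qed.

Lemma ipZl a v x : D v -> D x -> ip (a *: v) x = a * ip v x.
Proof. by move=> Dv Dx; rewrite -[_ *: _]addr0 ip_linl// ip0l// addr0. Qed.

Lemma ipBl v w x : D v -> D w -> D x -> ip (v - w) x = ip v x - ip w x.
Proof.
by move=> Dv Dw Dx; rewrite addrC -scaleN1r ip_linl// mulN1r addrC.
Qed.

Lemma ipBr v w x : D v -> D w -> D x -> ip x (v - w) = ip x v - ip x w.
Proof.
by move=> Dv Dw Dx; rewrite addrC -scaleN1r ip_linr// mulN1r addrC.
Qed.

Lemma ip_sq a v w : D v -> D w ->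
  ip (a *: v + w) (a *: v + w) = a ^+ 2 * ip v v + 2 * a * ip v w + ip w w.
Proof.
move=> Dv Dw; have Dl := Dlin a Dv Dw.
by rewrite ip_linl// !ip_linr// (ipC Dw Dv); ring.
Qed.

Lemma ip_CS v w : D v -> D w -> ip v w ^+ 2 <= ip v v * ip w w.
Proof.
move=> Dv Dw; have v0 := ip_ge0 Dv; have w0 := ip_ge0 Dw.
have [vv0|vv0] := eqVneq (ip v v) 0.
  have [->|vw0] := eqVneq (ip v w) 0; first by rewrite expr0n/= mulr_ge0.
  (* When v is a null vector the quadratic polynomial in the coefficient of v is affine, and this
     coefficient gives it the value -1. *)
  have := ip_ge0 (Dlin (- (ip w w + 1) / (2 * ip v w)) Dv Dw).
  rewrite ip_sq// vv0 mulr0 add0r.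
  have -> : 2 * (- (ip w w + 1) / (2 * ip v w)) * ip v w = - (ip w w + 1) by field.
  lra.
have := ip_ge0 (Dlin (- ip v w / ip v v) Dv Dw); rewrite ip_sq//.
have vgt0 : 0 < ip v v by rewrite lt_neqAle eq_sym vv0.
have -> : (- ip v w / ip v v) ^+ 2 * ip v v + 2 * (- ip v w / ip v v) * ip v w + ip w w
   = (ip v v * ip w w - ip v w ^+ 2) / ip v v by field.
by rewrite pmulr_lge0 ?invr_gt0// subr_ge0.
Qed.

Lemma ipnorm_ge0 v : 0 <= ipnorm v. Proof. exact: sqrtr_ge0. Qed.

Lemma ipnorm_sq v : D v -> ipnorm v ^+ 2 = ip v v.
Proof. by move=> Dv; rewrite sqr_sqrtr// ip_ge0. Qed.

Lemma ip_CSn v w : D v -> D w -> `|ip v w| <= ipnorm v * ipnorm w.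
Proof.
move=> Dv Dw; rewrite -ler_sqr ?nnegrE ?mulr_ge0 ?ipnorm_ge0//.
by rewrite real_normK ?num_real// exprMn !ipnorm_sq// ip_CS.
Qed.

Lemma semi_inner_seminormed : seminormed D ipnorm.
Proof.
split => //.
- move=> a v Dv; rewrite /ipnorm ipZl//; last first.
    by rewrite -[_ *: _]addr0; exact: Dlin.
  rewrite ipC//; last by rewrite -[_ *: _]addr0; exact: Dlin.
  by rewrite ipZl// mulrA -expr2 sqrtrM ?sqr_ge0// sqrtr_sqr.
- move=> v w Dv Dw; rewrite -ler_sqr ?nnegrE ?addr_ge0 ?ipnorm_ge0//.
  rewrite ipnorm_sq; last by rewrite -{1}[v]scale1r; exact: Dlin.
  rewrite -{1 2}[v]scale1r ip_sq// sqrrD !ipnorm_sq//.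
  have := ip_CSn Dv Dw; have := ler_norm (ip v w).
  rewrite expr2 !mul1r !mulr1 -mulr_natl; lra.
Qed.

Lemma ipnorm_lin a v w : D v -> D w ->
  ipnorm (a *: v + w) ^+ 2 = a ^+ 2 * ipnorm v ^+ 2 + 2 * a * ip v w + ipnorm w ^+ 2.
Proof. by move=> Dv Dw; rewrite !ipnorm_sq ?ip_sq//; exact: Dlin. Qed.

(** The parallelogram identity with weights t and 1 - t. It gives the defect of convexity of a
    squared norm exactly: t = 1/2 serves minimization, general t serves strict convexity of the
    cost. *)
Lemma ipnorm_convex t v w : D v -> D w ->
  ipnorm (t *: v + (1 - t) *: w) ^+ 2 =
  t * ipnorm v ^+ 2 + (1 - t) * ipnorm w ^+ 2 - t * (1 - t) * ipnorm (v - w) ^+ 2.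
Proof.
move=> Dv Dw.
have DZ a u : D u -> D (a *: u) by move=> Du; rewrite -[_ *: _]addr0; exact: Dlin.
rewrite ipnorm_lin//; last exact: DZ.
rewrite (ipC Dv (DZ _ _ Dw)) ipZl//.
have -> : v - w = (-1) *: w + v by rewrite scaleN1r addrC.
rewrite ipnorm_lin// -[(1 - t) *: w]addr0 ipnorm_lin//.
rewrite ![ip w 0]ipC// ip0l// /ipnorm ip0l// sqrtr0; ring.
Qed.

Lemma ip_null v w x : D v -> D w -> D x -> ipnorm (v - w) = 0 -> ip v x = ip w x.
Proof.
move=> Dv Dw Dx e; apply/eqP; rewrite -subr_eq0 -ipBl// -normr_eq0 eq_le normr_ge0.
rewrite andbT; apply: le_trans (ip_CSn _ Dx) _; last by rewrite e mul0r.
by rewrite -scaleN1r addrC; exact: Dlin.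
Qed.

Lemma ip_cvg (v_ w_ : nat -> V) v w :
  (forall n, D (v_ n)) -> (forall n, D (w_ n)) -> D v -> D w ->
  (fun n => ipnorm (v_ n - v)) @ \oo --> (0 : R) ->
  (fun n => ipnorm (w_ n - w)) @ \oo --> (0 : R) ->
  (fun n => ip (v_ n) (w_ n)) @ \oo --> ip v w.
Proof.
move=> Dv_ Dw_ Dv Dw cv cw.
have sN := semi_inner_seminormed.
have DB := sn_DB sN.
apply: cvg_sub0 (cvg_cst (ip v w)).
apply: norm_cvg0.
pose b n := ipnorm (v_ n - v) * (ipnorm w + ipnorm (w_ n - w)) + ipnorm v * ipnorm (w_ n - w).
apply: (@squeeze_cvgr _ _ _ _ (cst 0) b); last 2 first.
- exact: cvg_cst.
- rewrite [X in _ --> X](_ : _ = 0 * (ipnorm w + 0) + ipnorm v * 0); last by rewrite mul0r mulr0 addr0.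
  apply: cvgD; apply: cvgM => //; last exact: cvg_cst.
  by apply: cvgD => //; exact: cvg_cst.
apply: nearW => n; rewrite normr_ge0/=.
have -> : ((fun n => ip (v_ n) (w_ n)) - cst (ip v w)) n = ip (v_ n) (w_ n) - ip v w by [].
have -> : ip (v_ n) (w_ n) - ip v w = ip (v_ n - v) (w_ n) + ip v (w_ n - w).
  by rewrite ipBl// ipBr//; lra.
apply: le_trans (ler_normD _ _) _; apply: lerD.
  apply: le_trans (ip_CSn _ (Dw_ n)) _; first exact: DB.
  apply: ler_wpM2l; first exact: ipnorm_ge0.
  have := sn_dist sN (Dw_ n) Dw (sn_D0 sN); rewrite !subr0; lra.
by apply: ip_CSn => //; exact: DB.
Qed.

End semi_inner.

(** * Zabreiko's lemma *)

Section zabreiko.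
Context (R : realType) (V : lmodType R) (D : set V) (N : V -> R).
Hypotheses (sN : seminormed D N) (cN : seminorm_complete D N).

(** Baire's theorem: some [A n] is dense in some ball. Otherwise every ball contains a smaller one
    that avoids [A n], and nested balls chosen in this way for n = 0, 1, ... shrink to a point that
    lies in no [A n]. *)
Lemma baire_balls (A : nat -> set V) : (forall v, D v -> exists n, A n v) ->
  exists n v0 r, [/\ D v0, 0 < r &
    forall v, D v -> N (v - v0) < r -> forall e, 0 < e ->
    exists a, [/\ D a, A n a & N (a - v) < e]].
Proof.
move=> Acov; apply: contrapT => H.
(* The factor 2 puts the limit of the centres strictly inside every ball, where the last clause
   forbids points of [A n]; the bound 2^-(n+1) on the radius makes the centres converge fast enough
   for [cN]. *)
have step (p : nat * (V * R)) : exists q : V * R, D p.2.1 -> 0 < p.2.2 ->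
    [/\ D q.1, 0 < q.2, N (q.1 - p.2.1) + 2 * q.2 <= p.2.2, q.2 <= 2^-1 ^+ p.1.+1 &
     forall a, D a -> A p.1 a -> q.2 <= N (a - q.1)].
  case: p => n [v0 r] /=.
  have [[Dv0 r0]|] := pselect (D v0 /\ 0 < r); last first.
    by move=> h; exists (0, 0) => ? ?; exfalso; apply: h.
  have [v [e [Dv vv0 e0 He]]] : exists v e,
      [/\ D v, N (v - v0) < r, 0 < e & forall a, D a -> A n a -> e <= N (a - v)].
    apply: contrapT => H'; apply: H; exists n, v0, r; split=> // v Dv vr e e0.
    apply: contrapT => H2; apply: H'; exists v, e; split=> // a Da Aa.
    by rewrite leNgt; apply/negP => ae; apply: H2; exists a.
  pose s := Num.min (Num.min e (2^-1 ^+ n.+1)) ((r - N (v - v0)) / 2).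
  have s3 : s <= (r - N (v - v0)) / 2 by rewrite ge_min lexx orbT.
  have s1 : s <= e by rewrite !ge_min lexx.
  have s2 : s <= 2^-1 ^+ n.+1 by rewrite !ge_min lexx orbT.
  have sp : 0 < s by rewrite !lt_min e0 half_exp_gt0/=; lra.
  exists (v, s) => _ _ /=; split => //; first lra.
  by move=> a Da Aa; apply: le_trans (He _ Da Aa).
have [f Hf] := choice step.
pose q := fix q n := if n is m.+1 then f (m, q m) else (0, 1) : V * R.
have Pq n : D (q n).1 /\ 0 < (q n).2.
  elim: n => [|n [Dn rn]]; first by split; [exact: sn_D0 sN|exact: ltr01].
  by case: (Hf (n, q n) Dn rn).
have Hq n : [/\ D (q n.+1).1, 0 < (q n.+1).2,
     N ((q n.+1).1 - (q n).1) + 2 * (q n.+1).2 <= (q n).2,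
     (q n.+1).2 <= 2^-1 ^+ n.+1 &
     forall a, D a -> A n a -> (q n.+1).2 <= N (a - (q n.+1).1)].
  by case: (Pq n) => Dn rn; exact: (Hf (n, q n) Dn rn).
have Dq n : D (q n).1 by case: (Pq n).
have nested n k : N ((q (k + n)%N).1 - (q n).1) + (q (k + n)%N).2 <= (q n).2.
  elim: k => [|k IH]; first by rewrite add0n subrr (sn_0 sN) add0r.
  rewrite addSn; have [_ r0 H3 _ _] := Hq (k + n)%N.
  have := sn_dist sN (Dq (k + n).+1) (Dq (k + n)%N) (Dq n); lra.
have [||v Dv Hv] := @cN (fun n => (q n).1) => //.
  move=> n; have [_ r0 H3 _ _] := Hq n.
  have : (q n).2 <= 2^-1 ^+ n by case: n {r0 H3} => [|n] //=; case: (Hq n).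
  lra.
have [n An] := Acov v Dv.
have [_ r0 _ _ /(_ v Dv An) H4] := Hq n.
have [_ r1 H5 _ _] := Hq n.+1.
have [n0 Hn0] := Hv _ r1.
have := Hn0 _ (leq_maxl n0 n.+2); have := leq_maxr n0 n.+2.
set m := maxn n0 n.+2 => le_m; rewrite (sn_sym sN)// => vm.
have := nested n.+2 (m - n.+2)%N; rewrite subnK// => nm.
have [_ rm] := Pq m.
have := sn_dist sN Dv (Dq m) (Dq n.+2); have := sn_dist sN Dv (Dq n.+2) (Dq n.+1).
lra.
Qed.

Variable Q : V -> R -> Prop.
Hypotheses (Q00 : Q 0 0) (Q_ex : forall v, D v -> exists M, Q v M)
  (Q_le : forall v M M', Q v M -> M <= M' -> Q v M')
  (Q_lin : forall a v w M M', D v -> D w -> Q v M -> Q w M' ->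
     Q (a *: v + w) (`|a| * M + M'))
  (Q_sum : forall (v_ : nat -> V) v M, 0 < M -> (forall k, D (v_ k)) -> D v ->
     (forall k, Q (v_ k) (M * 2^-1 ^+ k)) ->
     (forall n, N (\sum_(k < n) v_ k - v) < M * 2^-1 ^+ n) -> Q v (2 * M)).

Let QZ a v M : D v -> Q v M -> Q (a *: v) (`|a| * M).
Proof.
by move=> Dv Qv; rewrite -[_ *: _]addr0 -[_ * M]addr0; exact: Q_lin (sn_D0 sN) Qv Q00.
Qed.

(* Zabreiko's lemma, with [Q v M] in the role of "p(v) <= M" for a countably
   subadditive seminorm p. *)
Lemma zabreiko : exists2 K, 0 < K & forall v e, D v -> N v < e -> Q v (K * e).
Proof.
have [|n [v0 [r [Dv0 r0 H]]]] := @baire_balls (fun n v => Q v n%:R).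
  move=> v Dv; have [M QM] := Q_ex Dv.
  have [n Hn] : exists n : nat, M <= n%:R.
    exists (Num.trunc `|M|).+1; apply: le_trans (ler_norm _) _.
    by apply/ltW/truncnS_gt.
  by exists n; exact: Q_le QM Hn.
(* A bound for the difference of two elements of the n-th sublevel set; the summand 1 makes it
   positive. *)
pose C : R := 2 * n%:R + 1.
have C0 : 0 < C by have := ler0n R n; rewrite /C; lra.
(* Recentring at 0: with a1 close to v0 + w / c and a2 close to v0, the vector c (a1 - a2) is close
   to w, and [Q] holds for it with bound C c. *)
have app c w : 0 < c -> D w -> N w < c * r -> forall e, 0 < e ->
    exists a, [/\ D a, Q a (C * c) & N (w - a) < e].
  move=> c0 Dw wr e e0.
  have DZ := sn_DZ sN; have DB := sn_DB sN; have DD := sn_DD sN.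
  have e' : 0 < e / c / 2 by rewrite !divr_gt0.
  have [||a1 [Da1 Q1 H1]] := H (v0 + c^-1 *: w) _ _ _ e'.
  - by apply: DD => //; exact: DZ.
  - rewrite addrC addKr (sn_Z sN)// gtr0_norm ?invr_gt0//.
    by rewrite ltr_pdivrMl.
  have [||a2 [Da2 Q2 H2]] := H v0 _ _ _ e' => //.
    by rewrite subrr (sn_0 sN).
  exists (c *: (a1 - a2)); split.
  - by apply/DZ/DB.
  - have Qd : Q (a1 - a2) C.
      rewrite addrC -scaleN1r; apply: Q_le (Q_lin (-1) Da2 Da1 Q2 Q1) _.
      by rewrite normrN normr1 /C; lra.
    by have := QZ c (DB _ _ Da1 Da2) Qd; rewrite gtr0_norm// mulrC.
  - have -> : w - c *: (a1 - a2) =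
        c *: ((a2 - v0) - (a1 - (v0 + c^-1 *: w))).
      rewrite opprB -[v0 + _ - a1]addrA subrKA addrCA -[a2 - a1]opprB [RHS]scalerBr.
      by rewrite scalerA divff ?gt_eqF// scale1r.
    have D1 : D (a2 - v0) by exact: DB.
    have D2 : D (a1 - (v0 + c^-1 *: w)) by apply: DB => //; apply: DD => //; exact: DZ.
    rewrite (sn_Z sN) ?gtr0_norm//; last exact: DB.
    rewrite -ltr_pdivlMl// [_^-1 * _]mulrC; apply: le_lt_trans (sn_tri sN D1 (sn_DN sN D2)) _.
    by rewrite (sn_opp sN)//; move: H1 H2; lra.
have appr k w : exists a, D w -> N w < 2^-1 ^+ k * r ->
    [/\ D a, Q a (C * 2^-1 ^+ k) & N (w - a) < 2^-1 ^+ k.+1 * r].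
  have [[Dw wr]|h] := pselect (D w /\ N w < 2^-1 ^+ k * r); last first.
    by exists 0 => ? ?; exfalso; exact: h.
  have [|a [Da Qa wa]] := app _ w (half_exp_gt0 R k) Dw wr (2^-1 ^+ k.+1 * r).
    by rewrite mulr_gt0// half_exp_gt0.
  by exists a.
have /choice[f Hf] : forall p : nat * V, exists a, D p.2 -> N p.2 < 2^-1 ^+ p.1 * r ->
    [/\ D a, Q a (C * 2^-1 ^+ p.1) & N (p.2 - a) < 2^-1 ^+ p.1.+1 * r].
  by move=> [k w]; exact: appr.
(* Successive approximation: [res n] is what remains of w after n corrections. Its norm is below
   2^-n r, so w is the sum of corrections that satisfy [Q] with bounds C 2^-n, and [Q_sum]
   applies. *)
have ball w : D w -> N w < r -> Q w (2 * (C + r)).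
  move=> Dw wr.
  pose res := fix res n := if n is m.+1 then res m - f (m, res m) else w.
  have Pres k : D (res k) /\ N (res k) < 2^-1 ^+ k * r.
    elim: k => [|k [Dn Nn]]; first by rewrite expr0 mul1r.
    have [Da _ Nw] := Hf (k, res k) Dn Nn.
    by split => //; exact: (sn_DB sN).
  have Pf k : [/\ D (f (k, res k)), Q (f (k, res k)) (C * 2^-1 ^+ k) &
      N (res k - f (k, res k)) < 2^-1 ^+ k.+1 * r].
    by have [Dn Nn] := Pres k; exact: (Hf (k, res k)).
  apply: (@Q_sum (fun n => f (n, res n))) => //; first lra.
  - by move=> k; case: (Pf k).
  - move=> k; have [_ Qk _] := Pf k; apply: Q_le Qk _.
    by apply: ler_wpM2r; [exact/ltW/half_exp_gt0|lra].
  - move=> m; have -> : \sum_(k < m) f (k : nat, res k) - w = - res m.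
      elim: m => [|m IH]; first by rewrite big_ord0 sub0r.
      by rewrite big_ord_recr/= addrAC IH addrC opprB.
    have [Dn Nn] := Pres m; rewrite (sn_opp sN)//; apply: lt_le_trans Nn _.
    by rewrite mulrC; apply: ler_wpM2r; [exact/ltW/half_exp_gt0|lra].
(* Scaling the ball of radius e to the ball of radius r costs the factor e / r. *)
exists (2 * (C + r) / r) => [|v e Dv ve].
  by rewrite divr_gt0// mulr_gt0//; lra.
have e0 : 0 < e by apply: le_lt_trans ve; exact: (sn_ge0 sN).
have re0 : 0 < r / e by rewrite divr_gt0.
have := ball ((r / e) *: v); rewrite (sn_Z sN)// gtr0_norm//.
rewrite -ltr_pdivlMl// invf_div divfK ?gt_eqF// => /(_ (sn_DZ sN _ Dv) ve) h.
have := QZ (e / r) (sn_DZ sN _ Dv) h.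
rewrite scalerA -[e / r]invf_div mulVf ?gt_eqF// scale1r gtr0_norm ?invr_gt0//.
by rewrite invf_div [_ / r * e]mulrAC [_ * e]mulrC -mulrA mulrCA [_ / r]mulrC mulrA.
Qed.
End zabreiko.

(** * Minimization and Mazur's theorem *)

Section minimization.
Context (R : realType) (V : lmodType R) (D : set V) (N : V -> R).
Hypotheses (sN : seminormed D N) (cN : seminorm_complete D N).

(** The second weight is left as 1 - 2^-1 so that this is literally convexity at t = 2^-1. *)
Definition midpoint_closed (A : set V) : Prop :=
  forall v w, A v -> A w -> A (2^-1 *: v + (1 - 2^-1) *: w).

(** The value at a midpoint is at least the infimum, so two points whose values exceed the infimum
    by at most d satisfy c N(v - w)^2 <= d. This makes minimizing sequences Cauchy and, with d = 0,
    minimizers unique. *)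
Lemma unif_convex_min (A : set V) (f : V -> R) c :
  A `<=` D -> A !=set0 -> seminorm_closed D N A -> midpoint_closed A ->
  (forall v, A v -> 0 <= f v) -> seminorm_continuous D N f -> 0 < c ->
  (forall v w, A v -> A w -> c * N (v - w) ^+ 2 <=
     2^-1 * f v + 2^-1 * f w - f (2^-1 *: v + (1 - 2^-1) *: w)) ->
  exists2 z, A z /\ (forall y, A y -> f z <= f y) &
    forall z', A z' -> (forall y, A y -> f z' <= f y) -> N (z' - z) = 0.
Proof.
move=> AD [a0 Aa0] Acl Amid f0 fc c0 fconv.
have NB0 v w : A v -> A w -> 0 <= N (v - w).
  by move=> Av Aw; apply: (sn_ge0 sN); apply: (sn_DB sN); exact: AD.
pose m := inf (f @` A).
have hA : has_inf (f @` A).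
  by split; [exists (f a0), a0|exists 0 => _ [v Av <-]; exact: f0].
have mle v : A v -> m <= f v.
  by move=> Av; apply: inf_lbound; [case: hA|exists v].
have near_min v w d : A v -> A w -> f v <= m + d -> f w <= m + d ->
    c * N (v - w) ^+ 2 <= d.
  move=> Av Aw fv fw; apply: le_trans (fconv _ _ Av Aw) _.
  by have := mle _ (Amid _ _ Av Aw); lra.
have sq_le v w r : A v -> A w -> 0 < r -> c * N (v - w) ^+ 2 <= c * r ^+ 2 -> N (v - w) <= r.
  move=> Av Aw r0; rewrite ler_pM2l// ler_sqr// nnegrE ?NB0//; exact: ltW.
(* The excess c 4^-n is what [near_min] turns into increments of at most 2^-n. *)
have /choice[v_ Hv] : forall n, exists v, A v /\ f v <= m + c * (2^-1 ^+ n) ^+ 2.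
  move=> n; have e0 : 0 < c * (2^-1 ^+ n : R) ^+ 2.
    by rewrite mulr_gt0// exprn_gt0// half_exp_gt0.
  have [_ [v Av <-] fv] := inf_adherent e0 hA.
  by exists v; split => //; exact: ltW.
have Av n : A (v_ n) by case: (Hv n).
have [||z Dz Hz] := cN (v_ := v_).
- by move=> n; exact: AD.
- move=> n; apply: (sq_le _ _ _ (Av _) (Av _) (half_exp_gt0 _ _)).
  apply: near_min => //; last by case: (Hv n).
  case: (Hv n.+1) => _ /le_trans; apply; rewrite lerD2l ler_pM2l//.
  have h := half_exp_gt0 R n; have h1 := half_exp_gt0 R n.+1.
  by rewrite ler_sqr ?nnegrE ?(ltW h) ?(ltW h1)// exprS; lra.
have Az : A z.
  by apply: Acl => // e e0; have [n Hn] := Hz e e0; exists (v_ n) => //; exact: Hn.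
have fz : f z <= m.
  apply/ler_addgt0Pl => e e0; have e20 : 0 < e / 2 by lra.
  have [del del0 Hd] := fc z Dz _ e20.
  have [n1 Hn1] := Hz _ del0.
  have [n2 Hn2] := half_exp_small c e20.
  have := Hd _ (AD _ (Av (maxn n1 n2))) (Hn1 _ (leq_maxl _ _)).
  rewrite ltr_norml => /andP[h1 _].
  have := Hn2 _ (leq_maxr n1 n2); case: (Hv (maxn n1 n2)) => _.
  have hh := half_exp_gt0 R (maxn n1 n2).
  have : (2^-1 : R) ^+ maxn n1 n2 ^+ 2 <= 2^-1 ^+ maxn n1 n2.
    rewrite expr2 ger_pMl//; apply: exprn_ile1; rewrite ?invr_ge0//; lra.
  by rewrite -(ler_pM2l c0); move: h1; lra.
exists z; first by split => // y Ay; apply: le_trans fz (mle _ Ay).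
move=> z' Az' z'min; apply/eqP; rewrite eq_le NB0// andbT.
apply/ler_addgt0Pl => e e0; rewrite addr0; apply: sq_le => //.
apply: le_trans (near_min _ _ 0 Az' Az _ _) _; rewrite ?addr0//.
  exact: le_trans (z'min _ Az) fz.
by rewrite mulr_ge0 ?sqr_ge0// ltW.
Qed.

End minimization.

Section hilbert.
Context (R : realType) (V : lmodType R) (D : set V) (ip : V -> V -> R).
Hypotheses (sip : semi_inner D ip) (cN : seminorm_complete D (ipnorm ip)).
Let N := ipnorm ip.
Let sN : seminormed D N := semi_inner_seminormed sip.

Definition convex_subset (A : set V) : Prop := forall t v w,
  0 <= t <= 1 -> A v -> A w -> A (t *: v + (1 - t) *: w).

Lemma ip_bounded_functional h : D h -> bounded_functional D N (ip h).
Proof.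
move=> Dh; split => [a v w Dv Dw|]; first exact: (ip_linr sip).
by exists (N h) => v Dv; exact: (ip_CSn sip).
Qed.

(* Mazur: the projection [x] of a point [v] outside [A] yields the
   functional [ip (v - x)], which separates [v] from [A]. *)
Lemma closed_convex_weakly_closed (A : set V) :
  A `<=` D -> seminorm_closed D N A -> convex_subset A -> weakly_closed D N A.
Proof.
move=> AD Acl Acv v Dv Hw.
have A0 : A !=set0.
  (* The weak neighbourhood given by an empty family of functionals is everything, so A is
     nonempty. *)
  have [|a Aa _] := Hw 0%N (fun _ _ => 0) 1 _ ltr01; last by exists a.
  by case=> i; rewrite ltn0.
have DB := sn_DB sN; have DZ := sn_DZ sN; have DD := sn_DD sN.
have Amid : midpoint_closed A.
  by move=> x y Ax Ay; apply: Acv; rewrite ?invr_ge0 ?invf_le1 ?ler1n ?ler0n.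
have fc : seminorm_continuous D N (fun x => N (x - v) ^+ 2).
  move=> x Dx e e0; have n0 := sn_ge0 sN (DB _ _ Dx Dv).
  have den : 0 < 2 * N (x - v) + 1 by lra.
  exists (Num.min 1 (e / (2 * N (x - v) + 1))).
    by rewrite lt_min ltr01 divr_gt0.
  move=> w Dw; rewrite lt_min => /andP[h1 h2].
  have := sn_lip sN (DB _ _ Dw Dv) (DB _ _ Dx Dv).
  have -> : w - v - (x - v) = w - x by rewrite opprB addrA subrK.
  have m0 := sn_ge0 sN (DB _ _ Dw Dv).
  have k0 := sn_ge0 sN (DB _ _ Dw Dx).
  move=> h; rewrite subr_sqr normrM [X in _ * X]ger0_norm; last by lra.
  move: h2; rewrite ltr_pdivlMr// => h2; apply: le_lt_trans h2.
  apply: ler_pM => //; first lra.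
  by move: h; rewrite ler_norml; lra.
(* For the squared distance to v the midpoint defect is exactly t (1 - t) = 1/4 times N(x - y)^2. *)
have [] := @unif_convex_min _ _ _ _ sN cN A (fun x => N (x - v) ^+ 2) (2^-1 * 2^-1) AD A0 Acl Amid.
- by move=> x _; exact: sqr_ge0.
- by [].
- by lra.
- move=> x y Ax Ay; have Dx := AD _ Ax; have Dy := AD _ Ay.
  have -> : 2^-1 *: x + (1 - 2^-1) *: y - v = 2^-1 *: (x - v) + (1 - 2^-1) *: (y - v).
    rewrite [in RHS]scalerBr [in RHS]scalerBr [in RHS]addrACA -[in RHS]opprD.
    by rewrite -[in RHS]scalerDl [2^-1 + _]addrC subrK scale1r.
  rewrite (ipnorm_convex sip); try exact: DB.
  have -> : x - v - (y - v) = x - y by rewrite opprB addrA subrK.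
  by rewrite /N; lra.
move=> x [Ax xmin] _; have Dx := AD _ Ax.
have Dh := DB _ _ Dv Dx.
have sep a : A a -> ip (v - x) (a - x) <= 0.
  move=> Aa; have Da := AD _ Aa; have Dax := DB _ _ Da Dx.
  (* The point x is compared with x + t (a - x), which is in A by convexity; the variational
     inequality is the limit t -> 0. *)
  have key t : 0 < t <= 1 -> 2 * ip (v - x) (a - x) <= t * N (a - x) ^+ 2.
    move=> /andP[t0 t1].
    have := xmin _ (Acv t a x _ Aa Ax); rewrite (ltW t0) t1 => /(_ isT).
    have -> : t *: a + (1 - t) *: x - v = t *: (a - x) + (x - v).
      by rewrite scalerBl scale1r scalerBr addrA addrAC [_ + (_ - _)]addrA.
    rewrite (ipnorm_lin sip)//; last exact: DB.
    have -> : ip (a - x) (x - v) = - ip (v - x) (a - x).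
      rewrite -[x - v]opprB -[- (v - x)]scaleN1r (ipC sip Dax (DZ _ _ Dh)).
      by rewrite (ipZl sip _ Dh Dax) mulN1r.
    rewrite -/N => h.
    by rewrite -(ler_pM2l t0); lra.
  have Nsq : 0 <= N (a - x) ^+ 2 := sqr_ge0 _.
  have [->|n0] := eqVneq (ip (v - x) (a - x)) 0; first exact: lexx.
  rewrite leNgt; apply/negP => i0.
  (* With i > 0 the inner product, s (N^2 + i) = i gives s N^2 < i, while [key] at s gives 2 i <= s
     N^2. *)
  pose s := ip (v - x) (a - x) / (N (a - x) ^+ 2 + ip (v - x) (a - x)).
  have d0 : 0 < N (a - x) ^+ 2 + ip (v - x) (a - x) by lra.
  have s0 : 0 < s by rewrite divr_gt0.
  have s1 : s <= 1 by rewrite ler_pdivrMr//; lra.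
  have := key s; rewrite s0 s1 => /(_ isT).
  have : s * (N (a - x) ^+ 2 + ip (v - x) (a - x)) = ip (v - x) (a - x).
    by rewrite divfK// gt_eqF.
  have : 0 < s * ip (v - x) (a - x) by rewrite mulr_gt0.
  lra.
have Nh : N (v - x) = 0.
  apply: contrapT => /eqP hn.
  have h0 : 0 < N (v - x) ^+ 2.
    by rewrite exprn_gt0// lt_neqAle eq_sym hn (sn_ge0 sN).
  (* A point a of A in the weak neighbourhood of radius N(v - x)^2 would have ip (v - x) (a - x) >
     0, against [sep]. *)
  have [i|a Aa /(_ ord0)] := Hw 1%N (fun=> ip (v - x)) _ _ h0.
    exact: ip_bounded_functional.
  have Da := AD _ Aa.
  have -> : ip (v - x) a - ip (v - x) v = ip (v - x) (a - x) - N (v - x) ^+ 2.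
    by rewrite (ipnorm_sq sip)// !(ipBr sip)//; ring.
  by have := sep _ Aa; rewrite ltr_norml; lra.
by apply: Acl => // e e0; exists x => //; rewrite (sn_sym sN) ?Nh.
Qed.

(** The sublevel set of f at r is closed and convex, hence weakly closed; a point with value above r
    thus has a weak neighbourhood that misses it. *)
Lemma convex_continuous_wlsc (f : V -> R) : seminorm_continuous D N f ->
  (forall t v w, D v -> D w -> 0 <= t <= 1 ->
     f (t *: v + (1 - t) *: w) <= t * f v + (1 - t) * f w) ->
  weakly_lower_semicontinuous D N f.
Proof.
move=> fc fcv v Dv r rfv.
pose A := [set w | D w /\ f w <= r].
have wA : weakly_closed D N A.
  apply: closed_convex_weakly_closed.
  - by move=> w [].
  - move=> w Dw H; split => //; apply/ler_addgt0Pl => e e0.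
    have [del del0 Hd] := fc w Dw e e0.
    have [a [Da fa] aw] := H del del0.
    by have := Hd _ Da aw; rewrite ltr_norml; lra.
  - move=> t x y t01 [Dx fx] [Dy fy]; split.
      by apply: (sn_DD sN); exact: (sn_DZ sN).
    apply: le_trans (fcv _ _ _ Dx Dy t01) _; case/andP: t01 => t0 t1.
    have : t * f x <= t * r by exact: ler_wpM2l.
    have : (1 - t) * f y <= (1 - t) * r by apply: ler_wpM2l => //; lra.
    lra.
apply: contrapT => H.
have [_] : A v; last by lra.
apply: wA => // n l e bl e0; apply: contrapT => H2; apply: H.
exists n, l, e; split => // w Dw Hw; rewrite ltNge; apply/negP => fw.
by apply: H2; exists w.
Qed.

End hilbert.

(** * Differentiation in time for the seminorm topology *)

Section clamp.
Context (R : realType) (T : R).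
Hypothesis T0 : 0 < T.

(** The projection of the line onto [0, T]. Functions of time are constrained on [0, T] only, and
    composing with it makes them continuous on the whole line. *)
Definition clamp (t : R) : R := Num.max 0 (Num.min t T).

Lemma clamp_itv t : clamp t \in `[0, T].
Proof.
by rewrite in_itv/= /clamp le_max lexx/= ge_max (ltW T0)/= ge_min lexx orbT.
Qed.

Lemma clamp_id t : t \in `[0, T] -> clamp t = t.
Proof. by rewrite in_itv/= => /andP[t0 tT]; rewrite /clamp (min_idPl tT) (max_idPr t0). Qed.

Lemma clamp_lip s t : `|clamp s - clamp t| <= `|s - t|.
Proof.
have T0' := ltW T0.
rewrite /clamp; case: (leP s T) => ?; case: (leP t T) => ?;
  rewrite ?(max_idPr T0'); case: (leP 0 s) => ?; case: (leP 0 t) => ?;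
  rewrite ler_norml; apply/andP; split;
  have := ler_norm (s - t); have := ler_norm (t - s); rewrite (distrC t s); lra.
Qed.

Lemma clamp_continuous (phi : R -> R) :
  (forall t, t \in `[0, T] -> forall e, 0 < e -> exists2 del, 0 < del &
     forall s, s \in `[0, T] -> `|s - t| < del -> `|phi s - phi t| < e) ->
  continuous (phi \o clamp).
Proof.
move=> H t; apply/cvgrPdist_lt => e e0.
have [del del0 Hd] := H _ (clamp_itv t) _ e0.
near=> s; rewrite /= distrC; apply: Hd (clamp_itv s) _.
apply: le_lt_trans (clamp_lip s t) _.
near: s; apply: filterS (nbhsx_ballx t del del0) => s.
by rewrite -ball_normE /= distrC.
Unshelve. all: by end_near. Qed.

Lemma continuous_itv_bounded (phi : R -> R) : continuous (phi \o clamp) ->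
  exists M, forall t, t \in `[0, T] -> phi t <= M.
Proof.
move=> cphi.
have [c _ Hc] := @EVT_max R (phi \o clamp) 0 T (ltW T0)
  (continuous_subspaceT cphi).
by exists (phi (clamp c)) => t t01; have := Hc t t01; rewrite /= clamp_id.
Qed.

End clamp.

(** * Continuous and differentiable curves, and the mean value inequality *)

Section C0.
Context (R : realType) (T : R) (V : lmodType R) (D : set V) (N : V -> R).
Hypotheses (T0 : 0 < T) (sN : seminormed D N).

Let DB := sn_DB sN. Let DZ := sn_DZ sN. Let DD := sn_DD sN.

Lemma C0_time_lin a f g : C0_time T D N f -> C0_time T D N g ->
  C0_time T D N (fun t => a *: f t + g t).
Proof.
move=> [Df cf] [Dg cg]; split=> [t tT|t tT e e0].
  by apply: (sn_Dlin sN); [exact: Df|exact: Dg].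
have a1 : 0 < `|a| + 1 by have := normr_ge0 a; lra.
have e1 : 0 < e / 2 / (`|a| + 1) by rewrite !divr_gt0.
have [d1 d10 H1] := cf t tT _ e1.
have [d2 d20 H2] := cg t tT _ (divr_gt0 e0 (ltr0Sn R 1)).
exists (Num.min d1 d2) => [|s sT]; first by rewrite lt_min d10.
rewrite lt_min => /andP[s1 s2].
have Dfs := Df s sT; have Dft := Df t tT; have Dgs := Dg s sT; have Dgt := Dg t tT.
have -> : a *: f s + g s - (a *: f t + g t) = a *: (f s - f t) + (g s - g t).
  by rewrite scalerBr opprD addrACA.
apply: le_lt_trans (sn_tri sN _ _) _; [by apply/DZ/DB|exact: DB|].
rewrite (sn_Z sN); last exact: DB.
have := H1 s sT s1; have := H2 s sT s2 => h2 h1.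
have : `|a| * N (f s - f t) <= (`|a| + 1) * N (f s - f t).
  by apply: ler_wpM2r; [apply/(sn_ge0 sN)/DB|lra].
by move: h1; rewrite ltr_pdivlMr// mulrC; lra.
Qed.

Lemma C0_time_cst v : D v -> C0_time T D N (fun=> v).
Proof.
move=> Dv; split=> // t tT e e0; exists 1 => // s sT _.
by rewrite subrr (sn_0 sN).
Qed.

Lemma C0_time_norm f : C0_time T D N f ->
  continuous ((fun t => N (f t)) \o clamp T).
Proof.
move=> [Df cf]; apply: clamp_continuous => // t tT e e0.
have [del del0 Hd] := cf t tT e e0; exists del => // s sT st.
by apply: le_lt_trans (sn_lip sN (Df s sT) (Df t tT)) (Hd s sT st).
Qed.

Lemma C0_time_bounded f : C0_time T D N f ->
  exists M, forall t, t \in `[0, T] -> N (f t) <= M.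
Proof. by move=> /C0_time_norm /(continuous_itv_bounded T0). Qed.

Lemma C0_time_unif (f_ : nat -> R -> V) f :
  (forall n, C0_time T D N (f_ n)) -> (forall t, t \in `[0, T] -> D (f t)) ->
  (forall e, 0 < e -> exists n, forall t, t \in `[0, T] -> N (f_ n t - f t) < e) ->
  C0_time T D N f.
Proof.
move=> cf Df H; split=> // t tT e e0.
have e3 : 0 < e / 3 by lra.
have [n Hn] := H _ e3; have [Dn cn] := cf n.
have [del del0 Hd] := cn t tT _ e3; exists del => // s sT st.
have := sn_dist sN (Df s sT) (Dn s sT) (Df t tT).
have := sn_dist sN (Dn s sT) (Dn t tT) (Df t tT).
have := Hn s sT; have := Hn t tT; have := Hd s sT st.
by rewrite (sn_sym sN (Dn s sT) (Df s sT)); lra.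
Qed.

Lemma C0_time_sum (f_ : nat -> R -> V) n :
  (forall k, C0_time T D N (f_ k)) -> C0_time T D N (fun t => \sum_(k < n) f_ k t).
Proof.
move=> cf; elim: n => [|n IH].
  rewrite (_ : (fun _ => _) = fun=> 0); first exact/C0_time_cst/(sn_D0 sN).
  by apply/funext => t; rewrite big_ord0.
rewrite (_ : (fun _ => _) = fun t => 1 *: (\sum_(k < n) f_ k t) + f_ n t).
  exact: C0_time_lin.
by apply/funext => t; rewrite big_ord_recr/= scale1r.
Qed.

Lemma time_derivative_lin a f f' g g' :
  (forall t, t \in `[0, T] -> D (f t)) -> (forall t, t \in `[0, T] -> D (f' t)) ->
  (forall t, t \in `[0, T] -> D (g t)) -> (forall t, t \in `[0, T] -> D (g' t)) ->
  time_derivative T N f f' -> time_derivative T N g g' ->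
  time_derivative T N (fun t => a *: f t + g t) (fun t => a *: f' t + g' t).
Proof.
move=> Df Df' Dg Dg' cf cg t tT e e0.
have a1 : 0 < `|a| + 1 by have := normr_ge0 a; lra.
have e1 : 0 < e / 2 / (`|a| + 1) by rewrite !divr_gt0.
have [d1 d10 H1] := cf t tT _ e1.
have [d2 d20 H2] := cg t tT _ (divr_gt0 e0 (ltr0Sn R 1)).
exists (Num.min d1 d2) => [|s sT st]; first by rewrite lt_min d10.
rewrite lt_min => /andP[s1 s2].
have D1 : D ((s - t)^-1 *: (f s - f t) - f' t).
  by apply: DB; [apply/DZ/DB; exact: Df|exact: Df'].
have D2 : D ((s - t)^-1 *: (g s - g t) - g' t).
  by apply: DB; [apply/DZ/DB; exact: Dg|exact: Dg'].
have -> : (s - t)^-1 *: (a *: f s + g s - (a *: f t + g t)) - (a *: f' t + g' t) =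
   a *: ((s - t)^-1 *: (f s - f t) - f' t) + ((s - t)^-1 *: (g s - g t) - g' t).
  rewrite [a *: f s + _ - _](_ : _ = a *: (f s - f t) + (g s - g t)); last first.
    by rewrite scalerBr opprD addrACA.
  by rewrite scalerDr opprD addrACA [in RHS]scalerBr !scalerA [a * _]mulrC.
apply: le_lt_trans (sn_tri sN _ _) _ => //; first exact: DZ.
rewrite (sn_Z sN)//.
have := H1 s sT st s1; have := H2 s sT st s2 => h2 h1.
have := ler_wpM2r (sn_ge0 sN D1) (_ : `|a| <= `|a| + 1).
move=> /(_ (ltac:(lra))).
by move: h1; rewrite ltr_pdivlMr// mulrC; lra.
Qed.

Section mean_value.
Variables f f' : R -> V.
Hypotheses (Df : forall t, t \in `[0, T] -> D (f t))
  (Df' : forall t, t \in `[0, T] -> D (f' t)) (ff' : time_derivative T N f f').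

Lemma time_derivative_slope t e : t \in `[0, T] -> 0 < e -> exists2 del, 0 < del &
  forall s, s \in `[0, T] -> `|s - t| < del ->
    N (f s - f t) <= (N (f' t) + e) * `|s - t|.
Proof.
move=> tT e0; have [del del0 Hd] := ff' tT e0; exists del => // s sT st.
have [->|nst] := eqVneq s t; first by rewrite !subrr (sn_0 sN) normr0 mulr0.
have := Hd s sT nst st.
have Ds := Df sT; have Dt := Df tT; have Dt' := Df' tT.
have D1 : D ((s - t)^-1 *: (f s - f t)) by apply/DZ/DB.
have n0 : 0 < `|s - t| by rewrite normr_gt0 subr_eq0.
have := sn_dist sN D1 Dt' (sn_D0 sN); rewrite !subr0 (sn_Z sN); last exact: DB.
by rewrite normfV mulrC -ler_pdivrMr//; lra.
Qed.

(** For vector values the mean value theorem is replaced by a continuation argument: with slope M +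
    e, the bound cannot stop holding before t. *)
Lemma mean_value_le s t M : 0 <= s -> s <= t -> t <= T ->
  (forall r, s <= r <= t -> N (f' r) <= M) -> N (f t - f s) <= M * (t - s).
Proof.
move=> s0 st tT HM.
have inT r : s <= r <= t -> r \in `[0, T] by move=> /andP[? ?]; rewrite in_itv/=; lra.
suff H e : 0 < e -> N (f t - f s) <= (M + e) * (t - s).
  apply/ler_addgt0Pl => e e0.
  have d0 : 0 < t - s + 1 by lra.
  have := H _ (divr_gt0 e0 d0).
  have : e / (t - s + 1) * (t - s) <= e.
    by rewrite mulrAC ler_pdivrMr// ler_wpM2l; lra.
  lra.
move=> e0.
(* The supremum c of this set belongs to it, by the slope estimate to the left of c. If c < t, the
   slope estimate to the right of c puts a larger point into the set. *)
pose S := [set r | s <= r <= t /\ N (f r - f s) <= (M + e) * (r - s)].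
have Ss : S s by split; rewrite ?subrr ?(sn_0 sN) ?mulr0// lexx.
have hS : has_sup S by split; [exists s|exists t => r [/andP[]]].
pose c := sup S.
have sc : s <= c by apply: ub_le_sup => //; case: hS.
have ct : c <= t by apply: ge_sup; [exists s|move=> r [/andP[]]].
have cT : c \in `[0, T] by apply: inT; rewrite sc ct.
have [del del0 Hd] := time_derivative_slope cT e0.
have slope r : s <= r <= t -> `|r - c| < del -> N (f r - f c) <= (M + e) * `|r - c|.
  move=> rst rc; apply: le_trans (Hd _ (inT _ rst) rc) _.
  by apply: ler_wpM2r => //; have := HM c; rewrite sc ct => /(_ isT); lra.
have DS r : s <= r <= t -> D (f r) by move=> h; exact/Df/inT.
have Ds : D (f s) by apply: DS; rewrite lexx.
have Dc : D (f c) by apply: DS; rewrite sc.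
have Sc : N (f c - f s) <= (M + e) * (c - s).
  have [r [rst Sr] cr] := sup_adherent del0 hS.
  have rc : r <= c by apply: ub_le_sup => //; case: hS.
  have := sn_dist sN Dc (DS r rst) Ds.
  have := slope r rst; rewrite distrC ger0_norm; last by lra.
  rewrite (sn_sym sN (DS r rst) Dc) => /(_ (ltac:(rewrite -/c in cr; lra))); lra.
have [cet|ct'] := eqVneq c t; first by rewrite -cet.
have clt : c < t by rewrite lt_neqAle ct'.
pose r := Num.min t (c + del / 2).
have cr : c < r by rewrite lt_min clt/=; lra.
have rt : r <= t by rewrite ge_min lexx.
have rd : r <= c + del / 2 by rewrite ge_min lexx orbT.
have rst : s <= r <= t by apply/andP; split => //; lra.
suff : r <= c by lra.
apply: ub_le_sup; first by case: hS.
split=> //.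
have := slope r rst; rewrite gtr0_norm; last by lra.
move=> /(_ (ltac:(lra))).
have := sn_dist sN (DS r rst) Dc Ds; lra.
Qed.

End mean_value.

(** Uniform convergence of the derivatives gives an error of the difference quotients of [f_ n] that
    is uniform in n, by the mean value inequality; n then goes to infinity. *)
Lemma time_derivative_lim (f_ f'_ : nat -> R -> V) (f f' : R -> V) :
  (forall n, C0_time T D N (f_ n)) -> (forall n, C0_time T D N (f'_ n)) ->
  (forall n, time_derivative T N (f_ n) (f'_ n)) ->
  C0_time T D N f -> C0_time T D N f' ->
  (forall e, 0 < e -> exists n0, forall n, (n0 <= n)%N ->
     forall t, t \in `[0, T] -> N (f_ n t - f t) < e /\ N (f'_ n t - f' t) < e) ->
  time_derivative T N f f'.
Proof.
move=> cf_ cf'_ df_ [Df _] [Df' cf'] H t tT e e0.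
have [Df_ Df'_] : (forall n t, t \in `[0, T] -> D (f_ n t)) /\
    (forall n t, t \in `[0, T] -> D (f'_ n t)).
  by split=> n; [case: (cf_ n)|case: (cf'_ n)].
have e4 : 0 < e / 4 by lra.
have [del del0 Hd] := cf' t tT _ e4.
have [n1 Hn1] := H _ e4.
exists del => // s sT nst st.
have ns : 0 < `|s - t| by rewrite normr_gt0 subr_eq0.
have Dfs := Df s sT; have Dft := Df t tT; have Dft' := Df' t tT.
suff H2 : N (f s - f t - (s - t) *: f' t) <= 3 * e / 4 * `|s - t|.
  have -> : (s - t)^-1 *: (f s - f t) - f' t = (s - t)^-1 *: (f s - f t - (s - t) *: f' t).
    by rewrite [RHS]scalerBr scalerA mulVf ?scale1r// subr_eq0.
  rewrite (sn_Z sN); last by apply: DB; [exact: DB|exact: DZ].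
  by rewrite normfV mulrC ltr_pdivrMr//; apply: le_lt_trans H2 _; rewrite ltr_pM2r//; lra.
(* The index n may depend on d, while the neighbourhood [del] was fixed before and depends on e
   only. *)
apply/ler_addgt0Pl => d d0.
have c0 : 0 < 2 + `|s - t| by lra.
have [n2 Hn2] := H _ (divr_gt0 d0 c0).
pose n := maxn n1 n2.
have Hn1' := Hn1 n (leq_maxl _ _); have Hn2' := Hn2 n (leq_maxr _ _).
have Dns := Df_ n s sT; have Dnt := Df_ n t tT; have Dnt' := Df'_ n t tT.
have key : N (f_ n s - f_ n t - (s - t) *: f'_ n t) <= 3 * e / 4 * `|s - t|.
  (* Subtracting the tangent slope at t leaves a curve whose derivative is at most 3 e / 4 near t,
     by three comparisons through f'. *)
  pose g r := - r *: f'_ n t + f_ n r; pose g' r := - f'_ n t + f'_ n r.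
  have Dg r : r \in `[0, T] -> D (g r).
    by move=> rT; apply: DD; [exact: DZ|exact: Df_].
  have Dg' r : r \in `[0, T] -> D (g' r).
    by move=> rT; apply: DD; [exact: (sn_DN sN)|exact: Df'_].
  have gg' : time_derivative T N g g'.
    move=> r rT e' e'0; have [del' del'0 Hd'] := df_ n r rT e' e'0.
    exists del' => // q qT nqr qr; apply: le_lt_trans (Hd' q qT nqr qr).
    rewrite [X in N X <= _](_ : _ = (q - r)^-1 *: (f_ n q - f_ n r) - f'_ n r)//.
    have -> : g q - g r = - (q - r) *: f'_ n t + (f_ n q - f_ n r).
      rewrite /g opprD addrACA -[- (- r *: _)]scaleNr opprK -scalerDl.
      by rewrite opprB [- q + r]addrC.
    rewrite [(q - r)^-1 *: (_ *: _ + _)]scalerDr scalerA mulrN mulVf ?subr_eq0// scaleN1r /g'.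
    by rewrite opprD addrACA subrr add0r.
  have bound r : r \in `[0, T] -> `|r - t| < del -> N (g' r) <= 3 * e / 4.
    move=> rT rt; rewrite /g' addrC.
    have := sn_dist sN (Df'_ n r rT) (Df' r rT) Dnt'.
    have := sn_dist sN (Df' r rT) Dft' Dnt'.
    have := Hd r rT rt; case: (Hn1' r rT) => _; case: (Hn1' t tT) => _.
    rewrite (sn_sym sN Dft' Dnt'); lra.
  have -> : f_ n s - f_ n t - (s - t) *: f'_ n t = g s - g t.
    rewrite /g opprD [RHS]addrACA -[- (- t *: _)]scaleNr opprK -scalerDl.
    by rewrite addrC -scaleNr opprB [- s + t]addrC.
  move: (sT) (tT); rewrite !in_itv/= => /andP[s0 sT'] /andP[t0 tT'].
  have [ts|st'] := leP t s.
    rewrite ger0_norm; last by lra.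
    apply: (mean_value_le Dg Dg' gg') => // r /andP[tr rs]; apply: bound.
      by rewrite in_itv/=; lra.
    rewrite ger0_norm; last by lra.
    by move: st; rewrite ger0_norm; lra.
  rewrite (sn_sym sN (Dg _ sT) (Dg _ tT)) ltr0_norm; last by lra.
  rewrite opprB; apply: (mean_value_le Dg Dg' gg') => //; first exact: ltW.
  move=> r /andP[sr rt]; apply: bound.
    by rewrite in_itv/=; lra.
  rewrite ler0_norm; last by lra.
  by move: st; rewrite ltr0_norm; lra.
have [h1 _] := Hn2' s sT; have [h2 h3] := Hn2' t tT.
have DX : D (f s - f t - (s - t) *: f' t) by apply: DB; [exact: DB|exact: DZ].
have DXn : D (f_ n s - f_ n t - (s - t) *: f'_ n t) by apply: DB; [exact: DB|exact: DZ].
have := sn_dist sN DX DXn (sn_D0 sN); rewrite !subr0 (sn_sym sN DX DXn).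
suff : N (f_ n s - f_ n t - (s - t) *: f'_ n t - (f s - f t - (s - t) *: f' t)) <= d.
  by move: key; lra.
rewrite opprD addrACA opprD [_ + (- f s - _)]addrACA -[- f_ n t - - f t]opprD -[- _ - - (_ *: _)]opprD -scalerBr.
apply: le_trans (sn_tri sN _ _) _.
- by apply: DD; [exact: DB|apply: (sn_DN sN); exact: DB].
- by apply/(sn_DN sN)/DZ/DB.
rewrite (sn_opp sN); last by apply/DZ/DB.
rewrite (sn_Z sN); last exact: DB.
apply: le_trans (lerD (sn_tri sN _ _) (lexx _)) _; first exact: DB.
- by apply: (sn_DN sN); exact: DB.
rewrite (sn_opp sN); last exact: DB.
have := divfK (lt0r_neq0 c0) d; move: h1 h2 h3; set q := d / _ => h1 h2 h3 <-.
have : `|s - t| * N (f'_ n t - f' t) <= `|s - t| * q by apply: ler_wpM2l => //; exact: ltW.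
lra.
Qed.

End C0.

Section C0_series.
Context (R : realType) (T : R) (V : lmodType R) (D : set V) (N : V -> R).
Hypotheses (T0 : 0 < T) (sN : seminormed D N) (cN : seminorm_complete D N).

Lemma C0_time_series (f_ : nat -> R -> V) M : 0 < M ->
  (forall k, C0_time T D N (f_ k)) ->
  (forall k t, t \in `[0, T] -> N (f_ k t) <= M * 2^-1 ^+ k) ->
  exists2 f, C0_time T D N f & forall n t, t \in `[0, T] ->
    N (\sum_(k < n) f_ k t - f t) <= 2 * M * 2^-1 ^+ n.
Proof.
move=> M0 cf fM.
have DS n t : t \in `[0, T] -> D (\sum_(k < n) f_ k t).
  by move=> tT; apply: (sn_Dsum sN) => k _; case: (cf k) => + _; exact.
have /choice[f Hf] : forall t, exists v, t \in `[0, T] ->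
    D v /\ forall n, N (\sum_(k < n) f_ k t - v) <= 2 * M * 2^-1 ^+ n.
  move=> t; have [tT|] := boolP (t \in `[0, T]); last by exists 0.
  have [||v Dv Hv] := complete_fast sN cN M0 (v_ := fun n => \sum_(k < n) f_ k t).
  - by move=> n; exact: DS.
  - by move=> n; rewrite big_ord_recr/= [X in N (X - _)]addrC addrK; exact: fM.
  by exists v.
exists f => [|n t tT]; last by case: (Hf t tT).
apply: (C0_time_unif sN (f_ := fun n t => \sum_(k < n) f_ k t)).
- by move=> n; exact: (C0_time_sum sN).
- by move=> t tT; case: (Hf t tT).
- move=> e e0; have [n Hn] := half_exp_small (2 * M) e0.
  by exists n => t tT; apply: le_lt_trans (Hn n (leqnn n)); case: (Hf t tT).
Qed.

End C0_series.

(** * Smooth cut-off functions *)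

Section bump.
Context (R : realType).

(** For k = 0 this is the flat function exp(-1/t) extended by 0; the powers t^-k close the family
    under differentiation. *)
Definition psi (k : nat) (t : R) : R :=
  if 0 < t then t^-1 ^+ k * expR (- t^-1) else 0.

Lemma psi_ge0 k t : 0 <= psi k t.
Proof.
rewrite /psi; case: ifPn => // t0.
by rewrite mulr_ge0 ?expR_ge0// exprn_ge0// invr_ge0 ltW.
Qed.

(** From s^n / n! <= exp s with s = 1/t and n = k + m + 1: every member of the family vanishes at 0
    to all orders. *)
Lemma psi_le k m t : 0 < t -> psi k t <= (k + m.+1)`!%:R * t ^+ m.+1.
Proof.
move=> t0; rewrite /psi t0; have s0 : 0 < t^-1 by rewrite invr_gt0.
rewrite -[in X in _ <= _ * X](invrK t) [X in _ <= _ * X]exprVn.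
move: s0; set s := t^-1 => s0.
rewrite expRN ler_pdivrMr ?expR_gt0//.
have := expR_ge1Dxn (k + m) (ltW s0).
set F := (k + m).+1`!%:R : R.
have F0 : 0 < F by rewrite ltr0n fact_gt0.
move=> h; rewrite addnS -/F.
have h2 : s ^+ (k + m).+1 <= F * expR s.
  rewrite mulrC -ler_pdivrMr//; apply: le_trans h; rewrite ler_wpDl//.
have -> : s ^+ k = s ^+ (k + m).+1 * s ^- m.+1.
  by rewrite -addnS exprD mulfK// gt_eqF// exprn_gt0.
by rewrite -mulrAC ler_pM2r// invr_gt0 exprn_gt0.
Qed.

Lemma psi0_le1 t : psi 0 t <= 1.
Proof.
rewrite /psi; case: ifPn => // t0; rewrite expr0 mul1r -expR0 ler_expR.
by rewrite oppr_le0 invr_ge0 ltW.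
Qed.

Lemma is_derive_psi (k : nat) (t : R) :
  is_derive t (1 : R) (psi k : R -> R) (psi k.+2 t - k%:R * psi k.+1 t).
Proof.
have [t0|t0|<-] := ltgtP 0 t.
- pose f : R -> R := (fun x : R => x^-1) ^+ k * (expR \o (fun x : R => - x^-1)).
  have dV : is_derive t (1 : R) (fun x : R => x^-1) (- t ^- 2 *: 1).
    by apply: (is_deriveV (f := id)); rewrite gt_eqF.
  have dN : is_derive t (1 : R) (fun x : R => - x^-1) (- (- t ^- 2 *: 1)) by exact: is_deriveN.
  have dE := @is_derive1_comp R expR (fun x : R => - x^-1) t _ _ (is_derive_expR _) dN.
  have df := is_deriveM (is_deriveX k dV) dE.
  apply: (near_eq_is_derive (f := f)).
    near=> x; rewrite /f /psi.
    by rewrite (_ : 0 < x); [rewrite /GRing.mul/= exprfctE|near: x; exact: lt_nbhsr].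
  apply: is_derive_eq df _.
  rewrite /psi t0 exprfctE /GRing.scale/= !mulr1 opprK -exprVn.
  set e := expR _; set u := t^-1; clearbody e u.
  case: {f dV dN dE} k => [|m] /=; first by ring.
  by rewrite !exprS; ring.
- apply: (near_eq_is_derive (f := cst 0)).
    near=> x; rewrite /psi ifF//; apply/negbTE; rewrite -leNgt.
    by near: x; exact: lt_le_nbhsl.
  by rewrite /psi !ltNge (ltW t0)/= mulr0 subr0; exact: is_derive_cst.
(* At 0 the difference quotient is at most (k + 2)! h, by [psi_le] with m = 1. *)
- have c : (fun h : R => h^-1 *: ((psi k \o shift 0) (h *: (1 : R)) - psi k 0)) @ 0^' --> (0 : R).
    apply/cvgrPdist_lt => e e0.
    pose C : R := (k + 2)`!%:R.
    have C0 : 0 < C by rewrite ltr0n fact_gt0.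
    near=> h; rewrite sub0r normrN /= addr0 /GRing.scale/= mulr1 /psi ltxx subr0.
    case: ifPn => h0; last by rewrite mulr0 normr0.
    have hC : h * C < e.
      rewrite -ltr_pdivlMr//; have : `|h| < e / C.
        by near: h; apply: dnbhs0_lt; exact: divr_gt0.
      by rewrite gtr0_norm.
    have := psi_le k 1 h0; rewrite /psi h0 => hb.
    rewrite ger0_norm; last by rewrite !mulr_ge0 ?expR_ge0 ?exprn_ge0 ?invr_ge0// ltW.
    rewrite mulrC ltr_pdivrMr//; apply: le_lt_trans hb _.
    by rewrite expr2 mulrA ltr_pM2r// mulrC.
  have -> : psi k.+2 0 - k%:R * psi k.+1 0 = 0 by rewrite /psi ltxx mulr0 subr0.
  apply: DeriveDef; first by apply/cvg_ex; exists 0.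
  by apply/cvg_lim.
Unshelve. all: by end_near.
Qed.

Lemma differentiable_psi k t : differentiable (psi k : R -> R) t.
Proof. by apply/derivable1_diffP; case: (is_derive_psi k t). Qed.

Section elementary.
Variable E : normedModType R.

(** A class that contains the cut-off functions and is closed under directional derivatives, so that
    smoothness follows by induction. The derivative [dl v] of l is independent of the point: l is
    affine. *)
Inductive elementary : (E -> R) -> Prop :=
| elementary_cst c : elementary (fun=> c)
| elementary_psi k (l : E -> R) (dl : E -> R) :
    (forall x, differentiable l x) -> (forall x v, 'D_v l x = dl v) ->
    elementary (fun x => psi k (l x))
| elementary_add f g : elementary f -> elementary g ->
    elementary (fun x => f x + g x)
| elementary_mul f g : elementary f -> elementary g ->
    elementary (fun x => f x * g x).

Lemma elementary_derive f : elementary f ->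
  (forall x, differentiable f x) /\ forall v, elementary ('D_v f).
Proof.
elim=> [c|k l dl ldiff Dl|{}f g ef [df Df] eg [dg Dg]|{}f g ef [df Df] eg [dg Dg]].
- split=> // v; rewrite (_ : 'D_v _ = fun=> 0); first exact: elementary_cst.
  by apply/funext => x; exact: derive_cst.
- have dc x : differentiable (fun x => psi k (l x)) x.
    by apply: (differentiable_comp (f := l) (g := psi k)) => //; exact: differentiable_psi.
  split=> // v; rewrite (_ : 'D_v _ = fun x =>
      (psi k.+2 (l x) + - k%:R * psi k.+1 (l x)) * dl v).
    apply: elementary_mul (elementary_cst _); apply: elementary_add.
      exact: elementary_psi Dl.
    by apply: elementary_mul (elementary_cst _) _; exact: elementary_psi Dl.
  apply/funext => x; rewrite deriveE//.
  rewrite (diff_comp (f := l) (g := psi k))//; last exact: differentiable_psi.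
  rewrite /= -(Dl x) deriveE// diff1E; last exact: differentiable_psi.
  have := is_derive_psi k (l x) => dp.
  by rewrite derive1E derive_val [LHS]mulrC mulNr.
- split=> [x|v]; first exact: (differentiableD (f := f) (g := g)).
  rewrite (_ : 'D_v _ = fun x => 'D_v f x + 'D_v g x).
    by apply: elementary_add.
  by apply/funext => x; rewrite (deriveD (f := f) (g := g))//; exact: diff_derivable.
- split=> [x|v]; first exact: (differentiableM (f := f) (g := g)).
  rewrite (_ : 'D_v _ = fun x => f x * 'D_v g x + g x * 'D_v f x).
    by apply: elementary_add; apply: elementary_mul.
  by apply/funext => x; rewrite (deriveM (f := f) (g := g))//; exact: diff_derivable.
Qed.

Lemma elementary_smooth f : elementary f -> smooth f.
Proof.
move=> ef vs x; suff : elementary (foldr (fun v g => 'D_v g) f vs).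
  by move=> /elementary_derive[].
by elim: vs => //= v vs /elementary_derive[].
Qed.

Lemma elementary_prod I (r : seq I) (f : I -> E -> R) :
  (forall i, elementary (f i)) -> elementary (fun x => \prod_(i <- r) f i x).
Proof.
move=> ef; elim: r => [|i r IH].
  rewrite (_ : (fun _ => _) = fun=> 1); first exact: elementary_cst.
  by apply/funext => x; rewrite big_nil.
rewrite (_ : (fun _ => _) = fun x => f i x * \prod_(i <- r) f i x).
  exact: elementary_mul.
by apply/funext => x; rewrite big_cons.
Qed.

End elementary.

Lemma psi_scale_cvg (s : R) : 0 < s -> (fun n => psi 0 (n.+1%:R * s)) @ \oo --> (1 : R).
Proof.
move=> s0; apply: (@squeeze_cvgr _ _ _ _ (fun n : nat => 1 - n.+1%:R^-1 * s^-1) (cst 1)).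
- apply: nearW => n; rewrite psi0_le1 andbT.
  have n0 : 0 < n.+1%:R * s by rewrite mulr_gt0// ltr0n.
  rewrite /psi n0 expr0 mul1r -invfM.
  exact: expR_ge1Dx.
- rewrite -[X in _ --> X]subr0 -[X in _ --> _ - X](mul0r s^-1).
  apply: cvgB; first exact: cvg_cst.
  apply: cvgM; last exact: cvg_cst.
  exact: cvg_harmonic.
- exact: cvg_cst.
Qed.

End bump.

Import HBNNSimple.

(** * Integrals of almost everywhere defined functions *)

Section ae_integral.
Context (disp : measure_display) (X : measurableType disp) (R : realType).
Context (mu : {measure set X -> \bar R}) (D : set X) (mD : measurable D).

Lemma ae_null (P : X -> Prop) : {ae mu, forall x, P x} ->
  exists N, [/\ measurable N, mu N = 0%E & forall x, ~ N x -> P x].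
Proof.
by move=> [N [mN N0 sub]]; exists N; split=> // x Nx; apply: contrapT => Px; exact/Nx/sub.
Qed.

Lemma ge0_integral_ae_le (f g : X -> \bar R) :
  (forall x, D x -> (0 <= f x)%E) -> (forall x, D x -> (0 <= g x)%E) ->
  {ae mu, forall x, D x -> (f x <= g x)%E} ->
  (\int[mu]_(x in D) f x <= \int[mu]_(x in D) g x)%E.
Proof.
move=> f0 g0 /ae_null[N [mN N0 fg]].
rewrite ge0_integralE// [leRHS]ge0_integralE//.
apply: ge_ereal_sup => _ [h /= hf <-].
pose h' := proj_nnsfun h (measurableC mN).
have hh' x : h' x = h x * \1_(~` N) x by [].
apply: (@le_trans _ _ (sintegral mu h')); last first.
  apply: ereal_sup_ubound; exists h' => // x.
  rewrite hh' indicE; have [Nx|Nx] := boolP (x \in ~` N); last first.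
    by rewrite mulr0 /patch; case: ifPn => // /set_mem Dx; exact: g0.
  rewrite mulr1; apply: le_trans (hf x) _; rewrite /patch; case: ifPn => // /set_mem Dx.
  by apply: fg => //; exact: set_mem.
rewrite -!integralT_nnsfun le_eqVlt; apply/orP; left; apply/eqP.
apply: ge0_ae_eq_integral => //.
- by apply/measurable_EFinP; exact: measurable_funP.
- by apply/measurable_EFinP; exact: measurable_funP.
- by move=> x _; rewrite lee_fin.
- by move=> x _; rewrite lee_fin.
- exists N; split => // x hx; apply: contrapT => Nx; apply: hx => _.
  by congr (_%:E); rewrite hh' indicE mem_set ?mulr1.
Qed.

(* Neither function has to be measurable: the integral is a supremum over
   simple functions, which can be cut off on the exceptional set. *)
Lemma integral_ae (f g : X -> \bar R) :
  {ae mu, forall x, D x -> f x = g x} ->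
  (\int[mu]_(x in D) f x = \int[mu]_(x in D) g x)%E.
Proof.
suff H : forall f g : X -> \bar R, (forall x, D x -> 0 <= f x)%E -> (forall x, D x -> 0 <= g x)%E ->
    {ae mu, forall x, D x -> f x = g x} ->
    (\int[mu]_(x in D) f x = \int[mu]_(x in D) g x)%E.
  move=> fg; rewrite integralE [RHS]integralE.
  have /ae_eq_funeposneg[fgp fgn] : ae_eq mu D f g by [].
  by congr (_ - _)%E; apply: H.
move=> {}f {}g f0 g0 fg; apply/eqP; rewrite eq_le; apply/andP; split;
  apply: ge0_integral_ae_le => //; by apply: filterS fg => x fg Dx; rewrite fg.
Qed.

Lemma Rintegral_ae (f g : X -> R) : {ae mu, forall x, D x -> f x = g x} ->
  \int[mu]_(x in D) f x = \int[mu]_(x in D) g x.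
Proof.
by move=> fg; rewrite /Rintegral (@integral_ae _ (EFin \o g))//; apply: filterS fg => x + Dx => ->.
Qed.

(** The sigma-algebra need not be complete, so a limit that exists almost everywhere may fail to be
    measurable. A measurable representative is enough, since the integral ignores null sets by
    [integral_ae]. *)
Definition aemeas (f : X -> R) : Prop :=
  exists2 f', measurable_fun D f' & {ae mu, forall x, D x -> f x = f' x}.

Definition aeint (f : X -> R) : Prop :=
  exists2 f', mu.-integrable D (EFin \o f') & {ae mu, forall x, D x -> f x = f' x}.

Lemma aeint_meas f : aeint f -> aemeas f.
Proof.
by case=> f' /(measurable_int mu)/measurable_EFinP mf' ff'; exists f'.
Qed.

Lemma meas_aemeas f : measurable_fun D f -> aemeas f.
Proof. by exists f => //; exact: aeW. Qed.

Lemma integrable_aeint f : mu.-integrable D (EFin \o f) -> aeint f.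
Proof. by exists f => //; exact: aeW. Qed.

Lemma aemeas_eq f g : {ae mu, forall x, D x -> f x = g x} -> aemeas f -> aemeas g.
Proof.
move=> fg [f' mf' ff']; exists f' => //.
by apply: filterS2 fg ff' => x + + Dx => -> // ->.
Qed.

Lemma aeint_eq f g : {ae mu, forall x, D x -> f x = g x} -> aeint f -> aeint g.
Proof.
move=> fg [f' mf' ff']; exists f' => //.
by apply: filterS2 fg ff' => x + + Dx => -> // ->.
Qed.

Lemma aemeasM f g : aemeas f -> aemeas g -> aemeas (fun x => f x * g x).
Proof.
move=> [f' mf' ff'] [g' mg' gg']; exists (fun x => f' x * g' x).
  exact: measurable_funM.
by apply: filterS2 ff' gg' => x + + Dx => -> // ->.
Qed.

Lemma aemeas_comp (phi : R -> R) f : measurable_fun setT phi -> aemeas f ->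
  aemeas (fun x => phi (f x)).
Proof.
move=> mphi [f' mf' ff']; exists (phi \o f'); first exact: measurableT_comp.
by apply: filterS ff' => x + Dx => -> .
Qed.

Lemma aemeas_lim (f_ : nat -> X -> R) f : (forall n, aemeas (f_ n)) ->
  {ae mu, forall x, D x -> (fun n => f_ n x) @ \oo --> f x} -> aemeas f.
Proof.
move=> mf_ ff.
have /choice[g Hg] : forall n, exists g, measurable_fun D g /\ {ae mu, forall x, D x -> f_ n x = g x}.
  by move=> n; case: (mf_ n) => g; exists g.
have /ae_foralln/ae_null[N1 [mN1 N10 H1]] : forall n, {ae mu, forall x, D x -> f_ n x = g n x}.
  by move=> n; case: (Hg n).
have [N2 [mN2 N20 H2]] := ae_null ff.
(* Cutting off on the exceptional null set makes the convergence hold everywhere on D, so the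
   cut-off limit is measurable. *)
have mN : measurable (~` (N1 `|` N2)) by apply: measurableC; exact: measurableU.
exists (fun x => f x * \1_(~` (N1 `|` N2)) x).
  apply: (measurable_fun_cvg (h := fun n x => g n x * \1_(~` (N1 `|` N2)) x)).
    move=> n; apply: measurable_funM; first by case: (Hg n).
    exact: measurable_indic.
  move=> x Dx; rewrite indicE; case: (boolP (x \in _)) => [/set_mem Nx|_] /=.
    have -> : (fun n => g n x * 1) = fun n => f_ n x.
      by apply/funext => n; rewrite mulr1 H1// => N1x; apply: Nx; left.
    by rewrite mulr1; apply: H2 => // N2x; apply: Nx; right.
  rewrite mulr0 (_ : (fun _ => _) = fun=> 0); first exact: cvg_cst.
  by apply/funext => n; rewrite mulr0.
exists (N1 `|` N2); split; first exact: measurableU.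
  by rewrite null_set_setU.
by move=> x /=; apply: contra_notP => Nx Dx; rewrite indicE mem_set ?mulr1.
Qed.

Lemma aeint_lin a f g : aeint f -> aeint g ->
  aeint (fun x => a * f x + g x) /\
  \int[mu]_(x in D) (a * f x + g x) =
  a * \int[mu]_(x in D) f x + \int[mu]_(x in D) g x.
Proof.
move=> [f' mf' ff'] [g' mg' gg'].
have E : {ae mu, forall x, D x -> a * f x + g x = a * f' x + g' x}.
  by apply: filterS2 ff' gg' => x + + Dx => -> // ->.
have mZ : mu.-integrable D (EFin \o (fun x => a * f' x)) by exact: (integrableZl mD a mf').
split; first by exists (fun x => a * f' x + g' x) => //; exact: (integrableD mD mZ mg').
by rewrite (Rintegral_ae E) (Rintegral_ae ff') (Rintegral_ae gg') RintegralD// RintegralZl.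
Qed.

Lemma aeint0 : aeint (fun=> 0).
Proof. by apply: integrable_aeint; exact: integrable0. Qed.

Lemma aeint_cst c : (mu D < +oo)%E -> aeint (cst c).
Proof.
move=> fD; apply: integrable_aeint; apply/integrableP; split.
  exact/measurable_EFinP/measurable_cst.
rewrite (_ : (fun x => _) = cst `|c|%:E)// integral_cst//.
by apply: lte_mul_pinfty => //; rewrite lee_fin.
Qed.

Lemma aeintZ a f : aeint f -> aeint (fun x => a * f x) /\
  \int[mu]_(x in D) (a * f x) = a * \int[mu]_(x in D) f x.
Proof.
move=> ff; have [h1 h2] := aeint_lin a ff aeint0.
have E : {ae mu, forall x, D x -> a * f x + 0 = a * f x} by apply: aeW => x _; rewrite addr0.
split; first exact: aeint_eq E h1.
by rewrite -(Rintegral_ae E) h2 Rintegral_cst// mul0r addr0.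
Qed.

Lemma aeintD f g : aeint f -> aeint g -> aeint (fun x => f x + g x) /\
  \int[mu]_(x in D) (f x + g x) = \int[mu]_(x in D) f x + \int[mu]_(x in D) g x.
Proof.
move=> ff gg; have [h1 h2] := aeint_lin 1 ff gg.
have E : {ae mu, forall x, D x -> 1 * f x + g x = f x + g x} by apply: aeW => x _; rewrite mul1r.
by split; [exact: aeint_eq E h1|rewrite -(Rintegral_ae E) h2 mul1r].
Qed.

Lemma aeintB f g : aeint f -> aeint g -> aeint (fun x => f x - g x) /\
  \int[mu]_(x in D) (f x - g x) = \int[mu]_(x in D) f x - \int[mu]_(x in D) g x.
Proof.
move=> ff gg; have [g1 g2] := aeintZ (-1) gg; have [h1 h2] := aeintD ff g1.
have E : {ae mu, forall x, D x -> f x + -1 * g x = f x - g x} by apply: aeW => x _; rewrite mulN1r.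
by split; [exact: aeint_eq E h1|rewrite -(Rintegral_ae E) h2 g2 mulN1r].
Qed.

Lemma aeint_sum I (r : seq I) (f : I -> X -> R) : (forall i, aeint (f i)) ->
  aeint (fun x => \sum_(i <- r) f i x) /\
  \int[mu]_(x in D) (\sum_(i <- r) f i x) = \sum_(i <- r) \int[mu]_(x in D) f i x.
Proof.
move=> mf; elim: r => [|i r [IH1 IH2]].
  have E : {ae mu, forall x, D x -> 0 = \sum_(i <- [::]) f i x} by apply: aeW => x _; rewrite big_nil.
  split; first by apply: aeint_eq E aeint0.
  by rewrite -(Rintegral_ae E) Rintegral_cst// mul0r big_nil.
have [h1 h2] := aeintD (mf i) IH1.
have E : {ae mu, forall x, D x -> f i x + \sum_(j <- r) f j x = \sum_(j <- i :: r) f j x}.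
  by apply: aeW => x _; rewrite big_cons.
by split; [exact: aeint_eq E h1|rewrite -(Rintegral_ae E) h2 IH2 big_cons].
Qed.

Lemma aeint_dom f g : aemeas f -> aeint g ->
  {ae mu, forall x, D x -> `|f x| <= g x} -> aeint f.
Proof.
move=> [f' mf' ff'] [g' mg' gg'] fg.
have /ae_null[N [mN N0 H]] : {ae mu, forall x, D x -> `|f' x| <= g' x}.
  by apply: filterS3 ff' gg' fg => x h1 h2 h3 Dx; rewrite -h1// -h2//; exact: h3.
have mCN := measurableC mN.
exists (fun x => f' x * \1_(~` N) x).
  apply: le_integrable mg' => //.
    apply/measurable_EFinP; apply: measurable_funM => //; exact: measurable_indic.
  move=> x Dx; rewrite /= lee_fin indicE; case: (boolP (x \in _)) => [/set_mem Nx|_] /=.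
    by rewrite mulr1; apply: le_trans (H x Nx Dx) (ler_norm _).
  by rewrite mulr0 normr0.
have N' : {ae mu, forall x, ~ N x} by exists N; split => // x /= /contrapT.
by apply: filterS2 N' ff' => x Nx h Dx; rewrite h// indicE mem_set ?mulr1.
Qed.

Lemma aeint_norm f : aeint f -> aeint (fun x => `|f x|).
Proof.
move=> [f' mf' ff']; exists (fun x => `|f' x|); first exact: integrable_norm.
by apply: filterS ff' => x + Dx => ->.
Qed.

Lemma ae_Rintegral_ge0 f : {ae mu, forall x, D x -> 0 <= f x} ->
  0 <= \int[mu]_(x in D) f x.
Proof.
move=> f0; rewrite (@Rintegral_ae _ (fun x => `|f x|)).
  exact: Rintegral_ge0.
by apply: filterS f0 => x + Dx => h; rewrite ger0_norm//; exact: h.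
Qed.

Lemma ae_le_Rintegral f g : aeint f -> aeint g ->
  {ae mu, forall x, D x -> f x <= g x} ->
  \int[mu]_(x in D) f x <= \int[mu]_(x in D) g x.
Proof.
move=> ff gg fg; rewrite -subr_ge0 -(aeintB gg ff).2.
by apply: ae_Rintegral_ge0; apply: filterS fg => x h Dx; rewrite subr_ge0; exact: h.
Qed.

Lemma ae_norm_Rintegral f g : aeint f -> aeint g ->
  {ae mu, forall x, D x -> `|f x| <= g x} ->
  `|\int[mu]_(x in D) f x| <= \int[mu]_(x in D) g x.
Proof.
move=> ff gg fg; rewrite ler_norml; apply/andP; split.
  rewrite -mulN1r -(aeintZ _ gg).2.
  apply: ae_le_Rintegral => //; first by case: (aeintZ (-1) gg).
  by apply: filterS fg => x h Dx; have := h Dx; rewrite ler_norml mulN1r => /andP[].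
by apply: ae_le_Rintegral => //; apply: filterS fg => x h Dx; exact: le_trans (ler_norm _) (h Dx).
Qed.

Lemma ae_dominated_convergence (f_ : nat -> X -> R) f g :
  (forall n, aemeas (f_ n)) -> aeint g ->
  {ae mu, forall x, D x -> (fun n => f_ n x) @ \oo --> f x} ->
  (forall n, {ae mu, forall x, D x -> `|f_ n x| <= g x}) ->
  aeint f /\ (fun n => \int[mu]_(x in D) f_ n x) @ \oo --> \int[mu]_(x in D) f x.
Proof.
move=> mf_ ig ff fg.
have [f' mf' ff'] := aemeas_lim mf_ ff.
have /choice[h Hh] : forall n, exists h, measurable_fun D h /\ {ae mu, forall x, D x -> f_ n x = h x}.
  by move=> n; case: (mf_ n) => h; exists h.
have aeh := ae_foralln (fun n => (Hh n).2).
case: ig => g' ig' gg'.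
have [|||||i' _ c'] := @dominated_convergence _ _ _ mu D mD (fun n => EFin \o h n) (EFin \o f') (EFin \o g').
- by move=> n; apply/measurable_EFinP; case: (Hh n).
- exact/measurable_EFinP.
- apply: filterS3 aeh ff' ff => x h1 h2 h3 Dx.
  rewrite /= -h2//; apply: cvg_EFin; first exact: nearW.
  by rewrite (_ : _ \o _ = fun n => f_ n x); [exact: h3|apply/funext => n /=; rewrite h1].
- exact: ig'.
- apply: filterS3 aeh gg' (ae_foralln fg) => x h1 h2 h3 n Dx.
  by rewrite /= lee_fin -h1// -h2//; exact: h3.
split; first by exists f'.
rewrite (Rintegral_ae ff').
rewrite (_ : (fun n => _) = fun n => fine (\int[mu]_(x in D) (h n x)%:E)).
  by apply: fine_cvg; rewrite /Rintegral fineK//; exact: integrable_fin_num.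
by apply/funext => n; apply: Rintegral_ae; case: (Hh n).
Qed.

Lemma ae_Rintegral_eq0 f : aeint f -> {ae mu, forall x, D x -> 0 <= f x} ->
  \int[mu]_(x in D) f x = 0 -> {ae mu, forall x, D x -> f x = 0}.
Proof.
move=> [f' if' ff'] f0; rewrite (Rintegral_ae ff') => h.
have f'0 : {ae mu, forall x, D x -> f' x = `|f' x|}.
  by apply: filterS2 ff' f0 => x h1 h2 Dx; rewrite -h1// ger0_norm//; exact: h2.
have : (\int[mu]_(x in D) `|(EFin \o f') x| = 0)%E.
  rewrite (@integral_ae _ (EFin \o f')); last first.
    by apply: filterS f'0 => x h1 Dx /=; rewrite -h1.
  by rewrite -(fineK (integrable_fin_num mD if')) -/(Rintegral _ _ _) h.
move=> /(ae_eq_integral_abs mu mD (measurable_int mu if')) h0.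
by apply: filterS2 h0 ff' => x + + Dx => /(_ Dx) h1 -> //; case: h1.
Qed.

(** Translates the finiteness conditions in the definitions of [L2] and [L2_time] into
    integrability. *)
Lemma aeint_lty f : (forall x, D x -> 0 <= f x) -> aemeas f ->
  (\int[mu]_(x in D) (f x)%:E < +oo)%E <-> aeint f.
Proof.
move=> f0 [f' mf' ff']; split.
  move=> h; exists f' => //; apply/integrableP; split; first exact/measurable_EFinP.
  rewrite (@integral_ae _ (EFin \o f))//.
  by apply: filterS ff' => x h1 Dx /=; rewrite -h1// ger0_norm//; exact: f0.
move=> [g ig fg]; rewrite (@integral_ae _ (EFin \o g)); last first.
  by apply: filterS fg => x + Dx => ->.
by rewrite -(fineK (integrable_fin_num mD ig)) ltry.
Qed.

Lemma aeint_EFin f : aeint f -> (\int[mu]_(x in D) (f x)%:E)%E = (\int[mu]_(x in D) f x)%:E.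
Proof.
move=> [g ig fg]; rewrite /Rintegral (@integral_ae _ (EFin \o g)); last first.
  by apply: filterS fg => x + Dx => ->.
by rewrite fineK//; exact: integrable_fin_num.
Qed.

(** By monotone convergence the sum has integral at most 2 C, so it is finite almost everywhere.
    Norm estimates are turned into pointwise convergence in this way. *)
Lemma ae_series_bounded (h : nat -> X -> R) C : (forall n, aeint (h n)) ->
  (forall n, {ae mu, forall x, D x -> 0 <= h n x}) ->
  (forall n, \int[mu]_(x in D) h n x <= C * 2^-1 ^+ n) ->
  {ae mu, forall x, D x -> exists M, forall n, \sum_(k < n) h k x <= M}.
Proof.
move=> ih h0 hC.
have /choice[g Hg] : forall n, exists g, mu.-integrable D (EFin \o g) /\ {ae mu, forall x, D x -> h n x = g x}.
  by move=> n; case: (ih n) => g; exists g.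
have mg n : measurable_fun D (fun x => `|(EFin \o g n) x|)%E.
  by apply: measurableT_comp => //; case: (Hg n) => /(measurable_int mu).
have I n : (\int[mu]_(x in D) `|(EFin \o g n) x| <= (C * 2^-1 ^+ n)%:E)%E.
  apply: le_trans (_ : _ <= (\int[mu]_(x in D) h n x)%:E)%E _; last by rewrite lee_fin.
  rewrite -aeint_EFin// le_eqVlt; apply/orP; left; apply/eqP; apply: integral_ae.
  by apply: filterS2 (Hg n).2 (h0 n) => x h1 h2 Dx /=; rewrite -h1// ger0_norm//; exact: h2.
have C0 : 0 <= C.
  by have := hC 0%N; rewrite expr0 mulr1; apply: le_trans; exact: ae_Rintegral_ge0.
have S : (\int[mu]_(x in D) \sum_(n <oo) `|(EFin \o g n) x| < +oo)%E.
  rewrite integral_nneseries//; apply: le_lt_trans (_ : _ <= (2 * C)%:E)%E _; last exact: ltry.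
  apply: (@le_trans _ _ (\sum_(n <oo) (C * 2^-1 ^+ n)%:E)%E).
    by apply: lee_nneseries => [n _ _|n _]; [exact: integral_ge0|exact: I].
  apply: lime_le; first by apply: is_cvg_nneseries => n _ _; rewrite lee_fin mulr_ge0// exprn_ge0.
  apply: nearW => n; rewrite sumEFin lee_fin.
  suff -> : \sum_(0 <= k < n) C * 2^-1 ^+ k = 2 * C * (1 - 2^-1 ^+ n).
    by rewrite ler_piMr ?mulr_ge0//; have := half_exp_gt0 R n; lra.
  elim: n => [|n IH]; first by rewrite big_geq// expr0 subrr mulr0.
  by rewrite big_nat_recr//= IH exprS; lra.
have iS : mu.-integrable D (fun x => \sum_(n <oo) `|(EFin \o g n) x|)%E.
  apply/integrableP; split; first exact: ge0_emeasurable_sum.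
  rewrite (_ : (\int[mu]_(x in D) _ = \int[mu]_(x in D) \sum_(n <oo) `|(EFin \o g n) x|)%E)//.
  by apply: eq_integral => x _; rewrite gee0_abs// nneseries_ge0.
have := integrable_ae mD iS.
apply: filterS2 (ae_foralln (fun n => (Hg n).2)) => x hg fin Dx.
exists (fine (\sum_(n <oo) `|(EFin \o g n) x|)%E) => n.
rewrite -lee_fin fineK; last exact: fin.
apply: le_trans (nneseries_lim_ge n _); last by [].
rewrite sumEFin lee_fin big_mkord; apply: ler_sum => k _.
by rewrite hg//; exact: ler_norm.
Qed.

(** Fatou's lemma is applied to the absolute values of measurable representatives, which are
    nonnegative everywhere; the integrability of the limit is part of the conclusion. *)
Lemma ae_fatou (f_ : nat -> X -> R) f C : (forall n, aeint (f_ n)) ->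
  (forall n, {ae mu, forall x, D x -> 0 <= f_ n x}) ->
  {ae mu, forall x, D x -> (fun n => f_ n x) @ \oo --> f x} ->
  (forall n, \int[mu]_(x in D) f_ n x <= C) ->
  aeint f /\ \int[mu]_(x in D) f x <= C.
Proof.
move=> if_ f0 ff fC.
have mf : aemeas f by apply: aemeas_lim ff => n; exact: aeint_meas.
have /choice[g Hg] : forall n, exists g, mu.-integrable D (EFin \o g) /\ {ae mu, forall x, D x -> f_ n x = g x}.
  by move=> n; case: (if_ n) => g; exists g.
have mg n : measurable_fun D (fun x => `|(EFin \o g n) x|)%E.
  by apply: measurableT_comp => //; case: (Hg n) => /(measurable_int mu).
have I n : (\int[mu]_(x in D) `|(EFin \o g n) x| <= C%:E)%E.
  apply: le_trans (_ : _ <= (\int[mu]_(x in D) f_ n x)%:E)%E _; last by rewrite lee_fin.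
  rewrite -aeint_EFin// le_eqVlt; apply/orP; left; apply/eqP; apply: integral_ae.
  by apply: filterS2 (Hg n).2 (f0 n) => x h1 h2 Dx /=; rewrite -h1// ger0_norm//; exact: h2.
have := fatou mu mD mg (fun n x _ => abse_ge0 _).
have L : {ae mu, forall x, D x -> limn_einf (fun n => `|(EFin \o g n) x|)%E = `|f x|%:E}.
  apply: filterS3 (ae_foralln (fun n => (Hg n).2)) (ae_foralln f0) ff => x h1 h2 h3 Dx.
  have c : (fun n => `|(EFin \o g n) x|)%E @ \oo --> `|f x|%:E.
    apply: cvg_EFin; first exact: nearW.
    rewrite (_ : _ \o _ = fun n => `|f_ n x|); first by apply: cvg_norm; exact: h3.
    by apply/funext => n /=; rewrite h1.
  by have /cvg_limn_einf_sup[] := c.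
have posf : {ae mu, forall x, D x -> `|f x| = f x}.
  apply: filterS2 (ae_foralln f0) ff => x h2 h3 Dx; rewrite ger0_norm//.
  by apply: (cvgr_to_ge (h3 Dx)); apply: nearW => n; exact: h2.
rewrite (integral_ae L) => h.
have h2 : (\int[mu]_(x in D) `|f x|%:E <= C%:E)%E.
  apply: le_trans h _; rewrite limn_einf_lim; apply: lime_le; first exact: is_cvg_einfs.
  by apply: nearW => n; apply: le_trans (I n); apply: ereal_inf_lbound; exists n => /=.
have i1 : aeint (fun x => `|f x|).
  apply/aeint_lty => //; last exact: le_lt_trans h2 (ltry _).
  by apply: aemeas_comp mf; exact: normr_measurable.
split; first exact: aeint_eq posf i1.
by rewrite -(Rintegral_ae posf) -lee_fin -aeint_EFin.
Qed.

End ae_integral.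

#[global] Instance lebesgue_ae_filter (R : realType) :
  Filter (nbhs (almost_everywhere (@lebesgue_measure R))).
Proof. exact: (ae_filter_ringOfSetsType (@lebesgue_measure R)). Qed.

(** * L2 spaces *)

Section L2_space.
Context (disp : measure_display) (X : measurableType disp) (R : realType).
Context (mu : {measure set X -> \bar R}) (D : set X) (mD : measurable D).
Implicit Types f g : X -> R.

Lemma L2_sq_aeint f : L2 mu D f -> aeint mu D (fun x => f x ^+ 2).
Proof.
move=> [mf if_]; apply/(aeint_lty mD); last exact: if_.
- by move=> x _; exact: sqr_ge0.
- by apply: meas_aemeas; exact: measurable_funX.
Qed.

Lemma aeint_sq_L2 f : measurable_fun D f -> aeint mu D (fun x => f x ^+ 2) -> L2 mu D f.
Proof.
move=> mf h; split => //; apply/(aeint_lty mD) => //.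
  by move=> x _; exact: sqr_ge0.
exact: aeint_meas h.
Qed.

Lemma L2_mul_aeint f g : L2 mu D f -> L2 mu D g -> aeint mu D (fun x => f x * g x).
Proof.
move=> L2f L2g; have [h _] := aeintD mD (L2_sq_aeint L2f) (L2_sq_aeint L2g).
apply: (aeint_dom mD) h _.
  by apply: meas_aemeas; apply: measurable_funM; [case: L2f|case: L2g].
apply: aeW => x _; rewrite ler_norml; apply/andP.
have := sqr_ge0 (f x + g x); have := sqr_ge0 (f x - g x).
by split; lra.
Qed.

Lemma L2_lin a f g : L2 mu D f -> L2 mu D g -> L2 mu D (a *: f + g).
Proof.
move=> L2f L2g; apply: aeint_sq_L2.
  apply: measurable_funD; last by case: L2g.
  by apply: measurable_funM; [exact: measurable_cst|case: L2f].
have [h1 _] := aeintZ mD (a ^+ 2) (L2_sq_aeint L2f).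
have [h2 _] := aeintZ mD (2 * a) (L2_mul_aeint L2f L2g).
have [h3 _] := aeintD mD h1 h2.
have [h4 _] := aeintD mD h3 (L2_sq_aeint L2g).
apply: aeint_eq h4; apply: aeW => x _.
have -> : (a *: f + g) x = a * f x + g x by [].
by ring.
Qed.

Lemma L2_0 : L2 mu D 0.
Proof.
split; first exact: measurable_cst.
rewrite (_ : (fun x => _) = cst 0%E); first by rewrite integral0 ltry.
by apply/funext => x; congr (_%:E); exact: expr0n.
Qed.

Lemma L2_semi_inner : semi_inner (L2 mu D) (L2ip mu D).
Proof.
split.
- exact: L2_0.
- by move=> a v w; exact: L2_lin.
- move=> a v w x Lv Lw Lx; rewrite /L2ip.
  have [_ <-] := aeint_lin mD a (L2_mul_aeint Lv Lx) (L2_mul_aeint Lw Lx).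
  apply: eq_Rintegral => y _.
  have -> : (a *: v + w) y = a * v y + w y by [].
  by rewrite mulrDl mulrA.
- by move=> v w _ _; apply: eq_Rintegral => y _; rewrite mulrC.
- by move=> v _; apply: Rintegral_ge0 => x _; rewrite -expr2 sqr_ge0.
Qed.

Lemma L2_seminormed : seminormed (L2 mu D) (L2norm mu D).
Proof. exact: (semi_inner_seminormed L2_semi_inner). Qed.

Lemma L2norm_sq f : L2 mu D f -> L2norm mu D f ^+ 2 = \int[mu]_(x in D) f x ^+ 2.
Proof.
by move=> Lf; rewrite (ipnorm_sq L2_semi_inner Lf).
Qed.

Lemma L2_complete : seminorm_complete (L2 mu D) (L2norm mu D).
Proof.
move=> f_ Lf Hf.
have LB n m : L2 mu D (f_ n - f_ m) by exact: (sn_DB L2_seminormed).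
(* Squared increments have integrals of order 4^-n, so the weight 2^n still leaves a summable bound
   2^-n. *)
pose h n x := 2 ^+ n * (f_ n.+1 x - f_ n x) ^+ 2.
have ih n : aeint mu D (h n).
  by case: (aeintZ mD (2 ^+ n) (L2_sq_aeint (LB n.+1 n))).
have h0 n x : 0 <= h n x by apply: mulr_ge0; [exact: exprn_ge0|exact: sqr_ge0].
have hint n : \int[mu]_(x in D) h n x <= 1 * 2^-1 ^+ n.
  have [_ ->] := aeintZ mD (2 ^+ n) (L2_sq_aeint (LB n.+1 n)).
  rewrite mul1r -(L2norm_sq (LB n.+1 n)).
  have p2 : 0 < 2 ^+ n :> R by rewrite exprn_gt0.
  by rewrite -ler_pdivlMl// -exprVn -expr2 lerXn2r// ?nnegrE ?sqrtr_ge0// exprn_ge0// invr_ge0.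
have /ae_null[N [mN N0 HN]] := ae_series_bounded mD ih (fun n => aeW _ (fun x _ => h0 n x)) hint.
have cvgf x : ~ N x -> D x -> cvgn (fun n => f_ n x).
  move=> Nx Dx; have [M HM] := HN x Nx Dx.
  pose u k := f_ k.+1 x - f_ k x.
  have su : cvgn (series u).
    apply: normed_cvg; apply: nondecreasing_is_cvgn.
      by apply: nondecreasing_series => k ? ?; exact: normr_ge0.
    exists (M + 1) => _ [n _ <-]; rewrite [leLHS]/= seriesEord /=.
    (* Young's inequality: |u| <= (2^k u^2 + 2^-k) / 2 for each increment u, so a bound on the
       partial sums of h makes the series of increments absolutely convergent. *)
    apply: (@le_trans _ _ (\sum_(k < n) (2^-1 * h k x + 2^-1 * 2^-1 ^+ k))).
      apply: ler_sum => k _; rewrite /h -/(u k).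
      have p2 : 0 < 2 ^+ k :> R by rewrite exprn_gt0.
      rewrite exprVn; move: p2; set p := 2 ^+ k => p2; have pn : p != 0 by rewrite gt_eqF.
      have p2V : 0 <= p^-1 by rewrite invr_ge0 ltW.
      have := mulr_ge0 p2V (sqr_ge0 (p * `|u k| - 1)).
      have -> : p^-1 * (p * `|u k| - 1) ^+ 2 = p * `|u k| ^+ 2 - 2 * `|u k| + p^-1 by field.
      by rewrite real_normK ?num_real//; lra.
    rewrite big_split/= -!mulr_sumr.
    have -> : \sum_(k < n) 2^-1 ^+ k = 2 * (1 - 2^-1 ^+ n) :> R.
      elim: n => [|n IH]; first by rewrite big_ord0 expr0 subrr mulr0.
      by rewrite big_ord_recr/= IH exprS; lra.
    have := HM n; have := half_exp_gt0 R n.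
    have : 0 <= \sum_(k < n) h k x by apply: sumr_ge0 => k _; exact: h0.
    lra.
  rewrite (_ : (fun n => f_ n x) = fun n => series u n + f_ 0%N x).
    by apply: is_cvgD => //; exact: is_cvg_cst.
  by apply/funext => n; rewrite /series/= telescope_sumr// subrK.
(* [L2] asks for true measurability, so the limit is set to 0 on the exceptional set. *)
pose C := \1_(~` N) : X -> R.
have mCN := measurableC mN.
have NC x : ~ N x -> C x = 1 by move=> Nx; rewrite /C indicE mem_set.
pose f x := limn (fun n => f_ n x * C x).
have ff x : D x -> (fun n => f_ n x * C x) @ \oo --> f x.
  rewrite /f => Dx; have [Nx|Nx] := pselect (N x).
    have -> : (fun n => f_ n x * C x) = fun=> 0.
      apply/funext => n; rewrite /C indicE (_ : x \in ~` N = false) ?mulr0//.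
      by apply/negbTE/negP => /set_mem /(_ Nx).
    exact: is_cvg_cst.
  rewrite (_ : (fun n => f_ n x * C x) = fun n => f_ n x); first exact: cvgf.
  by apply/funext => n; rewrite NC ?mulr1.
have mf : measurable_fun D f.
  apply: (measurable_fun_cvg (h := fun n x => f_ n x * C x)) => // n.
  apply: measurable_funM; [by case: (Lf n)|exact: measurable_indic].
have ffN x : ~ N x -> D x -> (fun n => f_ n x) @ \oo --> f x.
  by move=> Nx Dx; have := ff x Dx; under eq_fun do rewrite NC// mulr1.
have aeN : {ae mu, forall x, ~ N x} by exists N; split => // x /= /contrapT.
have key n : aeint mu D (fun x => (f_ n x - f x) ^+ 2) /\
    \int[mu]_(x in D) (f_ n x - f x) ^+ 2 <= (2 * 2^-1 ^+ n) ^+ 2.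
  (* Fatou in m with n fixed: the distance of f_ n to the limit is at most the supremum of its
     distances to later terms. *)
  apply: (@ae_fatou _ _ _ mu D mD (fun m x => (f_ n x - f_ (m + n)%N x) ^+ 2)).
  - by move=> m; exact: (L2_sq_aeint (LB n (m + n)%N)).
  - by move=> m; apply: aeW => x _; exact: sqr_ge0.
  - apply: filterS aeN => x Nx Dx.
    have c : (fun m => f_ n x - f_ (m + n)%N x) @ \oo --> f_ n x - f x.
      apply: cvgB; first exact: cvg_cst.
      by have := ffN x Nx Dx; rewrite -(cvg_shiftn n).
    by under eq_fun do rewrite expr2; rewrite expr2; exact: cvgM.
  - move=> m; rewrite -(L2norm_sq (LB n (m + n)%N)).
    rewrite ler_sqr ?nnegrE; last 2 first.
    + exact: sqrtr_ge0.
    + by rewrite mulr_ge0// exprn_ge0// invr_ge0.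
    rewrite (sn_sym L2_seminormed)//.
    have := @fast_cauchy _ _ _ _ L2_seminormed f_ 1 Lf.
    rewrite mulr1; apply; last exact: leq_addl.
    by move=> k; rewrite mul1r; exact: Hf.
have Lfn n : L2 mu D (f_ n - f).
  apply: aeint_sq_L2; last by case: (key n).
  by apply: measurable_funB => //; case: (Lf n).
exists f.
  rewrite -(subKr (f_ 0%N) f); apply: (sn_DB L2_seminormed) => //.
move=> e e0; have [n0 Hn0] := half_exp_small 2 e0.
exists n0 => n nn0; apply: le_lt_trans (Hn0 n nn0).
rewrite -ler_sqr ?nnegrE; last 2 first.
- exact: sqrtr_ge0.
- by rewrite mulr_ge0// exprn_ge0// invr_ge0.
by rewrite (L2norm_sq (Lfn n)); case: (key n).
Qed.

Lemma L2_ae f g : L2 mu D f -> L2 mu D g -> L2norm mu D (f - g) = 0 ->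
  {ae mu, forall x, D x -> f x = g x}.
Proof.
move=> Lf Lg fg.
have LB : L2 mu D (f - g) by exact: (sn_DB L2_seminormed).
have : \int[mu]_(x in D) (f - g) x ^+ 2 = 0 by rewrite -L2norm_sq// fg expr0n.
move=> /(ae_Rintegral_eq0 mD (L2_sq_aeint LB)) H.
have : {ae mu, forall x, D x -> (f - g) x ^+ 2 = 0}.
  by apply: H; apply: aeW => x _; exact: sqr_ge0.
apply: filterS => x h Dx; have /eqP := h Dx.
by rewrite expf_eq0/= => /eqP h2; apply/eqP; rewrite -subr_eq0; apply/eqP; exact: h2.
Qed.

Lemma ae_L2norm0 f g : {ae mu, forall x, D x -> f x = g x} -> L2norm mu D (f - g) = 0.
Proof.
move=> fg; rewrite /L2norm /L2ip (@Rintegral_ae _ _ _ mu D _ (fun=> 0)).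
  by rewrite Rintegral_cst// mul0r sqrtr0.
apply: filterS fg => x h Dx; have -> : (f - g) x = f x - g x by [].
by rewrite h// subrr mul0r.
Qed.

Section Linfty.

Lemma L2_Linfty c f : Linfty mu D c -> L2 mu D f -> L2 mu D (fun x => c x * f x).
Proof.
move=> [mc [M cM]] Lf; apply: aeint_sq_L2; first by apply: measurable_funM => //; case: Lf.
have [h _] := aeintZ mD (M ^+ 2) (L2_sq_aeint Lf).
apply: (aeint_dom mD) h _.
  apply: meas_aemeas; apply: measurable_funX; apply: measurable_funM => //.
  by case: Lf.
apply: filterS cM => x cM Dx; rewrite ger0_norm ?sqr_ge0// exprMn.
apply: ler_wpM2r; first exact: sqr_ge0.
have := cM Dx => h2; rewrite -[c x ^+ 2]real_normK ?num_real//.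
by rewrite ler_sqr ?nnegrE//; exact: le_trans h2.
Qed.

End Linfty.

Section finite.
Hypothesis finD : (mu D < +oo)%E.

Lemma L2_cst c : L2 mu D (cst c).
Proof.
split; first exact: measurable_cst.
rewrite (_ : (fun x => _) = cst (c ^+ 2)%:E)//.
rewrite integral_cst//; apply: lte_mul_pinfty => //.
by rewrite lee_fin sqr_ge0.
Qed.

Lemma L2_aeint f : L2 mu D f -> aeint mu D f.
Proof.
move=> Lf; have := L2_mul_aeint (L2_cst 1) Lf.
by apply: aeint_eq; apply: aeW => x _; rewrite /cst mul1r.
Qed.

End finite.

End L2_space.

(** * Square integrable functions of time *)

Section bochner.
Context (R : realType) (T : R) (V : lmodType R) (D : set V) (ip : V -> V -> R).
Hypotheses (T0 : 0 < T) (sip : semi_inner D ip).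
Local Notation leb := (@lebesgue_measure R).
Local Notation N := (ipnorm ip).
Local Notation I := (`[0, T]%classic : set R).

Let sN : seminormed D N := semi_inner_seminormed sip.
Let mI : @measurable _ (measurableTypeR R) I. Proof. exact: measurable_itv. Qed.

Definition simple_in (s : seq (set R * V)) : Prop :=
  forall p, p \in s -> measurable p.1 /\ D p.2.

Lemma simple_inP (s : seq (set R * V)) : simple_in s <->
  (forall k : 'I_(size s), let p := tnth (in_tuple s) k in measurable p.1 /\ D p.2).
Proof.
split=> [H k /=|H p ps]; first by apply: H; exact: mem_tnth.
by have /tnthP[k ->] : p \in in_tuple s by []; exact: H.
Qed.

Lemma simple_time_in s t : simple_in s -> D (simple_time s t).
Proof.
move=> H; rewrite /simple_time big_seq; apply: (sn_Dsum sN) => p ps.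
by apply: (sn_DZ sN); case: (H p ps).
Qed.

Lemma simple_time_meas s w : simple_in s -> D w ->
  measurable_fun I (fun t => ip (simple_time s t) w).
Proof.
move=> H Dw; elim: s H => [|p s IH] H.
  rewrite (_ : (fun _ => _) = cst 0); first exact: measurable_cst.
  by apply/funext => t; rewrite /simple_time big_nil (ip0l sip).
have [mp Dp] := H p (mem_head _ _).
have Hs : simple_in s by move=> q qs; apply: H; rewrite inE qs orbT.
rewrite (_ : (fun _ => _) = fun t => \1_(p.1) t * ip p.2 w + ip (simple_time s t) w).
  apply: measurable_funD; last exact: IH.
  by apply: measurable_funM; [exact: measurable_indic|exact: measurable_cst].
apply/funext => t; rewrite {1}/simple_time big_cons (ip_linl sip)//.
exact: simple_time_in.
Qed.

Lemma simple_time_meas2 s s' : simple_in s -> simple_in s' ->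
  measurable_fun I (fun t => ip (simple_time s t) (simple_time s' t)).
Proof.
move=> H H'; elim: s' H' => [|p s' IH] H'.
  rewrite (_ : (fun _ => _) = cst 0); first exact: measurable_cst.
  apply/funext => t; rewrite {2}/simple_time big_nil (ipC sip) ?(ip0l sip)//.
  - exact: simple_time_in.
  - exact: simple_time_in.
  - exact: (sn_D0 sN).
have [mp Dp] := H' p (mem_head _ _).
have Hs : simple_in s' by move=> q qs; apply: H'; rewrite inE qs orbT.
rewrite (_ : (fun _ => _) = fun t =>
    \1_(p.1) t * ip (simple_time s t) p.2 + ip (simple_time s t) (simple_time s' t)).
  apply: measurable_funD; last exact: IH.
  by apply: measurable_funM; [exact: measurable_indic|exact: simple_time_meas].
apply/funext => t; rewrite {2}/simple_time big_cons (ip_linr sip)//.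
- exact: simple_time_in.
- exact: simple_time_in.
Qed.

Lemma strongly_measurableP (f : R -> V) : strongly_measurable T D N f <->
  exists s : (seq (set R * V))^nat, (forall n, simple_in (s n)) /\
    {ae leb, forall t, I t -> (fun n => N (simple_time (s n) t - f t)) @ \oo --> (0 : R)}.
Proof.
by split=> -[s [Hs cs]]; exists s; split=> // n; apply/simple_inP; exact: Hs.
Qed.

(** The inner product is jointly continuous, so it is an almost everywhere limit of inner products
    of step functions, which are measurable by [simple_time_meas2]. *)
Lemma strongly_measurable_ip f g : (forall t, I t -> D (f t)) -> (forall t, I t -> D (g t)) ->
  strongly_measurable T D N f -> strongly_measurable T D N g ->
  aemeas leb I (fun t => ip (f t) (g t)).
Proof.
move=> Df Dg /strongly_measurableP[s [Hs cs]] /strongly_measurableP[s' [Hs' cs']].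
apply: (@aemeas_lim _ _ _ leb I (fun n t => ip (simple_time (s n) t) (simple_time (s' n) t))).
  by move=> n; apply: meas_aemeas; exact: simple_time_meas2.
apply: filterS2 cs cs' => t h h' It.
apply: (ip_cvg sip); [| |exact: Df|exact: Dg|exact: h|exact: h'] => n;
  exact: simple_time_in.
Qed.

Lemma strongly_measurable_lin a f g :
  (forall t, I t -> D (f t)) -> (forall t, I t -> D (g t)) ->
  strongly_measurable T D N f -> strongly_measurable T D N g ->
  strongly_measurable T D N (a *: f + g).
Proof.
move=> Df Dg /strongly_measurableP[s [Hs cs]] /strongly_measurableP[s' [Hs' cs']].
apply/strongly_measurableP.
pose u n := [seq (p.1, a *: p.2) | p <- s n] ++ s' n.
have uE n t : simple_time (u n) t = a *: simple_time (s n) t + simple_time (s' n) t.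
  rewrite /simple_time big_cat big_map/= scaler_sumr; congr (_ + _).
  by apply: eq_bigr => p _; rewrite !scalerA mulrC.
exists u; split.
  move=> n p; rewrite mem_cat => /orP[/mapP[q qs ->]|]; last exact: Hs'.
  by have [mq Dq] := Hs n q qs; split => //; exact: (sn_DZ sN).
apply: filterS2 cs cs' => t h h' It.
have Ds n := simple_time_in t (Hs n); have Ds' n := simple_time_in t (Hs' n).
have DB := sn_DB sN.
apply: (@squeeze_cvgr _ _ _ _ (cst 0)
  (fun n => `|a| * N (simple_time (s n) t - f t) + N (simple_time (s' n) t - g t))).
- apply: nearW => n; apply/andP; split.
    exact: sqrtr_ge0.
  rewrite uE (_ : _ - _ = a *: (simple_time (s n) t - f t) + (simple_time (s' n) t - g t)).
    rewrite -(sn_Z sN); last by apply: DB => //; exact: Df.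
    apply: (sn_tri sN); first by apply/(sn_DZ sN)/DB => //; exact: Df.
    by apply: DB => //; exact: Dg.
  by rewrite [X in _ - X](_ : _ = a *: f t + g t)// scalerBr opprD addrACA.
- exact: cvg_cst.
- rewrite [X in _ --> X](_ : _ = `|a| * 0 + 0); last by rewrite mulr0 addr0.
  apply: cvgD; last exact: h'.
  by apply: cvgM; [exact: cvg_cst|exact: h].
Qed.

Lemma simple_strongly_measurable s : simple_in s ->
  strongly_measurable T D N (simple_time s).
Proof.
move=> Hs; apply/strongly_measurableP; exists (fun=> s); split => //.
apply: aeW => t It; rewrite (_ : (fun _ => _) = fun=> 0); first exact: cvg_cst.
by apply/funext => n; rewrite subrr (sn_0 sN).
Qed.

Lemma C0_strongly_measurable f : C0_time T D N f -> strongly_measurable T D N f.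
Proof.
move=> [Df cf]; apply/strongly_measurableP.
(* Step functions on the cells [k/(n+1), (k+1)/(n+1)), sampled at the left end. The m n cells cover
   [0, T], and all their left ends stay in [0, T], where f is controlled. *)
pose c n k : R := k%:R / n.+1%:R.
pose m n := (Num.trunc (n.+1%:R * T)).+1.
pose s n := [seq (`[c n k, c n k.+1[%classic, f (c n k)) | k <- iota 0 (m n)].
have n0 n : 0 < n.+1%:R :> R by rewrite ltr0n.
have ck n k : (k < m n)%N -> c n k \in `[0, T].
  rewrite /m ltnS truncn_ge_nat; last by rewrite mulr_ge0// ltW.
  by move=> h; rewrite in_itv/= divr_ge0//= ler_pdivrMr// mulrC.
exists s; split.
  move=> n p /mapP[k]; rewrite mem_iota add0n => /andP[_ km] ->.
  by split; [exact: measurable_itv|exact/Df/ck].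
apply: aeW => t It.
have tT : 0 <= t <= T by move: It; rewrite /= in_itv.
case/andP: tT => t0 tT.
pose k n := Num.trunc (n.+1%:R * t).
have kP n : c n (k n) <= t < c n (k n).+1.
  have /truncn_itv/andP[h1 h2] : 0 <= n.+1%:R * t by rewrite mulr_ge0// ltW.
  by rewrite /c ler_pdivrMr// ltr_pdivlMr// ![t * _]mulrC h1.
have kj n j : (c n j <= t < c n j.+1) = (j == k n).
  apply/idP/eqP => [|->//] /andP[h1 h2]; have /andP[h3 h4] := kP n.
  have lt_c i l : c n i < c n l -> (i < l)%N.
    by rewrite /c ltr_pM2r ?invr_gt0// ltr_nat.
  have := lt_c _ _ (le_lt_trans h1 h4); have := lt_c _ _ (le_lt_trans h3 h2).
  by rewrite !ltnS => a b; apply/eqP; rewrite eqn_leq a b.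
have km n : (k n < m n)%N.
  by rewrite /m ltnS; apply: le_truncn; rewrite ler_pM2l.
have sE n : simple_time (s n) t = f (c n (k n)).
  rewrite /simple_time /s big_map (_ : iota 0 (m n) = index_iota 0 (m n)); last by rewrite /index_iota subn0.
  rewrite big_mkord.
  rewrite (bigD1 (Ordinal (km n)))//= indicE mem_set ?scale1r; last first.
    by rewrite /= in_itv/=; exact: kP.
  rewrite big1 ?addr0// => j; rewrite -val_eqE/= -kj => h.
  rewrite indicE (_ : _ \in _ = false) ?scale0r//.
  by apply/negbTE/negP => /set_mem; rewrite /= in_itv/=; exact/negP.
apply/cvgrPdist_lt => e e0; have [del del0 Hd] := cf t It e e0.
have [n1 Hn1] : exists n1, forall n, (n1 <= n)%N -> n.+1%:R^-1 < del.
  exists (Num.trunc del^-1) => n nn; rewrite -[ltRHS]invrK ltf_pV2 ?posrE ?invr_gt0//.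
  by apply: lt_le_trans (truncnS_gt _) _; rewrite ler_nat ltnS.
exists n1 => // n nn; rewrite /= sub0r normrN ger0_norm ?sqrtr_ge0// sE.
apply: Hd; first exact: ck.
have /andP[h1 h2] := kP n.
have h3 : c n (k n).+1 = c n (k n) + n.+1%:R^-1 by rewrite /c -natr1 mulrDl mul1r.
move: h1 h2 h3 (Hn1 n nn) del0; move: (c n (k n)) (c n (k n).+1) n.+1%:R^-1 => x y z.
by move=> h1 h2 h3 h4 h5; rewrite ltr_norml; apply/andP; split; lra.
Qed.

Local Notation L2t := (L2_time T D N).

Lemma L2_time_aeint f : L2t f -> aeint leb I (fun t => N (f t) ^+ 2).
Proof.
move=> [Df mf if_]; apply/(@aeint_lty _ _ _ leb I mI); last exact: if_.
  by move=> t _; exact: sqr_ge0.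
apply: (aemeas_eq _ (strongly_measurable_ip Df Df mf mf)).
by apply: aeW => t It; rewrite (ipnorm_sq sip)//; exact: Df.
Qed.

Lemma L2_time_aeint_ip f g : L2t f -> L2t g -> aeint leb I (fun t => ip (f t) (g t)).
Proof.
move=> Lf Lg; have [h _] := aeintD mI (L2_time_aeint Lf) (L2_time_aeint Lg).
case: Lf Lg => [Df mf _] [Dg mg _].
apply: (aeint_dom mI) h _; first exact: strongly_measurable_ip.
apply: aeW => t It; apply: le_trans (ip_CSn sip (Df t It) (Dg t It)) _.
have := sqr_ge0 (N (f t) - N (g t)).
have := mulr_ge0 (sqrtr_ge0 (ip (f t) (f t))) (sqrtr_ge0 (ip (g t) (g t))).
rewrite -!/(ipnorm _ _); nra.
Qed.

Lemma aeint_L2_time f : (forall t, I t -> D (f t)) -> strongly_measurable T D N f ->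
  aeint leb I (fun t => N (f t) ^+ 2) -> L2t f.
Proof.
move=> Df mf h; split => //; apply/(@aeint_lty _ _ _ leb I mI) => //.
  by move=> t _; exact: sqr_ge0.
exact: aeint_meas h.
Qed.

Lemma L2_time_lin a f g : L2t f -> L2t g -> L2t (a *: f + g).
Proof.
move=> Lf Lg; have [Df mf _] := Lf; have [Dg mg _] := Lg.
apply: aeint_L2_time.
- by move=> t It; apply: (sn_Dlin sN); [exact: Df|exact: Dg].
- exact: strongly_measurable_lin.
have [h1 _] := aeintZ mI (a ^+ 2) (L2_time_aeint Lf).
have [h2 _] := aeintZ mI (2 * a) (L2_time_aeint_ip Lf Lg).
have [h3 _] := aeintD mI h1 h2.
have [h4 _] := aeintD mI h3 (L2_time_aeint Lg).
apply: aeint_eq h4; apply: aeW => t It.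
have -> : (a *: f + g) t = a *: f t + g t by [].
by rewrite (ipnorm_lin sip)//; [exact: Df|exact: Dg].
Qed.

Lemma C0_L2_time f : C0_time T D N f -> L2t f.
Proof.
move=> cf; have [Df _] := cf; have mf := C0_strongly_measurable cf.
apply: aeint_L2_time => //.
have [M HM] := C0_time_bounded T0 sN cf.
have finI : (leb I < +oo)%E.
  by rewrite lebesgue_measure_itv/=; case: ifP => _; rewrite ltry.
have i2 : aeint leb I (cst (M ^+ 2)).
  exact: aeint_cst.
apply: (aeint_dom mI) i2 _.
  apply: (aemeas_eq _ (strongly_measurable_ip Df Df mf mf)).
  by apply: aeW => t It; rewrite (ipnorm_sq sip)//; exact: Df.
apply: aeW => t It; rewrite ger0_norm ?sqr_ge0//.
by apply: lerXn2r; rewrite ?nnegrE ?sqrtr_ge0 ?(le_trans (sqrtr_ge0 _) (HM t It))//; exact: HM.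
Qed.

Definition ip_time (f g : R -> V) : R := \int[leb]_(t in I) ip (f t) (g t).

Lemma L2_time_semi_inner : semi_inner L2t ip_time.
Proof.
split.
- apply: C0_L2_time.
  rewrite (_ : 0 = (fun=> 0) :> (R -> V))//; apply: C0_time_cst => //; exact: (sn_D0 sN).
- by move=> a f g; exact: L2_time_lin.
- move=> a f g h Lf Lg Lh; rewrite /ip_time.
  have [_ <-] := aeint_lin mI a (L2_time_aeint_ip Lf Lh) (L2_time_aeint_ip Lg Lh).
  case: Lf Lg Lh => [Df _ _] [Dg _ _] [Dh _ _].
  apply: eq_Rintegral => t /set_mem It.
  have -> : (a *: f + g) t = a *: f t + g t by [].
  by rewrite (ip_linl sip)//; [exact: Df|exact: Dg|exact: Dh].
- move=> f g [Df _ _] [Dg _ _]; apply: eq_Rintegral => t /set_mem It.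
  by rewrite (ipC sip)//; [exact: Df|exact: Dg].
- move=> f [Df _ _]; apply: Rintegral_ge0 => t It.
  by apply: (ip_ge0 sip); exact: Df.
Qed.

Let sT := semi_inner_seminormed L2_time_semi_inner.

Lemma ip_time_sq f : L2t f ->
  ipnorm ip_time f ^+ 2 = \int[leb]_(t in I) N (f t) ^+ 2.
Proof.
move=> Lf; rewrite (ipnorm_sq L2_time_semi_inner Lf); apply: eq_Rintegral => t /set_mem It.
by rewrite (ipnorm_sq sip)//; case: Lf => + _ _; exact.
Qed.

Hypothesis cN : seminorm_complete D N.

(** Truncation at 1 makes dominated convergence available, so pointwise convergence of the step
    functions becomes smallness in measure with a prescribed rate. This prepares the diagonal
    argument for limits of strongly measurable functions. *)
Lemma strongly_measurable_approx f n : (forall t, I t -> D (f t)) ->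
  strongly_measurable T D N f ->
  exists s, simple_in s /\
    let h t := Num.min 1 (N (simple_time s t - f t)) in
    aeint leb I h /\ \int[leb]_(t in I) h t <= 2^-1 ^+ n.
Proof.
move=> Df mf; have /strongly_measurableP[s [Hs cs]] := mf.
pose h k t := Num.min 1 (N (simple_time (s k) t - f t)).
have finI : (leb I < +oo)%E.
  by rewrite lebesgue_measure_itv/=; case: ifP => _; rewrite ltry.
have i1 : aeint leb I (cst 1).
  exact: aeint_cst.
have mh k : aemeas leb I (h k).
  have Dk t : I t -> D (simple_time (s k) t) by move=> _; exact: simple_time_in.
  have mk : strongly_measurable T D N (-1 *: f + simple_time (s k)).
    apply: strongly_measurable_lin => //; exact: simple_strongly_measurable.
  have Dkf t : I t -> D ((-1 *: f + simple_time (s k)) t).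
    by move=> It; apply: (sn_Dlin sN); [exact: Df|exact: Dk].
  have := strongly_measurable_ip Dkf Dkf mk mk.
  have mphi : measurable_fun setT (fun x : R => Num.min 1 (Num.sqrt x)).
    apply: measurable_minr; first exact: measurable_cst.
    by apply: continuous_measurable_fun; exact: sqrt_continuous.
  move=> /(aemeas_comp mphi); apply: aemeas_eq; apply: aeW => t It.
  rewrite /h /ipnorm.
  by have -> : (-1 *: f + simple_time (s k)) t = simple_time (s k) t - f t by rewrite addrC -scaleN1r.
have hb k t : `|h k t| <= 1.
  by rewrite ger0_norm /h; [rewrite ge_min lexx|rewrite le_min ler01/= sqrtr_ge0].
have [||_ c] := @ae_dominated_convergence _ _ _ leb I mI h (cst 0) (cst 1) mh i1.
- apply: filterS cs => t c It.
  apply: (@squeeze_cvgr _ _ _ _ (cst 0) (fun k => N (simple_time (s k) t - f t))).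
  + by apply: nearW => k; rewrite /h le_min ler01 sqrtr_ge0 ge_min lexx orbT.
  + exact: cvg_cst.
  + exact: c.
- by move=> k; apply: aeW => t _; exact: hb.
have : \int[leb]_(t in I) cst 0 t = 0 :> R by rewrite Rintegral_cst// mul0r.
move=> I0; rewrite I0 in c.
have /cvgrPdist_le/(_ _ (half_exp_gt0 R n))[k _ Hk] := c.
exists (s k); split => //; split.
  apply: (aeint_dom mI (mh k) i1); apply: aeW => t _; exact: hb.
have := Hk k (leqnn k); rewrite /= sub0r normrN; apply: le_trans; exact: ler_norm.
Qed.

Lemma L2_time_complete : seminorm_complete L2t (ipnorm ip_time).
Proof.
apply: complete_of_quick => // f_ Lf Hf.
have LB n m : L2t (f_ n - f_ m) by exact: (sn_DB sT).
have Df n t : I t -> D (f_ n t) by case: (Lf n) => + _ _; exact.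
(* Increments 4^-n give 8^n 16^-n = 2^-n for the integral of h n. Conversely h n t <= M bounds the
   increment at t by (M + 1) 2^-n, as 8^n >= 4^n. *)
pose h n t := 8 ^+ n * N ((f_ n.+1 - f_ n) t) ^+ 2.
have ih n : aeint leb I (h n).
  by case: (aeintZ mI (8 ^+ n) (L2_time_aeint (LB n.+1 n))).
have h0 n t : 0 <= h n t by apply: mulr_ge0; [exact: exprn_ge0|exact: sqr_ge0].
have hint n : \int[leb]_(t in I) h n t <= 1 * 2^-1 ^+ n.
  have [_ ->] := aeintZ mI (8 ^+ n) (L2_time_aeint (LB n.+1 n)).
  rewrite mul1r -(ip_time_sq (LB n.+1 n)).
  have -> : (2^-1 : R) ^+ n = 8 ^+ n * (4^-1 ^+ n) ^+ 2.
    by rewrite -exprM mulnC exprM -exprMn; congr (_ ^+ _); field.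
  by rewrite ler_pM2l ?exprn_gt0//; apply: lerXn2r; rewrite ?nnegrE ?sqrtr_ge0 ?exprn_ge0 ?invr_ge0.
have h0' n : {ae leb, forall t, I t -> 0 <= h n t} by apply: aeW.
have SB := ae_series_bounded mI ih h0' hint.
(* The default 0 is used where the sum is unbounded as well, so that the limit takes values in D on
   all of [0, T]. *)
have lim t : exists v, I t -> D v /\
    ((exists M, forall n, \sum_(k < n) h k t <= M) -> (fun n => N (f_ n t - v)) @ \oo --> (0 : R)).
  have [It|] := pselect (I t); last by exists 0.
  have [[M HM]|nM] := pselect (exists M, forall n, \sum_(k < n) h k t <= M); last first.
    by exists 0 => _; split => //; exact: (sn_D0 sN).
  have M0 : 0 <= M by apply: le_trans (HM 0%N); rewrite big_ord0.
  have step n : N (f_ n.+1 t - f_ n t) <= (M + 1) * 2^-1 ^+ n.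
    have hn : h n t <= M.
      apply: le_trans (HM n.+1); rewrite big_ord_recr/= ler_wpDl//.
      by apply: sumr_ge0 => k _; exact: h0.
    rewrite -ler_sqr ?nnegrE; last 2 first.
    + exact: sqrtr_ge0.
    + by rewrite mulr_ge0 ?exprn_ge0 ?invr_ge0//; lra.
    have p8 : 0 < 8 ^+ n :> R by rewrite exprn_gt0.
    have p4 : 0 < 4 ^+ n :> R by rewrite exprn_gt0.
    have : N (f_ n.+1 t - f_ n t) ^+ 2 <= M / 8 ^+ n.
      by rewrite ler_pdivlMr// mulrC; exact: hn.
    move=> /le_trans; apply.
    have -> : ((M + 1) * 2^-1 ^+ n) ^+ 2 = (M + 1) ^+ 2 / 4 ^+ n.
      by rewrite exprMn -exprM mulnC exprM -exprVn; congr (_ * _ ^+ _); field.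
    apply: ler_pM => //.
      by nra.
    by rewrite lef_pV2 ?posrE//; apply: lerXn2r; rewrite ?nnegrE//; lra.
  have M1 : 0 < M + 1 by lra.
  have [n||v Dv Hv] := complete_fast sN cN M1 (v_ := fun n => f_ n t).
  - exact: Df.
  - exact: step.
  exists v => _; split => // _; apply/cvgrPdist_lt => e e0.
  have [n0 Hn0] := half_exp_small (2 * (M + 1)) e0.
  exists n0 => // n nn; rewrite /= sub0r normrN ger0_norm ?sqrtr_ge0//.
  exact: le_lt_trans (Hv n) (Hn0 n nn).
have /choice[f Hf'] := lim.
have Dfl t : I t -> D (f t) by move=> It; case: (Hf' t It).
have cf : {ae leb, forall t, I t -> (fun n => N (f_ n t - f t)) @ \oo --> (0 : R)}.
  by apply: filterS SB => t H It; case: (Hf' t It) => _; apply; exact: H.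
(* Diagonal choice: s n is within 2^-n of f_ n in the truncated distance. The sum of these distances
   is finite almost everywhere, so s n follows f_ n to the limit. *)
have /choice[s Hs] n := strongly_measurable_approx n (Df n) (let: And3 _ m _ := Lf n in m).
have mf : strongly_measurable T D N f.
  apply/strongly_measurableP; exists s; split; first by move=> n; case: (Hs n).
  pose q n t := Num.min 1 (N (simple_time (s n) t - f_ n t)).
  have q0 n t : 0 <= q n t by rewrite le_min ler01/= sqrtr_ge0.
  have q0' n : {ae leb, forall t, I t -> 0 <= q n t} by apply: aeW.
  have qi n : aeint leb I (q n) by case: (Hs n) => _ [].
  have qb n : \int[leb]_(t in I) q n t <= 1 * 2^-1 ^+ n.
    by rewrite mul1r; case: (Hs n) => _ [].
  have H := ae_series_bounded mI qi q0' qb.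
  apply: filterS2 cf H => t c Hq It; have [M HM] := Hq It.
  have cq : (fun n => q n t) @ \oo --> (0 : R).
    apply: cvg_series_cvg_0; apply: nondecreasing_is_cvgn.
      by apply: nondecreasing_series => k _ _; exact: q0.
    by exists M => _ [n _ <-]; rewrite [leLHS]/= seriesEord; exact: HM.
  have c2 : (fun n => N (simple_time (s n) t - f_ n t)) @ \oo --> (0 : R).
    apply/cvgrPdist_lt => e e0.
    have e1 : 0 < Num.min 1 e by rewrite lt_min ltr01.
    have /cvgrPdist_lt/(_ _ e1)[n0 _ Hn0] := cq.
    exists n0 => // n nn; have := Hn0 n nn.
    rewrite /= !sub0r !normrN !ger0_norm ?q0 ?sqrtr_ge0// /q.
    by rewrite lt_min => /andP[]; rewrite gt_min ltxx/= gt_min => h1 /orP[|//]; lra.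
  apply: (@squeeze_cvgr _ _ _ _ (cst 0)
    (fun n => N (simple_time (s n) t - f_ n t) + N (f_ n t - f t))).
  - apply: nearW => n; rewrite sqrtr_ge0/=; apply: (sn_dist sN).
    + by apply: simple_time_in; case: (Hs n).
    + exact: Df.
    + exact: Dfl.
  - exact: cvg_cst.
  - rewrite [X in _ --> X](_ : _ = 0 + 0); last by rewrite addr0.
    by apply: cvgD => //; exact: c.
have Hf2 n : ipnorm ip_time (f_ n.+1 - f_ n) <= 1 * 2^-1 ^+ n.
  apply: le_trans (Hf n) _; rewrite mul1r; apply: lerXn2r; rewrite ?nnegrE ?invr_ge0//.
  by rewrite lef_pV2 ?posrE//; lra.
have key n : aeint leb I (fun t => N ((f_ n - f) t) ^+ 2) /\
    \int[leb]_(t in I) N ((f_ n - f) t) ^+ 2 <= (2 * 2^-1 ^+ n) ^+ 2.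
  apply: (@ae_fatou _ _ _ leb I mI (fun m t => N ((f_ n - f_ (m + n)%N) t) ^+ 2)).
  - by move=> m; exact: L2_time_aeint.
  - by move=> m; apply: aeW => t _; exact: sqr_ge0.
  - apply: filterS cf => t c It.
    have Dn := Df n t It; have Dt := Dfl t It.
    have c3 : (fun m => N (f_ n t - f_ (m + n)%N t)) @ \oo --> N (f_ n t - f t).
      apply: cvg_sub0 (cvg_cst _); apply: norm_cvg0.
      apply: (@squeeze_cvgr _ _ _ _ (cst 0) (fun m => N (f_ (m + n)%N t - f t))).
      - apply: nearW => m; rewrite normr_ge0/=.
        have Dm := Df (m + n)%N t It.
        have := sn_lip sN (sn_DB sN Dn Dm) (sn_DB sN Dn Dt).
        rewrite (_ : f_ n t - f_ (m + n)%N t - (f_ n t - f t) = f t - f_ (m + n)%N t).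
          by rewrite (sn_sym sN Dt Dm).
        by rewrite opprB addrC addrA subrK.
      - exact: cvg_cst.
      - by have := c It; rewrite -(cvg_shiftn n).
    by under eq_fun do rewrite expr2; rewrite expr2; exact: cvgM.
  - move=> m; rewrite -ip_time_sq//.
    apply: lerXn2r; rewrite ?nnegrE ?sqrtr_ge0 ?mulr_ge0 ?exprn_ge0 ?invr_ge0//.
    rewrite (sn_sym sT)//.
    have := fast_cauchy sT Lf Hf2; rewrite mulr1; apply; exact: leq_addl.
have Lfn n : L2t (f_ n - f).
  apply: aeint_L2_time; last by case: (key n).
  - by move=> t It; apply: (sn_DB sN); [exact: Df|exact: Dfl].
  - rewrite addrC -scaleN1r; apply: strongly_measurable_lin => //; first exact: Df.
    by case: (Lf n).
have Lfl : L2t f by rewrite -(subKr (f_ 0%N) f); exact: (sn_DB sT).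
exists f => // e e0; have [n0 Hn0] := half_exp_small 2 e0.
exists n0 => n nn0; apply: le_lt_trans (Hn0 n nn0).
rewrite -ler_sqr ?nnegrE; last 2 first.
- exact: sqrtr_ge0.
- by rewrite mulr_ge0// exprn_ge0// invr_ge0.
by rewrite ip_time_sq//; case: (key n).
Qed.

End bochner.

(** * Weak derivatives on an interval *)

Section one_dim.
Context (R : realType).
Local Notation leb := (@lebesgue_measure R).

Lemma psi_succ k (t : R) : 0 <= t -> t * psi k.+1 t = psi k t.
Proof.
rewrite /psi le_eqVlt => /predU1P[<-|t0]; first by rewrite ltxx mul0r.
by rewrite t0 exprS mulrA mulrA divff ?mul1r// gt_eqF.
Qed.

Lemma psi1_le1 (t : R) : psi 1 t <= 1.
Proof.
rewrite /psi; case: ifPn => // t0; rewrite expr1 expRN ler_pdivrMr ?expR_gt0// mul1r.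
by have := expR_ge1Dx t^-1; lra.
Qed.

Lemma psi1_cvg0 (s : R) : (fun n => psi 1 (n.+1%:R * s)) @ \oo --> (0 : R).
Proof.
apply: (@squeeze_cvgr _ _ _ _ (cst 0) (fun n : nat => n.+1%:R^-1 * `|s|^-1)).
- apply: nearW => n; rewrite psi_ge0/= /psi; case: ifPn => h; last first.
    by rewrite mulr_ge0 ?invr_ge0.
  have s0 : 0 < s by move: h; rewrite pmulr_rgt0.
  rewrite expr1 gtr0_norm// -invfM; apply: ler_piMr; first by rewrite invr_ge0 ltW.
  by rewrite expR_le1 oppr_le0 invr_ge0 ltW.
- exact: cvg_cst.
- rewrite -[X in _ --> X](mul0r `|s|^-1).
  by apply: cvgM; [exact: cvg_harmonic|exact: cvg_cst].
Qed.

Lemma is_derive_affine (c a t v : R) : is_derive t v (fun t : R => c * (t - a)) (c * v).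
Proof.
have h : is_derive t v (fun t : R => t - a) (v - 0) := is_deriveB (is_derive_id t v) (is_derive_cst a t v).
by have := is_deriveZ c h; rewrite subr0.
Qed.

Lemma is_derive_psi_affine k (c a t : R) :
  is_derive t (1 : R) (fun t => psi k (c * (t - a)))
    (c * (psi k.+2 (c * (t - a)) - k%:R * psi k.+1 (c * (t - a)))).
Proof.
have h := @is_derive1_comp R (psi k) (fun t => c * (t - a)) t _ _
  (is_derive_psi k _) (is_derive_affine c a t 1).
by apply: is_derive_eq h _; rewrite mulr1 mulrC.
Qed.

Lemma elementary_psi_affine k (c a : R) : elementary (fun t : R => psi k (c * (t - a))).
Proof.
apply: (@elementary_psi _ _ k (fun t => c * (t - a)) (fun v => c * v)).
  by move=> x; apply/derivable1_diffP; case: (is_derive_affine c a x 1).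
by move=> x v; have h := is_derive_affine c a x v; exact: derive_val.
Qed.

Lemma Rintegral_derive (F f : R -> R) a b : a < b ->
  (forall x, is_derive x (1 : R) F (f x)) -> continuous f ->
  \int[leb]_(x in `[a, b]) f x = F b - F a.
Proof.
move=> ab dF cf; rewrite /Rintegral (@continuous_FTC2 _ f F a b ab)//.
- exact: continuous_subspaceT.
- have cF : continuous F.
    move=> x; apply: differentiable_continuous; apply/derivable1_diffP.
    by case: (dF x).
  split; first by move=> x _; case: (dF x).
  + exact: (cvg_at_right_filter (cF a)).
  + exact: (cvg_at_left_filter (cF b)).
- by move=> x _; rewrite derive1E; have h := dF x; exact: derive_val.
Qed.

Lemma continuous_aeint (f : R -> R) a b : continuous f -> aeint leb `[a, b] f.
Proof.
move=> cf; apply: integrable_aeint; apply: continuous_compact_integrable.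
  exact: segment_compact.
exact: continuous_subspaceT.
Qed.

Section bump1.
Variables (a b : R).
Hypothesis ab : a < b.

(** As n grows these increase in steepness and tend to the indicator of ]a, b[. *)
Definition bump (n : nat) (t : R) : R :=
  psi 0 (n.+1%:R * (t - a)) * psi 0 (- n.+1%:R * (t - b)).

Definition dbump (n : nat) (t : R) : R :=
  n.+1%:R * psi 2 (n.+1%:R * (t - a)) * psi 0 (- n.+1%:R * (t - b)) -
  n.+1%:R * psi 0 (n.+1%:R * (t - a)) * psi 2 (- n.+1%:R * (t - b)).

Lemma is_derive_bump n t : is_derive t (1 : R) (bump n) (dbump n t).
Proof.
have h1 := is_derive_psi_affine 0 n.+1%:R a t.
have h2 := is_derive_psi_affine 0 (- n.+1%:R) b t.
apply: (is_derive_eq (is_deriveM h1 h2)).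
by rewrite /dbump /GRing.scale/=; ring.
Qed.

Lemma bump_out n t : ~~ (a < t < b) -> bump n t = 0.
Proof.
rewrite negb_and -!leNgt /bump => /orP[h|h].
  by rewrite {1}/psi ifF ?mul0r//; apply/negbTE; rewrite -leNgt pmulr_rle0//; lra.
rewrite mulrC {1}/psi ifF ?mul0r//; apply/negbTE.
by rewrite -leNgt mulNr oppr_le0 pmulr_rge0//; lra.
Qed.

Lemma bump_ge0 n t : 0 <= bump n t. Proof. by rewrite mulr_ge0 ?psi_ge0. Qed.

Lemma bump_le1 n t : bump n t <= 1.
Proof. by apply: mulr_ile1; rewrite ?psi_ge0 ?psi0_le1. Qed.

Lemma bump_cvg t : (fun n => bump n t) @ \oo --> (\1_(`]a, b[%classic) t : R).
Proof.
rewrite indicE; have [tab|tab] := boolP (a < t < b).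
  rewrite mem_set ?[true%:R]/(1); last by rewrite /= in_itv.
  rewrite -[X in _ --> X](mulr1 1); case/andP: tab => at_ tb; apply: cvgM.
    by apply: psi_scale_cvg; lra.
  under eq_fun do rewrite mulNr -mulrN opprB.
  by apply: psi_scale_cvg; lra.
rewrite (_ : t \in _ = false); last first.
  by apply/negbTE; apply: contra tab => /set_mem; rewrite /= in_itv.
by under eq_fun do rewrite bump_out//; exact: cvg_cst.
Qed.

Lemma bump_test n (T : R) : 0 < a -> b < T -> test_function `]0, T[%classic (bump n).
Proof.
move=> a0 bT; split.
  by apply: elementary_smooth; apply: elementary_mul; exact: elementary_psi_affine.
exists `[a, b]%classic; split; first exact: segment_compact.
  by move=> t /=; rewrite !in_itv/=; lra.
move=> t tab; apply: bump_out; apply: contra_notN tab => /andP[? ?].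
by rewrite /= in_itv/=; lra.
Qed.

Lemma derive_bump n t : 'D_1 (bump n) t = dbump n t.
Proof. by have h := is_derive_bump n t; exact: derive_val. Qed.

Lemma dbump_out n t : ~~ (a < t < b) -> dbump n t = 0.
Proof.
rewrite negb_and -!leNgt /dbump => /orP[h|h].
  have E k : psi k (n.+1%:R * (t - a)) = 0.
    by rewrite /psi ifF//; apply/negbTE; rewrite -leNgt pmulr_rle0//; lra.
  by rewrite !E !(mulr0, mul0r) subr0.
have E k : psi k (- n.+1%:R * (t - b)) = 0.
  rewrite /psi ifF//; apply/negbTE.
  by rewrite -leNgt mulNr oppr_le0 pmulr_rge0//; lra.
by rewrite !E !(mulr0, mul0r) subr0.
Qed.

Lemma continuous_bump n : continuous (bump n).
Proof.
move=> t; apply: differentiable_continuous; apply/derivable1_diffP.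
by case: (is_derive_bump n t).
Qed.

Lemma continuous_psi_affine k (c d : R) : continuous (fun t : R => psi k (c * (t - d))).
Proof.
move=> t; apply: differentiable_continuous; apply/derivable1_diffP.
by case: (is_derive_psi_affine k c d t).
Qed.

Lemma continuous_dbump n : continuous (dbump n).
Proof.
move=> t; apply: cvgB; apply: cvgM.
- by apply: cvgM; [exact: cvg_cst|exact: continuous_psi_affine].
- exact: continuous_psi_affine.
- by apply: cvgM; [exact: cvg_cst|exact: continuous_psi_affine].
- exact: continuous_psi_affine.
Qed.

(** A majorant of |dbump n| that is the derivative of a difference of two functions with values in
    [0, 1]; its integral is therefore at most 2 for every n. *)
Definition dmass n t := n.+1%:R * psi 2 (n.+1%:R * (t - a)) +
  n.+1%:R * psi 2 (- n.+1%:R * (t - b)).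

Lemma dbump_le n t : `|dbump n t| <= dmass n t.
Proof.
apply: le_trans (ler_normB _ _) _.
have e x k : `|psi k x| = psi k x :> R by rewrite ger0_norm ?psi_ge0.
rewrite !normrM !e normr_nat; apply: lerD.
  by rewrite ler_piMr ?psi0_le1// mulr_ge0 ?psi_ge0.
by rewrite mulrAC ler_piMr ?psi0_le1// mulr_ge0 ?psi_ge0.
Qed.

Lemma continuous_dmass n : continuous (dmass n).
Proof.
move=> t; apply: cvgD; apply: cvgM; by [exact: cvg_cst|exact: continuous_psi_affine].
Qed.

Lemma dmass_int n c d : c < d -> \int[leb]_(t in `[c, d]) dmass n t <= 2.
Proof.
move=> cd.
pose F t := psi 0 (n.+1%:R * (t - a)) - psi 0 (- n.+1%:R * (t - b)).
have dF x : is_derive x (1 : R) F (dmass n x).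
  have h1 := is_derive_psi_affine 0 n.+1%:R a x.
  have h2 := is_derive_psi_affine 0 (- n.+1%:R) b x.
  by apply: (is_derive_eq (is_deriveB h1 h2)); rewrite /dmass; ring.
have -> : \int[leb]_(t in `[c, d]) dmass n t = F d - F c.
  have E := @Rintegral_derive F (dmass n) c d cd dF (@continuous_dmass n).
  exact: E.
have := psi0_le1 (n.+1%:R * (d - a)); have := psi_ge0 0 (n.+1%:R * (c - a)).
have := psi0_le1 (- n.+1%:R * (c - b)); have := psi_ge0 0 (- n.+1%:R * (d - b)).
rewrite /F; lra.
Qed.

(* On the support the weight [(t - a) * (b - t)] compensates the blow-up of the
   derivative at the end points, since [t * psi 2 t = psi 1 t]. *)
Lemma dbump_weight n t : a < t < b -> (t - a) * (b - t) * `|dbump n t| <=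
  (b - a) * (psi 1 (n.+1%:R * (t - a)) + psi 1 (- n.+1%:R * (t - b))).
Proof.
move=> /andP[at_ tb].
have n0 : 0 <= n.+1%:R :> R by [].
have h1 : 0 <= n.+1%:R * (t - a) by apply: mulr_ge0 => //; lra.
have h2 : 0 <= - n.+1%:R * (t - b) by rewrite mulNr -mulrN; apply: mulr_ge0 => //; lra.
have w0 : 0 <= (t - a) * (b - t) by apply: mulr_ge0; lra.
apply: le_trans (ler_wpM2l w0 (dbump_le n t)) _; rewrite /dmass.
rewrite -(psi_succ 1 h1) -(psi_succ 1 h2) [leLHS]mulrDr [leRHS]mulrDr; apply: lerD.
  have -> : (t - a) * (b - t) * (n.+1%:R * psi 2 (n.+1%:R * (t - a))) =
     (b - t) * (n.+1%:R * (t - a) * psi 2 (n.+1%:R * (t - a))) by ring.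
  by apply: ler_wpM2r; [rewrite mulr_ge0 ?psi_ge0|lra].
have -> : (t - a) * (b - t) * (n.+1%:R * psi 2 (- n.+1%:R * (t - b))) =
   (t - a) * (- n.+1%:R * (t - b) * psi 2 (- n.+1%:R * (t - b))) by ring.
by apply: ler_wpM2r; [rewrite mulr_ge0 ?psi_ge0|lra].
Qed.

End bump1.
End one_dim.

(** * The fundamental theorem of calculus for weak derivatives *)

Section weak_ftc.
Context (R : realType) (T : R).
Hypothesis T0 : 0 < T.
Local Notation leb := (@lebesgue_measure R).
Local Notation I := (`[0, T]%classic : set R).

Let mI : @measurable _ (measurableTypeR R) I. Proof. exact: measurable_itv. Qed.

Lemma leb_itv : leb I = T%:E.
Proof. by rewrite lebesgue_measure_itv/= lte_fin T0 sube0. Qed.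

Let finI : (leb I < +oo)%E. Proof. by rewrite leb_itv ltry. Qed.

Lemma Rintegral_itv_cst (c : R) : \int[leb]_(t in I) c = T * c.
Proof.
rewrite Rintegral_cst// mulrC; congr (_ * _).
by rewrite -[RHS]/(fine T%:E); congr fine; exact: leb_itv.
Qed.

(** Near the end points h is below e by continuity; elsewhere the product (t - a) (b - t) is at
    least d1 d2, and h is bounded. It lets h be paired with [dbump] although h has no derivative. *)
Lemma vanishing_weight (h : R -> R) a b e : a < b -> 0 < e -> continuous h ->
  h a = 0 -> h b = 0 ->
  exists2 C, 0 <= C & forall t, a < t < b -> `|h t| <= e + C * ((t - a) * (b - t)).
Proof.
move=> ab e0 ch ha hb.
have near0 c : h c = 0 -> exists2 del, 0 < del & forall t, `|t - c| < del -> `|h t| < e.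
  move=> hc; have /cvgrPdist_lt/(_ _ e0)/nbhs_ballP[del del0 H] := ch c.
  exists del => // t tc; have := H t; rewrite /= hc sub0r normrN; apply.
  by rewrite -ball_normE /= distrC.
have [d1 d10 H1] := near0 a ha; have [d2 d20 H2] := near0 b hb.
have cnh : continuous (fun t => `|h t|).
  by move=> t; apply: cvg_norm; exact: ch.
have [c _ Hc] := @EVT_max R _ a b (ltW ab) (continuous_subspaceT cnh).
exists (`|h c| / (d1 * d2)); first by rewrite divr_ge0 ?mulr_ge0// ltW.
move=> t /andP[at_ tb].
have w0 : 0 <= (t - a) * (b - t) by apply: mulr_ge0; lra.
have q0 : 0 <= `|h c| / (d1 * d2) by rewrite divr_ge0 ?mulr_ge0// ltW.
have := mulr_ge0 q0 w0.
have [h1|h1] := ltP (t - a) d1.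
  by have := H1 t; rewrite ger0_norm; [move=> /(_ h1)|]; lra.
have [h2|h2] := ltP (b - t) d2.
  by have := H2 t; rewrite ler0_norm; [rewrite opprB => /(_ h2)|]; lra.
move=> _; have ht : `|h t| <= `|h c| by apply: Hc; rewrite in_itv/=; lra.
apply: le_trans ht _; rewrite -[leLHS]add0r; apply: lerD; first exact: ltW.
rewrite -[leLHS](divfK (_ : d1 * d2 != 0)) ?mulf_neq0 ?gt_eqF//.
by apply: ler_wpM2l => //; apply: ler_pM => //; exact: ltW.
Qed.

(** The weak identity is tested with bumps that tend to the indicator of ]a, b[. Their derivatives
    concentrate at a and b, and the difficulty is to evaluate the limit when F is only
    continuous. *)
Lemma weak_ftc (F g : R -> R) : continuous F -> aeint leb I g ->
  (forall eta, test_function `]0, T[%classic eta ->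
    \int[leb]_(t in I) (F t * 'D_1 eta t) = - \int[leb]_(t in I) (g t * eta t)) ->
  forall a b, 0 < a -> a < b -> b < T ->
  F b - F a = \int[leb]_(t in I) (g t * \1_(`]a, b[%classic) t).
Proof.
move=> cF ig H a b a0 ab bT.
(* The affine interpolant p of F is handled by classical integration by parts; the remainder h
   vanishes at a and b, where the derivative of the bump concentrates. *)
pose s := (F b - F a) / (b - a); pose p t := F a + s * (t - a).
pose h t := F t - p t.
have cp : continuous p.
  move=> t; apply: cvgD; first exact: cvg_cst.
  by apply: cvgM; [exact: cvg_cst|apply: cvgB => //; exact: cvg_cst].
have ch : continuous h by move=> t; apply: cvgB; [exact: cF|exact: cp].
have ba0 : b - a != 0 by rewrite subr_eq0 gt_eqF.
have ha : h a = 0 by rewrite /h /p subrr mulr0 addr0 subrr.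
have hb : h b = 0 by rewrite /h /p /s divfK// [F a + _]addrC subrK subrr.
have cmul (u v : R -> R) : continuous u -> continuous v -> continuous (fun t => u t * v t).
  by move=> cu cv t; apply: cvgM; [exact: cu|exact: cv].
have cB n := @continuous_bump R a b n; have cdB n := @continuous_dbump R a b n.
have iB n : aeint leb I (bump a b n) by exact: continuous_aeint.
have ipd n : aeint leb I (fun t => p t * dbump a b n t) by exact/continuous_aeint/cmul.
have ihd n : aeint leb I (fun t => h t * dbump a b n t) by exact/continuous_aeint/cmul.
have parts n : \int[leb]_(t in I) (p t * dbump a b n t) = - (s * \int[leb]_(t in I) bump a b n t).
  pose Q t := p t * bump a b n t.
  have dQ x : is_derive x (1 : R) Q (s * bump a b n x + p x * dbump a b n x).
    have dp : is_derive x (1 : R) p s.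
      apply: (is_derive_eq (is_deriveD (is_derive_cst (F a) x 1) (is_derive_affine s a x 1))).
      by rewrite add0r mulr1.
    apply: (is_derive_eq (is_deriveM dp (is_derive_bump a b n x))).
    by rewrite /GRing.scale/= addrC mulrC.
  have cQ : continuous (fun x => s * bump a b n x + p x * dbump a b n x).
    move=> x; apply: cvgD; last exact: cmul.
    by apply: cvgM; [exact: cvg_cst|exact: cB].
  have := @Rintegral_derive R Q _ 0 T T0 dQ cQ.
  have [_ ->] := aeint_lin mI s (iB n) (ipd n).
  rewrite /Q !bump_out ?mulr0 ?subr0//; last 2 first.
  - by rewrite ?(lt_gtF bT) ?(lt_gtF a0) ?andbF.
  - by rewrite ?(lt_gtF bT) ?(lt_gtF a0) ?andbF.
  lra.
have split_int n : \int[leb]_(t in I) (h t * dbump a b n t) =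
    s * \int[leb]_(t in I) bump a b n t - \int[leb]_(t in I) (g t * bump a b n t).
  have := H _ (bump_test n a0 bT).
  under eq_Rintegral do rewrite derive_bump.
  have -> : \int[leb]_(t in I) (F t * dbump a b n t) =
      \int[leb]_(t in I) (h t * dbump a b n t) + \int[leb]_(t in I) (p t * dbump a b n t).
    have [_ <-] := aeintD mI (ihd n) (ipd n).
    by apply: eq_Rintegral => t _; rewrite /h; ring.
  rewrite parts; lra.
have lim1 : (fun n => \int[leb]_(t in I) bump a b n t) @ \oo --> b - a.
  have [||||_ L] := @ae_dominated_convergence _ _ _ leb I mI (bump a b) (\1_(`]a, b[%classic)) (cst 1).
  - by move=> n; exact: aeint_meas.
  - exact: aeint_cst.
  - by apply: aeW => t _; exact: bump_cvg.
  - by move=> n; apply: aeW => t _; rewrite ger0_norm ?bump_ge0 ?bump_le1.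
  have E : \int[leb]_(t in I) \1_(`]a, b[%classic) t = b - a.
    have mab : @measurable _ (measurableTypeR R) `]a, b[%classic by exact: measurable_itv.
    rewrite /Rintegral integral_indic//=.
    rewrite setIidl; last by move=> t /=; rewrite !in_itv/=; lra.
    by rewrite lebesgue_measure_itv/= lte_fin ab.
  by rewrite E in L.
have lim2 : (fun n => \int[leb]_(t in I) (g t * bump a b n t)) @ \oo -->
    \int[leb]_(t in I) (g t * \1_(`]a, b[%classic) t).
  have [||||//] := @ae_dominated_convergence _ _ _ leb I mI (fun n t => g t * bump a b n t)
    (fun t => g t * \1_(`]a, b[%classic) t) (fun t => `|g t|).
  - by move=> n; apply: aemeasM; exact: aeint_meas.
  - exact: aeint_norm.
  - by apply: aeW => t _; apply: cvgM; [exact: cvg_cst|exact: bump_cvg].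
  - move=> n; apply: aeW => t _; rewrite normrM ler_piMr//.
    by rewrite ger0_norm ?bump_ge0 ?bump_le1.
pose w n t := psi 1 (n.+1%:R * (t - a)) + psi 1 (- n.+1%:R * (t - b)) : R.
have iw n : aeint leb I (w n).
  by apply: continuous_aeint => t; apply: cvgD; exact: continuous_psi_affine.
have lim3 : (fun n => \int[leb]_(t in I) w n t) @ \oo --> (0 : R).
  have [||||_ L] := @ae_dominated_convergence _ _ _ leb I mI w (cst 0) (cst 2).
  - by move=> n; exact: aeint_meas.
  - exact: aeint_cst.
  - apply: aeW => t _; rewrite /w -[cst 0 t]addr0; apply: cvgD; first exact: psi1_cvg0.
    under eq_fun do rewrite mulNr -mulrN; exact: psi1_cvg0.
  - move=> n; apply: aeW => t _.
    have := psi1_le1 (n.+1%:R * (t - a)); have := psi1_le1 (- n.+1%:R * (t - b)).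
    by rewrite ger0_norm /w ?addr_ge0 ?psi_ge0// /cst; lra.
  by move: L; rewrite Rintegral_cst// mul0r.
have lim : (fun n => \int[leb]_(t in I) (h t * dbump a b n t)) @ \oo -->
    (F b - F a) - \int[leb]_(t in I) (g t * \1_(`]a, b[%classic) t).
  under eq_fun do rewrite split_int.
  apply: cvgB lim2; rewrite -[F b - F a](divfK ba0) -/s.
  by apply: cvgM lim1; exact: cvg_cst.
apply/eqP; rewrite -subr_eq0 -normr_eq0 eq_le normr_ge0 andbT.
apply/ler_addgt0Pl => e e0; rewrite addr0.
have e2 : 0 < e / 2 by lra.
have [C C0 HC] := vanishing_weight ab e2 ch ha hb.
(* The part e/2 of [vanishing_weight] meets a mass of at most 2; the weighted part is controlled by
   [dbump_weight] and tends to 0 by [lim3]. *)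
pose bd n := e + C * (b - a) * \int[leb]_(t in I) w n t.
have bound n : `|\int[leb]_(t in I) (h t * dbump a b n t)| <= bd n.
  have im : aeint leb I (dmass a b n) by apply: continuous_aeint; exact: continuous_dmass.
  have [i1 E1] := aeintZ mI (e / 2) im; have [i2 E2] := aeintZ mI (C * (b - a)) (iw n).
  have [i3 E3] := aeintD mI i1 i2.
  apply: le_trans (ae_norm_Rintegral mI (ihd n) i3 _) _; last first.
    rewrite E3 E1 E2 /bd lerD2r.
    have := dmass_int a b n T0; have : 0 < e by [].
    by move=> e0' hm; have := ler_wpM2l (ltW e2) hm; lra.
  apply: aeW => t _; rewrite normrM.
  have [tab|tab] := boolP (a < t < b); last first.
    rewrite dbump_out// normr0 mulr0 addr_ge0//.
      by rewrite mulr_ge0 ?(ltW e2)// (le_trans _ (dbump_le a b n t)).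
    by apply: mulr_ge0; [apply: mulr_ge0 => //; lra|rewrite addr_ge0 ?psi_ge0].
  apply: le_trans (ler_wpM2r (normr_ge0 _) (HC t tab)) _.
  rewrite mulrDl; apply: lerD; first by apply: ler_wpM2l (dbump_le a b n t); exact: ltW.
  by rewrite -[leLHS]mulrA -[leRHS]mulrA; apply: ler_wpM2l => //; exact: dbump_weight.
have limbd : bd @ \oo --> e.
  rewrite -[X in _ --> X]addr0; apply: cvgD; first exact: cvg_cst.
  by rewrite -[X in _ --> X](mulr0 (C * (b - a))); apply: cvgM; [exact: cvg_cst|exact: lim3].
apply: (ler_cvg_to (cvg_norm lim) limbd); apply: nearW => n; exact: bound.
Qed.

(** The primitive of g is constant on ]0, T[, so its derivative vanishes there; by Lebesgue
    differentiation that derivative is g almost everywhere. *)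
Lemma ae0_of_intervals (g : R -> R) : aeint leb I g ->
  (forall a b, 0 < a -> a < b -> b < T ->
     \int[leb]_(t in I) (g t * \1_(`]a, b[%classic) t) = 0) ->
  {ae leb, forall t, I t -> g t = 0}.
Proof.
move=> [g' ig' gg'] H.
pose f := g' \_ I.
have if_ : leb.-integrable setT (EFin \o f).
  have := ig'; rewrite (integrable_mkcond _ mI) => h.
  by rewrite (_ : EFin \o f = (EFin \o g') \_ I)// restrict_EFin.
have lf : locally_integrable setT f by exact: integrable_locally.
have fy y : leb.-integrable [set` Interval -oo%O (BRight y)] (EFin \o f).
  have my : @measurable _ (measurableTypeR R) [set` Interval -oo%O (BRight y)].
    exact: measurable_itv.
  exact: (integrableS _ my _ if_).
have FT := FTC1Ny fy lf.
have fE x y : 0 < x -> x < y -> y < T ->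
   \int[leb]_(t in [set` Interval -oo%O (BRight x)]) f t =
   \int[leb]_(t in [set` Interval -oo%O (BRight y)]) f t.
  move=> x0 xy yT.
  have mset (c : R) : measurable [set` Interval -oo%O (BRight c)] by exact: measurable_itv.
  have E c : \int[leb]_(t in [set` Interval -oo%O (BRight c)]) f t =
      \int[leb]_(t in I) (g' t * \1_([set` Interval -oo%O (BRight c)]) t).
    rewrite Rintegral_mkcond [RHS]Rintegral_mkcond; apply: eq_Rintegral => t _.
    rewrite /f /patch indicE; case: ifP => h1; case: ifP => h2; by rewrite ?mulr1 ?mulr0.
  have ic c : aeint leb I (fun t => g' t * \1_([set` Interval -oo%O (BRight c)]) t).
    apply: (@aeint_dom _ _ _ leb I mI _ (fun t => `|g' t|)).
    - apply: meas_aemeas; apply: measurable_funM.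
        by apply/measurable_EFinP; exact: (measurable_int leb).
      exact: measurable_indic.
    - by apply: aeint_norm; exact: integrable_aeint.
    - apply: aeW => t _; rewrite normrM ler_piMr// indicE.
      by case: (_ \in _); rewrite ?normr1 ?normr0.
  apply/eqP; rewrite !E eq_sym -subr_eq0; apply/eqP.
  have [_ <-] := aeintB mI (ic y) (ic x).
  rewrite -[RHS](H x y x0 xy yT); apply: Rintegral_ae.
  (* The difference of the two half-lines is ]x, y], while the hypothesis concerns ]x, y[; the point
     y is null. *)
  have ny : {ae leb, forall t : R, t != y}.
    exists [set y]; split => //; first exact: lebesgue_measure_set1.
    by move=> t /= /negP; rewrite negbK => /eqP.
  apply: filterS2 gg' ny => t ht ty It; rewrite ht// -mulrBr; congr (_ * _).
  rewrite !indicE; have -> : (t \in [set` Interval -oo%O (BRight y)]) = (t <= y).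
    by apply/idP/idP => [/set_mem|h]; [|apply: mem_set]; rewrite /= in_itv.
  have -> : (t \in [set` Interval -oo%O (BRight x)]) = (t <= x).
    by apply/idP/idP => [/set_mem|h]; [|apply: mem_set]; rewrite /= in_itv.
  have -> : (t \in `]x, y[%classic) = (x < t < y).
    by apply/idP/idP => [/set_mem|h]; [|apply: mem_set]; rewrite /= in_itv.
  have [tx|xt] := leP t x; first by rewrite (le_trans tx (ltW xy)) subrr.
  by rewrite /= subr0 [t < y]lt_neqAle ty.
have n0 : {ae leb, forall t : R, t != 0}.
  exists [set 0]; split => //; first exact: lebesgue_measure_set1.
  by move=> t /= /negP; rewrite negbK => /eqP.
have nT : {ae leb, forall t : R, t != T}.
  exists [set T]; split => //; first exact: lebesgue_measure_set1.
  by move=> t /= /negP; rewrite negbK => /eqP.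
pose G c := \int[leb]_(t in [set` Interval -oo%O (BRight c)]) f t.
apply: filterS3 FT (filterI n0 nT) gg' => t + [t0 tT] + It => -[_] + /(_ It) ->.
rewrite -/G; have ft : f t = g' t by rewrite /f patchE mem_set.
rewrite ft => <-; have /andP[tgt0 tltT] : 0 < t < T.
  by move: It; rewrite /= in_itv/= !lt_neqAle eq_sym t0 tT.
rewrite derive1E (@near_eq_derive _ _ _ _ (cst (G t))) ?derive_cst//.
near=> x.
have x0 : 0 < x by near: x; exact: lt_nbhsr.
have xT : x < T by near: x; exact: lt_nbhsl.
have [xt|tx|->//] := ltgtP x t; first exact: fE.
by rewrite /cst /G [RHS](fE t x).
Unshelve. all: by end_near.
Qed.

End weak_ftc.

(** * H1 in time *)

Section H1_time_space.
Context (R : realType) (T : R) (V : lmodType R) (D : set V) (ip : V -> V -> R).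
Hypotheses (T0 : 0 < T) (sip : semi_inner D ip).
Local Notation leb := (@lebesgue_measure R).
Local Notation N := (ipnorm ip).
Local Notation I := (`[0, T]%classic : set R).
Local Notation L2t := (L2_time T D N).
Local Notation ipt := (ip_time T ip).
Local Notation weak := (weak_time_derivative T D N ip).
Local Notation dt := (dt T D N ip).

Let sN : seminormed D N := semi_inner_seminormed sip.
Let mI : @measurable _ (measurableTypeR R) I. Proof. exact: measurable_itv. Qed.
Let sipT : semi_inner L2t ipt := L2_time_semi_inner T0 sip.
Let sT := semi_inner_seminormed sipT.

Lemma C0_time_scale (phi : R -> R) x : continuous phi -> D x ->
  C0_time T D N (fun t => phi t *: x).
Proof.
move=> cphi Dx; split=> [t _|t tT e e0]; first exact: (sn_DZ sN).
have Nx : 0 <= N x := sqrtr_ge0 _.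
have e1 : 0 < e / (N x + 1) by rewrite divr_gt0//; lra.
have /cvgrPdist_lt/(_ _ e1)/nbhs_ballP[del del0 H] := cphi t.
exists del => // s sT' st; rewrite -scalerBl (sn_Z sN)//.
have := H s; rewrite -ball_normE /= [`|t - s|]distrC => /(_ st).
rewrite [`|phi t - _|]distrC ltr_pdivlMr; last by lra.
have := normr_ge0 (phi s - phi t); lra.
Qed.

Lemma ip_time_scale f (phi : R -> R) x : L2t f -> D x ->
  ipt f (fun t => phi t *: x) = \int[leb]_(t in I) (ip (f t) x * phi t).
Proof.
move=> [Df _ _] Dx; apply: eq_Rintegral => t /set_mem It.
have Dt := Df t It.
by rewrite (ipC sip Dt (sn_DZ sN _ Dx)) (ipZl sip _ Dx Dt) (ipC sip Dx Dt) mulrC.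
Qed.

Lemma test_function_continuous (eta : R -> R) : test_function `]0, T[%classic eta ->
  continuous eta /\ continuous ('D_1 eta).
Proof.
move=> [sm _]; split => t; apply: differentiable_continuous.
- exact: (sm [::] t).
- exact: (sm [:: 1] t).
Qed.

(** In terms of the inner product of L2(0, T), both sides are continuous and linear in z and g, so
    combinations and limits of weak derivatives are Hilbert space computations. *)
Lemma weakE z g : L2t z -> weak z g <-> L2t g /\
  forall (eta : R -> R) x, test_function `]0, T[%classic eta -> D x ->
    ipt z (fun t => 'D_1 eta t *: x) = - ipt g (fun t => eta t *: x).
Proof.
move=> Lz; split=> -[Lg H]; split=> // eta x ht Dx.
  by rewrite !ip_time_scale//; exact: H.
by rewrite -!ip_time_scale//; exact: H.
Qed.

Lemma weak_lin a z z' g g' : L2t z -> L2t z' -> weak z g -> weak z' g' ->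
  weak (a *: z + z') (a *: g + g').
Proof.
move=> Lz Lz' /weakE[//|Lg H] /weakE[//|Lg' H'].
apply/weakE; first exact: (sn_Dlin sT).
split=> [|eta x ht Dx]; first exact: (sn_Dlin sT).
have [c1 c2] := test_function_continuous ht.
have L1 := C0_L2_time T0 sip (C0_time_scale c1 Dx).
have L2 := C0_L2_time T0 sip (C0_time_scale c2 Dx).
rewrite !(ip_linl sipT)// H// H'//; lra.
Qed.

Lemma L2_time_aeint_cst f x : L2t f -> D x -> aeint leb I (fun t => ip (f t) x).
Proof.
move=> Lf Dx; apply: (L2_time_aeint_ip sip Lf (g := fun=> x)).
by apply: (C0_L2_time T0 sip); exact: (C0_time_cst T sN).
Qed.

(** For each x the difference is orthogonal to x outside a null set that depends on x. Strong
    measurability provides countably many step values to test with, which replaces separability of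
    the space. *)
Lemma weak_unique z g g' : L2t z -> weak z g -> weak z g' ->
  {ae leb, forall t, I t -> N (g t - g' t) = 0}.
Proof.
move=> Lz wg wg'.
have [Lg _] := wg; have [Lg' _] := wg'.
have Lh : L2t (g - g') by exact: (sn_DB sT).
(* The difference g - g' is a weak derivative of the zero function. *)
have w0 : weak (-1 *: z + z) (g - g').
  by rewrite [g - g']addrC -[- g']scaleN1r; exact: weak_lin.
have orth x : D x -> {ae leb, forall t, I t -> ip ((g - g') t) x = 0}.
  move=> Dx; apply: (@ae0_of_intervals R T); first exact: L2_time_aeint_cst.
  have H := @weak_ftc R T T0 (cst 0) (fun t => ip ((g - g') t) x) (fun=> cvg_cst 0)
    (L2_time_aeint_cst Lh Dx).
  move=> a b a0 ab bT; rewrite -H ?subrr// => eta ht.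
  case: w0 => _ /(_ eta x ht Dx) <-.
  apply: eq_Rintegral => t /set_mem It; congr (_ * _).
  have -> : (-1 *: z + z) t = 0 by rewrite scaleN1r addNr.
  by rewrite (ip0l sip).
have [Dh mh _] := Lh.
have /strongly_measurableP[s [Hs cs]] := mh.
(* Only the finitely many values of s n are tested, so one null set serves all t, and then all n. *)
have orths n : {ae leb, forall t, I t -> ip ((g - g') t) (simple_time (s n) t) = 0}.
  elim: (s n) (Hs n) => [|p r IH] Hr.
    apply: aeW => t It; rewrite /simple_time big_nil (ipC sip) ?(ip0l sip)//; try exact: Dh.
    exact: (sn_D0 sN).
  have [_ Dp] := Hr p (mem_head _ _).
  have Hr' : simple_in D r by move=> q qr; apply: Hr; rewrite inE qr orbT.
  apply: filterS2 (orth p.2 Dp) (IH Hr') => t h1 h2 It.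
  rewrite /simple_time big_cons (ip_linr sip)//; try exact: Dh.
    by rewrite h1// mulr0 add0r; exact: h2.
  exact: (simple_time_in sip).
apply: filterS2 (ae_foralln orths) cs => t h c It.
have Dt := Dh t It.
suff i0 : ip ((g - g') t) ((g - g') t) = 0 by rewrite /ipnorm [X in Num.sqrt X]i0 sqrtr0.
have c0 : (fun n => N ((g - g') t - (g - g') t)) @ \oo --> (0 : R).
  by under eq_fun do rewrite subrr (sn_0 sN); exact: cvg_cst.
have cc := ip_cvg sip (fun=> Dt) (fun n => simple_time_in sip t (Hs n)) Dt Dt c0 (c It).
have c2 : (fun n => ip ((g - g') t) (simple_time (s n) t)) @ \oo --> (0 : R).
  rewrite (_ : (fun n => _) = cst 0); first exact: cvg_cst.
  by apply/funext => n; exact: h.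
exact: (cvg_unique (@Rhausdorff R) cc c2).
Qed.

Definition Zgen (z : R -> V) : Prop :=
  [/\ C0_time T D N z, H1_time T D N ip z & N (z 0) = 0].

Definition ipZ (y z : R -> V) : R := ipt (dt y) (dt z).

Lemma weak_dt z : H1_time T D N ip z -> weak z (dt z).
Proof. by move=> [_ [g wg]]; apply: xgetPex; exists g. Qed.

Lemma dt_L2 z : Zgen z -> L2t (dt z).
Proof. by case=> _ /weak_dt[]. Qed.

Let T00 : 0 \in `[0, T]. Proof. by rewrite in_itv/= lexx ltW. Qed.

Lemma Zgen_lin a y z : Zgen y -> Zgen z -> Zgen (a *: y + z).
Proof.
move=> [cy [Ly [gy wy]] y0] [cz [Lz [gz wz]] z0]; split.
- exact: (C0_time_lin sN).
- split; first exact: (sn_Dlin sT).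
  by exists (a *: gy + gz); exact: weak_lin.
- have Dy : D (y 0) by case: cy => + _; apply.
  have Dz : D (z 0) by case: cz => + _; apply.
  have := sn_tri sN (sn_DZ sN a Dy) Dz; rewrite (sn_Z sN)// y0 z0 mulr0 addr0.
  move=> h; apply/eqP; rewrite eq_le h/=; exact: sqrtr_ge0.
Qed.

Lemma Zgen0 : Zgen 0.
Proof.
have c0 : C0_time T D N (0 : R -> V) by apply: C0_time_cst => //; exact: (sn_D0 sN).
have L0 := C0_L2_time T0 sip c0.
split => //; last exact: (sn_0 sN).
split => //; exists 0; apply/weakE => //; split => // eta x ht Dx.
have [c1 c2] := test_function_continuous ht.
have h1 := C0_L2_time T0 sip (C0_time_scale c1 Dx).
have h2 := C0_L2_time T0 sip (C0_time_scale c2 Dx).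
by rewrite !(ip0l sipT)// oppr0.
Qed.

Lemma ipt_ae f g h : {ae leb, forall t, I t -> N (f t - g t) = 0} ->
  L2t f -> L2t g -> L2t h -> ipt f h = ipt g h.
Proof.
move=> H [Df _ _] [Dg _ _] [Dh _ _]; apply: Rintegral_ae.
apply: filterS H => t H It.
by apply: (ip_null sip); [exact: Df|exact: Dg|exact: Dh|exact: H].
Qed.

Lemma dt_lin a y z : Zgen y -> Zgen z ->
  {ae leb, forall t, I t -> N (dt (a *: y + z) t - (a *: dt y + dt z) t) = 0}.
Proof.
move=> Zy Zz; have Zl := Zgen_lin a Zy Zz.
case: Zy Zz Zl => _ Hy _ [_ Hz _] [_ Hl _].
apply: weak_unique (weak_dt Hl) _; first by case: Hl.
by apply: weak_lin; [case: Hy|case: Hz|exact: weak_dt|exact: weak_dt].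
Qed.

Lemma Zgen_semi_inner : semi_inner Zgen ipZ.
Proof.
split.
- exact: Zgen0.
- exact: Zgen_lin.
- move=> a y z x Zy Zz Zx; rewrite /ipZ.
  have Ly := dt_L2 Zy; have Lz := dt_L2 Zz; have Lx := dt_L2 Zx.
  have Ll := dt_L2 (Zgen_lin a Zy Zz).
  have Lr : L2t (a *: dt y + dt z) by exact: (sn_Dlin sT).
  by rewrite (ipt_ae (dt_lin a Zy Zz) Ll Lr Lx) (ip_linl sipT).
- by move=> y z Zy Zz; apply: (ipC sipT); exact: dt_L2.
- by move=> z Zz; apply: (ip_ge0 sipT); exact: dt_L2.
Qed.

Let sZ := semi_inner_seminormed Zgen_semi_inner.

(** With x = z b - z a, the fundamental theorem for t -> ip (z t) x gives N(x)^2 as the inner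
    product of [dt z] with the step function 1_]a,b[ x, whose norm is at most sqrt T N(x). *)
Lemma Zgen_increment z a b : Zgen z -> 0 < a -> a < b -> b < T ->
  N (z b - z a) <= Num.sqrt T * ipnorm ipZ z.
Proof.
move=> Zz a0 ab bT; have [cz Hz _] := Zz.
have [Dz _] := cz.
have Da : D (z a) by apply: Dz; rewrite in_itv/=; lra.
have Db : D (z b) by apply: Dz; rewrite in_itv/=; lra.
pose x := z b - z a; have Dx : D x by exact: (sn_DB sN).
have Lg := dt_L2 Zz.
pose F := (fun t => ip (z t) x) \o clamp T.
have cF : continuous F.
  apply: clamp_continuous => // t tT e e0.
  have Nx : 0 <= N x := sqrtr_ge0 _.
  have e1 : 0 < e / (N x + 1) by rewrite divr_gt0//; lra.
  have [del del0 Hd] := cz.2 t tT _ e1.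
  exists del => // s sT' st; have Ds := Dz s sT'; have Dt := Dz t tT.
  rewrite -(ipBl sip Ds Dt Dx).
  apply: le_lt_trans (ip_CSn sip (sn_DB sN Ds Dt) Dx) _.
  have := Hd s sT' st; rewrite ltr_pdivlMr; last by lra.
  have := sqrtr_ge0 (ip (z s - z t) (z s - z t)); rewrite -/(ipnorm _ _); nra.
have := weak_ftc T0 cF (L2_time_aeint_cst Lg Dx) _ a0 ab bT.
have -> : F b - F a = N x ^+ 2.
  by rewrite /F /= !clamp_id// ?in_itv/=; [rewrite -(ipBl sip)// (ipnorm_sq sip)|lra|lra].
move=> E; have {}E : N x ^+ 2 = \int[leb]_(t in I) (ip (dt z t) x * \1_(`]a, b[%classic) t).
  apply: E => eta ht; case: (weak_dt Hz) => _ /(_ eta x ht Dx) <-.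
  by apply: eq_Rintegral => t /set_mem It; rewrite /F /= clamp_id.
pose y := simple_time [:: (`]a, b[%classic, x)].
have yE t : y t = \1_(`]a, b[%classic) t *: x by rewrite /y /simple_time big_seq1.
have sy : simple_in D [:: (`]a, b[%classic, x)].
  by move=> p; rewrite inE => /eqP ->; split => //; exact: measurable_itv.
have Dy t : I t -> D (y t) by move=> _; exact: (simple_time_in sip).
have bd t : N (y t) ^+ 2 <= N x ^+ 2.
  rewrite yE (sn_Z sN)// exprMn ler_piMl ?sqr_ge0// indicE.
  by case: (_ \in _); rewrite ?normr1 ?normr0 ?expr1n// expr0n.
have sm := simple_strongly_measurable T sip sy.
have finI : (leb I < +oo)%E by rewrite (leb_itv T0) ltry.
have icst : aeint leb I (cst (N x ^+ 2)) by exact: aeint_cst.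
have iy : aeint leb I (fun t => N (y t) ^+ 2).
  apply: (@aeint_dom _ _ _ leb I mI _ (cst (N x ^+ 2))) => //.
    apply: (aemeas_eq _ (strongly_measurable_ip sip Dy Dy sm sm)).
    by apply: aeW => t It; rewrite (ipnorm_sq sip)//; exact: Dy.
  by apply: aeW => t _; rewrite ger0_norm ?sqr_ge0.
have Ly : L2t y by exact: aeint_L2_time.
have Ny : ipnorm ipt y ^+ 2 <= T * N x ^+ 2.
  rewrite (ip_time_sq T0 sip Ly).
  have bd' : {ae leb, forall t, I t -> N (y t) ^+ 2 <= cst (N x ^+ 2) t} by apply: aeW.
  have := ae_le_Rintegral mI iy icst bd'.
  by rewrite (Rintegral_itv_cst T0).
have : N x ^+ 2 <= ipnorm ipZ z * ipnorm ipt y.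
  rewrite E; apply: le_trans (ler_norm _) _.
  have -> : \int[leb]_(t in I) (ip (dt z t) x * \1_(`]a, b[%classic) t) = ipt (dt z) y.
    rewrite (_ : y = fun t => \1_(`]a, b[%classic) t *: x) ?ip_time_scale//.
    exact/funext.
  exact: (ip_CSn sipT Lg Ly).
have Nx0 : 0 <= N x := sqrtr_ge0 _.
have Nz0 : 0 <= ipnorm ipZ z := sqrtr_ge0 _.
have Ny0 : 0 <= ipnorm ipt y := sqrtr_ge0 _.
have {}Ny : ipnorm ipt y <= Num.sqrt T * N x.
  rewrite -ler_sqr ?nnegrE ?mulr_ge0 ?sqrtr_ge0// exprMn.
  by rewrite [Num.sqrt T ^+ 2]sqr_sqrtr ?(ltW T0).
have sT0 : 0 <= Num.sqrt T := sqrtr_ge0 _.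
move=> h; have {}h : N x * N x <= (Num.sqrt T * ipnorm ipZ z) * N x.
  rewrite -expr2; apply: le_trans h _.
  by rewrite [_ * ipnorm ipZ z]mulrC -mulrA; exact: ler_wpM2l.
have [x0|] := eqVneq (N x) 0; first by rewrite -/x x0 mulr_ge0.
move=> xn; have xpos : 0 < N x by rewrite lt_neqAle eq_sym xn.
by rewrite -(ler_pM2r xpos).
Qed.

(** The increment estimate holds between interior points; it reaches 0 and t by continuity, and z
    vanishes at 0. *)
Lemma Zgen_sup z t : Zgen z -> t \in `[0, T] -> N (z t) <= Num.sqrt T * ipnorm ipZ z.
Proof.
move=> Zz tT; have [[Dz cz] _ z0] := Zz.
apply/ler_addgt0Pl => e e0; have e2 : 0 < e / 2 by lra.
have [d1 d10 H1] := cz 0 T00 _ e2; have [d2 d20 H2] := cz t tT _ e2.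
have /andP[t0 tT'] : 0 <= t <= T by move: tT; rewrite in_itv.
(* The interior point b near t is taken to the right of t in the first half of [0, T] and to the
   left otherwise. *)
have [b [b0 bT bt]] : exists b, [/\ 0 < b, b < T & `|b - t| < d2].
  have [tT2|tT2] := ltP t (T / 2).
    pose r := Num.min (d2 / 2) (T / 2).
    have r0 : 0 < r by rewrite lt_min; lra.
    have r1 : r <= d2 / 2 by rewrite ge_min lexx.
    have r2 : r <= T / 2 by rewrite ge_min lexx orbT.
    exists (t + r); split; [lra|lra|].
    by rewrite addrC addKr gtr0_norm//; lra.
  pose r := Num.min (d2 / 2) (T / 4).
  have r0 : 0 < r by rewrite lt_min !divr_gt0.
  have r1 : r <= d2 / 2 by rewrite ge_min lexx.
  have r2 : r <= T / 4 by rewrite ge_min lexx orbT.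
  exists (t - r); split; [lra|lra|].
  by rewrite addrC addrA addNr add0r normrN gtr0_norm//; lra.
pose a := Num.min (d1 / 2) (b / 2).
have a0 : 0 < a by rewrite lt_min; lra.
have a1 : a <= d1 / 2 by rewrite ge_min lexx.
have a2 : a <= b / 2 by rewrite ge_min lexx orbT.
have bI : b \in `[0, T] by rewrite in_itv/=; lra.
have aI : a \in `[0, T] by rewrite in_itv/=; lra.
have ab : a < b by lra.
have h1 := H1 a aI; rewrite subr0 gtr0_norm// in h1.
have {}h1 := h1 (ltac:(lra)).
have := H2 b bI bt; have := Zgen_increment Zz a0 ab bT.
have Dt := Dz t tT; have Da := Dz a aI; have Db := Dz b bI; have D0 := Dz 0 T00.
rewrite (sn_sym sN Db Dt).
have := sn_dist sN Dt Db (sn_D0 sN); have := sn_dist sN Db Da (sn_D0 sN).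
have := sn_dist sN Da D0 (sn_D0 sN); rewrite !subr0 z0; lra.
Qed.

Hypothesis cN : seminorm_complete D N.

(** The derivatives converge in L2(0, T), and by [Zgen_sup] the functions converge uniformly; the
    weak derivative identity and the value at 0 pass to the limit. *)
Lemma Zgen_complete : seminorm_complete Zgen (ipnorm ipZ).
Proof.
move=> z_ Zz_ Hz.
have Lg n := dt_L2 (Zz_ n).
have ZB n m : Zgen (z_ n - z_ m) by exact: (sn_DB sZ).
have dB n m : {ae leb, forall t, I t -> N (dt (z_ n - z_ m) t - (dt (z_ n) - dt (z_ m)) t) = 0}.
  have := dt_lin (-1) (Zz_ m) (Zz_ n); rewrite !scaleN1r.
  by rewrite [- z_ m + _]addrC [- dt (z_ m) + _]addrC.
have normB n m : ipnorm ipt (dt (z_ n) - dt (z_ m)) = ipnorm ipZ (z_ n - z_ m).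
  have LB : L2t (dt (z_ n) - dt (z_ m)) by exact: (sn_DB sT).
  rewrite /ipnorm; congr Num.sqrt; rewrite /ipZ.
  have LdB := dt_L2 (ZB n m).
  by rewrite (ipt_ae (dB n m) LdB LB LdB) (ipC sipT LB LdB) (ipt_ae (dB n m) LdB LB LB).
have [n|g Lgl Hg] := L2_time_complete T0 sip cN Lg; first by rewrite normB; exact: Hz.
have Dz n t : t \in `[0, T] -> D (z_ n t) by move=> tT; case: (Zz_ n) => -[+ _] _ _; apply.
have C0 : 0 < Num.sqrt T + 1 by have := sqrtr_ge0 T; lra.
have step n t : t \in `[0, T] -> N (z_ n.+1 t - z_ n t) <= (Num.sqrt T + 1) * 2^-1 ^+ n.
  move=> tT; have := Zgen_sup (ZB n.+1 n) tT; move=> /le_trans; apply.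
  by apply: ler_pM; rewrite ?sqrtr_ge0//; lra.
have lim t : exists v, t \in `[0, T] -> D v /\
    forall n, N (z_ n t - v) <= 2 * (Num.sqrt T + 1) * 2^-1 ^+ n.
  have [tT|] := boolP (t \in `[0, T]); last by exists 0.
  have [n||v Dv Hv] := complete_fast sN cN C0 (v_ := fun n => z_ n t).
  - exact: Dz.
  - by move=> n; exact: step.
  by exists v.
have /choice[z Hz'] := lim.
have cz : C0_time T D N z.
  apply: (C0_time_unif sN (f_ := z_)).
  - by move=> n; case: (Zz_ n).
  - by move=> t tT; case: (Hz' t tT).
  - move=> e e0; have [n Hn] := half_exp_small (2 * (Num.sqrt T + 1)) e0.
    by exists n => t tT; apply: le_lt_trans (Hn n (leqnn n)); case: (Hz' t tT).
have Lz := C0_L2_time T0 sip cz.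
have Lz_ n : L2t (z_ n) by case: (Zz_ n) => _ [].
have czL : (fun n => ipnorm ipt (z_ n - z)) @ \oo --> (0 : R).
  pose C := Num.sqrt T * (2 * (Num.sqrt T + 1)).
  have B n : ipnorm ipt (z_ n - z) <= C * 2^-1 ^+ n.
    have LBn : L2t (z_ n - z) by exact: (sn_DB sT).
    rewrite -ler_sqr ?nnegrE ?sqrtr_ge0//; last first.
      by rewrite /C !mulr_ge0 ?exprn_ge0 ?invr_ge0 ?sqrtr_ge0//; exact: ltW.
    rewrite (ip_time_sq T0 sip LBn) /C -mulrA exprMn [Num.sqrt T ^+ 2]sqr_sqrtr ?(ltW T0)//.
    have finI : (leb I < +oo)%E by rewrite (leb_itv T0) ltry.
    have ic := @aeint_cst _ _ _ leb I mI ((2 * (Num.sqrt T + 1) * 2^-1 ^+ n) ^+ 2) finI.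
    apply: le_trans (ae_le_Rintegral mI (L2_time_aeint sip LBn) ic _) _.
      have c0 : 0 <= 2 * (Num.sqrt T + 1) * 2^-1 ^+ n :> R.
        by apply: mulr_ge0; [apply: mulr_ge0 => //; exact: ltW|exact/ltW/half_exp_gt0].
      apply: aeW => t It; rewrite /cst lerXn2r// ?nnegrE ?sqrtr_ge0//.
      by case: (Hz' t It) => _; apply.
    by rewrite (Rintegral_itv_cst T0).
  apply/cvgrPdist_lt => e e0; have [n0 Hn0] := half_exp_small C e0.
  exists n0 => // n nn; rewrite /= sub0r normrN ger0_norm ?sqrtr_ge0//.
  exact: le_lt_trans (B n) (Hn0 n nn).
have cgL : (fun n => ipnorm ipt (dt (z_ n) - g)) @ \oo --> (0 : R).
  apply/cvgrPdist_lt => e e0; have [n0 Hn0] := Hg _ e0.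
  by exists n0 => // n nn; rewrite /= sub0r normrN ger0_norm ?sqrtr_ge0//; exact: Hn0.
have wz : weak z g.
  apply/weakE => //; split => // eta x ht Dx.
  have [c1 c2] := test_function_continuous ht.
  have h1 := C0_L2_time T0 sip (C0_time_scale c1 Dx).
  have h2 := C0_L2_time T0 sip (C0_time_scale c2 Dx).
  have cc (v : R -> V) : L2t v -> (fun n : nat => ipnorm ipt (v - v)) @ \oo --> (0 : R).
    by move=> Lv; under eq_fun do rewrite subrr (sn_0 sT); exact: cvg_cst.
  have a1 := ip_cvg sipT Lz_ (fun=> h2) Lz h2 czL (cc _ h2).
  have a2 := ip_cvg sipT Lg (fun=> h1) Lgl h1 cgL (cc _ h1).
  apply: (cvg_unique (@Rhausdorff R) a1).
  apply: cvg_trans (cvgN a2).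
  rewrite (_ : (fun n => ipt (z_ n) (fun t => 'D_1 eta t *: x)) =
    - (fun n => ipt (dt (z_ n)) (fun t => eta t *: x)))//.
  apply/funext => n; have /weakE[//|_] := weak_dt (let: And3 _ h _ := Zz_ n in h).
  exact.
have Zz : Zgen z.
  split => //; first by split => //; exists g.
  apply/eqP; rewrite eq_le sqrtr_ge0 andbT; apply/ler_addgt0Pl => e e0; rewrite addr0.
  have [n Hn] := half_exp_small (2 * (Num.sqrt T + 1)) e0.
  have [Dz0 /(_ n) h] := Hz' 0 T00.
  have := sn_dist sN Dz0 (Dz n 0 T00) (sn_D0 sN); rewrite !subr0 (sn_sym sN Dz0 (Dz n 0 T00)).
  have [_ _ ->] := Zz_ n; have := Hn n (leqnn n); lra.
exists z => // e e0; have [n0 Hn0] := Hg e e0; exists n0 => n nn.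
suff -> : ipnorm ipZ (z_ n - z) = ipnorm ipt (dt (z_ n) - g) by exact: Hn0.
have wn := weak_dt (let: And3 _ h _ := Zz_ n in h).
have wB : weak (z_ n - z) (dt (z_ n) - g).
  have -> : z_ n - z = -1 *: z + z_ n by rewrite scaleN1r addrC.
  have -> : dt (z_ n) - g = -1 *: g + dt (z_ n) by rewrite scaleN1r addrC.
  exact: weak_lin.
have ZzB : Zgen (z_ n - z) by exact: (sn_DB sZ).
have LB : L2t (z_ n - z) by exact: (sn_DB sT).
have LgB : L2t (dt (z_ n) - g) by exact: (sn_DB sT).
have U := weak_unique LB (weak_dt (let: And3 _ h _ := ZzB in h)) wB.
rewrite /ipnorm; congr Num.sqrt; rewrite /ipZ.
have LdB := dt_L2 ZzB.
by rewrite (ipt_ae U LdB LgB LdB) (ipC sipT LgB LdB) (ipt_ae U LdB LgB LgB).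
Qed.

End H1_time_space.

(** * Lebesgue measure on R^d *)

Section outer.
Context (R : realType) (T : pointedType).
Variable w : set (g_sigma_algebraType [set: set T]) -> \bar R.
Hypotheses (w0 : w set0 = 0%E) (w_ge0 : forall A, (0 <= w A)%E).

(** The weight lives on the discrete sigma-algebra, so every countable cover is admissible. *)
Lemma mu_ext_cover (A : set T) (F : nat -> set T) : A `<=` \bigcup_k F k ->
  (mu_ext w A <= \sum_(k <oo) w (F k))%E.
Proof.
move=> AF; apply: ereal_inf_lbound; exists F => //; split => // k.
exact: sub_gen_smallest.
Qed.

Lemma le_mu_ext_weight (A : set T) : (mu_ext w A <= w A)%E.
Proof.
apply: (le_trans (@mu_ext_cover A (fun k => if k is 0%N then A else set0) _)).
  by move=> x Ax; exists 0%N.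
rewrite (nneseries_split 0 1)// add0n big_nat1 eseries0 ?adde0// => -[|n] //= _.
Qed.

Lemma mu_ext_adherent (A : set T) (e : R) : 0 < e -> mu_ext w A \is a fin_num ->
  exists2 F : nat -> set T, A `<=` \bigcup_k F k &
    (\sum_(k <oo) w (F k) <= mu_ext w A + e%:E)%E.
Proof.
move=> e0 fA; have [_ [F [_ AF] <-] FA] := lb_ereal_inf_adherent e0 fA.
by exists F => //; exact: ltW.
Qed.

(* A weight that is superadditive under splitting by [H] makes [H] measurable. *)
Lemma split_mu_ext (H X : set T) :
  (forall F, (w (F `&` H) + w (F `&` ~` H) <= w F)%E) ->
  (mu_ext w (X `&` H) + mu_ext w (X `&` ~` H) <= mu_ext w X)%E.
Proof.
move=> wH; apply: le_ereal_inf_tmp => _ [F [_ XF] <-].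
apply: (@le_trans _ _ (\sum_(k <oo) w (F k `&` H) + \sum_(k <oo) w (F k `&` ~` H))%E).
  apply: leeD; apply: mu_ext_cover => x [Xx Hx]; have [k _ Fx] := XF x Xx;
    by exists k.
rewrite -nneseriesD//; apply: lee_nneseries => [k _ _|k _]; last exact: wH.
exact: adde_ge0.
Qed.

End outer.

Section lebesgue_rV.
Context (R : realType) (d : nat).
Local Notation E := 'rV[R]_d.
Local Notation mu := (@lebesgue_rV R d).
Local Notation out := (@lebesgue_outer R d).
Local Notation meas := (@measurable _ (caratheodory_type (@lebesgue_outer_measure R d))).

Let bv0 := @box_volume0 R d.
Let bv_ge0 := @box_volume_ge0 R d.

Lemma box_volume_le (A : set E) (p q : E) : (forall i, p 0 i <= q 0 i) ->
  A `<=` box p q -> (box_volume A <= (\prod_i (q 0 i - p 0 i))%:E)%E.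
Proof.
move=> pq Apq; rewrite /box_volume; case: asboolP => _.
  by rewrite lee_fin prodr_ge0// => i _; rewrite subr_ge0.
by apply: ereal_inf_lbound; exists (p, q).
Qed.

Lemma box_volume_nonempty (A : set E) : A !=set0 -> box_volume A =
  ereal_inf [set (\prod_i (p.2 0 i - p.1 0 i))%:E
    | p in [set p : E * E | (forall i, p.1 0 i <= p.2 0 i) /\ A `<=` box p.1 p.2]].
Proof. by move=> [x Ax]; rewrite /box_volume; case: asboolP => // A0; rewrite A0 in Ax. Qed.

Definition set_coord (p : E) (i : 'I_d) (c : R) : E := \row_j if j == i then c else p 0 j.

Lemma set_coordE p i c j : set_coord p i c 0 j = if j == i then c else p 0 j.
Proof. by rewrite mxE. Qed.

(** A hyperplane cuts a box into two boxes whose volumes add up; when it misses the box, one of the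
    two pieces is empty. *)
Lemma split_box_volume (i : 'I_d) (a : R) (F : set E) :
  (box_volume (F `&` [set x : E | (x 0 i < a)%R]) +
   box_volume (F `&` ~` [set x : E | (x 0 i < a)%R]) <= box_volume F)%E.
Proof.
set H := [set x : E | (x 0 i < a)%R]; have [->|/set0P F0] := eqVneq F set0.
  by rewrite !set0I bv0 adde0.
rewrite (box_volume_nonempty F0); apply: le_ereal_inf_tmp => _ [[p q] /= [pq Fpq] <-].
have [ap|pa] := ltP a (p 0 i).
  rewrite (_ : F `&` H = set0) ?bv0 ?add0e; last first.
    by apply/seteqP; split => // x [/Fpq/(_ i)/andP[h _] /=]; rewrite /H/=; lra.
  by apply: box_volume_le => // x [/Fpq].
have [qa|aq] := ltP (q 0 i) a.
  rewrite (_ : F `&` ~` H = set0) ?bv0 ?adde0; last first.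
    by apply/seteqP; split => // x [/Fpq/(_ i)/andP[_ h] /=]; rewrite /H/=; lra.
  by apply: box_volume_le => // x [/Fpq].
apply: (@le_trans _ _ ((\prod_j (set_coord q i a 0 j - p 0 j))%:E +
    (\prod_j (q 0 j - set_coord p i a 0 j))%:E)%E).
  apply: leeD; apply: box_volume_le.
  - by move=> j; rewrite set_coordE; case: eqP => [->|].
  - move=> x [/Fpq h hx] j; rewrite set_coordE; have /andP[h1 h2] := h j.
    by case: eqP => [ji|_]; rewrite h1 ?h2// ji /= ltW.
  - by move=> j; rewrite set_coordE; case: eqP => [->|].
  - move=> x [/Fpq h hx] j; rewrite set_coordE; have /andP[h1 h2] := h j.
    by case: eqP => [ji|_]; rewrite h2 ?h1// ji andbT leNgt; exact/negP.
rewrite -EFinD lee_fin !(bigD1 (P := predT) i)//= !set_coordE eqxx.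
rewrite (eq_bigr (fun j => q 0 j - p 0 j)); last by move=> j /negbTE ji; rewrite set_coordE ji.
rewrite [X in _ + _ * X](eq_bigr (fun j => q 0 j - p 0 j)); last first.
  by move=> j /negbTE ji; rewrite set_coordE ji.
by rewrite -mulrDl addrC addrA subrK.
Qed.

Lemma halfspace_measurable (i : 'I_d) (a : R) : meas [set x : E | x 0 i < a].
Proof.
apply: le_caratheodory_measurable => X.
exact: (split_mu_ext (w := @box_volume R d) bv_ge0 _ (split_box_volume i a)).
Qed.

Lemma coord_measurable (i : 'I_d) (D : set E) :
  measurable_fun (D : set (caratheodory_type (@lebesgue_outer_measure R d))) (fun x : E => x 0 i).
Proof.
move=> mD; apply: (measurability _ (RGenInftyO.measurableE R)) => // _ [_ [a ->] <-].
apply: measurableI => //.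
rewrite (_ : _ @^-1` _ = [set x : E | x 0 i < a]); first exact: halfspace_measurable.
by apply/seteqP; split => x /=; rewrite in_itv.
Qed.

Definition cube (q : E) (r : R) : set E := [set x | forall i, `|x 0 i - q 0 i| < r].
Definition ccube (q : E) (r : R) : set E := [set x | forall i, `|x 0 i - q 0 i| <= r].

Lemma cube_measurable q r : meas (cube q r).
Proof.
rewrite (_ : cube q r = \bigcap_(i in [set: 'I_d]) [set x : E | `|x 0 i - q 0 i| < r]); last first.
  by apply/seteqP; split => [x h i _|x h i]; [exact: h|exact: (h i)].
apply: fin_bigcap_measurable => // i _.
have mf : measurable_fun setT (fun x : caratheodory_type (@lebesgue_outer_measure R d) =>
    `|(x : E) 0 i - q 0 i|).
  have mb := measurable_funB (coord_measurable i (D := setT)) (measurable_cst (q 0 i)).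
  exact: (measurableT_comp (@normr_measurable R setT) mb).
have := mf measurableT `]-oo, r[%classic (measurable_itv _).
by rewrite setTI; congr (meas _); apply/seteqP; split => x /=; rewrite in_itv.
Qed.

Lemma ccube_compact q r : compact (ccube q r).
Proof.
have := @rV_compact R d (fun i => `[q 0 i - r, q 0 i + r]%classic) (fun i => @segment_compact _ _ _).
congr compact; apply/seteqP; split => x h i; have := h i;
  by rewrite /= in_itv/= ler_distl.
Qed.

Lemma ball_cube (q : E) r : 0 < r -> ball q r = cube q r.
Proof.
move=> r0; apply/seteqP; split => x /=.
  by move=> [_ h] i; have := h 0 i; rewrite -ball_normE /= distrC.
by move=> h; split => // i j; rewrite -ball_normE /= distrC ord1; exact: h.
Qed.

(** An enumeration of cubes with rational centre and radius 1/(n+1) whose closure lies in U; other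
    indices give [None]. It exhausts open sets, both for measurability and for the construction of
    cut-off functions. *)
Definition rat_cube (U : set E) (k : nat) : option (E * R) :=
  if unpickle k is Some qn then
    let: (q, n) := (qn : 'rV[rat]_d * nat) in
    let c : E := \row_i ratr (q 0 i) in let r : R := n.+1%:R^-1 in
    if `[< ccube c r `<=` U >] then Some (c, r) else None
  else None.

Lemma rat_cube_sub U k q r : rat_cube U k = Some (q, r) -> 0 < r /\ ccube q r `<=` U.
Proof.
rewrite /rat_cube; case: unpickle => // -[q' n]; case: asboolP => // h [<- <-].
by split => //; rewrite invr_gt0.
Qed.

Lemma rat_cube_cover U x : open U -> U x ->
  exists k q r, rat_cube U k = Some (q, r) /\ cube q r x.
Proof.
move=> oU Ux; have /nbhs_ballP[e /= e0 eU] : nbhs x U by exact: open_nbhs_nbhs.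
(* Twice the radius must stay below e: the centre is within r of x, and points of the closed cube
   are within r of the centre. *)
pose n := Num.trunc (2 / e).
pose r : R := n.+1%:R^-1.
have r0 : 0 < r by rewrite invr_gt0.
have re : 2 * r < e.
  rewrite /r ltr_pdivrMr// mulrC -ltr_pdivrMr//; exact: truncnS_gt.
have /choice[q Hq] : forall i, exists q : rat, `|x 0 i - ratr q| < r.
  move=> i; have [q] := @rat_in_itvoo R (x 0 i - r) (x 0 i + r) (ltac:(lra)).
  by rewrite in_itv/= => h; exists q; rewrite ltr_distlC.
pose qv : 'rV[rat]_d := \row_i q i.
exists (pickle (qv, n)), (\row_i ratr (qv 0 i)), r; split.
  rewrite /rat_cube pickleK/= -/r; case: asboolP => // h; exfalso; apply: h.
  move=> y hy; apply: eU; rewrite ball_cube// => i.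
  have := hy i; have := Hq i; rewrite !mxE => h1 h2.
  apply: le_lt_trans (ler_distD (ratr (q i)) _ _) _.
  by rewrite [X in _ + X]distrC; lra.
by move=> i; rewrite !mxE; exact: Hq.
Qed.

Definition rat_cube_set U k : set E :=
  if rat_cube U k is Some (q, r) then cube q r else set0.

Lemma open_bigcup_cube (U : set E) : open U -> U = \bigcup_k rat_cube_set U k.
Proof.
move=> oU; apply/seteqP; split => [x Ux|x [k _]].
  have [k [q [r [h hx]]]] := rat_cube_cover oU Ux.
  by exists k => //; rewrite /rat_cube_set h.
rewrite /rat_cube_set; case h : rat_cube => [[q r]|//] hx.
have [r0 sub] := rat_cube_sub h; apply: sub => i; exact/ltW/hx.
Qed.

Lemma open_rV_measurable (U : set E) : open U -> meas U.
Proof.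
move=> oU; rewrite (open_bigcup_cube oU); apply: bigcupT_measurable => k.
rewrite /rat_cube_set; case: rat_cube => [[q r]|]; first exact: cube_measurable.
exact: measurable0.
Qed.

Lemma ccube_finite q r : 0 <= r -> (out (ccube q r) < +oo)%E.
Proof.
move=> r0; apply: le_lt_trans (le_mu_ext_weight bv0 bv_ge0 _) _.
apply: le_lt_trans (box_volume_le (p := \row_i (q 0 i - r)) (q := \row_i (q 0 i + r)) _ _) _.
- by move=> i; rewrite !mxE; lra.
- by move=> x h i; rewrite !mxE; have := h i; rewrite ler_distl => /andP[? ?]; apply/andP; split; lra.
- exact: ltry.
Qed.

Lemma bounded_in_ccube (A : set E) : bounded_set A -> exists2 r, 0 <= r & A `<=` ccube 0 r.
Proof.
move=> [M [_ HM]]; exists (`|M| + 2); first by have := normr_ge0 M; lra.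
move=> x Ax; have Mx := HM (`|M| + 1) (ltac:(have := ler_norm M; lra)) x Ax.
have : ball (0 : E) (`|M| + 2) x.
  by rewrite mx_norm_ball /ball_/= sub0r normrN; apply: le_lt_trans Mx _; lra.
rewrite ball_cube; last by have := normr_ge0 M; lra.
by move=> h i; exact/ltW/h.
Qed.

Lemma bounded_finite (A : set E) : bounded_set A -> (out A < +oo)%E.
Proof.
move=> /bounded_in_ccube[r r0 Ar].
by apply: le_lt_trans (ccube_finite 0 r0); exact: le_lebesgue_outer.
Qed.

(** The volume of the enlarged box is a polynomial in the enlargement, hence continuous at 0. *)
Lemma prod_enlarge (p q : E) (e : R) : (forall i, p 0 i <= q 0 i) -> 0 < e ->
  exists2 del, 0 < del &
    \prod_i ((q 0 i + del) - (p 0 i - del)) < \prod_i (q 0 i - p 0 i) + e.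
Proof.
move=> pq e0.
pose P : {poly R} := \prod_i ((q 0 i - p 0 i)%:P + 2%:P * 'X).
have PE x : P.[x] = \prod_i ((q 0 i + x) - (p 0 i - x)).
  rewrite /P horner_prod; apply: eq_bigr => i _.
  by rewrite !hornerE; ring.
have c : P.[x] @[x --> (0:R)] --> P.[0] by exact: continuous_horner.
have /cvgrPdist_lt/(_ _ e0)/nbhs_ballP[del /= del0 H] := c.
exists (del / 2); first by rewrite divr_gt0.
have := H (del / 2); rewrite -ball_normE /= sub0r normrN gtr0_norm ?divr_gt0//.
move=> /(_ (ltac:(lra))); rewrite !PE.
under [X in `|X - _|]eq_bigr do rewrite addr0 subr0.
by rewrite ltr_norml => /andP[]; lra.
Qed.

(** Outer regularity: the sets of a nearly optimal cover are replaced by open boxes of slightly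
    larger volume. *)
Lemma outer_open (A : set E) (e : R) : 0 < e -> (out A < +oo)%E ->
  exists U, [/\ open U, A `<=` U & (out U <= out A + e%:E)%E].
Proof.
move=> e0 Afin; have e2 : 0 < e / 2 by rewrite divr_gt0.
have fA : mu_ext (@box_volume R d) A \is a fin_num.
  by rewrite ge0_fin_numE//; exact: lebesgue_outer_ge0.
have [F AF SF] := mu_ext_adherent e2 fA.
(* Half of e was spent on the cover; the other half is distributed over the boxes as a geometric
   series. *)
have /choice[W HW] : forall k, exists W, [/\ open W, F k `<=` W &
    (out W <= box_volume (F k) + (e / 2 / (2 ^ k.+1)%:R)%:E)%E].
  move=> k; have ek : 0 < e / 2 / (2 ^ k.+1)%:R by rewrite divr_gt0// ltr0n expn_gt0.
  have [->|/set0P F0] := eqVneq (F k) set0.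
    exists set0; split; [exact: open0|by []|].
    by rewrite lebesgue_outer0 bv0 add0e lee_fin ltW.
  have bfin : box_volume (F k) \is a fin_num.
    rewrite ge0_fin_numE//; apply: le_lt_trans (_ : _ <= mu_ext (@box_volume R d) A + (e / 2)%:E)%E _.
      apply: le_trans SF; apply: (@le_trans _ _ (\sum_(k <= i < k.+1) box_volume (F i))%E).
        by rewrite big_nat1.
      apply: (@le_trans _ _ (\sum_(0 <= i < k.+1) box_volume (F i))%E); last exact: nneseries_lim_ge.
      by rewrite [leRHS](big_cat_nat _ (n := k))//= leeDr// sume_ge0.
    by rewrite lte_add_pinfty// ?ltry.
  move: ek; set ek := e / 2 / _ => ek0.
  have ek2 : 0 < ek / 2 by rewrite divr_gt0.
  have := bfin; rewrite (box_volume_nonempty F0) => bf.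
  have [_ [[p q] /= [pq Fpq] <-] hv] := lb_ereal_inf_adherent ek2 bf.
  have [del del0 hd] := prod_enlarge pq ek2.
  pose p' : E := \row_i (p 0 i - del); pose q' : E := \row_i (q 0 i + del).
  exists [set x : E | forall i, p' 0 i < x 0 i < q' 0 i].
  have cc i : continuous (fun x : E => x 0 i) by exact: coord_continuous.
  split.
  - rewrite openE => x hx.
    change (\forall y \near x, forall i, p' 0 i < (y : E) 0 i < q' 0 i).
    apply: (@filter_forall E _ (fun i => [set y : E | p' 0 i < y 0 i < q' 0 i]) (nbhs x)) => i.
    apply: (@open_nbhs_nbhs _ x [set x : E | p' 0 i < x 0 i < q' 0 i]); split; last exact: hx.
    rewrite (_ : [set _ | _] = (fun x : E => x 0 i) @^-1` `]p' 0 i, q' 0 i[%classic).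
      by apply: open_comp => //.
    by apply/seteqP; split => y /=; rewrite in_itv.
  - by move=> x /Fpq h i; have /andP[? ?] := h i; rewrite /= !mxE; apply/andP; split; lra.
  - apply: le_trans (le_mu_ext_weight bv0 bv_ge0 _) _.
    apply: le_trans (box_volume_le (p := p') (q := q') _ _) _.
    + by move=> i; rewrite !mxE; have := pq i; lra.
    + by move=> x h i; have /andP[h1 h2] := h i; rewrite !ltW.
    + rewrite -(fineK bf) -EFinD lee_fin.
      move: hv; rewrite -[X in (_ < X + _)%E](fineK bf) -EFinD lte_fin => hv.
      under eq_bigr do rewrite !mxE; move: hd hv.
      set x1 := \prod_i _; set x2 := \prod_i _; lra.
exists (\bigcup_k W k); split.
- by apply: bigcup_open => k _; case: (HW k).
- by move=> x /AF[k _ Fx]; exists k => //; case: (HW k) => _ + _; apply.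
- apply: le_trans (lebesgue_outer_sigma_subadditive W) _.
  apply: le_trans (_ : _ <= \sum_(k <oo) (box_volume (F k) + (e / 2 / (2 ^ k.+1)%:R)%:E))%E _.
    by apply: lee_nneseries => [k _ _|k _]; [exact: lebesgue_outer_ge0|case: (HW k)].
  apply: le_trans (epsilon_trick _ _ (ltW e2)) _; first by move=> k.
  apply: le_trans (leeD2r _ SF) _.
  by rewrite -addeA -EFinD -splitr.
Qed.

End lebesgue_rV.

#[global] Instance lebesgue_rV_ae_filter (R : realType) (d : nat) :
  Filter (nbhs (almost_everywhere (@lebesgue_rV R d))).
Proof. exact: (ae_filter_ringOfSetsType (@lebesgue_rV R d)). Qed.

#[global] Instance surface_ae_filter (R : realType) (d : nat) :
  Filter (nbhs (almost_everywhere (@surface_measure R d))).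
Proof. exact: (ae_filter_ringOfSetsType (@surface_measure R d)). Qed.

(** * The fundamental lemma of the calculus of variations *)

Section fundamental.
Context (R : realType) (d : nat) (Om : set 'rV[R]_d).
Hypotheses (oOm : open Om) (bOm : bounded_set Om).
Local Notation E := 'rV[R]_d.
Local Notation mu := (@lebesgue_rV R d).
Local Notation X := (caratheodory_type (@lebesgue_outer_measure R d)).
Local Notation meas := (@measurable _ X).

Lemma Om_meas : meas Om. Proof. exact: open_rV_measurable. Qed.

Lemma Om_finite : (mu Om < +oo)%E. Proof. exact: bounded_finite. Qed.

Lemma continuous_rV_measurable (f : E -> R) (D : set E) : continuous f ->
  measurable_fun (D : set X) f.
Proof.
move=> cf mD; apply: (measurability _ (RGenInftyO.measurableE R)) => // _ [_ [a ->] <-].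
apply: measurableI => //; apply: open_rV_measurable.
by apply: open_comp => [x _|]; [exact: cf|exact: interval_open].
Qed.

Lemma continuous_bounded_Om (f : E -> R) : continuous f ->
  exists2 M, 0 <= M & forall x, Om x -> `|f x| <= M.
Proof.
move=> cf; have [r r0 Omr] := bounded_in_ccube bOm.
have [M [Mr HM]] : bounded_set (f @` ccube 0 r).
  by apply: compact_bounded; apply: continuous_compact;
    [exact: continuous_subspaceT|exact: ccube_compact].
exists (`|M| + 1) => [|x Omx]; first by have := normr_ge0 M; lra.
by apply: HM; [have := ler_norm M; lra|exists x => //; exact: Omr].
Qed.

Lemma continuous_L2 (f : E -> R) : continuous f -> L2 mu Om f.
Proof.
move=> cf; have mf := continuous_rV_measurable (D := Om) cf.
apply: (aeint_sq_L2 Om_meas mf).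
have [M M0 HM] := continuous_bounded_Om cf.
have ic := @aeint_cst _ _ _ mu Om Om_meas (M ^+ 2) Om_finite.
apply: (aeint_dom Om_meas _ ic).
  by apply: meas_aemeas; exact: measurable_funX.
apply: aeW => x Omx; rewrite ger0_norm ?sqr_ge0// -[f x ^+ 2]real_normK ?num_real//.
by rewrite /cst lerXn2r// ?nnegrE//; exact: HM.
Qed.

Lemma smooth_continuous (f : E -> R) v : smooth f -> continuous f /\ continuous ('D_v f).
Proof.
move=> sm; split => x; apply: differentiable_continuous.
- exact: (sm [::] x).
- exact: (sm [:: v] x).
Qed.

Definition cube_bump (c : option (E * R)) (n : nat) (x : E) : R :=
  if c is Some (q, r) then
    \prod_i (psi 0 (n.+1%:R * (x 0 i - (q 0 i - r))) * psi 0 (n.+1%:R * ((q 0 i + r) - x 0 i)))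
  else 0.

Lemma cube_bump_elementary c n : elementary (cube_bump c n).
Proof.
case: c => [[q r]|]; last exact: elementary_cst.
apply: elementary_prod => i.
have dc (x : E) : differentiable (fun y : E => y 0 i) x by exact: differentiable_coord.
have ih (x v : E) : is_derive x v (fun y : E => y 0 i) (v 0 i).
  have [dd h] : derivable (fun y : E => y 0 i) x v /\ 'D_v (fun y : E => y 0 i) x = v 0 i.
    have dv : derivable (fun y : E => y 0 i) x v by exact: diff_derivable.
    split => //; apply: cvg_lim => //.
    apply: (@cvg_trans _ ((fun=> v 0 i) @ (0:R)^')); last exact: cvg_cst.
    apply: near_eq_cvg; near=> t.
    rewrite /= !mxE addrK /GRing.scale/= mulrA mulVf ?mul1r//.
    by near: t; exact: nbhs_dnbhs_neq.
  exact: DeriveDef.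
apply: elementary_mul.
- apply: (@elementary_psi _ _ 0 (fun x : E => n.+1%:R * (x 0 i - (q 0 i - r))) (fun v : E => n.+1%:R * v 0 i)).
    by move=> x; apply: differentiableM => //; apply: differentiableB.
  move=> x v; have h := is_deriveB (ih x v) (is_derive_cst (q 0 i - r) x v).
  have h2 := is_deriveZ n.+1%:R h.
  by rewrite -[RHS]/(n.+1%:R *: v 0 i) -[v 0 i]subr0; exact: (@derive_val _ _ _ _ _ _ _ h2).
- apply: (@elementary_psi _ _ 0 (fun x : E => n.+1%:R * (q 0 i + r - x 0 i)) (fun v : E => n.+1%:R * (- v 0 i))).
    by move=> x; apply: differentiableM => //; apply: differentiableB.
  move=> x v; have h := is_deriveB (is_derive_cst (q 0 i + r) x v) (ih x v).
  have h2 := is_deriveZ n.+1%:R h.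
  by rewrite -[RHS]/(n.+1%:R *: - v 0 i) -[- v 0 i]sub0r; exact: (@derive_val _ _ _ _ _ _ _ h2).
Unshelve. all: by end_near. Qed.

Lemma cube_bump01 c n x : 0 <= cube_bump c n x <= 1.
Proof.
case: c => [[q r]|] /=; last by rewrite lexx ler01.
apply/andP; split.
  by apply: prodr_ge0 => i _; rewrite mulr_ge0 ?psi_ge0.
apply: prodr_ile1 => i _; apply/andP; split; first by rewrite mulr_ge0 ?psi_ge0.
by apply: mulr_ile1; rewrite ?psi_ge0 ?psi0_le1.
Qed.

Lemma cube_bump_out q r n x : ~ cube q r x -> cube_bump (Some (q, r)) n x = 0.
Proof.
move=> /existsNP[i /negP]; rewrite -leNgt => h.
rewrite /= (bigD1 i)//=.
have [h1|h1] := leP (x 0 i) (q 0 i).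
  rewrite {1}/psi ifF ?mul0r//; apply/negbTE; rewrite -leNgt pmulr_rle0//.
  by move: h; rewrite ler0_norm; lra.
rewrite [psi 0 (_ * (_ + _ - _))]/psi ifF ?mulr0 ?mul0r//; apply/negbTE.
rewrite -leNgt pmulr_rle0//.
by move: h; rewrite gtr0_norm; lra.
Qed.

Lemma cube_bump_cvg q r x : cube q r x ->
  (fun n => cube_bump (Some (q, r)) n x) @ \oo --> (1 : R).
Proof.
move=> h; pose F i n := psi 0 (n.+1%:R * (x 0 i - (q 0 i - r))) * psi 0 (n.+1%:R * ((q 0 i + r) - x 0 i)).
have cF i : (fun n => F i n) @ \oo --> (1 : R).
  rewrite -[X in _ --> X](mulr1 1); have := h i; rewrite ltr_distl => /andP[h1 h2].
  by apply: cvgM; apply: psi_scale_cvg; lra.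
suff H (s : seq 'I_d) : (fun n => \prod_(i <- s) F i n) @ \oo --> (1 : R) by exact: H.
elim: s => [|i s IH].
  rewrite (_ : (fun n => _) = fun=> 1); first exact: cvg_cst.
  by apply/funext => n; rewrite big_nil.
rewrite (_ : (fun n => _) = fun n => F i n * \prod_(j <- s) F j n).
  by rewrite -[X in _ --> X](mulr1 1); apply: cvgM => //; exact: cF.
by apply/funext => n; rewrite big_cons.
Qed.

(** A smooth union of the bumps on the first n cubes of the enumeration: values in [0, 1], support
    in finitely many closed cubes inside U, limit the indicator of U. *)
Definition open_bump (U : set E) (n : nat) (x : E) : R :=
  1 - \prod_(k < n) (1 - cube_bump (rat_cube U k) n x).

Lemma open_bump01 U n x : 0 <= open_bump U n x <= 1.
Proof.
have f01 k : 0 <= 1 - cube_bump (rat_cube U k) n x <= 1.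
  by have /andP[? ?] := cube_bump01 (rat_cube U k) n x; apply/andP; split; lra.
have : \prod_(k < n) (1 - cube_bump (rat_cube U k) n x) <= 1.
  by apply: prodr_ile1 => k _; exact: f01.
have : 0 <= \prod_(k < n) (1 - cube_bump (rat_cube U k) n x).
  by apply: prodr_ge0 => k _; case/andP: (f01 k).
by rewrite /open_bump => ? ?; apply/andP; split; lra.
Qed.

Lemma open_bump_cvg U x : open U ->
  (fun n => open_bump U n x) @ \oo --> (\1_U x : R).
Proof.
move=> oU; have [Ux|Ux] := pselect (U x); last first.
  rewrite indicE memNset// (_ : (fun n => _) = fun=> 0); first exact: cvg_cst.
  apply/funext => n; rewrite /open_bump big1 ?subrr// => k _.
  case h : rat_cube => [[q r]|]; last by rewrite subr0.
  rewrite cube_bump_out ?subr0// => hx; apply: Ux.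
  by have [_ sub] := rat_cube_sub h; apply: sub => i; exact/ltW/hx.
rewrite indicE mem_set//.
have [k [q [r [h hx]]]] := rat_cube_cover oU Ux.
apply: (@squeeze_cvgr _ _ _ _ (fun n => cube_bump (rat_cube U k) n x) (cst 1)).
- exists k.+1 => // n /= kn; apply/andP; split; last by case/andP: (open_bump01 U n x).
  rewrite /open_bump (bigD1 (Ordinal kn))//=.
  set c := cube_bump _ _ _; set P := \prod_(i < n | _) _.
  have /andP[c0 c1] : 0 <= c <= 1 by exact: cube_bump01.
  have P1 : P <= 1.
    apply: prodr_ile1 => j _.
    by have /andP[? ?] := cube_bump01 (rat_cube U j) n x; apply/andP; split; lra.
  have : (1 - c) * P <= (1 - c) * 1 by apply: ler_wpM2l => //; lra.
  lra.
- by rewrite h; exact: cube_bump_cvg.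
- exact: cvg_cst.
Qed.

Lemma open_bump_test U n : open U -> U `<=` Om -> test_function Om (open_bump U n).
Proof.
move=> oU UOm; split.
  apply: elementary_smooth; apply: (elementary_add (f := fun=> 1)); first exact: elementary_cst.
  rewrite (_ : (fun x => _) = fun x => -1 * \prod_(k < n) (1 + -1 * cube_bump (rat_cube U k) n x)).
    apply: elementary_mul; first exact: elementary_cst.
    apply: elementary_prod => k; apply: elementary_add; first exact: elementary_cst.
    by apply: elementary_mul; [exact: elementary_cst|exact: cube_bump_elementary].
  apply/funext => x; rewrite mulN1r; congr (- _); apply: eq_bigr => k _.
  by rewrite mulN1r.
pose C k := if rat_cube U k is Some (q, r) then ccube q r else set0.
exists (\big[setU/set0]_(k < n) C k); split.
- apply: bigsetU_compact => k _; rewrite /C; case: rat_cube => [[q r]|]; first exact: ccube_compact.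
  exact: compact0.
- move=> x; rewrite -bigcup_mkord => -[k _]; rewrite /C.
  case h : rat_cube => [[q r]|//] hx; apply: UOm.
  by have [_ sub] := rat_cube_sub h; exact: sub.
- move=> x Kx; rewrite /open_bump big1 ?subrr// => k _.
  case h : rat_cube => [[q r]|]; last by rewrite subr0.
  rewrite cube_bump_out ?subr0// => hx; apply: Kx.
  rewrite -bigcup_mkord; exists k => //=; rewrite /C h => i; exact/ltW/hx.
Qed.

(** Orthogonality passes from cut-off functions to indicators of open sets by dominated convergence,
    then to measurable sets by outer regularity, and finally to the sets where g is positive or
    negative. *)
Lemma test_orthogonal_ae0 (g : E -> R) : L2 mu Om g ->
  (forall eta, test_function Om eta -> \int[mu]_(x in Om) (g x * eta x) = 0) ->
  {ae mu, forall x, Om x -> g x = 0}.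
Proof.
move=> Lg H.
have mOm := Om_meas; have finOm := Om_finite.
have ig := L2_aeint mOm finOm Lg.
have H1 U : open U -> U `<=` Om -> \int[mu]_(x in Om) (g x * \1_U x) = 0.
  move=> oU UOm.
  have [||||_ L] := @ae_dominated_convergence _ _ _ mu Om mOm
    (fun n x => g x * open_bump U n x) (fun x => g x * \1_U x) (fun x => `|g x|).
  - move=> n; apply: aemeasM; first exact: aeint_meas.
    apply: meas_aemeas; apply: continuous_rV_measurable.
    have [sm _] := open_bump_test n oU UOm.
    by have [c _] := smooth_continuous 0 sm.
  - exact: aeint_norm.
  - by apply: aeW => x _; apply: cvgM; [exact: cvg_cst|exact: open_bump_cvg].
  - move=> n; apply: aeW => x _; rewrite normrM ler_piMr//.
    by have /andP[? ?] := open_bump01 U n x; rewrite ger0_norm.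
  apply: (cvg_unique (@Rhausdorff R) L).
  rewrite (_ : (fun n => _) = cst 0); first exact: cvg_cst.
  by apply/funext => n; apply: H; exact: open_bump_test.
have mg : measurable_fun (Om : set X) g by case: Lg.
have Lind (A : set E) : meas A -> L2 mu Om (\1_A : E -> R).
  move=> mA; apply: (aeint_sq_L2 mOm); first exact: measurable_indic.
  apply: (aeint_dom mOm _ (@aeint_cst _ _ _ mu Om mOm 1 finOm)).
    by apply: meas_aemeas; apply: measurable_funX; exact: measurable_indic.
  apply: aeW => x _; rewrite indicE.
  by case: (_ \in _); rewrite ?expr1n ?normr1// expr0n normr0.
have H2 (A : set E) : meas A -> A `<=` Om -> \int[mu]_(x in Om) (g x * \1_A x) = 0.
  move=> mA AOm; apply/eqP; rewrite -normr_eq0 eq_le normr_ge0 andbT.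
  apply/ler_addgt0Pl => e e0; rewrite addr0.
  pose G := L2norm mu Om g; have G0 : 0 <= G := sqrtr_ge0 _.
  (* The square is there because the L2 norm of an indicator is the root of the measure; G + 1
     avoids a division by 0. *)
  have e1 : 0 < (e / (G + 1)) ^+ 2 by rewrite exprn_gt0// divr_gt0//; lra.
  have finA : (mu A < +oo)%E by apply: le_lt_trans finOm; exact: le_lebesgue_outer.
  have [W [oW AW muW]] := outer_open e1 finA.
  pose U := W `&` Om.
  have oU : open U by exact: openI.
  have UOm : U `<=` Om by move=> x [].
  have AU : A `<=` U by move=> x Ax; split; [exact: AW|exact: AOm].
  have mU := open_rV_measurable oU.
  have mUA : meas (U `\` A) by exact: measurableD.
  have -> : \int[mu]_(x in Om) (g x * \1_A x) = - \int[mu]_(x in Om) (g x * \1_(U `\` A) x).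
    have := H1 U oU UOm.
    have -> : \int[mu]_(x in Om) (g x * \1_U x) =
        \int[mu]_(x in Om) (g x * \1_A x) + \int[mu]_(x in Om) (g x * \1_(U `\` A) x).
      have [_ <-] := aeintD mOm (L2_mul_aeint mOm Lg (Lind A mA)) (L2_mul_aeint mOm Lg (Lind _ mUA)).
      apply: eq_Rintegral => x _; rewrite -mulrDr; congr (_ * _); rewrite !indicE.
      have [Ax|Ax] := pselect (A x).
        rewrite (mem_set (AU x Ax)) (mem_set Ax) (memNset (A := U `\` A)) ?addr0//.
        by move=> [_]; exact.
      rewrite (memNset Ax) add0r; congr (_%:R); congr nat_of_bool.
      by apply/idP/idP => /set_mem; [move=> Ux|case=> Ux _]; apply: mem_set.
    lra.
  rewrite normrN -[X in `|X|]/(L2ip mu Om g (\1_(U `\` A))); have L1 := Lind _ mUA.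
  apply: le_trans (ip_CSn (L2_semi_inner mu mOm) Lg L1) _.
  have N2 : ipnorm (L2ip mu Om) (\1_(U `\` A) : E -> R) <= e / (G + 1).
    have q0 : 0 <= e / (G + 1) by rewrite divr_ge0//; lra.
    rewrite -ler_sqr ?nnegrE ?sqrtr_ge0// (ipnorm_sq (L2_semi_inner mu mOm) L1).
    rewrite /L2ip (_ : \int[mu]_(x in Om) _ = fine (mu (U `\` A))); last first.
      rewrite /Rintegral (eq_integral (fun x : X => (\1_(U `\` A) (x : E))%:E)); last first.
        by move=> x _; rewrite indicE; case: (_ \in _); rewrite ?mulr1 ?mulr0.
      by rewrite integral_indic// setIidl// => x [/UOm].
    have finU : (mu U < +oo)%E by apply: le_lt_trans finOm; exact: le_lebesgue_outer.
    have fA : mu A \is a fin_num by rewrite ge0_fin_numE.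
    have fUA : mu (U `\` A) \is a fin_num.
      rewrite ge0_fin_numE//; apply: le_lt_trans finU; exact: le_lebesgue_outer.
    rewrite -lee_fin (fineK fUA).
    have -> : mu (U `\` A) = (mu U - mu A)%E by rewrite measureD// setIidr.
    rewrite leeBlDl//.
    by apply: le_trans muW; apply: le_lebesgue_outer => x [].
  apply: (@le_trans _ _ (G * (e / (G + 1)))); first exact: ler_wpM2l.
  rewrite mulrCA ler_piMr ?(ltW e0)// ler_pdivrMr; lra.
(* Used with s = 1 and s = -1: the integral of s g over the set where it is positive is 0, so that
   set is null. *)
have split_sign (s : R) : {ae mu, forall x, Om x -> s * g x <= 0}.
  pose A := Om `&` [set x : E | 0 < s * g x].
  have msg : measurable_fun (Om : set X) (fun x => s * g x).
    by apply: measurable_funM => //; exact: measurable_cst.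
  have mA : meas A.
    rewrite (_ : A = Om `&` (fun x => s * g x) @^-1` `]0, +oo[%classic).
      by apply: msg => //; exact: measurable_itv.
    by rewrite /A; congr (_ `&` _); apply/seteqP; split => x /=; rewrite in_itv/= andbT.
  have iA := L2_mul_aeint mOm Lg (Lind A mA).
  have [isA EsA] := aeintZ mOm s iA.
  have := ae_Rintegral_eq0 mOm isA.
  have pos : {ae mu, forall x, Om x -> 0 <= s * (g x * \1_A x)}.
    apply: aeW => x _; rewrite indicE; case: (boolP (x \in A)) => [/set_mem[_ h]|_].
      by rewrite mulr1 ltW.
    by rewrite !mulr0.
  have A0 : A `<=` Om by move=> x [].
  move=> /(_ pos); rewrite EsA H2// mulr0 => /(_ erefl).
  apply: filterS => x h Omx; rewrite leNgt; apply/negP => sg.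
  have := h Omx; rewrite indicE mem_set; last by split.
  by rewrite mulr1 => e0; rewrite e0 ltxx in sg.
apply: filterS2 (split_sign 1) (split_sign (-1)) => x h1 h2 Omx.
by apply/eqP; rewrite eq_le -{1}[g x]mul1r h1//= -oppr_le0 -mulN1r h2.
Qed.

End fundamental.

(** * Translation invariance *)

Section translation.
Context (R : realType) (d : nat).
Local Notation E := 'rV[R]_d.
Local Notation mu := (@lebesgue_rV R d).
Local Notation out := (@lebesgue_outer R d).
Local Notation X := (caratheodory_type (@lebesgue_outer_measure R d)).
Local Notation meas := (@measurable _ X).

Definition translate (a x : E) : E := x + a.

Let box_volume_translate_le a (A : set E) :
  (box_volume (translate a @^-1` A) <= box_volume A)%E.
Proof.
have [->|/set0P A0] := eqVneq A set0; first by rewrite preimage_set0 box_volume0.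
rewrite (box_volume_nonempty A0); apply: le_ereal_inf_tmp => _ [[p q] /= [pq Apq] <-].
apply: le_trans (box_volume_le (p := p - a) (q := q - a) _ _) _.
- by move=> i; rewrite !mxE lerD2r.
- move=> x /Apq h i; have := h i; rewrite /translate !mxE => /andP[h1 h2].
  by apply/andP; split; rewrite ?lerBlDr ?lerBrDr.
rewrite lee_fin; under eq_bigr do rewrite !mxE opprB addrA subrK.
exact: lexx.
Qed.

Let outer_translate_le a (A : set E) : (out (translate a @^-1` A) <= out A)%E.
Proof.
apply: le_ereal_inf_tmp => _ [F [_ AF] <-].
apply: le_trans (@mu_ext_cover R E (@box_volume R d) _ (fun k => translate a @^-1` F k) _) _.
  by move=> x /AF[k _ Fx]; exists k.
by apply: lee_nneseries => [k _ _|k _]; [exact: box_volume_ge0|exact: box_volume_translate_le].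
Qed.

Let translateK a (A : set E) : translate (- a) @^-1` (translate a @^-1` A) = A.
Proof. by apply/seteqP; split => x /=; rewrite /translate subrK. Qed.

Lemma outer_translate a (A : set E) : out (translate a @^-1` A) = out A.
Proof.
apply/eqP; rewrite eq_le outer_translate_le/=.
by rewrite -[leLHS](congr1 out (translateK a A)); exact: outer_translate_le.
Qed.

(** Testing the preimage of A on Y in Caratheodory's condition is the same as testing A on the
    translate of Y, as the outer measure is invariant. *)
Lemma translate_measurable a : measurable_fun setT (translate a : X -> X).
Proof.
move=> _ A mA; rewrite setTI; apply: le_caratheodory_measurable => Y.
pose Z := translate (- a) @^-1` Y.
have YZ : Y = translate a @^-1` Z by have := translateK (- a) Y; rewrite opprK => <-.
have hZ : out Z = (out (Z `&` A) + out (Z `&` ~` A))%E := mA Z.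
rewrite YZ preimage_setC -!preimage_setI.
change (out (translate a @^-1` (Z `&` A)) + out (translate a @^-1` (Z `&` ~` A)) <=
  out (translate a @^-1` Z))%E.
by rewrite (outer_translate a (Z `&` A)) (outer_translate a (Z `&` ~` A)) (outer_translate a Z) hZ.
Qed.

Lemma indic_integrable (C : set E) : meas C -> (mu C < +oo)%E ->
  mu.-integrable (setT : set X) (EFin \o (\1_C : X -> R)).
Proof.
move=> mC fC; apply/integrableP; split; first exact/measurable_EFinP/measurable_indic.
rewrite (eq_integral (fun x : X => (\1_C x)%:E)); last by move=> t _; rewrite /= ger0_norm // indicE ler0n.
by rewrite integral_indic// setIT.
Qed.

Definition bounded_support (f : E -> R) : Prop :=
  exists2 r, 0 <= r & forall x, f x != 0 -> cube 0 r x.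

Lemma bounded_support_aeint f M : measurable_fun (setT : set X) f -> bounded_support f ->
  (forall x, `|f x| <= M) -> mu.-integrable setT (EFin \o f).
Proof.
move=> mf [r r0 Hr] HM.
have mC : meas (cube 0 r) by exact: cube_measurable.
have fC : (mu (cube 0 r) < +oo)%E.
  apply: le_lt_trans (ccube_finite 0 r0); apply: le_lebesgue_outer => x h i; exact/ltW/h.
apply: (@le_integrable _ _ _ mu setT measurableT (EFin \o f) (EFin \o (fun x => M * \1_(cube 0 r) x))).
- exact/measurable_EFinP.
- move=> x _ /=; rewrite lee_fin.
  have M0 : 0 <= M by apply: le_trans (HM x).
  have [fx|fx] := eqVneq (f x) 0; first by rewrite fx normr0.
  rewrite indicE mem_set; last exact: Hr.
  by rewrite mulr1 (le_trans (HM x))// ler_norm.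
- rewrite (_ : _ \o _ = (fun x => M%:E * (\1_(cube 0 r) x)%:E)%E); last by apply/funext => x /=; rewrite EFinM.
  by apply: integrableZl => //; exact: indic_integrable.
Qed.

Lemma coord_le_sum (a : E) i : `|a 0 i| <= \sum_j `|a 0 j|.
Proof. by rewrite (bigD1 i)//= lerDl sumr_ge0. Qed.

Lemma Rintegral_translate (f : E -> R) M a : continuous f -> bounded_support f ->
  (forall x, `|f x| <= M) -> \int[mu]_x f (x + a) = \int[mu]_x f x.
Proof.
move=> cf [r r0 Hr] HM.
have mf : measurable_fun (setT : set X) f by exact: continuous_rV_measurable.
have mt := translate_measurable a.
have int : mu.-integrable setT ((EFin \o f) \o translate a).
  apply: (@bounded_support_aeint (f \o translate a) M) => [||x]; last exact: HM.
    exact: (measurableT_comp mf mt).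
  have [s s0 Hs] : exists2 s, 0 <= s & forall i, `|a 0 i| <= s.
    by exists (\sum_i `|a 0 i|); [exact: sumr_ge0|exact: coord_le_sum].
  exists (r + s) => [|x fx i]; first exact: addr_ge0.
  rewrite !mxE subr0; have := Hr _ fx i; have := Hs i; rewrite /translate !mxE subr0 => h1 h2.
  rewrite -(addrK (a 0 i) (x 0 i)); apply: le_lt_trans (ler_normB _ _) _.
  by apply: ltr_leD.
rewrite /Rintegral; congr fine.
have -> : (\int[mu]_x (f x)%:E = \int[pushforward mu (translate a : X -> X)]_x (f x)%:E)%E.
  apply: eq_measure_integral => A mA _; exact/esym/outer_translate.
have mE : measurable_fun (setT : set X) (EFin \o f) by exact/measurable_EFinP.
by rewrite (@integral_pushforward _ _ _ _ _ _ mt mu setT _ mE int measurableT).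
Qed.

End translation.

(** * Derivatives of test functions have integral 0 *)

Section integral_derivative.
Context (R : realType) (d : nat) (Om : set 'rV[R]_d).
Hypotheses (oOm : open Om) (bOm : bounded_set Om).
Local Notation E := 'rV[R]_d.
Local Notation mu := (@lebesgue_rV R d).
Local Notation X := (caratheodory_type (@lebesgue_outer_measure R d)).
Variables (eta : E -> R) (e : E).
Hypothesis te : test_function Om eta.

Let h n : R := n.+1%:R^-1.
Let q n x : R := (h n)^-1 * (eta (x + h n *: e) - eta x).

Let line_derive (x : E) (s : R) :
  is_derive s 1 (fun s : R => eta (x + s *: e)) ('D_e eta (x + s *: e)).
Proof.
have [sm _] := te; have de := diff_derivable (v := e) (sm [::] (x + s *: e)).
have fe : (fun k : R => k^-1 *: (((fun s : R => eta (x + s *: e)) \o shift s) (k *: 1) - eta (x + s *: e))) =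
    (fun k : R => k^-1 *: ((eta \o shift (x + s *: e)) (k *: e) - eta (x + s *: e))).
  apply/funext => k /=; congr (_ *: (eta _ - _)).
  by rewrite [k *: 1]mulr1 scalerDl addrCA.
split; first by rewrite /derivable fe.
by rewrite /derive fe.
Qed.

Let h0 n : 0 < h n. Proof. by rewrite invr_gt0. Qed.

(** By the mean value theorem the difference quotients inherit the bound of the derivative, as
    dominated convergence requires. *)
Let q_mean n x : exists c : R, q n x = 'D_e eta (x + c *: e).
Proof.
have [sm _] := te.
have cont : continuous (fun s : R => eta (x + s *: e)).
  move=> s; apply: differentiable_continuous; apply/derivable1_diffP.
  exact: (@ex_derive _ _ _ _ _ _ _ (line_derive x s)).
have [c _] := @MVT R (fun s => eta (x + s *: e)) (fun s => 'D_e eta (x + s *: e)) 0 (h n) (h0 n)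
  (fun s _ => line_derive x s) (continuous_subspaceT cont).
rewrite scale0r addr0 subr0 => H; exists c.
by rewrite /q H mulrC mulfK// gt_eqF.
Qed.

Let q_cvg x : (fun n => q n x) @ \oo --> 'D_e eta x.
Proof.
have [sm _] := te; have de := diff_derivable (v := e) (sm [::] x).
have hc : h @ \oo --> (0 : R)^'.
  move=> A /= [r r0 Hr]; have := @cvg_harmonic R.
  move=> /cvgrPdist_lt/(_ r r0); apply: filterS => n hn.
  by apply: Hr; [rewrite /ball_/= sub0r normrN; move: hn; rewrite sub0r normrN|rewrite gt_eqF].
have de' : (fun k : R => k^-1 *: ((eta \o shift x) (k *: e) - eta x)) @ 0^' --> 'D_e eta x := de.
have := cvg_comp _ _ hc de'.
rewrite (_ : _ \o _ = fun n => q n x) //.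
by apply/funext => n /=; rewrite /q [h n *: e + x]addrC.
Qed.

(* By translation invariance the difference quotients have integral 0. *)
Lemma test_integral_derivative : \int[mu]_(x in Om) 'D_e eta x = 0.
Proof.
have [sm [K [cK KO eK]]] := te.
have [ce cde] := smooth_continuous e sm.
have clK : closed K by apply: compact_closed => //; exact: norm_hausdorff.
(* K is closed, so eta vanishes near x and the quotients at x are eventually 0. *)
have dK x : ~ K x -> 'D_e eta x = 0.
  move=> nKx; apply: (cvg_unique (@Rhausdorff R) (@q_cvg x)).
  have nb : \forall y \near x, ~ K y by apply: open_nbhs_nbhs; split => //; exact: closed_openC.
  have hc : (fun n => x + h n *: e) @ \oo --> x.
    rewrite -[X in _ --> X](addr0 x) -(scale0r e).
    by apply: cvgD; [exact: cvg_cst|apply: cvgZr_tmp; exact: cvg_harmonic].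
  have [n0 _ Hn0] : \forall n \near \oo, ~ K (x + h n *: e) := hc _ nb.
  apply: cvg_near_cst; exists n0 => // n /= n0n; have nK := Hn0 n n0n.
  by rewrite /q !eK// subrr mulr0.
have [M M0 HM] := continuous_bounded_Om bOm cde.
have HM' x : `|'D_e eta x| <= M.
  by have [/KO/HM//|/dK ->] := pselect (K x); rewrite normr0.
have [M1 M10 HM1] := continuous_bounded_Om bOm ce.
have HM1' x : `|eta x| <= M1.
  by have [/KO/HM1//|/eK ->] := pselect (K x); rewrite normr0.
have [r r0 Omr] := bounded_in_ccube bOm.
have sK x : K x -> cube 0 (r + 1) x.
  by move=> /KO/Omr hx i; apply: le_lt_trans (hx i) _; rewrite ltrDl.
have r1 : 0 <= r + 1 by exact: addr_ge0.
have seta : bounded_support eta.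
  by exists (r + 1) => // x ex; apply: sK; apply: contrapT => /eK e0; rewrite e0 eqxx in ex.
(* The steps h n are at most 1, so enlarging the cube by s contains the supports of all
   quotients. *)
pose s := \sum_j `|e 0 j|.
have etaK x : eta x != 0 -> K x.
  by move=> ex; apply: contrapT => /eK e0; rewrite e0 eqxx in ex.
have sshift n x : eta (x + h n *: e) != 0 -> cube 0 (r + 1 + s) x.
  move=> /etaK/sK H i; have := H i; rewrite !mxE !subr0 => h1.
  have h2 : `|h n * e 0 i| <= s.
    rewrite normrM gtr0_norm//; apply: le_trans (coord_le_sum e i).
    by rewrite ler_piMl// invf_le1// ler1n.
  rewrite -(addrK (h n * e 0 i) (x 0 i)); apply: le_lt_trans (ler_normB _ _) _.
  exact: ltr_leD.
have sq n x : q n x != 0 -> cube 0 (r + 1 + s) x.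
  move=> qx; have [ex|/etaK/sK H i] := eqVneq (eta x) 0.
    by apply: (sshift n); apply: contra qx => /eqP e0; rewrite /q e0 ex subrr mulr0.
  by apply: lt_le_trans (H i) _; rewrite lerDl sumr_ge0.
have meta : measurable_fun (setT : set X) eta by exact: continuous_rV_measurable.
have ieta : mu.-integrable setT (EFin \o eta) by exact: bounded_support_aeint HM1'.
have mshift n : measurable_fun (setT : set X) (fun x : E => eta (x + h n *: e)).
  exact: (measurableT_comp meta (@translate_measurable R d (h n *: e))).
have mq n : measurable_fun (setT : set X) (q n).
  by apply: measurable_funM; [exact: measurable_cst|apply: measurable_funB].
have s0 : 0 <= s by exact: sumr_ge0.
have C0 : 0 <= r + 1 + s by exact: addr_ge0.
have mC : @measurable _ X (cube 0 (r + 1 + s)) by exact: cube_measurable.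
have fC : (mu (cube 0 (r + 1 + s)) < +oo)%E.
  by apply: le_lt_trans (ccube_finite 0 C0); apply: le_lebesgue_outer => x hx i; exact/ltW/hx.
have q0 n : \int[mu]_x q n x = 0.
  have iq1 := @bounded_support_aeint R d eta M1 meta seta HM1'.
  have iq2 : mu.-integrable setT (EFin \o (fun x : E => eta (x + h n *: e))).
    apply: (@bounded_support_aeint R d _ M1 (mshift n)) => //.
    by exists (r + 1 + s) => [|x /sshift//]; exact: addr_ge0.
  have [i1 e1] := aeintB measurableT (integrable_aeint iq2) (integrable_aeint iq1).
  have [_ e2] := aeintZ measurableT (h n)^-1 i1.
  by rewrite /q e2 e1 (Rintegral_translate (h n *: e) ce seta HM1') subrr mulr0.
have ig : aeint mu setT (fun x => M * \1_(cube 0 (r + 1 + s)) x).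
  by have [] := aeintZ (mu := mu) measurableT M (integrable_aeint (indic_integrable mC fC)).
have [] := @ae_dominated_convergence _ _ _ mu setT measurableT q ('D_e eta) _ _ ig.
- by move=> n; exact: meas_aemeas.
- by apply: aeW => x _; exact: q_cvg.
- move=> n; apply: aeW => x _; have [qx|qx] := eqVneq (q n x) 0.
    by rewrite qx normr0 mulr_ge0.
  rewrite indicE mem_set; last exact: sq qx.
  by have [c ->] := q_mean n x; rewrite mulr1.
move=> _; rewrite (_ : (fun n => _) = cst 0); last by apply/funext => n; exact: q0.
move=> /(cvg_unique (@Rhausdorff R))/(_ (cvg_cst _)) e0.
rewrite Rintegral_mkcond -[RHS]e0; congr (Rintegral _ _ _); apply/funext => x.
rewrite patchE; case: ifPn => // /negP; rewrite inE => nO.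
by rewrite dK// => /KO.
Qed.

End integral_derivative.

(** * Hausdorff measurability of closed sets *)

Section euclidean_norm.
Context (R : realType) (d : nat).
Local Notation E := 'rV[R]_d.

Lemma dot_semi_inner : semi_inner (setT : set E) (@dot R d).
Proof.
split=> //.
- move=> a v w x _ _ _; rewrite /dot mulr_sumr -big_split; apply: eq_bigr => i _.
  by rewrite !mxE /=; ring.
- by move=> v w _ _; apply: eq_bigr => i _; rewrite mulrC.
- by move=> v _; apply: sumr_ge0 => i _; rewrite -expr2 sqr_ge0.
Qed.

Let sE : seminormed (setT : set E) (@enorm R d) := semi_inner_seminormed dot_semi_inner.

Lemma enorm_ge0 (x : E) : 0 <= enorm x. Proof. exact: sqrtr_ge0. Qed.

Lemma enorm_dist (x y z : E) : enorm (x - z) <= enorm (x - y) + enorm (y - z).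
Proof. exact: (sn_dist sE). Qed.

Lemma enorm_sym (x y : E) : enorm (x - y) = enorm (y - x).
Proof. exact: (sn_sym sE). Qed.

Lemma coord_le_enorm (x : E) i : `|x 0 i| <= enorm x.
Proof.
rewrite -ler_sqr ?nnegrE ?enorm_ge0// (ipnorm_sq dot_semi_inner)// real_normK ?num_real//.
rewrite /dot (bigD1 i)//= -expr2 lerDl; apply: sumr_ge0 => j _.
by rewrite -expr2 sqr_ge0.
Qed.

End euclidean_norm.

(** * Caratheodory's criterion for metric outer measures *)

Section hausdorff.
Context (R : realType) (d s : nat).
Local Notation E := 'rV[R]_d.
Local Notation out := (@hausdorff_outer R d s).
Local Notation gauge := (@hausdorff_gauge R d s).
Local Notation ext := (fun delta A => mu_ext (gauge delta) A).

Let g0 := @hausdorff_gauge0 R d s.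
Let g_ge0 := @hausdorff_gauge_ge0 R d s.

Definition separated (A B : set E) : Prop :=
  exists2 r, 0 < r & forall a b, A a -> B b -> r <= enorm (a - b).

Lemma hausdorff_gauge_antitone (del del' : R) A : del <= del' ->
  (gauge del' A <= gauge del A)%E.
Proof.
move=> dd; rewrite /hausdorff_gauge; case: asboolP => // _.
case: (ifPn (_ <= del%:E)%E) => h; last by rewrite leey.
by rewrite ifT// (le_trans h)// lee_fin.
Qed.

Lemma mu_ext_antitone (del del' : R) A : del <= del' ->
  (mu_ext (gauge del') A <= mu_ext (gauge del) A)%E.
Proof.
move=> dd; apply: le_ereal_inf_tmp => _ [F [_ AF] <-].
apply: (le_trans (@mu_ext_cover R E (gauge del') A F AF)).
by apply: lee_nneseries => [k _ _|k _]; [exact: g_ge0|exact: hausdorff_gauge_antitone].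
Qed.

(** A covering set that meets both A and B has diameter at least r > del, hence infinite gauge; the
    others can be assigned to one of the two sets. *)
Lemma mu_ext_separated (A B : set E) r del : 0 < del -> del < r ->
  (forall a b, A a -> B b -> r <= enorm (a - b)) ->
  (mu_ext (gauge del) A + mu_ext (gauge del) B <= mu_ext (gauge del) (A `|` B))%E.
Proof.
move=> del0 delr sep; apply: le_ereal_inf_tmp => _ [F [_ ABF] <-].
pose pick (S : set E) k := if `[< F k `&` S !=set0 >] then F k else set0.
have cov (S : set E) : S `<=` A `|` B -> S `<=` \bigcup_k pick S k.
  move=> SAB x Sx; have [k _ Fx] := ABF x (SAB x Sx); exists k => //.
  by rewrite /pick; case: asboolP => // h; exfalso; apply: h; exists x.
apply: (@le_trans _ _ (\sum_(k <oo) gauge del (pick A k) + \sum_(k <oo) gauge del (pick B k))%E).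
  by apply: leeD; apply: mu_ext_cover; apply: cov => x; [left|right].
rewrite -nneseriesD//; apply: lee_nneseries => [k _ _|k _]; first by rewrite adde_ge0.
rewrite /pick; case: asboolP => hA; case: asboolP => hB; rewrite ?g0 ?adde0 ?add0e//.
case: hA hB => a [Fa Aa] [b [Fb Bb]].
suff -> : gauge del (F k) = +oo%E by rewrite leey.
rewrite /hausdorff_gauge; case: asboolP => [F0|_]; first by rewrite F0 in Fa.
case: ifPn => // h; exfalso; have : (r%:E <= diameter (F k))%E.
  apply: (@le_trans _ _ (enorm (a - b))%:E); first by rewrite lee_fin; exact: sep.
  by apply: ereal_sup_ubound; exists (a, b).
by move=> /le_trans/(_ h); rewrite lee_fin leNgt delr.
Qed.

Lemma hausdorff_ext_le del A : 0 < del -> (mu_ext (gauge del) A <= out A)%E.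
Proof. by move=> d0; apply: ereal_sup_ubound; exists del. Qed.

Lemma hausdorff_separated (A B : set E) : separated A B -> (out A + out B <= out (A `|` B))%E.
Proof.
move=> [r r0 sep].
have [->|fin] := eqVneq (out (A `|` B)) +oo%E; first exact: leey.
have fAB : out (A `|` B) \is a fin_num.
  by rewrite ge0_fin_numE ?hausdorff_outer_ge0// ltey.
(* The scales for A and B vary independently, so that the two suprema can be taken one after the
   other. *)
have key del del' : 0 < del -> 0 < del' ->
    (mu_ext (gauge del) A + mu_ext (gauge del') B <= out (A `|` B))%E.
  move=> d0 d0'; pose m := Num.min (Num.min del del') (r / 2).
  have m0 : 0 < m by rewrite !lt_min d0 d0'/= divr_gt0.
  have m1 : m <= del by rewrite !ge_min lexx.
  have m2 : m <= del' by rewrite !ge_min lexx orbT.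
  have m3 : m <= r / 2 by rewrite !ge_min lexx orbT.
  apply: le_trans (hausdorff_ext_le _ m0).
  apply: le_trans (mu_ext_separated (r := r) m0 _ sep); last by lra.
  by apply: leeD; exact: mu_ext_antitone.
have fA del : 0 < del -> mu_ext (gauge del) A \is a fin_num.
  move=> d0; rewrite fin_numElt; apply/andP; split.
    exact: (lt_le_trans (ltNyr 0) (mu_ext_ge0 (@g_ge0 del) A)).
  have h := le_trans (@hausdorff_ext_le del A d0) (le_hausdorff_outer s (@subsetUl _ A B)).
  by apply: (le_lt_trans h); rewrite ltey.
have fB : out B \is a fin_num.
  rewrite fin_numElt; apply/andP; split.
    exact: (lt_le_trans (ltNyr 0) (hausdorff_outer_ge0 s B)).
  by apply: (le_lt_trans (le_hausdorff_outer s (@subsetUr _ A B))); rewrite ltey.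
rewrite -leeBrDr//; apply: ge_ereal_sup => _ [del /= d0 <-].
rewrite leeBrDr// addeC -leeBrDr//; last exact: fA.
apply: ge_ereal_sup => _ [del' /= d0' <-]; rewrite leeBrDr//; last exact: fA.
by rewrite addeC; exact: key.
Qed.

Section criterion.
Variables (C : set E).
Hypothesis clC : closed C.
Variable X : set E.
Hypothesis finX : (out X < +oo)%E.

(** The points of X at distance at least 1/(n+1) from C; they increase to the part of X outside C,
    and successive differences are the rings. *)
Let A n : set E := [set x | X x /\ forall c, C c -> n.+1%:R^-1 <= enorm (x - c)].
Let ring k : set E := A k.+1 `\` A k.

Let ring_near k x : ring k x -> exists2 c, C c & enorm (x - c) < k.+1%:R^-1.
Proof.
move=> [[Xx _] nA]; apply: contrapT => H; apply: nA; split => // c Cc.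
by rewrite leNgt; apply/negP => h; apply: H; exists c.
Qed.

Let A_mono m n : (m <= n)%N -> A m `<=` A n.
Proof.
move=> mn x [Xx h]; split => // c Cc; apply: le_trans (h c Cc).
by rewrite lef_pV2 ?posrE ?ltr0n// ler_nat ltnS.
Qed.

(** Neighbouring rings may touch; fixing the parity b leaves rings that are separated from each
    other. *)
Let rings b n : set E := \bigcup_(i in `I_n) ring (i.*2 + b).

(* Two rings whose indices differ by at least 2 are separated. *)
Let rings_sum b n : (\sum_(i < n) out (ring (i.*2 + b)) <= out (rings b n))%E.
Proof.
elim: n => [|n IH]; first by rewrite big_ord0 hausdorff_outer_ge0.
rewrite big_ord_recr/=; apply: le_trans (leeD IH (lexx _)) _.
have sub : rings b n `|` ring (n.*2 + b) `<=` rings b n.+1.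
  move=> x [[i /= ni ix]|nx]; last by exists n => /=.
  by exists i => //=; exact: ltnW.
apply: le_trans (le_hausdorff_outer s sub); apply: hausdorff_separated.
case: n {IH sub} => [|n]; first by exists 1 => // a c [].
pose m := (n.*2 + b).+1.
(* Earlier rings lie in A m, at distance at least 1/(m+1) from C, while points of ring m + 1 are
   closer than 1/(m+2) to C. *)
exists (m.+1%:R^-1 - m.+2%:R^-1).
  by rewrite subr_gt0 ltf_pV2 ?posrE ?ltr0n// ltr_nat.
move=> x y [i /= ni [Ax _]] /ring_near[c Cc yc].
have [_ /(_ c Cc) xc] : A m x.
  by apply: A_mono Ax; rewrite /m ltnS leq_add2r leq_double -ltnS.
have yc' : enorm (y - c) < m.+2%:R^-1 by move: yc; rewrite doubleS !addSn.
rewrite lerBlDr; apply: le_trans xc _.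
by apply: le_trans (enorm_dist x y c) _; rewrite lerD2l ltW.
Qed.

Let rings_series b : (\sum_(i <oo) out (ring (i.*2 + b)) <= out X)%E.
Proof.
apply: lime_le; first by apply: is_cvg_nneseries => k _ _; exact: hausdorff_outer_ge0.
apply: nearW => n; rewrite big_mkord; apply: le_trans (rings_sum b n) _.
by apply: (le_hausdorff_outer s) => x [i _ [[]]].
Qed.

Let rings_tail b (e : R) : 0 < e ->
  \forall n \near \oo, (\sum_(n <= i <oo) out (ring (i.*2 + b)) < e%:E)%E.
Proof.
move=> e0; have h := @nneseries_tail_cvg R (fun i => out (ring (i.*2 + b))) xpredT
  (le_lt_trans (rings_series b) finX) (fun k _ => hausdorff_outer_ge0 s _).
have o : nbhs (0 : \bar R)%E [set y : \bar R | (y < e%:E)%E].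
  by apply: open_nbhs_nbhs; split; [exact: open_ereal_lt_ereal|rewrite /= lte_fin].
exact: (h _ o).
Qed.

Let sub_rings n : X `\` C `<=` A n.*2 `|`
  ((\bigcup_(i in [set i | (n <= i)%N]) ring (i.*2 + 0)) `|`
   (\bigcup_(i in [set i | (n <= i)%N]) ring (i.*2 + 1))).
Proof.
move=> x [Xx nCx]; have : nbhs x (~` C) by apply: open_nbhs_nbhs; split => //; exact: closed_openC.
move=> /nbhs_ballP[e /= e0 eC].
have ex : exists k, `[< A k x >].
  exists (Num.trunc e^-1); apply/asboolP; split => // c Cc.
  rewrite leNgt; apply/negP => h; apply: (eC c) => //; rewrite ball_cube// => i.
  apply: le_lt_trans (lt_le_trans h _).
    by rewrite distrC; have := coord_le_enorm (x - c) i; rewrite !mxE.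
  by rewrite -[leRHS]invrK lef_pV2 ?posrE ?invr_gt0// ltW// truncnS_gt.
case: (ex_minnP ex) => k /asboolP Ak kmin.
have [kn|nk] := leqP k n.*2; first by left; exact: A_mono Ak.
right; case: k Ak kmin nk => // k Ak kmin nk.
have kx : ring k x.
  by split => //= /asboolP/kmin; rewrite ltnn.
rewrite -(odd_double_half k) addnC in kx.
have nk2 : (n <= k./2)%N by rewrite -ltnS in nk; rewrite -(doubleK n) half_leq.
by case: (odd k) kx => kx; [right|left]; exists k./2.
Qed.

(** What A (2n) misses of X outside C is covered by the tails of two convergent series of rings, and
    A (2n) itself is separated from C. *)
Lemma hausdorff_closed_split : (out (X `&` C) + out (X `&` ~` C) <= out X)%E.
Proof.
apply/lee_addgt0Pr => e e0; have e2 : 0 < e / 2 by rewrite divr_gt0.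
have [N _ HN] := rings_tail 0 e2; have [N' _ HN'] := rings_tail 1 e2.
pose n := maxn N N'; have t0 := HN n (leq_maxl N N'); have t1 := HN' n (leq_maxr N N').
have tail b : (out (\bigcup_(i in [set i | (n <= i)%N]) ring (i.*2 + b)) <=
    \sum_(n <= i <oo) out (ring (i.*2 + b)))%E.
  pose F i := if (n <= i)%N then ring (i.*2 + b) else set0.
  have sub : \bigcup_(i in [set i | (n <= i)%N]) ring (i.*2 + b) `<=` \bigcup_i F i.
    by move=> x [i /= ni ix]; exists i => //; rewrite /F ni.
  apply: le_trans (le_hausdorff_outer s sub) _.
  apply: le_trans (hausdorff_outer_sigma_subadditive s F) _.
  rewrite [leRHS]eseries_cond [leRHS]eseries_mkcondr.
  rewrite eseries_cond eseries_mkcondr; apply: lee_nneseries => [k _ _|k _].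
    exact: hausdorff_outer_ge0.
  by rewrite /F; case: ifP => // _; rewrite hausdorff_outer0.
have : (out (X `&` ~` C) <= out (A n.*2) + e%:E)%E.
  apply: le_trans (le_hausdorff_outer s (@sub_rings n)) _.
  apply: le_trans (outer_measureU2 (@hausdorff_outer_measure R d s) _ _) _.
  apply: leeD => //; rewrite (splitr e) EFinD.
  apply: le_trans (outer_measureU2 (@hausdorff_outer_measure R d s) _ _) _.
  exact: leeD (le_trans (tail 0%N) (ltW t0)) (le_trans (tail 1%N) (ltW t1)).
move=> h; apply: le_trans (leeD (lexx _) h) _; rewrite addeA leeD2r//.
apply: le_trans (hausdorff_separated _) _.
  exists (n.*2.+1%:R^-1) => [|c x [_ Cc] [_ h1]]; first by rewrite invr_gt0.
  by rewrite enorm_sym; exact: h1.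
by apply: (le_hausdorff_outer s) => x [[]|[]].
Qed.

End criterion.

Lemma closed_hausdorff_measurable (C : set E) : closed C ->
  @measurable _ (caratheodory_type (@hausdorff_outer_measure R d s)) C.
Proof.
move=> clC; apply: le_caratheodory_measurable => X.
have [XC|] := eqVneq (out X) +oo%E; first by rewrite [leRHS]XC leey.
by rewrite -ltey; exact: hausdorff_closed_split.
Qed.

End hausdorff.

(** * Subspaces, bounded operators and duals *)

Section subspace.
Context (R : realType) (V : lmodType R).
Implicit Types (D A : set V) (N : V -> R) (ip : V -> V -> R).

Lemma seminormed_sub D N A : seminormed D N -> A `<=` D -> A 0 ->
  (forall a v w, A v -> A w -> A (a *: v + w)) -> seminormed A N.
Proof.
move=> [_ _ NZ Ntri] AD A0 Alin; split => // [a v Av|v w Av Aw].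
  by apply: NZ; exact: AD.
by apply: Ntri; exact: AD.
Qed.

Lemma seminormed_eq D N N' : seminormed D N -> (forall v, D v -> N' v = N v) ->
  seminormed D N'.
Proof.
move=> sN NN'; split; [exact: (sn_D0 sN)|exact: (sn_Dlin sN)| |].
- by move=> a v Dv; rewrite !NN'//; [exact: (sn_Z sN)|exact: (sn_DZ sN)].
- by move=> v w Dv Dw; rewrite !NN'//; [exact: (sn_tri sN)|exact: (sn_DD sN)].
Qed.

Lemma seminorm_complete_closed D N A : seminorm_complete D N -> A `<=` D ->
  seminorm_closed D N A -> seminorm_complete A N.
Proof.
move=> cN AD clA v_ Av_ fast; have [v Dv Hv] := cN v_ (fun n => AD _ (Av_ n)) fast.
exists v => //; apply: clA => // e e0; have [n Hn] := Hv e e0.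
by exists (v_ n) => //; exact: Hn.
Qed.

Lemma semi_inner_sub D ip A : semi_inner D ip -> A `<=` D -> A 0 ->
  (forall a v w, A v -> A w -> A (a *: v + w)) -> semi_inner A ip.
Proof.
move=> [_ _ linl sym pos] AD A0 Alin; split => //.
- by move=> a v w x Av Aw Ax; apply: linl; exact: AD.
- by move=> v w Av Aw; apply: sym; exact: AD.
- by move=> v Av; apply: pos; exact: AD.
Qed.

Lemma semi_inner_add D ip ip' : semi_inner D ip -> semi_inner D ip' ->
  semi_inner D (fun v w => ip v w + ip' v w).
Proof.
move=> sip sip'; have [D0 Dlin _ _ _] := sip; split => //.
- by move=> a v w x Dv Dw Dx; rewrite (ip_linl sip)// (ip_linl sip')//; ring.
- by move=> v w Dv Dw; rewrite (ipC sip)// (ipC sip').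
- by move=> v Dv; rewrite addr_ge0 ?(ip_ge0 sip)// (ip_ge0 sip').
Qed.

Lemma semi_inner_sum (I : finType) D (ip : I -> V -> V -> R) : D 0 ->
  (forall a v w, D v -> D w -> D (a *: v + w)) -> (forall i, semi_inner D (ip i)) ->
  semi_inner D (fun v w => \sum_i ip i v w).
Proof.
move=> D0 Dlin sip; split => //.
- move=> a v w x Dv Dw Dx; rewrite mulr_sumr -big_split; apply: eq_bigr => i _.
  exact: (ip_linl (sip i)).
- by move=> v w Dv Dw; apply: eq_bigr => i _; exact: (ipC (sip i)).
- by move=> v Dv; apply: sumr_ge0 => i _; exact: (ip_ge0 (sip i)).
Qed.

(** Exact linearity of A would be too much to ask: weak derivatives are chosen, and are linear up to
    null elements. *)
Lemma semi_inner_pullback (W : lmodType R) (D' : set W) (ip : W -> W -> R) D (A : V -> W) :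
  semi_inner D' ip -> D 0 -> (forall a v w, D v -> D w -> D (a *: v + w)) ->
  (forall v, D v -> D' (A v)) ->
  (forall a v w, D v -> D w -> ipnorm ip (A (a *: v + w) - (a *: A v + A w)) = 0) ->
  semi_inner D (fun v w => ip (A v) (A w)).
Proof.
move=> sip D0 Dlin DA Alin; split => //.
- move=> a v w x Dv Dw Dx; have [_ D'lin _ _ _] := sip.
  rewrite (ip_null sip (w := a *: A v + A w)) ?Alin//;
    [|by apply: DA; exact: Dlin|by apply: D'lin; exact: DA|exact: DA].
  by apply: (ip_linl sip); exact: DA.
- by move=> v w Dv Dw; apply: (ipC sip); exact: DA.
- by move=> v Dv; apply: (ip_ge0 sip); exact: DA.
Qed.

Lemma small_eq0 (x C : R) : 0 <= x -> (forall e, 0 < e -> x <= C * e) -> x = 0.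
Proof.
move=> x0 H; apply/eqP; rewrite eq_le x0 andbT leNgt; apply/negP => xp.
have C1 : 0 < `|C| + 1 by rewrite ltr_wpDl.
have e0 : 0 < x / (`|C| + 1) / 2 by rewrite !divr_gt0.
have := H _ e0; rewrite leNgt => /negP; apply.
apply: (@le_lt_trans _ _ ((`|C| + 1) * (x / (`|C| + 1) / 2))).
  by rewrite ler_wpM2r ?ltW//; have := ler_norm C; lra.
by rewrite mulrA mulrCA divff ?gt_eqF// mulr1; lra.
Qed.

Lemma bounded_functional_B D N l v w : seminormed D N -> bounded_functional D N l ->
  D v -> D w -> l (v - w) = l v - l w.
Proof.
move=> sN [llin _] Dv Dw; have := llin (-1) w v Dw Dv.
by rewrite scaleN1r addrC => ->; ring.
Qed.

Lemma bounded_functional_kernel_closed D N l : seminormed D N -> bounded_functional D N l ->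
  seminorm_closed D N [set v | D v /\ l v = 0].
Proof.
move=> sN bl v Dv H; split => //; apply/eqP; rewrite -normr_eq0; apply/eqP.
have [llin [M lM]] := bl; apply: (@small_eq0 _ `|M|) => // e e0.
have [a [Da la0] av] := H e e0; have Dav := sn_DB sN Da Dv.
rewrite -normrN -(sub0r (l v)) -la0 -(bounded_functional_B sN bl)//.
apply: le_trans (lM _ Dav) _.
apply: (@le_trans _ _ (`|M| * N (a - v))).
  by rewrite ler_wpM2r ?(sn_ge0 sN)// ler_norm.
by rewrite ler_wpM2l// ltW.
Qed.

Lemma bounded_linear_B (W : lmodType R) D N (D' : set W) (N' : W -> R) S v w :
  seminormed D N -> seminormed D' N' -> bounded_linear_operator D N D' N' S ->
  D v -> D w -> N' (S (v - w) - (S v - S w)) = 0.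
Proof.
move=> sN sN' [DS Slin _] Dv Dw; have := Slin (-1) w v Dw Dv.
by rewrite !scaleN1r ![- w + _]addrC ![- S w + _]addrC.
Qed.

(** The constant is made nonnegative, and the Lipschitz bound absorbs the null element by which S (v
    - w) and S v - S w differ. *)
Lemma bounded_linear_dist (W : lmodType R) D N (D' : set W) (N' : W -> R) S :
  seminormed D N -> seminormed D' N' -> bounded_linear_operator D N D' N' S ->
  exists2 M, 0 <= M & (forall v, D v -> N' (S v) <= M * N v) /\
    forall v w, D v -> D w -> N' (S v - S w) <= M * N (v - w).
Proof.
move=> sN sN' bS; have [DS _ [M HM]] := bS.
have HM' v : D v -> N' (S v) <= `|M| * N v.
  move=> Dv; apply: le_trans (HM v Dv) _.
  by rewrite ler_wpM2r ?(sn_ge0 sN)// ler_norm.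
exists `|M| => //; split => // v w Dv Dw; have Dvw := sn_DB sN Dv Dw.
rewrite -(sn_null sN' _ _ (bounded_linear_B sN sN' bS Dv Dw)); first exact: HM'.
  exact: DS.
by apply: (sn_DB sN'); exact: DS.
Qed.

End subspace.

(** The intervals of radius 2 C 2^-n around a n are nested; the limit is the supremum of their left
    ends. *)
Lemma quick_limit (R : realType) (a : nat -> R) C : (forall n, `|a n.+1 - a n| <= C * 2^-1 ^+ n) ->
  exists l, forall n, `|a n - l| <= 2 * C * 2^-1 ^+ n.
Proof.
move=> H; pose b n := a n - 2 * C * 2^-1 ^+ n; pose c n := a n + 2 * C * 2^-1 ^+ n.
have C0 : 0 <= C by have := le_trans (normr_ge0 _) (H 0%N); rewrite expr0 mulr1.
have bS n : b n <= b n.+1.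
  have := H n; rewrite ler_norml => /andP[h _]; rewrite /b exprS; move: h.
  by move: (2^-1 ^+ n) => t; lra.
have cS n : c n.+1 <= c n.
  have := H n; rewrite ler_norml => /andP[_ h]; rewrite /c exprS; move: h.
  by move: (2^-1 ^+ n) => t; lra.
have bc n : b n <= c n.
  have := mulr_ge0 C0 (ltW (half_exp_gt0 R n)); rewrite /b /c.
  by rewrite -!mulrA; move: (C * _) => t; lra.
have bm m n : (m <= n)%N -> b m <= b n.
  by apply: (@homo_leq _ b (fun x y => x <= y)) => // x y z; exact: le_trans.
have cm m n : (m <= n)%N -> c n <= c m.
  by apply: (@homo_leq _ c (fun x y => y <= x)) => // x y z h1 h2; exact: le_trans h2 h1.
have bcm m n : b m <= c n.
  apply: le_trans (bm _ _ (leq_maxl m n)) _; apply: le_trans (bc _) _.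
  exact: cm (leq_maxr m n).
have sb : has_sup (range b).
  by split; [exists (b 0%N); exists 0%N|exists (c 0%N) => _ [m _ <-]].
exists (sup (range b)) => n; rewrite ler_distl; apply/andP; split; [rewrite lerBlDr|rewrite -lerBlDr].
  by apply: ge_sup => [|_ [m _ <-]]; [exists (b 0%N); exists 0%N|exact: bcm].
by apply: sup_upper_bound => //; exists n.
Qed.

(** * The dual of a seminormed space *)

Section dual.
Context (R : realType) (V : lmodType R) (D : set V) (N : V -> R).
Hypothesis sN : seminormed D N.
Local Notation bounded := (bounded_functional D N).
Local Notation dual := (@dual_norm R V D N).

Let has_sup_dual l : bounded l -> has_sup [set `|l v| | v in [set v | D v /\ N v <= 1]].
Proof.
move=> [_ [M lM]]; split.
  by exists `|l 0|; exists 0 => //; rewrite /= (sn_0 sN); split => //; exact: (sn_D0 sN).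
exists `|M| => _ [v [Dv Nv] <-]; apply: le_trans (lM v Dv) _.
apply: (@le_trans _ _ (`|M| * N v)); first by rewrite ler_wpM2r ?(sn_ge0 sN)// ler_norm.
by rewrite ler_piMr.
Qed.

Lemma dual_norm_ge0 l : bounded l -> 0 <= dual l.
Proof.
move=> bl; apply: le_trans (normr_ge0 (l 0)) _; apply: sup_upper_bound; first exact: has_sup_dual.
by exists 0 => //; rewrite /= (sn_0 sN); split => //; exact: (sn_D0 sN).
Qed.

Lemma functionalZ l a v : bounded l -> D v -> l (a *: v) = a * l v.
Proof.
move=> [llin _] Dv; have := llin 1 0 0 (sn_D0 sN) (sn_D0 sN).
rewrite scale1r addr0 mul1r => l0; have := llin a v 0 Dv (sn_D0 sN).
by rewrite addr0 => ->; lra.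
Qed.

Lemma dual_norm_apply l v : bounded l -> D v -> `|l v| <= dual l * N v.
Proof.
(* A null vector cannot be normalized; on it a bounded functional vanishes. *)
move=> bl Dv; have [Nv0|Nv0] := eqVneq (N v) 0.
  by have [_ [M lM]] := bl; have := lM v Dv; rewrite Nv0 !mulr0.
have Nv : 0 < N v by rewrite lt_neqAle eq_sym Nv0 (sn_ge0 sN).
rewrite -ler_pdivrMr//.
have -> : `|l v| / N v = `|l ((N v)^-1 *: v)|.
  by rewrite functionalZ// normrM gtr0_norm ?invr_gt0// mulrC.
apply: sup_upper_bound; first exact: has_sup_dual.
exists ((N v)^-1 *: v) => //=; split; first exact: (sn_DZ sN).
by rewrite (sn_Z sN)// gtr0_norm ?invr_gt0// mulVf.
Qed.

Lemma dual_norm_le l M : 0 <= M -> (forall v, D v -> `|l v| <= M * N v) -> dual l <= M.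
Proof.
move=> M0 lM; apply: ge_sup => [|_ [v [Dv Nv] <-]].
  by exists `|l 0|; exists 0 => //; rewrite /= (sn_0 sN); split => //; exact: (sn_D0 sN).
by apply: le_trans (lM v Dv) _; rewrite ler_piMr.
Qed.

Lemma bounded_functional_lin a l l' : bounded l -> bounded l' -> bounded (a *: l + l').
Proof.
move=> bl bl'; have [llin _] := bl; have [l'lin _] := bl'; split.
  move=> b v w Dv Dw; have := llin b v w Dv Dw; have := l'lin b v w Dv Dw.
  by rewrite !fctE => -> ->; rewrite /GRing.scale/=; ring.
exists (`|a| * dual l + dual l') => v Dv; rewrite !fctE mulrDl.
apply: le_trans (ler_normD _ _) _; apply: lerD; last exact: dual_norm_apply.
by rewrite normrM -mulrA ler_wpM2l// dual_norm_apply.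
Qed.

Lemma bounded_functional0 : bounded 0.
Proof.
split => [a v w _ _|]; first by change (0 = a * 0 + 0 :> R); rewrite mulr0 addr0.
by exists 0 => v _; change (`|0 : R| <= 0 * N v); rewrite normr0 mul0r.
Qed.

Lemma dual_seminormed : seminormed (bounded : set (V -> R)) dual.
Proof.
have dZ a l : bounded l -> dual (a *: l) <= `|a| * dual l.
  move=> bl; apply: dual_norm_le => [|v Dv]; first by rewrite mulr_ge0// dual_norm_ge0.
  by change (`|a * l v| <= `|a| * dual l * N v); rewrite normrM -mulrA ler_wpM2l// dual_norm_apply.
split.
- exact: bounded_functional0.
- exact: bounded_functional_lin.
- move=> a l bl; apply/eqP; rewrite eq_le dZ//=.
  have [->|a0] := eqVneq a 0.
    rewrite normr0 mul0r; apply: dual_norm_ge0; rewrite -(addr0 (0 *: l)).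
    by apply: bounded_functional_lin => //; exact: bounded_functional0.
  have bal : bounded (a *: l).
    by rewrite -(addr0 (a *: l)); apply: bounded_functional_lin => //; exact: bounded_functional0.
  have := dZ a^-1 (a *: l) bal; rewrite scalerA mulVf// scale1r normrV ?unitfE//.
  by rewrite mulrC ler_pdivlMr ?normr_gt0// mulrC.
- move=> l l' bl bl'; apply: dual_norm_le => [|v Dv]; first by rewrite addr_ge0// dual_norm_ge0.
  change (`|l v + l' v| <= (dual l + dual l') * N v); rewrite mulrDl; apply: le_trans (ler_normD _ _) _.
  by apply: lerD; exact: dual_norm_apply.
Qed.

Lemma dual_complete : seminorm_complete (bounded : set (V -> R)) dual.
Proof.
move=> l_ bl_ fast; have sd := dual_seminormed.
have /choice[l Hl] : forall v, exists l, D v -> forall n, `|l_ n v - l| <= 2 * N v * 2^-1 ^+ n.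
  move=> v; have [Dv|nDv] := pselect (D v); last by exists 0.
  have H n : `|l_ n.+1 v - l_ n v| <= N v * 2^-1 ^+ n.
    rewrite mulrC; apply: le_trans (dual_norm_apply (sn_DB sd (bl_ n.+1) (bl_ n)) Dv) _.
    by rewrite ler_wpM2r// (sn_ge0 sN).
  by have [l Hl] := quick_limit H; exists l.
have lN v n : D v -> `|(l_ n - l) v| <= 2 * 2^-1 ^+ n * N v.
  by move=> Dv; rewrite mulrAC; exact: Hl.
have bl : bounded l.
  split; last first.
    exists (2 + dual (l_ 0%N)) => v Dv; rewrite mulrDl.
    have := lN v 0%N Dv; rewrite expr0 mulr1 distrC => h.
    rewrite -(subrK (l_ 0%N v) (l v)); apply: le_trans (ler_normD _ _) _.
    by apply: lerD => //; exact: dual_norm_apply.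
  move=> a v w Dv Dw; apply/eqP; rewrite -subr_eq0 -normr_eq0; apply/eqP.
  pose C := 2 * N (a *: v + w) + `|a| * (2 * N v) + 2 * N w.
  have hn n : `|l (a *: v + w) - (a * l v + l w)| <= C * 2^-1 ^+ n.
    have Dvw := sn_Dlin sN a Dv Dw.
    have := Hl _ Dvw n; have := Hl _ Dv n; have := Hl _ Dw n.
    have [lnlin _] := bl_ n; rewrite (lnlin a v w Dv Dw) => h1 h2 h3.
    rewrite (_ : _ - _ = - (a * l_ n v + l_ n w - l (a *: v + w)) +
      (a * (l_ n v - l v) + (l_ n w - l w))); last by ring.
    apply: le_trans (ler_normD _ _) _; rewrite normrN /C 2!mulrDl -[leRHS]addrA; apply: lerD => //.
    apply: le_trans (ler_normD _ _) _; apply: lerD => //.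
    by rewrite normrM; have := ler_wpM2l (normr_ge0 a) h2; rewrite !mulrA.
  apply: (@small_eq0 _ _ 1) => // e e0; rewrite mul1r.
  have [n Hn] := half_exp_small C e0.
  exact: le_trans (hn n) (ltW (Hn n (leqnn n))).
exists l => // e e0; have [n0 Hn0] := half_exp_small 2 e0.
exists n0 => n n0n; apply: le_lt_trans (Hn0 n n0n); apply: dual_norm_le => [|v Dv].
  by rewrite mulr_ge0// ltW// half_exp_gt0.
exact: lN.
Qed.

End dual.

(* [comp] alone is the composition of ssrfun here. *)
Local Notation coords := Defs.comp.

(** * Sobolev spaces *)

Section components.
Context (R : realType) (d : nat).
Local Notation X := 'rV[R]_d.
Implicit Types (u w : X -> 'rV[R]_d).

Lemma coords_lin a u w i : coords (a *: u + w) i = a *: coords u i + coords w i.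
Proof. by apply/funext => x; rewrite /Defs.comp !fctE !mxE. Qed.

Lemma coords0 (i : 'I_d) : coords (0 : X -> 'rV[R]_d) i = 0.
Proof. by apply/funext => x; rewrite /Defs.comp mxE. Qed.

Lemma coordsB u w i : coords (u - w) i = coords u i - coords w i.
Proof. by apply/funext => x; rewrite /Defs.comp !fctE !mxE. Qed.

Variables (D : set (X -> R)) (N : (X -> R) -> R) (Nv : (X -> 'rV[R]_d) -> R) (C : R).
Hypotheses (sN : seminormed D N) (cN : seminorm_complete D N) (C0 : 0 < C).
Hypothesis NvP : forall u, (forall i, D (coords u i)) ->
  (forall i, N (coords u i) <= C * Nv u) /\ Nv u <= C * \sum_i N (coords u i).

(** [Nv] is only required to be equivalent to the sum of the component norms, which covers both the
    H^1 norm and the weighted norm with density rho. *)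
Lemma components_complete : seminorm_complete [set u | forall i, D (coords u i)] Nv.
Proof.
move=> u_ Du_ fast.
have DB n m i : D (coords (u_ n - u_ m) i) by rewrite coordsB; exact: (sn_DB sN (Du_ n i) (Du_ m i)).
have /choice[v Hv] : forall i, exists v, D v /\
    forall n, N (coords (u_ n) i - v) <= 2 * C * 2^-1 ^+ n.
  move=> i; have [||v Dv Hv] := complete_fast (v_ := fun n => coords (u_ n) i) sN cN C0.
  - by move=> n; exact: (Du_ n i).
  - move=> n; rewrite -coordsB; have [h _] := NvP (DB n.+1 n).
    by apply: le_trans (h i) _; rewrite ler_wpM2l// ltW.
  - by exists v.
pose u x : 'rV[R]_d := \row_i v i x.
have uv i : coords u i = v i by apply/funext => x; rewrite /Defs.comp mxE.
exists u => [i|e e0]; first by rewrite uv; case: (Hv i).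
have [n0 Hn0] := half_exp_small (C * (d%:R * (2 * C))) e0; exists n0 => n n0n.
apply: le_lt_trans (Hn0 n n0n); have Du : forall i, D (coords (u_ n - u) i).
  by move=> i; rewrite coordsB uv; apply: (sn_DB sN); [exact: (Du_ n i)|by case: (Hv i)].
have [_ h] := NvP Du; apply: le_trans h _; rewrite -!mulrA; apply: (ler_wpM2l (ltW C0)).
apply: (@le_trans _ _ (\sum_(i < d) (2 * C * 2^-1 ^+ n))); last first.
  by rewrite sumr_const card_ord -[leLHS]mulr_natl !mulrA.
by apply: ler_sum => i _; rewrite coordsB uv; case: (Hv i) => _; exact.
Qed.

End components.

Section sobolev_space.
Context (R : realType) (d : nat) (Om : set 'rV[R]_d).
Hypotheses (oOm : open Om) (bOm : bounded_set Om).
Local Notation E := 'rV[R]_d.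
Local Notation mu := (@lebesgue_rV R d).
Local Notation L2O := (L2 mu Om).
Local Notation nL2 := (L2norm mu Om).

Let mO := Om_meas oOm.
Let sL := L2_semi_inner mu mO.
Let sLn := L2_seminormed mu mO.
(** One component of [weak_gradient], written with L2 inner products so that Hilbert space lemmas
    apply. *)
Definition weak_partial (v : E -> R) (i : 'I_d) (g : E -> R) : Prop :=
  L2O g /\ forall eta : E -> R, test_function Om eta ->
    L2ip mu Om v ('D_(delta_mx 0 i) eta) = - L2ip mu Om g eta.

Lemma test_L2 (eta : E -> R) (i : 'I_d) : test_function Om eta ->
  L2O eta /\ L2O ('D_(delta_mx 0 i) eta).
Proof.
by move=> [sm _]; have [c1 c2] := smooth_continuous (delta_mx 0 i) sm; split; exact: continuous_L2.
Qed.

Lemma weak_partial_lin a v w i g h : L2O v -> L2O w -> weak_partial v i g ->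
  weak_partial w i h -> weak_partial (a *: v + w) i (a *: g + h).
Proof.
move=> Lv Lw [Lg vg] [Lh wh]; split=> [|eta te]; first exact: (sn_Dlin sLn).
have [L1 L2] := test_L2 i te.
by rewrite !(ip_linl sL)// vg// wh//; ring.
Qed.

Lemma weak_partial_unique v i g h : weak_partial v i g -> weak_partial v i h -> nL2 (g - h) = 0.
Proof.
move=> [Lg vg] [Lh vh]; apply: ae_L2norm0 => //.
have H := @test_orthogonal_ae0 R d Om oOm bOm (g - h) (sn_DB sLn Lg Lh).
have {}H : {ae mu, forall x, Om x -> (g - h) x = 0}.
  apply: H => eta te; have [L1 _] := test_L2 i te.
  have := ipBl sL Lg Lh L1; rewrite /L2ip => ->.
  by have := vg _ te; rewrite vh// /L2ip => /oppr_inj ->; rewrite subrr.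
by apply: filterS H => x h0 Ox; apply/eqP; rewrite -subr_eq0; apply/eqP; exact: h0.
Qed.

Lemma weak_partial_limit (v_ g_ : nat -> E -> R) v g i : (forall n, L2O (v_ n)) -> L2O v -> L2O g ->
  (forall n, weak_partial (v_ n) i (g_ n)) ->
  (forall e, 0 < e -> exists n, nL2 (v_ n - v) < e /\ nL2 (g_ n - g) < e) -> weak_partial v i g.
Proof.
move=> Lv_ Lv Lg wp H; split => // eta te; have [L1 L2] := test_L2 i te.
apply/eqP; rewrite -subr_eq0 opprK -normr_eq0; apply/eqP.
apply: (@small_eq0 _ _ (nL2 ('D_(delta_mx 0 i) eta) + nL2 eta)) => // e e0.
have [n [h1 h2]] := H e e0; have [Lgn vgn] := wp n.
rewrite (_ : _ + _ = - (L2ip mu Om (v_ n - v) ('D_(delta_mx 0 i) eta) +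
    L2ip mu Om (g_ n - g) eta)); last first.
  by rewrite (ipBl sL (Lv_ n) Lv L2) (ipBl sL Lgn Lg L1) (vgn _ te); ring.
rewrite normrN.
apply: le_trans (ler_normD _ _) _; rewrite mulrDl; apply: lerD.
  apply: le_trans (ip_CSn sL (sn_DB sLn (Lv_ n) Lv) L2) _.
  by rewrite mulrC ler_wpM2l ?sqrtr_ge0// ltW.
apply: le_trans (ip_CSn sL (sn_DB sLn Lgn Lg) L1) _.
by rewrite mulrC ler_wpM2l ?sqrtr_ge0// ltW.
Qed.

Definition partial (i : 'I_d) (v : E -> R) : E -> R := fun x => grad Om v x 0 i.

Lemma weak_partial_grad v i : H1 Om v -> weak_partial v i (partial i v).
Proof. by move=> [_ exg]; have := @xgetPex _ (fun=> 0) _ exg; rewrite /= => /(_ i). Qed.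

Lemma H1_L2 v : H1 Om v -> L2O v. Proof. by case. Qed.

Lemma partial_L2 v i : H1 Om v -> L2O (partial i v).
Proof. by move=> /(weak_partial_grad i)[]. Qed.

Lemma H1_intro v (g : 'I_d -> E -> R) : L2O v -> (forall i, weak_partial v i (g i)) -> H1 Om v.
Proof.
move=> Lv wp; split => //; exists (fun x => \row_i g i x) => i.
have e : (fun x => (\row_i g i x) 0 i) = g i by apply/funext => x; rewrite mxE.
have [Lg h] := wp i; split=> [|eta te]; first by rewrite e.
by have := h eta te; rewrite -e.
Qed.

Lemma H1_lin a v w : H1 Om v -> H1 Om w -> H1 Om (a *: v + w).
Proof.
move=> Hv Hw; apply: (@H1_intro _ (fun i => a *: partial i v + partial i w)) => [|i].
  by apply: (sn_Dlin sLn); exact: H1_L2.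
by apply: weak_partial_lin; [exact: H1_L2|exact: H1_L2|exact: weak_partial_grad|exact: weak_partial_grad].
Qed.

Lemma partial_lin i a v w : H1 Om v -> H1 Om w ->
  nL2 (partial i (a *: v + w) - (a *: partial i v + partial i w)) = 0.
Proof.
move=> Hv Hw; apply: (@weak_partial_unique (a *: v + w) i).
  by apply: weak_partial_grad; exact: H1_lin.
by apply: weak_partial_lin; [exact: H1_L2|exact: H1_L2|exact: weak_partial_grad|exact: weak_partial_grad].
Qed.

Lemma H1_0 : H1 Om 0.
Proof.
apply: (@H1_intro _ (fun=> 0)) => [|i]; first exact: (sn_D0 sLn).
split => [|eta te]; first exact: (sn_D0 sLn).
by have [L1 L2] := test_L2 i te; rewrite !(ip0l sL)// oppr0.
Qed.

Definition ip_H1 v w : R := L2ip mu Om v w + \sum_i L2ip mu Om (partial i v) (partial i w).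

Lemma H1_semi_inner : semi_inner (H1 Om) ip_H1.
Proof.
have sub : H1 Om `<=` L2O by move=> v; exact: H1_L2.
apply: semi_inner_add; first exact: (semi_inner_sub sL sub H1_0 H1_lin).
apply: semi_inner_sum => [||i]; [exact: H1_0|exact: H1_lin|].
apply: (semi_inner_pullback sL H1_0 H1_lin) => [v|a v w]; first exact: partial_L2.
exact: partial_lin.
Qed.

Lemma H1norm_ip v : H1 Om v -> H1norm Om v = ipnorm ip_H1 v.
Proof.
move=> Hv; congr (Num.sqrt (_ + _)).
by rewrite (aeint_sum mO _ (fun i => L2_mul_aeint mO (partial_L2 i Hv) (partial_L2 i Hv))).2.
Qed.

Lemma H1_seminormed : seminormed (H1 Om) (H1norm Om).
Proof. exact: (seminormed_eq (semi_inner_seminormed H1_semi_inner) H1norm_ip). Qed.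

Lemma H1norm_sq v : H1 Om v -> H1norm Om v ^+ 2 = nL2 v ^+ 2 + \sum_i nL2 (partial i v) ^+ 2.
Proof.
move=> Hv; rewrite H1norm_ip// (ipnorm_sq H1_semi_inner)// (ipnorm_sq sL (H1_L2 Hv)).
by congr (_ + _); apply: eq_bigr => i _; rewrite (ipnorm_sq sL (partial_L2 i Hv)).
Qed.

Lemma L2norm_le_H1 v : H1 Om v -> nL2 v <= H1norm Om v.
Proof.
move=> Hv; rewrite -ler_sqr ?nnegrE ?sqrtr_ge0// H1norm_sq// lerDl.
by apply: sumr_ge0 => i _; exact: sqr_ge0.
Qed.

Lemma partial_le_H1 i v : H1 Om v -> nL2 (partial i v) <= H1norm Om v.
Proof.
move=> Hv; rewrite -ler_sqr ?nnegrE ?sqrtr_ge0// H1norm_sq// (bigD1 i)//= addrCA lerDl.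
by apply: addr_ge0; [exact: sqr_ge0|apply: sumr_ge0 => j _; exact: sqr_ge0].
Qed.

Lemma sqrt_sum_le (I : finType) (a : R) (b : I -> R) : 0 <= a -> (forall i, 0 <= b i) ->
  a ^+ 2 + \sum_i b i ^+ 2 <= (a + \sum_i b i) ^+ 2.
Proof.
move=> a0 b0.
elim: (index_enum I) => [|i s IH]; first by rewrite !big_nil !addr0.
rewrite !big_cons; have s0 : 0 <= \sum_(j <- s) b j by exact: sumr_ge0.
have := mulr_ge0 (b0 i) (addr_ge0 a0 s0); move: IH (b0 i).
by move: (\sum_(j <- s) b j ^+ 2) (\sum_(j <- s) b j) (b i) => x y z; nra.
Qed.

Lemma H1norm_le v : H1 Om v -> H1norm Om v <= nL2 v + \sum_i nL2 (partial i v).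
Proof.
move=> Hv; have n0 f : 0 <= nL2 f by exact: sqrtr_ge0.
rewrite -ler_sqr ?nnegrE ?sqrtr_ge0 ?addr_ge0 ?sumr_ge0// H1norm_sq//.
exact: sqrt_sum_le.
Qed.

Lemma partialB i v w : H1 Om v -> H1 Om w ->
  nL2 (partial i (v - w)) = nL2 (partial i v - partial i w).
Proof.
move=> Hv Hw; have := partial_lin i (-1) Hw Hv; rewrite !scaleN1r ![- _ + _]addrC.
apply: (sn_null sLn); first by apply: partial_L2; exact: (sn_DB H1_seminormed).
by apply: (sn_DB sLn); exact: partial_L2.
Qed.

Lemma H1_complete : seminorm_complete (H1 Om) (H1norm Om).
Proof.
move=> v_ Hv_ fast; have sH := H1_seminormed.
have [||v Lv Hv] := complete_fast (v_ := v_) (C := 1) sLn (@L2_complete _ _ _ mu _ mO) ltr01.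
- by move=> n; exact: H1_L2.
- move=> n; rewrite mul1r; apply: le_trans (fast n).
  by apply: L2norm_le_H1; exact: (sn_DB sH).
have /choice[g Hg] : forall i, exists g, L2O g /\
    forall n, nL2 (partial i (v_ n) - g) <= 2 * 1 * 2^-1 ^+ n.
  move=> i; have [||g Lg Hg] := complete_fast (v_ := fun n => partial i (v_ n)) (C := 1)
    sLn (@L2_complete _ _ _ mu _ mO) ltr01.
  - by move=> n; exact: partial_L2.
  - move=> n; rewrite mul1r -partialB//; apply: le_trans (fast n).
    by apply: partial_le_H1; exact: (sn_DB sH).
  - by exists g.
have wp i : weak_partial v i (g i).
  have [Lg Hgi] := Hg i.
  apply: (@weak_partial_limit v_ (fun n => partial i (v_ n))) => //.
  - by move=> n; exact: H1_L2.
  - by move=> n; exact: weak_partial_grad.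
  - move=> e e0; have [n Hn] := half_exp_small (2 * 1) e0; exists n.
    by split; apply: le_lt_trans (Hn n (leqnn n)); [exact: Hv|exact: Hgi].
have H1v : H1 Om v by apply: H1_intro wp.
exists v => // e e0; have [n0 Hn0] := half_exp_small ((1 + d%:R) * (2 * 1)) e0.
exists n0 => n n0n; apply: le_lt_trans (Hn0 n n0n).
apply: le_trans (H1norm_le (sn_DB sH (Hv_ n) H1v)) _; rewrite -mulrA mulrDl mul1r.
apply: lerD => //; apply: (@le_trans _ _ (\sum_(i < d) (2 * 1 * 2^-1 ^+ n))); last first.
  by rewrite sumr_const card_ord -[leLHS]mulr_natl.
apply: ler_sum => i _; have [Lg Hgi] := Hg i; rewrite partialB//.
(* The chosen gradient of v need not be the constructed limit g i; they agree up to a null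
   function. *)
have gi : nL2 (partial i v - g i) = 0.
  by apply: (@weak_partial_unique v i) => //; exact: weak_partial_grad.
apply: le_trans (sn_dist sLn (partial_L2 i (Hv_ n)) Lg (partial_L2 i H1v)) _.
by rewrite (sn_sym sLn Lg (partial_L2 i H1v)) gi addr0.
Qed.

End sobolev_space.

Section L2_extra.
Context (disp : measure_display) (X : measurableType disp) (R : realType).
Context (mu : {measure set X -> \bar R}) (D : set X) (mD : measurable D).

Lemma L2_subset (D' : set X) f : measurable D' -> D' `<=` D -> L2 mu D f ->
  L2 mu D' f /\ L2norm mu D' f <= L2norm mu D f.
Proof.
move=> mD' DD Lf; have [mf fin] := Lf.
have mf' : measurable_fun D' f by exact: measurable_funS mf.
have le : (\int[mu]_(x in D') (f x ^+ 2)%:E <= \int[mu]_(x in D) (f x ^+ 2)%:E)%E.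
  apply: ge0_subset_integral => //; first exact/measurable_EFinP/measurable_funX.
  by move=> x _; rewrite lee_fin sqr_ge0.
have Lf' : L2 mu D' f by split => //; exact: le_lt_trans le fin.
split => //; rewrite -ler_sqr ?nnegrE ?sqrtr_ge0// !L2norm_sq//.
by rewrite -lee_fin -!aeint_EFin//; exact: L2_sq_aeint.
Qed.

Lemma L2norm_Linfty c : Linfty mu D c -> exists2 M, 0 <= M &
  forall f, L2 mu D f -> L2norm mu D (fun x => c x * f x) <= M * L2norm mu D f.
Proof.
move=> Lc; have [mc [M HM]] := Lc; exists `|M| => // f Lf.
have Lcf := L2_Linfty mD Lc Lf.
rewrite -ler_sqr ?nnegrE ?sqrtr_ge0 ?mulr_ge0 ?sqrtr_ge0// exprMn !L2norm_sq//.
have [h1 h2] := aeintZ mD (`|M| ^+ 2) (L2_sq_aeint mD Lf).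
rewrite -h2; apply: ae_le_Rintegral => //; first exact: L2_sq_aeint.
apply: filterS HM => x cM Dx; rewrite exprMn ler_wpM2r ?sqr_ge0//.
rewrite -[leLHS]real_normK ?num_real//; apply: lerXn2r; rewrite ?nnegrE//.
exact: le_trans (cM Dx) (ler_norm M).
Qed.

End L2_extra.

Lemma semi_inner_eq (R : realType) (V : lmodType R) (D : set V) (ip ip' : V -> V -> R) :
  semi_inner D ip -> (forall v w, D v -> D w -> ip' v w = ip v w) -> semi_inner D ip'.
Proof.
move=> [D0 Dlin lin sym pos] e; split => //.
- by move=> a v w x Dv Dw Dx; rewrite !e//; [exact: lin|exact: Dlin].
- by move=> v w Dv Dw; rewrite !e//; exact: sym.
- by move=> v Dv; rewrite e//; exact: pos.
Qed.

Section components_inner.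
Context (R : realType) (d : nat).
Local Notation E := 'rV[R]_d.
Context (D : set (E -> R)) (ip : (E -> R) -> (E -> R) -> R).
Hypothesis sip : semi_inner D ip.
Local Notation Dv := [set u : E -> 'rV[R]_d | forall i, D (coords u i)].

Lemma components0 : Dv 0.
Proof. by move=> i; rewrite coords0; exact: (sn_D0 (semi_inner_seminormed sip)). Qed.

Lemma components_lin a u w : Dv u -> Dv w -> Dv (a *: u + w).
Proof.
move=> Du Dw i; rewrite coords_lin.
exact: (sn_Dlin (semi_inner_seminormed sip) _ (Du i) (Dw i)).
Qed.

Lemma components_semi_inner :
  semi_inner Dv (fun u w => \sum_i ip (coords u i) (coords w i)).
Proof.
apply: semi_inner_sum => [||i]; [exact: components0|exact: components_lin|].
apply: (semi_inner_pullback sip components0 components_lin) => [u Du|a u w Du Dw].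
  exact: Du.
by rewrite coords_lin subrr; exact: (sn_0 (semi_inner_seminormed sip)).
Qed.

Lemma components_norm u : Dv u ->
  (forall i, ipnorm ip (coords u i) <= ipnorm (fun u w => \sum_i ip (coords u i) (coords w i)) u) /\
  ipnorm (fun u w => \sum_i ip (coords u i) (coords w i)) u <= \sum_i ipnorm ip (coords u i).
Proof.
move=> Du.
have e : ipnorm (fun u w => \sum_i ip (coords u i) (coords w i)) u ^+ 2 =
    \sum_i ipnorm ip (coords u i) ^+ 2.
  rewrite (ipnorm_sq components_semi_inner)//.
  by apply: eq_bigr => i _; rewrite (ipnorm_sq sip)//; exact: Du.
split=> [i|].
  rewrite -ler_sqr ?nnegrE ?sqrtr_ge0// e (bigD1 i)//= lerDl.
  by apply: sumr_ge0 => j _; exact: sqr_ge0.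
have s0 : 0 <= \sum_i ipnorm ip (coords u i) by apply: sumr_ge0 => i _; exact: sqrtr_ge0.
rewrite -ler_sqr ?nnegrE ?sqrtr_ge0// e.
have := @sqrt_sum_le R 'I_d 0 (fun i => ipnorm ip (coords u i)) (lexx _) (fun i => sqrtr_ge0 _).
by rewrite expr0n/= !add0r.
Qed.

End components_inner.

(** * The function spaces of the problem *)

Section setting_spaces.
Context (R : realType) (d : nat) (P : setting R d).
Local Notation E := 'rV[R]_d.
Local Notation Om := (Om P).
Local Notation Gam := (boundary Om).
Local Notation mu := (@lebesgue_rV R d).
Local Notation surf := (@surface_measure R d).

Lemma setting_open : open Om. Proof. by have [] := Om_lipschitz P. Qed.
Lemma setting_bounded : bounded_set Om. Proof. by have [] := Om_lipschitz P. Qed.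
Let oOm := setting_open.
Let bOm := setting_bounded.
Let mO := Om_meas oOm.
Let sH := H1_seminormed oOm bOm.
Let cH := H1_complete oOm bOm.
Let sL := L2_semi_inner mu mO.
Let sLn := L2_seminormed mu mO.

(** The L2 theory on the boundary presupposes a measurable domain of integration; for the Hausdorff
    measure this is the closed case of Caratheodory's criterion. *)
Lemma boundary_measurable :
  @measurable _ (caratheodory_type (@hausdorff_outer_measure R d d.-1)) Gam.
Proof.
apply: closed_hausdorff_measurable; rewrite /boundary setDE.
by apply: closedI; [exact: closed_closure|apply: open_closedC; exact: open_interior].
Qed.
Let mG := boundary_measurable.

Let sB := L2_semi_inner surf mG.
Let sBn := L2_seminormed surf mG.

(** The trace of the smooth function 1 is 1 almost everywhere on the boundary and is square
    integrable there, so its squared norm is the surface measure. *)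
Lemma boundary_finite : (surf Gam < +oo)%E.
Proof.
have [[gL _ _] gsm] := gam_trace P.
have sm : smooth (cst 1 : E -> R).
  have dc (vs : seq E) : exists c : R, foldr (fun v (g : E -> R) => 'D_v g) (cst 1 : E -> R) vs = cst c.
    elim: vs => [|v vs [c IH]]; first by exists 1.
    by exists 0; rewrite /= IH; apply/funext => x; exact: derive_cst.
  by move=> vs x; have [c ->] := dc vs; exact: differentiable_cst.
have H1c : H1 Om (cst 1).
  apply: (@H1_intro _ _ _ _ (fun=> 0)) => [|i]; first exact: (L2_cst mO (Om_finite bOm)).
  split=> [|eta te]; first exact: (sn_D0 sLn).
  have [L1 L2] := test_L2 oOm bOm i te; rewrite (ip0l sL)// oppr0.
  (* That 1 has weak gradient 0 says that derivatives of test functions have integral 0. *)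
  rewrite -[RHS](test_integral_derivative bOm (delta_mx 0 i) te).
  by congr (Rintegral _ _ _); apply/funext => x; rewrite mul1r.
have [_ fin] := gL _ H1c; move: fin.
rewrite (@integral_ae _ _ _ surf Gam _ (cst 1%E)) ?integral_cst ?mul1e//.
by apply: filterS (gsm _ sm) => x e Gx; rewrite e// expr1n.
Qed.

(** The zero mean condition is the kernel of the inner product with the constant 1, a bounded
    functional since the boundary has finite measure. *)
Lemma L2b0_closed : seminorm_closed (L2b Om) (normb Om) (L2b0 Om).
Proof.
have L1 : L2b Om (cst 1) := L2_cst mG boundary_finite 1.
have e z : ipb Om (cst 1) z = \int[surf]_(x in Gam) z x.
  by congr (Rintegral _ _ _); apply/funext => x; rewrite mul1r.
move=> z Lz H; have [|_ h] := bounded_functional_kernel_closed sBn (ip_bounded_functional sB L1) Lz _.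
  move=> e0 e00; have [a [La a0] az] := H e0 e00; exists a => //.
  by split => //; exact: etrans (e a) a0.
by split => //; exact: etrans (esym (e z)) h.
Qed.

Lemma L2b0_sub : L2b0 Om `<=` L2b Om. Proof. by move=> z []. Qed.

Lemma L2b0_0 : L2b0 Om 0.
Proof.
split; first exact: (sn_D0 sBn).
by have := Rintegral_cst surf mG 0; rewrite mul0r.
Qed.

Lemma L2b0_lin a z y : L2b0 Om z -> L2b0 Om y -> L2b0 Om (a *: z + y).
Proof.
move=> [Lz z0] [Ly y0]; split; first exact: (sn_Dlin sBn).
have [_] := aeint_lin mG a (L2_aeint mG boundary_finite Lz) (L2_aeint mG boundary_finite Ly).
by rewrite z0 y0 mulr0 addr0.
Qed.

Lemma L2b0_semi_inner : semi_inner (L2b0 Om) (ipb Om).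
Proof. exact: (semi_inner_sub sB L2b0_sub L2b0_0 L2b0_lin). Qed.

Lemma L2b0_complete : seminorm_complete (L2b0 Om) (normb Om).
Proof. exact: (seminorm_complete_closed (@L2_complete _ _ _ surf _ mG) L2b0_sub L2b0_closed). Qed.

Definition H1_null : set (E -> R) :=
  [set v | H1 Om v /\ {ae surf, forall x, GamD P x -> gam P v x = 0}].

Let GamD_sub : GamD P `<=` Gam.
Proof. by case: (GamD_open P) => O _ ->; exact: subIsetl. Qed.

Let mGD : @measurable _ (caratheodory_type (@hausdorff_outer_measure R d d.-1)) (GamD P).
Proof.
case: (GamD_open P) => O oO ->; apply: measurableI => //; rewrite -(setCK O).
apply: measurableC; apply: closed_hausdorff_measurable; exact: open_closedC.
Qed.

Let bgam := (gam_trace P).1.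

Lemma H1_null_lin a v w : H1_null v -> H1_null w -> H1_null (a *: v + w).
Proof.
move=> [Hv v0] [Hw w0]; split; first exact: (sn_Dlin sH).
have [gL glin _] := bgam.
have := L2_ae mG (gL _ (sn_Dlin sH a Hv Hw)) (sn_Dlin sBn a (gL _ Hv) (gL _ Hw)) (glin a v w Hv Hw).
apply: filterS3 v0 w0 => x v0 w0 e Gx; rewrite e; last exact: GamD_sub.
by rewrite !fctE v0// w0// scaler0 addr0.
Qed.

Lemma H1_null_0 : H1_null 0.
Proof.
split; first exact: (sn_D0 sH); have [gL _ _] := bgam.
have [M _ [gM _]] := bounded_linear_dist sH sBn bgam.
have n0 : normb Om (gam P 0 - 0) = 0.
  rewrite subr0; apply/eqP; rewrite eq_le sqrtr_ge0 andbT.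
  by have := gM 0 (sn_D0 sH); rewrite (sn_0 sH) mulr0.
have := L2_ae mG (gL _ (sn_D0 sH)) (sn_D0 sBn) n0.
by apply: filterS => x e Gx; exact/e/GamD_sub.
Qed.

(** Vanishing almost everywhere on [GamD] means norm 0 in L2 of [GamD], and the trace is Lipschitz
    into that space. *)
Lemma H1_null_closed : seminorm_closed (H1 Om) (H1norm Om) H1_null.
Proof.
move=> v Hv H; split => //; have [gL _ _] := bgam.
have [M M0 [_ gM]] := bounded_linear_dist sH sBn bgam.
have sD := L2_seminormed surf mGD.
have LD w : H1 Om w -> L2 surf (GamD P) (gam P w).
  by move=> Hw; have [] := L2_subset mG mGD GamD_sub (gL _ Hw).
suff n0 : L2norm surf (GamD P) (gam P v - 0) = 0.
  exact: (L2_ae mGD (LD _ Hv) (sn_D0 sD) n0).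
rewrite subr0; apply: (@small_eq0 _ _ M); first exact: sqrtr_ge0.
move=> e e0; have [a [Ha a0] av] := H e e0.
have a00 : L2norm surf (GamD P) (gam P a - 0) = 0 by exact: ae_L2norm0.
rewrite subr0 in a00.
have := sn_dist sD (LD _ Hv) (LD _ Ha) (sn_D0 sD); rewrite !subr0 a00 addr0 => h.
apply: le_trans h _.
have [_ h2] := L2_subset mG mGD GamD_sub (sn_DB sBn (gL _ Hv) (gL _ Ha)).
apply: le_trans h2 _; apply: le_trans (gM _ _ Hv Ha) _.
by apply: (ler_wpM2l M0); rewrite (sn_sym sH Hv Ha); exact: ltW.
Qed.

Let H1_null_sub : H1_null `<=` H1 Om. Proof. by move=> v []. Qed.

Let sN0 := semi_inner_sub (H1_semi_inner oOm bOm) H1_null_sub H1_null_0 H1_null_lin.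

Lemma H1normv_ip u : (forall i, H1 Om (coords u i)) -> H1normv Om u =
  ipnorm (fun u w => \sum_i ip_H1 Om (coords u i) (coords w i)) u.
Proof.
move=> Hu; congr Num.sqrt; apply: eq_bigr => i _.
by rewrite H1norm_ip// (ipnorm_sq (H1_semi_inner oOm bOm)).
Qed.

Let H1D_H1 u : H1D P u -> forall i, H1 Om (coords u i).
Proof. by move=> Hu i; have [] := Hu i. Qed.

Lemma H1D_seminormed : seminormed (H1D P) (H1normv Om).
Proof.
apply: (seminormed_eq (semi_inner_seminormed (components_semi_inner sN0))).
by move=> u /H1D_H1; exact: H1normv_ip.
Qed.

Lemma H1norm_le_H1normv u : (forall i, H1 Om (coords u i)) ->
  (forall i, H1norm Om (coords u i) <= H1normv Om u) /\
  H1normv Om u <= \sum_i H1norm Om (coords u i).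
Proof.
move=> Hu; have [h1 h2] := components_norm (H1_semi_inner oOm bOm) Hu.
rewrite H1normv_ip//; split=> [i|]; first by rewrite H1norm_ip//; exact: h1.
by apply: le_trans h2 _; apply: ler_sum => i _; rewrite H1norm_ip.
Qed.

Lemma H1D_complete : seminorm_complete (H1D P) (H1normv Om).
Proof.
have s0 := seminormed_sub sH H1_null_sub H1_null_0 H1_null_lin.
have c0 := seminorm_complete_closed cH H1_null_sub H1_null_closed.
apply: (components_complete s0 c0 ltr01) => u Hu.
by rewrite !mul1r; apply: H1norm_le_H1normv; exact: H1D_H1.
Qed.

Let H1G_closed : seminorm_closed (H1 Om) (H1norm Om) (H1G P).
Proof. exact: (bounded_functional_kernel_closed sH (GG_bounded P)). Qed.

Let H1G_sub : H1G P `<=` H1 Om. Proof. by move=> v []. Qed.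

Lemma H1G_seminormed : seminormed (H1G P) (H1norm Om).
Proof.
have b := GG_bounded P; have [glin _] := b.
apply: (seminormed_sub sH H1G_sub) => [|a v w [Hv v0] [Hw w0]].
  split; first exact: (sn_D0 sH).
  by have := functionalZ sH 0 b (sn_D0 sH); rewrite scale0r mul0r.
by split; [exact: (sn_Dlin sH)|rewrite glin// v0 w0 mulr0 addr0].
Qed.

Lemma H1G_complete : seminorm_complete (H1G P) (H1norm Om).
Proof. exact: (seminorm_complete_closed cH H1G_sub H1G_closed). Qed.

Lemma HD'_seminormed : seminormed (HD' P) (@norm_HD' R d P).
Proof. exact: (dual_seminormed H1D_seminormed). Qed.

Lemma HD'_complete : seminorm_complete (HD' P) (@norm_HD' R d P).
Proof. exact: (dual_complete H1D_seminormed). Qed.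

Let ipr f g := L2ip mu Om (fun x => rho P x * f x) g.

Let ipr_L f : L2 mu Om f -> L2 mu Om (fun x => rho P x * f x).
Proof. exact: (L2_Linfty mO (rho_Linfty P)). Qed.

Let ipr_semi_inner : semi_inner (L2 mu Om) ipr.
Proof.
have [r0 r00 Hr] := rho_gt0 P; split.
- exact: (sn_D0 sLn).
- exact: (sn_Dlin sLn).
- move=> a v w x Lv Lw Lx; apply: etrans (ip_linl sL a (ipr_L Lv) (ipr_L Lw) Lx).
  by congr (Rintegral _ _ _); apply/funext => y; rewrite !fctE /GRing.scale/=; ring.
- by move=> v w _ _; congr (Rintegral _ _ _); apply/funext => y; ring.
- move=> v Lv; apply: ae_Rintegral_ge0 => //; apply: filterS Hr => x rx Ox.
  by rewrite -mulrA mulr_ge0// -?expr2 ?sqr_ge0// (le_trans (ltW r00))// rx.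
Qed.

Let ip_rhoE u w : L2v Om u -> L2v Om w ->
  ip_rho P u w = \sum_i ipr (coords u i) (coords w i).
Proof.
move=> Lu Lw.
have [_ <-] := aeint_sum mO (index_enum 'I_d) (fun i => L2_mul_aeint mO (ipr_L (Lu i)) (Lw i)).
congr (Rintegral _ _ _); apply/funext => x; rewrite /dot mulr_sumr.
by apply: eq_bigr => i _; rewrite mulrA.
Qed.

Lemma rho_semi_inner : semi_inner (L2v Om) (ip_rho P).
Proof. exact: (semi_inner_eq (components_semi_inner ipr_semi_inner) ip_rhoE). Qed.

Lemma rho_seminormed : seminormed (L2v Om) (norm_rho P).
Proof. exact: (semi_inner_seminormed rho_semi_inner). Qed.

Lemma L2norm_rho : exists2 C, 0 < C & forall u, L2v Om u ->
  (forall i, L2norm mu Om (coords u i) <= C * norm_rho P u) /\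
  norm_rho P u <= C * \sum_i L2norm mu Om (coords u i).
Proof.
have [r0 r00 Hr] := rho_gt0 P; have [_ [M HM]] := rho_Linfty P.
(* One constant for both directions: the lower bound r0 of rho controls L2 by the weighted norm, the
   upper bound M the converse; the summand 1 makes C positive. *)
pose C := Num.sqrt r0^-1 + Num.sqrt `|M| + 1.
have C1 : Num.sqrt r0^-1 <= C by rewrite /C -addrA lerDl addr_ge0// sqrtr_ge0.
have C2 : Num.sqrt `|M| <= C by rewrite /C addrAC lerDr addr_ge0// sqrtr_ge0.
have r1 : 0 <= r0^-1 by rewrite invr_ge0 ltW.
have lo f : L2 mu Om f -> L2norm mu Om f <= Num.sqrt r0^-1 * ipnorm ipr f.
  move=> Lf; rewrite -ler_sqr ?nnegrE ?sqrtr_ge0 ?mulr_ge0 ?sqrtr_ge0// exprMn.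
  rewrite (sqr_sqrtr r1) (ipnorm_sq ipr_semi_inner)// L2norm_sq//.
  rewrite [leRHS]mulrC ler_pdivlMr//; have [h1 h2] := aeintZ mO r0 (L2_sq_aeint mO Lf).
  rewrite [leLHS]mulrC -h2; apply: ae_le_Rintegral => //; first exact: (L2_mul_aeint mO (ipr_L Lf) Lf).
  apply: filterS Hr => x rx Ox; rewrite -mulrA -expr2; apply: ler_wpM2r; first exact: sqr_ge0.
  exact: rx.
have hi f : L2 mu Om f -> ipnorm ipr f <= Num.sqrt `|M| * L2norm mu Om f.
  move=> Lf; rewrite -ler_sqr ?nnegrE ?sqrtr_ge0 ?mulr_ge0 ?sqrtr_ge0// exprMn.
  rewrite (sqr_sqrtr (normr_ge0 M)) (ipnorm_sq ipr_semi_inner)// L2norm_sq//.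
  have [h1 <-] := aeintZ mO `|M| (L2_sq_aeint mO Lf).
  apply: ae_le_Rintegral => //; first exact: (L2_mul_aeint mO (ipr_L Lf) Lf).
  apply: filterS HM => x rx Ox; rewrite -mulrA -expr2; apply: ler_wpM2r; first exact: sqr_ge0.
  by apply: le_trans (ler_norm _) _; apply: le_trans (rx Ox) (ler_norm _).
exists C => [|u Lu]; first by rewrite ltr_wpDl// addr_ge0// sqrtr_ge0.
have -> : norm_rho P u = ipnorm (fun u w => \sum_i ipr (coords u i) (coords w i)) u.
  by rewrite /ipnorm -ip_rhoE.
have [h1 h2] := components_norm ipr_semi_inner Lu; split=> [i|].
  apply: le_trans (lo _ (Lu i)) _; apply: ler_pM; rewrite ?sqrtr_ge0//; exact: h1.
apply: le_trans h2 _; rewrite mulr_sumr; apply: ler_sum => i _.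
by apply: le_trans (hi _ (Lu i)) _; apply: ler_wpM2r => //; exact: sqrtr_ge0.
Qed.

Lemma rho_complete : seminorm_complete (L2v Om) (norm_rho P).
Proof.
have [C C0 HC] := L2norm_rho.
exact: (components_complete sLn (@L2_complete _ _ _ mu _ mO) C0 HC).
Qed.

Lemma H1D_L2v u : H1D P u -> L2v Om u.
Proof. by move=> Hu i; have [[]] := Hu i. Qed.

Lemma norm_rho_H1normv : exists2 C, 0 < C &
  forall u, H1D P u -> norm_rho P u <= C * H1normv Om u.
Proof.
have [C C0 HC] := L2norm_rho.
exists (C * (d%:R + 1)) => [|u Hu]; first by rewrite mulr_gt0// ltr_wpDl.
have [_ h] := HC u (H1D_L2v Hu); apply: le_trans h _; rewrite -mulrA; apply: (ler_wpM2l (ltW C0)).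
apply: (@le_trans _ _ (\sum_(i < d) H1normv Om u)).
  apply: ler_sum => i _; have [h _] := H1norm_le_H1normv (H1D_H1 Hu).
  apply: le_trans (h i); apply: L2norm_le_H1 => //; exact: H1D_H1.
by rewrite sumr_const card_ord -[leLHS]mulr_natl ler_wpM2r ?sqrtr_ge0// lerDl.
Qed.

End setting_spaces.

(** * The bilinear form *)

Section operators_into_L2.
Context (disp : measure_display) (X : measurableType disp) (R : realType).
Context (mu : {measure set X -> \bar R}) (O : set X) (mO : measurable O).
Context (V : lmodType R) (D : set V) (N : V -> R).
Hypothesis sN : seminormed D N.
Local Notation L2O := (L2 mu O).
Local Notation nL2 := (L2norm mu O).
Local Notation operator := (bounded_linear_operator D N L2O nL2).
Implicit Types (Phi Psi : V -> X -> R).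

Let sL := L2_semi_inner mu mO.
Let sLn := L2_seminormed mu mO.
Let Dlin := sn_Dlin sN.

Lemma operator_add Phi Psi : operator Phi -> operator Psi -> operator (fun h => Phi h + Psi h).
Proof.
move=> bP bQ; have [PL Plin _] := bP; have [QL Qlin _] := bQ.
have [M M0 [HM _]] := bounded_linear_dist sN sLn bP.
have [M' M'0 [HM' _]] := bounded_linear_dist sN sLn bQ.
split.
- by move=> h Dh; apply: (sn_DD sLn); [exact: PL|exact: QL].
- move=> a h k Dh Dk.
  rewrite (_ : _ - _ = (Phi (a *: h + k) - (a *: Phi h + Phi k)) +
    (Psi (a *: h + k) - (a *: Psi h + Psi k))); last first.
    by rewrite scalerDr !opprD !addrA; apply/funext => x; rewrite !fctE; ring.
  apply/eqP; rewrite eq_le sqrtr_ge0 andbT.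
  have L1 : L2O (Phi (a *: h + k) - (a *: Phi h + Phi k)).
    by apply: (sn_DB sLn); [exact: (PL _ (Dlin a Dh Dk))|exact: (sn_Dlin sLn a (PL _ Dh) (PL _ Dk))].
  have L2 : L2O (Psi (a *: h + k) - (a *: Psi h + Psi k)).
    by apply: (sn_DB sLn); [exact: (QL _ (Dlin a Dh Dk))|exact: (sn_Dlin sLn a (QL _ Dh) (QL _ Dk))].
  by apply: le_trans (sn_tri sLn L1 L2) _; rewrite (Plin a h k Dh Dk) (Qlin a h k Dh Dk) addr0.
- exists (M + M') => h Dh; apply: le_trans (sn_tri sLn (PL _ Dh) (QL _ Dh)) _.
  by rewrite mulrDl; apply: lerD; [exact: HM|exact: HM'].
Qed.

Lemma operator0 : operator (fun=> 0).
Proof.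
split.
- by move=> h _; exact: (sn_D0 sLn).
- by move=> a h k _ _; rewrite scaler0 addr0 subrr (sn_0 sLn).
- by exists 0 => h _; rewrite (sn_0 sLn) mul0r.
Qed.

Lemma operator_sum (I : finType) (Phi : I -> V -> X -> R) : (forall i, operator (Phi i)) ->
  operator (fun h x => \sum_i Phi i h x).
Proof.
move=> bP; rewrite (_ : (fun h x => _) = (fun h => \sum_i Phi i h)); last first.
  by apply/funext => h; apply/funext => x; rewrite fct_sumE.
elim: (index_enum I) => [|i s IH].
  rewrite (_ : (fun h => _) = fun=> 0); first exact: operator0.
  by apply/funext => h; rewrite big_nil.
rewrite (_ : (fun h => _) = fun h => Phi i h + \sum_(j <- s) Phi j h).
  exact: operator_add.
by apply/funext => h; rewrite big_cons.
Qed.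

Lemma operator_mul c Phi : Linfty mu O c -> operator Phi -> operator (fun h x => c x * Phi h x).
Proof.
move=> Lc bP; have [PL Plin _] := bP.
have [M M0 [HM _]] := bounded_linear_dist sN sLn bP.
have [K K0 HK] := L2norm_Linfty mO Lc.
split.
- by move=> h Dh; exact: (L2_Linfty mO Lc (PL _ Dh)).
- move=> a h k Dh Dk.
  rewrite (_ : _ - _ = fun x => c x * (Phi (a *: h + k) - (a *: Phi h + Phi k)) x); last first.
    by apply/funext => x; rewrite !fctE /GRing.scale/=; ring.
  apply/eqP; rewrite eq_le sqrtr_ge0 andbT.
  have L1 : L2O (Phi (a *: h + k) - (a *: Phi h + Phi k)).
    by apply: (sn_DB sLn); [exact: (PL _ (Dlin a Dh Dk))|exact: (sn_Dlin sLn a (PL _ Dh) (PL _ Dk))].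
  by apply: le_trans (HK _ L1) _; rewrite (Plin a h k Dh Dk) mulr0.
- exists (K * M) => h Dh; apply: le_trans (HK _ (PL _ Dh)) _.
  by rewrite -mulrA; apply: (ler_wpM2l K0); exact: HM.
Qed.

Lemma operator_ip Phi g : operator Phi -> L2O g ->
  bounded_functional D N (fun h => L2ip mu O (Phi h) g).
Proof.
move=> bP Lg; have [PL Plin _] := bP.
have [M M0 [HM _]] := bounded_linear_dist sN sLn bP; split.
  move=> a h k Dh Dk.
  have L1 := PL _ (Dlin a Dh Dk); have L2 := sn_Dlin sLn a (PL _ Dh) (PL _ Dk).
  by rewrite (ip_null sL L1 L2 Lg (Plin a h k Dh Dk)) (ip_linl sL a (PL _ Dh) (PL _ Dk) Lg).
exists (M * nL2 g) => h Dh; apply: le_trans (ip_CSn sL (PL _ Dh) Lg) _.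
by rewrite mulrAC; apply: ler_wpM2r; [exact: sqrtr_ge0|exact: HM].
Qed.

Lemma bounded_functional_sum (I : finType) (l : I -> V -> R) :
  (forall i, bounded_functional D N (l i)) -> bounded_functional D N (fun h => \sum_i l i h).
Proof.
move=> bl; rewrite (_ : (fun h => _) = \sum_i l i); last by apply/funext => h; rewrite fct_sumE.
exact: (sn_Dsum (dual_seminormed sN)).
Qed.

Lemma bounded_functional_eq (l l' : V -> R) : bounded_functional D N l ->
  (forall h, D h -> l' h = l h) -> bounded_functional D N l'.
Proof.
move=> [lin [M HM]] e; split; last by exists M => v Dv; rewrite e//; exact: HM.
by move=> a v w Dv Dw; rewrite (e _ Dv) (e _ Dw) (e _ (Dlin a Dv Dw)); exact: lin.
Qed.

End operators_into_L2.

Section bilinear_form.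
Context (R : realType) (d : nat) (P : setting R d).
Local Notation E := 'rV[R]_d.
Local Notation Om := (Om P).
Local Notation mu := (@lebesgue_rV R d).
Local Notation V := ((E -> 'rV[R]_d) * (E -> R))%type.

Let oOm := @setting_open R d P.
Let bOm := @setting_bounded R d P.
Let mO := Om_meas oOm.
Let sU := H1D_seminormed P.
Let sG := H1G_seminormed P.

Definition state : set V := [set h | H1D P h.1 /\ H1G P h.2].
Definition state_norm (h : V) : R := H1normv Om h.1 + H1norm Om h.2.

Lemma state_seminormed : seminormed state state_norm.
Proof.
split.
- by split; [exact: (sn_D0 sU)|exact: (sn_D0 sG)].
- by move=> a [u p] [w q] [/= Hu Hp] [/= Hw Hq]; split; [exact: (sn_Dlin sU)|exact: (sn_Dlin sG)].
- move=> a [u p] [/= Hu Hp].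
  by rewrite /state_norm/= (sn_Z sU a Hu) (sn_Z sG a Hp) mulrDr.
- move=> [u p] [w q] [/= Hu Hp] [/= Hw Hq]; rewrite /state_norm addrACA.
  exact: lerD (sn_tri sU Hu Hw) (sn_tri sG Hp Hq).
Qed.

Let sS := state_seminormed.
Local Notation operator := (bounded_linear_operator state state_norm (L2 mu Om) (L2norm mu Om)).

Let H1D_H1 u i : H1D P u -> H1 Om (coords u i).
Proof. by move=> Hu; have [] := Hu i. Qed.

Let jacobian_operator i j : operator (fun h => partial Om j (coords h.1 i)).
Proof.
split.
- by move=> [u p] [/= Hu _]; apply: partial_L2; exact: H1D_H1.
- move=> a [u p] [w q] [/= Hu _] [/= Hw _]; rewrite coords_lin.
  by apply: partial_lin; [exact: oOm|exact: bOm|exact: H1D_H1|exact: H1D_H1].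
- exists 1 => -[u p] [/= Hu [Hp _]]; rewrite mul1r /state_norm/=.
  apply: (@le_trans _ _ (H1normv Om u)); last by rewrite lerDl sqrtr_ge0.
  have [h _] := @H1norm_le_H1normv R d P u (fun k => H1D_H1 k Hu); apply: le_trans (h i).
  by apply: partial_le_H1; [exact: oOm|exact: bOm|exact: H1D_H1].
Qed.

Let grad_operator j : operator (fun h => partial Om j h.2).
Proof.
split.
- by move=> [u p] [/= _ [Hp _]]; exact: partial_L2.
- by move=> a [u p] [w q] [/= _ [Hp _]] [/= _ [Hq _]]; apply: partial_lin.
- exists 1 => -[u p] [/= Hu [Hp _]]; rewrite mul1r /state_norm/=.
  apply: (@le_trans _ _ (H1norm Om p)); last by rewrite lerDr sqrtr_ge0.
  exact: partial_le_H1.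
Qed.

Let Linfty_cst c : Linfty mu Om (cst c).
Proof. by split; [exact: measurable_cst|exists `|c|; apply: aeW]. Qed.

Lemma strain_operator i j : operator (fun h x => strain Om h.1 x i j).
Proof.
have := operator_mul mO sS (Linfty_cst 2^-1)
  (operator_add mO sS (jacobian_operator i j) (jacobian_operator j i)).
by congr (bounded_linear_operator _ _ _ _ _); apply/funext => h; apply/funext => x; rewrite !mxE.
Qed.

Definition stress (h : V) (x : E) : 'M[R]_d :=
  apply4 (Cc P x) (strain Om h.1 x) + apply3 (Ee P x) (grad Om h.2 x).

(** The electric displacement up to sign, not the mechanical displacement u. *)
Definition displacement (h : V) (x : E) : 'rV[R]_d :=
  - apply3_tr (Ee P x) (strain Om h.1 x) + apply2 (kappa P x) (grad Om h.2 x).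

Lemma stress_operator i j : operator (fun h x => stress h x i j).
Proof.
have := operator_add mO sS
  (operator_sum mO sS (fun k => operator_sum mO sS (fun l =>
     operator_mul mO sS (Cc_Linfty P i j k l) (strain_operator k l))))
  (operator_sum mO sS (fun k => operator_mul mO sS (Ee_Linfty P i j k) (grad_operator k))).
by congr (bounded_linear_operator _ _ _ _ _); apply/funext => h; apply/funext => x; rewrite !mxE.
Qed.

Lemma displacement_operator k : operator (fun h x => displacement h x 0 k).
Proof.
have := operator_add mO sS
  (operator_sum mO sS (fun i => operator_sum mO sS (fun j =>
     operator_mul mO sS (Linfty_cst (- 1)) (operator_mul mO sS (Ee_Linfty P i j k) (strain_operator i j)))))
  (operator_sum mO sS (fun l => operator_mul mO sS (kappa_Linfty P k l) (grad_operator l))).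
congr (bounded_linear_operator _ _ _ _ _); apply/funext => h; apply/funext => x.
rewrite !mxE !fctE -sumrN; congr (_ + _); apply: eq_bigr => i _; last by rewrite !mxE mulrC.
by rewrite -sumrN; apply: eq_bigr => j _; rewrite /cst; ring.
Qed.

(** Continuity in the state for a fixed test pair is what the passage to the limit in the equation
    uses. Both integrals are finite sums of L2 products of operators with fixed functions. *)
Lemma bilinear_form_bounded w phi : H1D P w -> H1G P phi ->
  bounded_functional state state_norm (fun h => bilinear_form P h.1 h.2 w phi).
Proof.
move=> Hw Hphi; have Dw : state (w, phi) by [].
have Le i j : L2 mu Om (fun x => strain Om w x i j).
  by have [h _ _] := strain_operator i j; exact: (h _ Dw).
have Lg k : L2 mu Om (partial Om k phi) by apply: partial_L2; case: Hphi.
have b1 := bounded_functional_sum sS (fun i => bounded_functional_sum sS (fun j =>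
  operator_ip mO sS (stress_operator i j) (Le i j))).
have b2 := bounded_functional_sum sS (fun k => operator_ip mO sS (displacement_operator k) (Lg k)).
apply: (bounded_functional_eq sS (bounded_functional_lin sS 1 b1 b2)) => h Dh.
rewrite /bilinear_form !fctE scale1r; congr (_ + _).
  have ij i j : aeint mu Om (fun x => stress h x i j * strain Om w x i j).
    by have [L _ _] := stress_operator i j; exact: (L2_mul_aeint mO (L _ Dh) (Le i j)).
  have [_ e] := aeint_sum mO (index_enum 'I_d) (fun i => (aeint_sum mO (index_enum 'I_d) (ij i)).1).
  apply: etrans e _; apply: eq_bigr => i _.
  by have [_] := aeint_sum mO (index_enum 'I_d) (ij i).
have kk k : aeint mu Om (fun x => displacement h x 0 k * partial Om k phi x).
  by have [L _ _] := displacement_operator k; exact: (L2_mul_aeint mO (L _ Dh) (Lg k)).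
by have [_] := aeint_sum mO (index_enum 'I_d) kk.
Qed.

End bilinear_form.

(** * Boundedness of the solution operator *)

Section time_transfer.
Context (R : realType) (T : R) (V W : lmodType R).
Context (D : set V) (N : V -> R) (D' : set W) (N' : W -> R).
Hypotheses (sN : seminormed D N).

Lemma C0_time_map (A : V -> W) C f : 0 <= C -> (forall v, D v -> D' (A v)) ->
  (forall v w, D v -> D w -> N' (A v - A w) <= C * N (v - w)) ->
  C0_time T D N f -> C0_time T D' N' (fun t => A (f t)).
Proof.
move=> C0 DA HA [Df cf]; split => [t tT|t tT e e0]; first exact/DA/Df.
have C1 : 0 < C + 1 by rewrite ltr_wpDl.
have [del del0 H] := cf t tT _ (divr_gt0 e0 C1).
exists del => // s sT st; apply: le_lt_trans (HA _ _ (Df s sT) (Df t tT)) _.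
have := H s sT st; rewrite ltr_pdivlMr// mulrC; apply: le_lt_trans.
apply: ler_wpM2r; last by rewrite lerDl.
by apply: (sn_ge0 sN); apply: (sn_DB sN); exact: Df.
Qed.

(** Replaces a curve by one at distance 0; this occurs for functionals that agree on [H1D] but not
    as functions of all vector fields. *)
Lemma C0_time_null f g : C0_time T D N f -> (forall t, t \in `[0, T] -> D (g t)) ->
  (forall t, t \in `[0, T] -> N (f t - g t) = 0) -> C0_time T D N g.
Proof.
move=> [Df cf] Dg fg; split => // t tT e e0; have [del del0 H] := cf t tT e e0.
exists del => // s sT st; apply: le_lt_trans (H s sT st).
apply: le_trans (sn_dist sN (Dg s sT) (Df s sT) (Dg t tT)) _.
rewrite (sn_sym sN (Dg s sT) (Df s sT)) fg// add0r.
apply: le_trans (sn_dist sN (Df s sT) (Df t tT) (Dg t tT)) _.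
by rewrite fg// addr0.
Qed.

Lemma time_derivative_null f f' g : (forall t, t \in `[0, T] -> D (f t)) ->
  (forall t, t \in `[0, T] -> D (f' t)) -> (forall t, t \in `[0, T] -> D (g t)) ->
  (forall t, t \in `[0, T] -> N (f t - g t) = 0) ->
  time_derivative T N f f' -> time_derivative T N g f'.
Proof.
move=> Df Df' Dg fg H t tT e e0; have [del del0 Hd] := H t tT e e0.
exists del => // s sT st sd; apply: le_lt_trans (Hd s sT st sd).
have Dgst := sn_DB sN (Dg s sT) (Dg t tT); have Dfst := sn_DB sN (Df s sT) (Df t tT).
have fgst : N ((g s - g t) - (f s - f t)) = 0.
  have Dd := sn_DB sN Dgst Dfst; apply/eqP; rewrite eq_le (sn_ge0 sN Dd) andbT.
  rewrite (_ : _ - _ = (f t - g t) - (f s - g s)); last first.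
    by rewrite !opprB [g s - g t]addrC addrACA [- g t + _]addrC.
  apply: le_trans (sn_tri sN (sn_DB sN (Df t tT) (Dg t tT)) (sn_DN sN (sn_DB sN (Df s sT) (Dg s sT)))) _.
  by rewrite (sn_opp sN (sn_DB sN (Df s sT) (Dg s sT))) !fg// addr0.
rewrite le_eqVlt; apply/orP; left; apply/eqP; apply: (sn_null sN).
- by apply: (sn_DB sN); [exact: (sn_DZ sN _ Dgst)|exact: Df'].
- by apply: (sn_DB sN); [exact: (sn_DZ sN _ Dfst)|exact: Df'].
rewrite opprB addrA subrK -scalerBr (sn_Z sN); first by rewrite fgst mulr0.
exact: (sn_DB sN Dgst Dfst).
Qed.

End time_transfer.

Section solutions.
Context (R : realType) (d : nat) (P : setting R d).
Local Notation E := 'rV[R]_d.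
Local Notation Om := (Om P).
Local Notation T := (Tf P).
Local Notation nU := (H1normv Om).
Local Notation nG := (H1norm Om).
Local Notation nH := (@norm_HD' R d P).
Local Notation nR := (norm_rho P).

Let T0 : 0 < T := Tf_gt0 P.
Let sU := H1D_seminormed P.
Let cU := @H1D_complete R d P.
Let sG := H1G_seminormed P.
Let cG := @H1G_complete R d P.
Let sR := rho_seminormed P.
Let cR := @rho_complete R d P.
Let sV := HD'_seminormed P.
Let cV := @HD'_complete R d P.
Let sB : semi_inner (L2b0 Om) (ipb Om) := L2b0_semi_inner P.
Let sBf := L2_semi_inner (@surface_measure R d) (boundary_measurable P).
Definition Zspace_semi_inner : semi_inner (Zspace P) (ipZ T (L2b0 Om) (ipb Om)) :=
  Zgen_semi_inner T0 sB.
Let sZ := Zspace_semi_inner.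

Lemma ZnormE : Znorm P = ipnorm (ipZ T (L2b0 Om) (ipb Om)).
Proof.
apply/funext => z; congr (Num.sqrt (Rintegral _ _ _)); apply/funext => t.
by rewrite sqr_sqrtr// Rintegral_ge0// => x _; exact: sqr_ge0.
Qed.

Lemma Zspace_seminormed : seminormed (Zspace P) (Znorm P).
Proof. by rewrite ZnormE; exact: (semi_inner_seminormed sZ). Qed.
Let sZn := Zspace_seminormed.

Lemma Zspace_complete : seminorm_complete (Zspace P) (Znorm P).
Proof. by rewrite ZnormE; exact: (Zgen_complete T0 sB (@L2b0_complete R d P)). Qed.

Lemma Zspace_sup z t : Zspace P z -> t \in `[0, T] ->
  normb Om (z t) <= Num.sqrt T * Znorm P z.
Proof. by move=> Zz tT; rewrite ZnormE; exact: (Zgen_sup T0 sB Zz tT). Qed.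

Lemma rho_functional u : L2v Om u -> HD' P (ip_rho P u).
Proof.
move=> Lu; have [C C0 HC] := norm_rho_H1normv P; split.
  move=> a v w Hv Hw.
  exact: (ip_linr (rho_semi_inner P) a (H1D_L2v Hv) (H1D_L2v Hw) Lu).
exists (nR u * C) => v Hv; apply: le_trans (ip_CSn (rho_semi_inner P) Lu (H1D_L2v Hv)) _.
by rewrite -mulrA; apply: ler_wpM2l; [exact: sqrtr_ge0|exact: HC].
Qed.

Lemma rho_functional_dist : exists2 C, 0 <= C & forall u w, L2v Om u -> L2v Om w ->
  nH (ip_rho P u - ip_rho P w) <= C * nR (u - w).
Proof.
have [C C0 HC] := norm_rho_H1normv P; exists C; first exact: ltW.
move=> u w Lu Lw; apply: (dual_norm_le sU) => [|v Hv].
  by apply: mulr_ge0; [exact: ltW|exact: sqrtr_ge0].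
have -> : (ip_rho P u - ip_rho P w) v = ip_rho P (u - w) v.
  by rewrite (ipBl (rho_semi_inner P) Lu Lw (H1D_L2v Hv)).
apply: le_trans (ip_CSn (rho_semi_inner P) (sn_DB sR Lu Lw) (H1D_L2v Hv)) _.
by rewrite [C * _]mulrC -mulrA; apply: ler_wpM2l; [exact: sqrtr_ge0|exact: HC].
Qed.

Lemma HD'_norm_null l l' : HD' P l -> HD' P l' -> (forall w, H1D P w -> l w = l' w) ->
  nH (l - l') = 0.
Proof.
move=> bl bl' e; apply/eqP; rewrite eq_le (dual_norm_ge0 sU (sn_DB sV bl bl')) andbT.
apply: (dual_norm_le sU) => // w Hw.
by rewrite (_ : (l - l') w = l w - l' w)// e// subrr normr0 mul0r.
Qed.

(** [solution] with its existential witnesses as parameters, so that combinations and limits of the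
    derivatives can be named. *)
Definition weak_solution (z : R -> E -> R) (u : R -> E -> 'rV[R]_d) (psi : R -> E -> R)
    (u1 : R -> E -> 'rV[R]_d) (v1 v2 : R -> (E -> 'rV[R]_d) -> R) : Prop :=
  [/\ C0_time T (H1D P) nU u,
      C1_time T (L2v Om) nR u u1,
      C2_time T (HD' P) nH (fun t => ip_rho P (u t)) v1 v2 &
      C0_time T (H1G P) nG psi] /\
  [/\ forall t, t \in `[0, T] -> forall w phi, H1D P w -> H1G P phi ->
        v2 t w + bilinear_form P (u t) (psi t) w phi = - ipb Om (z t) (gam P phi),
      nU (u 0) = 0 &
      nR (u1 0) = 0].

Let gam_L2b phi : H1G P phi -> L2b Om (gam P phi).
Proof. by move=> [Hphi _]; have [[h _ _] _] := gam_trace P; exact: h. Qed.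

Let Z_L2b z t : Zspace P z -> t \in `[0, T] -> L2b Om (z t).
Proof. by move=> [[h _] _ _] tT; have [] := h t tT. Qed.

Let zT : 0 \in `[0, T]. Proof. by rewrite in_itv/= lexx ltW. Qed.

Lemma weak_solution_lin a z z' u u' psi psi' u1 u1' v1 v1' v2 v2' : Zspace P z -> Zspace P z' ->
  weak_solution z u psi u1 v1 v2 -> weak_solution z' u' psi' u1' v1' v2' ->
  weak_solution (a *: z + z') (fun t => a *: u t + u' t) (fun t => a *: psi t + psi' t)
    (fun t => a *: u1 t + u1' t) (fun t => a *: v1 t + v1' t) (fun t => a *: v2 t + v2' t).
Proof.
move=> Zz Zz' [[cu [cr cu1 du] [[cl cv1 dl] [_ cv2 dv]] cpsi] [eq u00 u10]]
  [[cu' [cr' cu1' du'] [[cl' cv1' dl'] [_ cv2' dv']] cpsi'] [eq' u00' u10']].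
have Du := cu.1; have Du' := cu'.1; have Dr := cr.1; have Dr' := cr'.1.
have Du1 := cu1.1; have Du1' := cu1'.1; have Dl := cl.1; have Dl' := cl'.1.
have Dv1 := cv1.1; have Dv1' := cv1'.1; have Dv2 := cv2.1; have Dv2' := cv2'.1.
have Dlu t : t \in `[0, T] -> HD' P (ip_rho P (a *: u t + u' t)).
  by move=> tT; apply: rho_functional; exact: (sn_Dlin sR a (Dr t tT) (Dr' t tT)).
(* Off the space L2 the integral in [ip_rho] need not be additive, so the two functionals are
   compared on [H1D] only, where equality means dual distance 0. *)
have nlu t : t \in `[0, T] ->
    nH ((a *: ip_rho P (u t) + ip_rho P (u' t)) - ip_rho P (a *: u t + u' t)) = 0.
  move=> tT; apply: HD'_norm_null => [||w Hw].
  - exact: (sn_Dlin sV a (Dl t tT) (Dl' t tT)).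
  - exact: Dlu.
  - exact: esym (ip_linl (rho_semi_inner P) a (Dr t tT) (Dr' t tT) (H1D_L2v Hw)).
have clu := C0_time_lin sV a cl cl'.
split; split.
- exact: (C0_time_lin sU).
- split; [exact: (C0_time_lin sR)|exact: (C0_time_lin sR)|].
  exact: (time_derivative_lin sR).
- split; split.
  + exact: (C0_time_null sV clu Dlu nlu).
  + exact: (C0_time_lin sV).
  + exact: (time_derivative_null sV clu.1 (C0_time_lin sV a cv1 cv1').1 Dlu nlu
      (time_derivative_lin sV a Dl Dv1 Dl' Dv1' dl dl')).
  + exact: (C0_time_lin sV).
  + exact: (C0_time_lin sV).
  + exact: (time_derivative_lin sV).
- exact: (C0_time_lin sG).
- move=> t tT w phi Hw Hphi.
  have [blin _] := bilinear_form_bounded Hw Hphi.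
  have Ds : state P (u t, psi t) by split; [exact: Du|exact: cpsi.1].
  have Ds' : state P (u' t, psi' t) by split; [exact: Du'|exact: cpsi'.1].
  have hb : bilinear_form P (a *: u t + u' t) (a *: psi t + psi' t) w phi =
      a * bilinear_form P (u t) (psi t) w phi + bilinear_form P (u' t) (psi' t) w phi.
    exact: (blin a _ _ Ds Ds').
  have hz : ipb Om ((a *: z + z') t) (gam P phi) = a * ipb Om (z t) (gam P phi) + ipb Om (z' t) (gam P phi).
    exact: (ip_linl sBf a (Z_L2b Zz tT) (Z_L2b Zz' tT) (gam_L2b Hphi)).
  have e1 := eq t tT w phi Hw Hphi; have e2 := eq' t tT w phi Hw Hphi.
  have alg (x x' b b' c c' : R) : x + b = - c -> x' + b' = - c' ->
      a * x + x' + (a * b + b') = - (a * c + c').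
    by move=> h h'; rewrite opprD -mulrN -h -h'; ring.
  by rewrite hb hz; exact: alg e1 e2.
- apply/eqP; rewrite eq_le sqrtr_ge0 andbT.
  apply: le_trans (sn_tri sU (sn_DZ sU a (Du 0 zT)) (Du' 0 zT)) _.
  by rewrite (sn_Z sU a (Du 0 zT)) u00 u00' mulr0 addr0.
- apply/eqP; rewrite eq_le sqrtr_ge0 andbT.
  apply: le_trans (sn_tri sR (sn_DZ sR a (Du1 0 zT)) (Du1' 0 zT)) _.
  by rewrite (sn_Z sR a (Du1 0 zT)) u10 u10' mulr0 addr0.
Qed.

Lemma weak_solution0 : weak_solution 0 (fun=> 0) (fun=> 0) (fun=> 0) (fun=> 0) (fun=> 0).
Proof.
have Dl : HD' P (ip_rho P 0) by apply: rho_functional; exact: (sn_D0 sR).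
have d0 (V : lmodType R) (D : set V) (N : V -> R) (v : V) : seminormed D N ->
    time_derivative T N (fun=> v) (fun=> 0).
  move=> sN t tT e e0; exists 1 => // s _ _ _.
  by rewrite subrr scaler0 subr0 (sn_0 sN).
split; split.
- exact: (C0_time_cst T sU (sn_D0 sU)).
- split; [exact: (C0_time_cst T sR (sn_D0 sR))|exact: (C0_time_cst T sR (sn_D0 sR))|exact: (d0 _ _ _ _ sR)].
- split; split.
  + exact: (C0_time_cst T sV Dl).
  + exact: (C0_time_cst T sV (sn_D0 sV)).
  + exact: (d0 _ _ _ _ sV).
  + exact: (C0_time_cst T sV (sn_D0 sV)).
  + exact: (C0_time_cst T sV (sn_D0 sV)).
  + exact: (d0 _ _ _ _ sV).
- exact: (C0_time_cst T sG (sn_D0 sG)).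
- move=> t tT w phi Hw Hphi.
  have b0 : bilinear_form P 0 0 w phi = 0.
    have b := bilinear_form_bounded Hw Hphi; have sS := state_seminormed P.
    have := functionalZ sS 0 b (sn_D0 sS); rewrite scale0r mul0r; exact.
  rewrite b0 addr0.
  by rewrite (_ : ipb Om ((0 : R -> E -> R) t) (gam P phi) = 0) ?oppr0//; exact: (ip0l sBf (gam_L2b Hphi)).
- exact: (sn_0 sU).
- exact: (sn_0 sR).
Qed.

Lemma weak_solution_sum (z : nat -> R -> E -> R) u psi u1 v1 v2 n : (forall k, Zspace P (z k)) ->
  (forall k, weak_solution (z k) (u k) (psi k) (u1 k) (v1 k) (v2 k)) ->
  weak_solution (\sum_(k < n) z k) (fun t => \sum_(k < n) u k t) (fun t => \sum_(k < n) psi k t)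
    (fun t => \sum_(k < n) u1 k t) (fun t => \sum_(k < n) v1 k t) (fun t => \sum_(k < n) v2 k t).
Proof.
move=> Zz Hs; have ZS m : Zspace P (\sum_(k < m) z k) by exact: (sn_Dsum sZn).
elim: n => [|n IH].
  have f0 (V : lmodType R) (f : nat -> R -> V) :
      (fun t => \sum_(k < 0) f k t) = fun=> 0 by apply/funext => t; rewrite big_ord0.
  by rewrite big_ord0 !f0; exact: weak_solution0.
have fS (V : lmodType R) (f : nat -> R -> V) :
    (fun t => \sum_(k < n.+1) f k t) = fun t => 1 *: f n t + \sum_(k < n) f k t.
  by apply/funext => t; rewrite big_ord_recr/= scale1r addrC.
have zS : \sum_(k < n.+1) z k = 1 *: z n + \sum_(k < n) z k.
  by rewrite big_ord_recr/= scale1r addrC.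
rewrite zS !fS; exact: (weak_solution_lin 1 (Zz n) (ZS n) (Hs n) IH).
Qed.

(** Plays the role of p(z) <= M in Zabreiko's lemma. All five norms are bounded, so that the series
    of solutions, potentials and derivatives converge uniformly in time together. *)
Definition bounded_solution (z : R -> E -> R) (M : R) : Prop :=
  exists u psi u1 v1 v2, weak_solution z u psi u1 v1 v2 /\
    forall t, t \in `[0, T] ->
      [/\ nU (u t) <= M, nG (psi t) <= M, nR (u1 t) <= M, nH (v1 t) <= M & nH (v2 t) <= M].

(** The five series have uniform limits by completeness of the spaces; [time_derivative_lim] keeps
    the derivative relations and continuity of the forms keeps the equation. *)
Lemma bounded_solution_series (z_ : nat -> R -> E -> R) z M : 0 < M ->
  (forall k, Zspace P (z_ k)) -> Zspace P z ->
  (forall k, bounded_solution (z_ k) (M * 2^-1 ^+ k)) ->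
  (forall n, Znorm P (\sum_(k < n) z_ k - z) < M * 2^-1 ^+ n) -> bounded_solution z (2 * M).
Proof.
move=> M0 Zz_ Zz bs zs.
have /choice[u_ /choice[p_ /choice[u1_ /choice[v1_ /choice[v2_ Hs]]]]] :
    forall k, exists u psi u1 v1 v2, weak_solution (z_ k) u psi u1 v1 v2 /\
    forall t, t \in `[0, T] ->
      [/\ nU (u t) <= M * 2^-1 ^+ k, nG (psi t) <= M * 2^-1 ^+ k, nR (u1 t) <= M * 2^-1 ^+ k,
          nH (v1 t) <= M * 2^-1 ^+ k & nH (v2 t) <= M * 2^-1 ^+ k] := bs.
have Hw k := (Hs k).1; have Hb k := (Hs k).2.
have cu_ k : C0_time T (H1D P) nU (u_ k) by case: (Hw k) => [[h _ _ _] _].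
have cp_ k : C0_time T (H1G P) nG (p_ k) by case: (Hw k) => [[_ _ _ h] _].
have cu1_ k : C0_time T (L2v Om) nR (u1_ k) by case: (Hw k) => [[_ [_ h _] _ _] _].
have cv1_ k : C0_time T (HD' P) nH (v1_ k) by case: (Hw k) => [[_ _ [[_ h _] _] _] _].
have cv2_ k : C0_time T (HD' P) nH (v2_ k) by case: (Hw k) => [[_ _ [_ [_ h _]] _] _].
have [u cu hu] := C0_time_series sU cU M0 cu_
  (fun k t tT => let: And5 h _ _ _ _ := Hb k t tT in h).
have [p cp hp] := C0_time_series sG cG M0 cp_
  (fun k t tT => let: And5 _ h _ _ _ := Hb k t tT in h).
have [u1 cu1 hu1] := C0_time_series sR cR M0 cu1_
  (fun k t tT => let: And5 _ _ h _ _ := Hb k t tT in h).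
have [v1 cv1 hv1] := C0_time_series sV cV M0 cv1_
  (fun k t tT => let: And5 _ _ _ h _ := Hb k t tT in h).
have [v2 cv2 hv2] := C0_time_series sV cV M0 cv2_
  (fun k t tT => let: And5 _ _ _ _ h := Hb k t tT in h).
have sol n := weak_solution_sum n Zz_ Hw.
pose U n t := \sum_(k < n) u_ k t; pose U1 n t := \sum_(k < n) u1_ k t.
pose V1 n t := \sum_(k < n) v1_ k t; pose V2 n t := \sum_(k < n) v2_ k t.
pose Ps n t := \sum_(k < n) p_ k t.
have cU' n : C0_time T (H1D P) nU (U n) by case: (sol n) => [[h _ _ _] _].
have cP n : C0_time T (H1G P) nG (Ps n) by case: (sol n) => [[_ _ _ h] _].
have cUr n : C0_time T (L2v Om) nR (U n) by case: (sol n) => [[_ [h _ _] _ _] _].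
have cU1 n : C0_time T (L2v Om) nR (U1 n) by case: (sol n) => [[_ [_ h _] _ _] _].
have dU n : time_derivative T nR (U n) (U1 n) by case: (sol n) => [[_ [_ _ h] _ _] _].
have cL n : C0_time T (HD' P) nH (fun t => ip_rho P (U n t)) by case: (sol n) => [[_ _ [[h _ _] _] _] _].
have cV1 n : C0_time T (HD' P) nH (V1 n) by case: (sol n) => [[_ _ [[_ h _] _] _] _].
have dL n : time_derivative T nH (fun t => ip_rho P (U n t)) (V1 n) by case: (sol n) => [[_ _ [[_ _ h] _] _] _].
have cV2 n : C0_time T (HD' P) nH (V2 n) by case: (sol n) => [[_ _ [_ [_ h _]] _] _].
have dV n : time_derivative T nH (V1 n) (V2 n) by case: (sol n) => [[_ _ [_ [_ _ h]] _] _].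
have [C C0 HC] := norm_rho_H1normv P; have C0' := ltW C0.
have [C' C'0 HC'] := rho_functional_dist.
have cur : C0_time T (L2v Om) nR u.
  apply: (C0_time_map (A := id) sU C0' _ _ cu); first exact: H1D_L2v.
  by move=> v w Hv Hw'; apply: HC; exact: (sn_DB sU).
have cul : C0_time T (HD' P) nH (fun t => ip_rho P (u t)).
  by apply: (C0_time_map (A := ip_rho P) sR C'0 _ _ cur); [exact: rho_functional|exact: HC'].
have hur n t : t \in `[0, T] -> nR (U n t - u t) <= C * (2 * M * 2^-1 ^+ n).
  move=> tT; apply: le_trans (HC _ (sn_DB sU ((cU' n).1 t tT) (cu.1 t tT))) _.
  by apply: (ler_wpM2l C0'); exact: hu.
have hul n t : t \in `[0, T] -> nH (ip_rho P (U n t) - ip_rho P (u t)) <= C' * (C * (2 * M * 2^-1 ^+ n)).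
  move=> tT; apply: le_trans (HC' _ _ ((cUr n).1 t tT) (cur.1 t tT)) _.
  by apply: (ler_wpM2l C'0); exact: hur.
have unif (a b : nat -> R -> R) (A B : R) :
    (forall n t, t \in `[0, T] -> a n t <= A * 2^-1 ^+ n) ->
    (forall n t, t \in `[0, T] -> b n t <= B * 2^-1 ^+ n) ->
    forall e, 0 < e -> exists n0, forall n, (n0 <= n)%N ->
      forall t, t \in `[0, T] -> a n t < e /\ b n t < e.
  move=> ha hb e e0; have [n1 H1] := half_exp_small A e0; have [n2 H2] := half_exp_small B e0.
  exists (maxn n1 n2) => n; rewrite geq_max => /andP[h1 h2] t tT.
  by split; [apply: le_lt_trans (ha n t tT) _; exact: H1|apply: le_lt_trans (hb n t tT) _; exact: H2].
have zB n t : t \in `[0, T] -> normb Om ((\sum_(k < n) z_ k) t - z t) <= Num.sqrt T * (M * 2^-1 ^+ n).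
  move=> tT; have ZB : Zspace P (\sum_(k < n) z_ k - z).
    by apply: (sn_DB sZn) => //; exact: (sn_Dsum sZn).
  apply: le_trans (Zspace_sup ZB tT) _.
  by apply: ler_wpM2l; [exact: sqrtr_ge0|exact: ltW].
exists u, p, u1, v1, v2; split; last first.
  (* The bound 2 M is the convergence rate at n = 0, where the partial sum is empty. *)
  have h0 (V : lmodType R) (D : set V) (N : V -> R) (f_ : nat -> R -> V) f t : seminormed D N ->
      D (f t) -> N (\sum_(k < 0) f_ k t - f t) <= 2 * M * 2^-1 ^+ 0 -> N (f t) <= 2 * M.
    by move=> sN Df; rewrite big_ord0 sub0r (sn_opp sN Df) expr0 mulr1.
  move=> t tT; split.
  - exact: (h0 _ _ _ _ _ _ sU (cu.1 t tT) (hu 0%N t tT)).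
  - exact: (h0 _ _ _ _ _ _ sG (cp.1 t tT) (hp 0%N t tT)).
  - exact: (h0 _ _ _ _ _ _ sR (cu1.1 t tT) (hu1 0%N t tT)).
  - exact: (h0 _ _ _ _ _ _ sV (cv1.1 t tT) (hv1 0%N t tT)).
  - exact: (h0 _ _ _ _ _ _ sV (cv2.1 t tT) (hv2 0%N t tT)).
split; split.
- exact: cu.
- split; [exact: cur|exact: cu1|].
  apply: (time_derivative_lim sR cUr cU1 dU cur cu1).
  by apply: (unif _ _ (C * (2 * M)) (2 * M)) => n t tT; [rewrite -mulrA; exact: hur|exact: hu1].
- split; split; [exact: cul|exact: cv1| |exact: cv1|exact: cv2|].
  + apply: (time_derivative_lim sV cL cV1 dL cul cv1).
    by apply: (unif _ _ (C' * (C * (2 * M))) (2 * M)) => n t tT; [rewrite -!mulrA; have := hul n t tT; rewrite -!mulrA|exact: hv1].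
  + apply: (time_derivative_lim sV cV1 cV2 dV cv1 cv2).
    by apply: (unif _ _ (2 * M) (2 * M)) => n t tT; [exact: hv1|exact: hv2].
- exact: cp.
- move=> t tT w phi Hw' Hphi.
  have sS := state_seminormed P; have b := bilinear_form_bounded Hw' Hphi.
  have Lg := gam_L2b Hphi; have bs' := b; have [_ [MB HMB]] := bs'.
  have Dh : state P (u t, p t) by split; [exact: cu.1|exact: cp.1].
  have Dh_ n : state P (U n t, Ps n t) by split; [exact: (cU' n).1|exact: (cP n).1].
  (* The residual of the limit in the equation differs from that of the n-th partial sum, which is
     0, by at most K 2^-n; the summands come from v2, the bilinear form and the data. *)
  pose K := 2 * M * nU w + `|MB| * (2 * M + 2 * M) + Num.sqrt T * M * normb Om (gam P phi).
  have key n : `|v2 t w + bilinear_form P (u t) (p t) w phi + ipb Om (z t) (gam P phi)| <= K * 2^-1 ^+ n.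
    have e1 : `|V2 n t w - v2 t w| <= 2 * M * 2^-1 ^+ n * nU w.
      have := dual_norm_apply sU (sn_DB sV ((cV2 n).1 t tT) (cv2.1 t tT)) Hw'.
      move/le_trans; apply; apply: ler_wpM2r; [exact: sqrtr_ge0|exact: hv2].
    have e2 : `|bilinear_form P (U n t) (Ps n t) w phi - bilinear_form P (u t) (p t) w phi| <=
        `|MB| * (2 * M * 2^-1 ^+ n + 2 * M * 2^-1 ^+ n).
      have := HMB _ (sn_DB sS (Dh_ n) Dh).
      rewrite (bounded_functional_B sS b (Dh_ n) Dh) => /le_trans; apply.
      apply: (@le_trans _ _ (`|MB| * state_norm P ((U n t, Ps n t) - (u t, p t)))).
        by apply: ler_wpM2r; [exact: (sn_ge0 sS (sn_DB sS (Dh_ n) Dh))|exact: ler_norm].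
      by apply: ler_wpM2l => //; exact: lerD (hu n t tT) (hp n t tT).
    have Zn : Zspace P (\sum_(k < n) z_ k) by exact: (sn_Dsum sZn).
    have e3 : `|ipb Om ((\sum_(k < n) z_ k) t) (gam P phi) - ipb Om (z t) (gam P phi)| <=
        Num.sqrt T * (M * 2^-1 ^+ n) * normb Om (gam P phi).
      rewrite /ipb -(ipBl sBf (Z_L2b Zn tT) (Z_L2b Zz tT) Lg).
      have LB := sn_DB (semi_inner_seminormed sBf) (Z_L2b Zn tT) (Z_L2b Zz tT).
      apply: le_trans (ip_CSn sBf LB Lg) _.
      by apply: ler_wpM2r; [exact: sqrtr_ge0|exact: zB].
    have [_ [eq _ _]] := sol n.
    have e0 : V2 n t w + bilinear_form P (U n t) (Ps n t) w phi = - ipb Om ((\sum_(k < n) z_ k) t) (gam P phi).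
      exact: eq.
    have alg (x x' y y' c c' a1 a2 a3 q : R) : x + y = - c -> `|x - x'| <= a1 * q ->
        `|y - y'| <= a2 * q -> `|c - c'| <= a3 * q -> `|x' + y' + c'| <= (a1 + a2 + a3) * q.
      move=> h h1 h2 h3; rewrite (_ : x' + y' + c' = - ((x - x') + (y - y') + (c - c'))); last first.
        by move: h; lra.
      rewrite normrN 2!mulrDl; apply: le_trans (ler_normD _ _) _; apply: lerD => //.
      by apply: le_trans (ler_normD _ _) _; exact: lerD.
    apply: (alg _ _ _ _ _ _ _ _ _ _ e0).
    + by rewrite mulrAC.
    + by rewrite -mulrA mulrDl.
    + by apply: le_trans e3 _; rewrite !mulrA [leLHS]mulrAC.
  apply/eqP; rewrite -subr_eq0 opprK -normr_eq0; apply/eqP.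
  apply: (@small_eq0 _ _ 1) => // e e0; rewrite mul1r.
  have [n Hn] := half_exp_small K e0; exact: le_trans (key n) (ltW (Hn n (leqnn n))).
- apply: (@small_eq0 _ _ 1) => [|e e0]; first exact: sqrtr_ge0.
  have [n Hn] := half_exp_small (2 * M) e0; rewrite mul1r.
  apply: le_trans _ (ltW (Hn n (leqnn n))); apply: le_trans _ (hu n 0 zT).
  have Un0 : nU (U n 0) = 0 by case: (sol n) => _ [].
  rewrite (sn_sym sU ((cU' n).1 0 zT) (cu.1 0 zT)).
  have := sn_dist sU (cu.1 0 zT) ((cU' n).1 0 zT) (sn_D0 sU).
  by rewrite !subr0 Un0 addr0.
- apply: (@small_eq0 _ _ 1) => [|e e0]; first exact: sqrtr_ge0.
  have [n Hn] := half_exp_small (2 * M) e0; rewrite mul1r.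
  apply: le_trans _ (ltW (Hn n (leqnn n))); apply: le_trans _ (hu1 n 0 zT).
  have Un0 : nR (U1 n 0) = 0 by case: (sol n) => _ [].
  rewrite (sn_sym sR ((cU1 n).1 0 zT) (cu1.1 0 zT)).
  have := sn_dist sR (cu1.1 0 zT) ((cU1 n).1 0 zT) (sn_D0 sR).
  by rewrite !subr0 Un0 addr0.
Qed.

Lemma bounded_solution_lin a z z' M M' : Zspace P z -> Zspace P z' ->
  bounded_solution z M -> bounded_solution z' M' ->
  bounded_solution (a *: z + z') (`|a| * M + M').
Proof.
move=> Zz Zz' [u [p [u1 [v1 [v2 [s b]]]]]] [u' [p' [u1' [v1' [v2' [s' b']]]]]].
do 5 eexists; split; first exact: (weak_solution_lin a Zz Zz' s s').
have h (V : lmodType R) (D : set V) (N : V -> R) v v' : seminormed D N -> D v -> D v' ->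
    N v <= M -> N v' <= M' -> N (a *: v + v') <= `|a| * M + M'.
  move=> sN Dv Dv' h1 h2; apply: le_trans (sn_tri sN (sn_DZ sN a Dv) Dv') _.
  by rewrite (sn_Z sN a Dv); apply: lerD => //; apply: ler_wpM2l.
case: s => [[cu [_ cu1 _] [[_ cv1 _] [_ cv2 _]] cp] _].
case: s' => [[cu' [_ cu1' _] [[_ cv1' _] [_ cv2' _]] cp'] _].
move=> t tT; have [b1 b2 b3 b4 b5] := b t tT; have [b1' b2' b3' b4' b5'] := b' t tT; split.
- exact: (h _ _ _ _ _ sU (cu.1 t tT) (cu'.1 t tT)).
- exact: (h _ _ _ _ _ sG (cp.1 t tT) (cp'.1 t tT)).
- exact: (h _ _ _ _ _ sR (cu1.1 t tT) (cu1'.1 t tT)).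
- exact: (h _ _ _ _ _ sV (cv1.1 t tT) (cv1'.1 t tT)).
- exact: (h _ _ _ _ _ sV (cv2.1 t tT) (cv2'.1 t tT)).
Qed.

Lemma bounded_solution_le z M M' : bounded_solution z M -> M <= M' -> bounded_solution z M'.
Proof.
move=> [u [p [u1 [v1 [v2 [s b]]]]]] MM; exists u, p, u1, v1, v2; split => // t tT.
by have [b1 b2 b3 b4 b5] := b t tT; split; exact: le_trans MM.
Qed.

Lemma weak_solution_bounded z u p u1 v1 v2 : weak_solution z u p u1 v1 v2 ->
  exists M, bounded_solution z M.
Proof.
move=> s; have [[cu [_ cu1 _] [[_ cv1 _] [_ cv2 _]] cp] _] := s.
have [M1 H1] := C0_time_bounded T0 sU cu; have [M2 H2] := C0_time_bounded T0 sG cp.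
have [M3 H3] := C0_time_bounded T0 sR cu1; have [M4 H4] := C0_time_bounded T0 sV cv1.
have [M5 H5] := C0_time_bounded T0 sV cv2.
exists (\big[Num.max/0]_(m <- [:: M1; M2; M3; M4; M5]) m); exists u, p, u1, v1, v2.
rewrite !big_cons big_nil; split => // t tT.
split; rewrite !le_max ?H1 ?H2 ?H3 ?H4 ?H5 ?orbT//.
Qed.

Lemma bounded_solution0 : bounded_solution 0 0.
Proof.
do 5 eexists; split; first exact: weak_solution0.
by move=> t tT; rewrite (sn_0 sU) (sn_0 sG) (sn_0 sR) (sn_0 sV).
Qed.

(** Zabreiko's lemma yields some solution bounded by K e for every e above the norm of z; uniqueness
    identifies it with S z. *)
Lemma solution_operator_bound S : solution_operator P S ->
  exists2 K, 0 < K & forall z t, Zspace P z -> t \in `[0, T] -> nU (S z t) <= K * Znorm P z.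
Proof.
move=> hS.
have alg (k x y : R) : 0 < k -> x < y / k -> y <= k * x -> False.
  by move=> k0; rewrite ltr_pdivlMr// mulrC => xy yx; have := lt_le_trans xy yx; rewrite ltxx.
have [K K0 HK] := @zabreiko _ _ _ _ sZn Zspace_complete bounded_solution bounded_solution0
  (fun z Zz => let: ex_intro2 psi (ex_intro u1 (ex_intro v1 (ex_intro v2 s))) _ := hS z Zz in
     weak_solution_bounded s)
  bounded_solution_le bounded_solution_lin bounded_solution_series.
exists K => // z t Zz tT; rewrite leNgt; apply/negP => h.
have lt : Znorm P z < nU (S z t) / K by rewrite ltr_pdivlMr// mulrC.
(* The conclusion of [zabreiko] needs e strictly above the norm of z, and the contradiction needs it
   strictly below nU (S z t) / K. *)
pose e := (Znorm P z + nU (S z t) / K) / 2.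
have e1 : Znorm P z < e by rewrite /e; move: lt; move: (Znorm P z) (_ / K) => x y; lra.
have e2 : e < nU (S z t) / K by rewrite /e; move: lt; move: (Znorm P z) (_ / K) => x y; lra.
have [u [p [u1 [v1 [v2 [s b]]]]]] := HK z e Zz e1.
have [psi [u1' [v1' [v2' [[cS _ _ _] _]]]] uniq] := hS z Zz.
have [un _] := uniq u p (ex_intro _ u1 (ex_intro _ v1 (ex_intro _ v2 s))) t tT.
have [b1 _ _ _ _] := b t tT.
have cu : C0_time T (H1D P) nU u by case: s => [[]].
have e3 := sn_null sU (cu.1 t tT) (cS.1 t tT) un.
rewrite e3 in b1; exact: alg K0 e2 b1.
Qed.

End solutions.

(** * The control problem *)

(** For h with values in [a, b] the distance of f to the interval is at most |h - f| pointwise, so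
    its square has arbitrarily small integral and vanishes almost everywhere. *)
Lemma L2_interval_closed (disp : measure_display) (X : measurableType disp) (R : realType)
    (mu : {measure set X -> \bar R}) (D : set X) (mD : measurable D) (a b : R) (f : X -> R) :
  L2 mu D f ->
  (forall e, 0 < e -> exists2 h, L2 mu D h /\ {ae mu, forall x, D x -> a <= h x <= b} &
     L2norm mu D (h - f) < e) ->
  {ae mu, forall x, D x -> a <= f x <= b}.
Proof.
move=> Lf H.
(* twice the distance to the interval [a, b] *)
pose phi y : R := `|y - a| + `|y - b| - (b - a).
have phi_le y h : a <= h <= b -> `|phi y| <= 2 * `|h - y|.
  move=> /andP[ah hb]; have phi0 : 0 <= phi y.
    by rewrite /phi; have := ler_norm (y - a); have := ler_norm (b - y); rewrite distrC; lra.
  rewrite ger0_norm// /phi; have := ler_distD h y a; have := ler_distD h y b.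
  rewrite [`|y - h|]distrC (ger0_norm (ltac:(lra) : 0 <= h - a)) [`|h - b|]distrC.
  by rewrite (ger0_norm (ltac:(lra) : 0 <= b - h)); lra.
have mphi : measurable_fun setT (fun y => phi y ^+ 2).
  have mn c : measurable_fun setT (fun y : R => `|y - c|).
    have mb := measurable_funB (@measurable_id _ R setT) (measurable_cst c).
    exact: (measurableT_comp (@normr_measurable R setT) mb).
  by apply: measurable_funX; apply: measurable_funB; [exact: measurable_funD|exact: measurable_cst].
have mf : aemeas mu D (fun x => phi (f x) ^+ 2).
  by apply: (aemeas_comp mphi); apply: meas_aemeas; case: Lf.
have sL := L2_seminormed mu mD.
have bound h : L2 mu D h -> {ae mu, forall x, D x -> a <= h x <= b} ->
    aeint mu D (fun x => phi (f x) ^+ 2) /\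
    \int[mu]_(x in D) phi (f x) ^+ 2 <= 4 * L2norm mu D (h - f) ^+ 2.
  move=> Lh ahb; have Lhf := sn_DB sL Lh Lf.
  have [i1 e1] := aeintZ mD 4 (L2_sq_aeint mD Lhf).
  have le : {ae mu, forall x, D x -> phi (f x) ^+ 2 <= 4 * (h - f) x ^+ 2}.
    apply: filterS ahb => x ab Dx; have := phi_le (f x) _ (ab Dx).
    rewrite -[leLHS]ger0_norm// -ler_sqr ?nnegrE ?mulr_ge0// !normr_id exprMn.
    by rewrite !real_normK ?num_real// -[2 ^+ 2]/(2 * 2) => /le_trans; apply; rewrite !fctE; lra.
  have i2 : aeint mu D (fun x => phi (f x) ^+ 2).
    apply: (aeint_dom mD mf i1); apply: filterS le => x le Dx.
    by rewrite ger0_norm ?sqr_ge0//; exact: le.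
  by split => //; rewrite (L2norm_sq mD Lhf) -e1; exact: ae_le_Rintegral.
have [h0 [Lh0 ah0] _] := H 1 ltr01; have [iphi _] := bound h0 Lh0 ah0.
have int0 : \int[mu]_(x in D) phi (f x) ^+ 2 = 0.
  apply: (@small_eq0 _ _ 1) => [|e e0]; first by apply: Rintegral_ge0 => x _; exact: sqr_ge0.
  (* With r <= 1 one has 4 r^2 <= 4 r <= e. *)
  rewrite mul1r; pose r := Num.min 1 (e / 4).
  have r0 : 0 < r by rewrite lt_min ltr01 divr_gt0.
  have r1 : r <= 1 by rewrite ge_min lexx.
  have r2 : r <= e / 4 by rewrite ge_min lexx orbT.
  have [h [Lh ah] hf] := H r r0; have [_ le] := bound h Lh ah.
  apply: le_trans le _; have := sqrtr_ge0 (L2ip mu D (h - f) (h - f)).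
  rewrite -/(L2norm mu D (h - f)); move: hf; move: (L2norm mu D (h - f)) => y hf y0.
  by clearbody r; nra.
have := ae_Rintegral_eq0 mD iphi _ int0; move=> /(_ (aeW _ (fun x _ => sqr_ge0 _))).
apply: filterS => x phi0 Dx; have /eqP := phi0 Dx; rewrite sqrf_eq0 => /eqP; rewrite /phi.
have := ler_norm (f x - a); have := ler_norm (f x - b).
have := ler_norm (- (f x - a)); have := ler_norm (- (f x - b)); rewrite !normrN.
have := normr_ge0 (f x - a); have := normr_ge0 (f x - b).
move: `|f x - a| `|f x - b| => p q *; apply/andP; split; lra.
Qed.

Lemma bounded_linear_comb (R : realType) (V W : lmodType R) (D : set V) (N : V -> R)
    (D' : set W) (N' : W -> R) (A : V -> W) a b v w :
  seminormed D N -> seminormed D' N' -> bounded_linear_operator D N D' N' A -> D v -> D w ->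
  N' (A (a *: v + b *: w) - (a *: A v + b *: A w)) = 0.
Proof.
move=> sN sN' bA Dv Dw; have [DA Alin _] := bA.
have [M _ [HM _]] := bounded_linear_dist sN sN' bA.
have D0 := sn_D0 sN; have Dbw := sn_DZ sN b Dw; have Dc := sn_Dlin sN a Dv Dbw.
have A0 : N' (A 0) = 0.
  apply/eqP; rewrite eq_le (sn_ge0 sN' (DA _ D0)) andbT.
  by have := HM _ D0; rewrite (sn_0 sN) mulr0.
have Abw : N' (A (b *: w) - b *: A w) = 0.
  have := Alin b w 0 Dw D0; rewrite addr0 opprD addrA => e0.
  have D1 := sn_DB sN' (DA _ Dbw) (sn_DZ sN' b (DA _ Dw)).
  rewrite -e0; apply: (sn_null sN' D1 (sn_DB sN' D1 (DA _ D0))).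
  by rewrite opprB addrC subrK.
have D2 := sn_DD sN' (sn_DZ sN' a (DA _ Dv)) (DA _ Dbw).
have D3 := sn_DD sN' (sn_DZ sN' a (DA _ Dv)) (sn_DZ sN' b (DA _ Dw)).
apply/eqP; rewrite eq_le (sn_ge0 sN' (sn_DB sN' (DA _ Dc) D3)) andbT.
apply: le_trans (sn_dist sN' (DA _ Dc) D2 D3) _.
by rewrite (Alin a v _ Dv Dbw) add0r opprD addrACA subrr add0r Abw.
Qed.

Lemma squares_continuous (R : realType) (V : lmodType R) (D : set V) (N p q f : V -> R) a b L :
  seminormed D N -> 0 <= a -> 0 <= b -> 0 <= L ->
  (forall v, D v -> 0 <= p v) -> (forall v, D v -> 0 <= q v) ->
  (forall v w, D v -> D w -> `|p w - p v| <= L * N (w - v)) ->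
  (forall v w, D v -> D w -> `|q w - q v| <= L * N (w - v)) ->
  (forall v, D v -> f v = a * p v ^+ 2 + b * q v ^+ 2) -> seminorm_continuous D N f.
Proof.
move=> sN a0 b0 L0 p0 q0 pL qL fE v Dv e e0.
have sq (x y del : R) : 0 <= x -> 0 <= del -> del <= 1 -> `|y - x| <= L * del ->
    `|y ^+ 2 - x ^+ 2| <= L * (2 * x + L) * del.
  move=> x0 d0 d1 h; rewrite subr_sqr normrM.
  apply: (@le_trans _ _ (L * del * (2 * x + L))); last by rewrite mulrAC.
  apply: ler_pM => //; rewrite (_ : y + x = (y - x) + 2 * x); last by ring.
  apply: le_trans (ler_normD _ _) _; rewrite (@ger0_norm _ (2 * x)) ?mulr_ge0// addrC lerD2l.
  by apply: le_trans h _; rewrite ler_piMr.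
(* A local Lipschitz constant: it is valid for increments of norm at most 1 at v, where p and q move
   by at most L. *)
pose B := a * (L * (2 * p v + L)) + b * (L * (2 * q v + L)).
have B0 : 0 <= B.
  by rewrite addr_ge0// mulr_ge0// mulr_ge0// addr_ge0// mulr_ge0// ?p0// q0.
have B1 : 0 < B + 1 by rewrite ltr_wpDl.
exists (Num.min 1 (e / (B + 1))); first by rewrite lt_min ltr01 divr_gt0.
move=> w Dw; rewrite lt_min => /andP[d1]; rewrite ltr_pdivlMr// => de.
have d0 := sn_ge0 sN (sn_DB sN Dw Dv).
have h1 := sq _ _ _ (p0 v Dv) d0 (ltW d1) (pL v w Dv Dw).
have h2 := sq _ _ _ (q0 v Dv) d0 (ltW d1) (qL v w Dv Dw).
apply: le_lt_trans de; rewrite (fE _ Dw) (fE _ Dv).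
rewrite (_ : _ - _ = a * (p w ^+ 2 - p v ^+ 2) + b * (q w ^+ 2 - q v ^+ 2)); last by ring.
apply: le_trans (ler_normD _ _) _; rewrite !normrM (ger0_norm a0) (ger0_norm b0).
apply: (@le_trans _ _ (N (w - v) * B)); last by rewrite ler_wpM2l// lerDl.
rewrite [leRHS]mulrC /B mulrDl -(mulrA a) -(mulrA b).
exact: lerD (ler_wpM2l a0 h1) (ler_wpM2l b0 h2).
Qed.

Section control_problem.
Context (R : realType) (d : nat) (P : setting R d).
Local Notation E := 'rV[R]_d.
Local Notation Om := (Om P).
Local Notation T := (Tf P).
Local Notation leb := (@lebesgue_measure R).
Local Notation I := (`[0, T]%classic : set R).
Context (S : (R -> E -> R) -> (R -> E -> 'rV[R]_d)) (hS : solution_operator P S).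

Let T0 : 0 < T := Tf_gt0 P.
Let mI : @measurable _ (measurableTypeR R) I. Proof. exact: measurable_itv. Qed.
Let finI : (leb I < +oo)%E. Proof. by rewrite (leb_itv T0) ltry. Qed.
Let sU := H1D_seminormed P.
Let sr := rho_semi_inner P.
Let sZ := Zspace_seminormed P.

Lemma solution_operator_Uspace z : Zspace P z -> Uspace P (S z).
Proof. by move=> Zz; have [psi [u1 [v1 [v2 [[cu _ _ _] _]]]] _] := hS Zz. Qed.

(** The combination of the two solutions solves the problem with the combined data, and uniqueness
    compares it with S at these data. *)
Lemma solution_operator_lin a z z' t : Zspace P z -> Zspace P z' -> t \in `[0, T] ->
  H1normv Om (S (a *: z + z') t - (a *: S z t + S z' t)) = 0.
Proof.
move=> Zz Zz' tT.
have [psi [u1 [v1 [v2 s]]] _] := hS Zz; have [psi' [u1' [v1' [v2' s']]] _] := hS Zz'.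
have [psi0 _ uniq] := hS (sn_Dlin sZ a Zz Zz').
have [e _] := uniq _ _ (ex_intro _ _ (ex_intro _ _ (ex_intro _ _ (weak_solution_lin a Zz Zz' s s')))) t tT.
have D1 := (solution_operator_Uspace (sn_Dlin sZ a Zz Zz')).1 t tT.
have D2 := sn_Dlin sU a ((solution_operator_Uspace Zz).1 t tT) ((solution_operator_Uspace Zz').1 t tT).
by rewrite (sn_sym sU D1 D2).
Qed.

Lemma Uspace_aeint u : Uspace P u -> aeint leb I (fun t => H1normv Om (u t) ^+ 2).
Proof.
move=> cu; have c := C0_time_norm T0 sU cu.
have c2 : continuous (fun t => H1normv Om (u (clamp T t)) ^+ 2).
  by move=> t; apply: cvgM; exact: c.
have i := continuous_aeint 0 T c2.
have e : {ae leb, forall t, I t -> H1normv Om (u (clamp T t)) ^+ 2 = H1normv Om (u t) ^+ 2}.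
  by apply: aeW => t It; rewrite clamp_id.
exact: (aeint_eq e i).
Qed.

Lemma solution_operator_bounded :
  bounded_linear_operator (Zspace P) (Znorm P) (Uspace P) (Unorm P) S.
Proof.
split; first exact: solution_operator_Uspace.
- move=> a z z' Zz Zz'; rewrite /Unorm.
  have e : {ae leb, forall t, I t ->
      H1normv Om ((S (a *: z + z') - (a *: S z + S z')) t) ^+ 2 = 0}.
    apply: aeW => t It; rewrite (_ : H1normv _ _ = 0) ?expr0n//.
    exact: solution_operator_lin.
  by rewrite (Rintegral_ae e) (Rintegral_itv_cst T0) mulr0 sqrtr0.
- have [K K0 HK] := solution_operator_bound hS.
  exists (Num.sqrt T * K) => z Zz.
  have Z0 := sn_ge0 sZ Zz.
  have KZ : 0 <= K * Znorm P z by rewrite mulr_ge0// ltW.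
  have int : \int[leb]_(t in I) (H1normv Om (S z t) ^+ 2) <= T * (K * Znorm P z) ^+ 2.
    rewrite -(Rintegral_itv_cst T0); apply: (@ae_le_Rintegral _ _ _ leb I mI).
    - exact: Uspace_aeint (solution_operator_Uspace Zz).
    - exact: (@aeint_cst _ _ _ leb I mI _ finI).
    - apply: aeW => t It; apply: lerXn2r; rewrite ?nnegrE//; first exact: sqrtr_ge0.
      exact: HK.
  rewrite -mulrA -ler_sqr ?nnegrE ?sqrtr_ge0//; last by apply: mulr_ge0 => //; exact: sqrtr_ge0.
  rewrite exprMn (sqr_sqrtr (ltW T0)) sqr_sqrtr//.
  by apply: Rintegral_ge0 => t _; exact: sqr_ge0.
Qed.

(** Convergence in Z is uniform in time by [Zspace_sup], so the constraint at each t reduces to the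
    closedness of an interval constraint in L2 of the boundary. *)
Lemma Zad_closed za zb : seminorm_closed (Zspace P) (Znorm P) (Zad P za zb).
Proof.
move=> z Zz H; split => // t tT; have [cz _ _] := Zz.
apply: (L2_interval_closed (boundary_measurable P)); first by have [] := cz.1 t tT.
move=> e e0; have sT : 0 < Num.sqrt T by rewrite sqrtr_gt0.
have [y [Zy yab] yz] := H _ (divr_gt0 e0 sT); exists (y t).
  by split; [have [[h _] _ _] := Zy; case: (h t tT)|exact: yab].
apply: le_lt_trans (Zspace_sup (sn_DB sZ Zy Zz) tT) _.
by rewrite mulrC -ltr_pdivlMr.
Qed.

Lemma Zad_convex za zb : convex_subset (Zad P za zb).
Proof.
move=> t y z /andP[t0 t1] [Zy ya] [Zz zab]; split.
  by apply: (sn_DD sZ); exact: (sn_DZ sZ).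
move=> s sT; apply: filterS2 (ya s sT) (zab s sT) => x hy hz Gx.
have /andP[y1 y2] := hy Gx; have /andP[z1 z2] := hz Gx.
rewrite (_ : (t *: y + (1 - t) *: z) s x = t * y s x + (1 - t) * z s x)//.
have t1' : 0 <= 1 - t by rewrite subr_ge0.
have := ler_wpM2l t0 y1; have := ler_wpM2l t0 y2.
have := ler_wpM2l t1' z1; have := ler_wpM2l t1' z2.
by move: (y s x) (z s x) => p q *; apply/andP; split; lra.
Qed.

Lemma Zad0 za zb : za <= 0 -> 0 <= zb -> Zad P za zb 0.
Proof.
move=> za0 zb0; split; first exact: (sn_D0 sZ).
by move=> t tT; apply: aeW => x Gx; apply/andP; split.
Qed.

(** * The cost functional *)

Section cost_functional.
Context (ud : R -> E -> 'rV[R]_d) (hud : Uspace P ud) (alpha : R) (halpha : 0 < alpha).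
Local Notation J := (cost P S ud alpha).
Local Notation n2 := (ipnorm (ip_time T (ip_rho P))).
Local Notation L2t := (L2_time T (L2v Om) (norm_rho P)).

Let sT : semi_inner L2t (ip_time T (ip_rho P)) := L2_time_semi_inner T0 sr.
Let sTn := semi_inner_seminormed sT.

Let U_L2t u : Uspace P u -> L2t u.
Proof.
move=> cu; apply: (C0_L2_time T0 sr); have [C C0 HC] := norm_rho_H1normv P.
apply: (C0_time_map (A := id) sU (ltW C0) _ _ cu); first exact: H1D_L2v.
by move=> v w Hv Hw; apply: HC; exact: (sn_DB sU).
Qed.

Let F z : R -> E -> 'rV[R]_d := S z - ud.

Let F_L2t z : Zspace P z -> L2t (F z).
Proof.
move=> Zz; apply: (sn_DB sTn); first exact/U_L2t/solution_operator_Uspace.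
exact: U_L2t.
Qed.

Lemma costE z : Zspace P z -> J z = 2^-1 * n2 (F z) ^+ 2 + alpha / 2 * Znorm P z ^+ 2.
Proof.
move=> Zz; rewrite (ip_time_sq T0 sr (F_L2t Zz)) (@sqr_sqrtr _ (\int[leb]_(t in I) _))//.
by apply: Rintegral_ge0 => t _; exact: sqr_ge0.
Qed.

Let n2_le u M : 0 <= M -> L2t u -> (forall t, t \in `[0, T] -> norm_rho P (u t) <= M) ->
  n2 u <= Num.sqrt T * M.
Proof.
move=> M0 Lu uM.
rewrite -ler_sqr ?nnegrE ?sqrtr_ge0//; last by apply: mulr_ge0 => //; exact: sqrtr_ge0.
rewrite exprMn (sqr_sqrtr (ltW T0)) (ip_time_sq T0 sr Lu) -(Rintegral_itv_cst T0).
apply: (@ae_le_Rintegral _ _ _ leb I mI).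
- exact: L2_time_aeint Lu.
- exact: (@aeint_cst _ _ _ leb I mI _ finI).
- by apply: aeW => t It; apply: lerXn2r; rewrite ?nnegrE//; [exact: sqrtr_ge0|exact: uM].
Qed.

(** The tracking term lives in the Hilbert space L2(0, T; L2_rho), where the parallelogram identity
    is available, so S is needed as an operator into that space too. *)
Let S_bounded : bounded_linear_operator (Zspace P) (Znorm P) L2t n2 S.
Proof.
have [K K0 HK] := solution_operator_bound hS; have [C C0 HC] := norm_rho_H1normv P.
split=> [z Zz|a z z' Zz Zz'|]; first exact/U_L2t/solution_operator_Uspace.
  have Zl := sn_Dlin sZ a Zz Zz'.
  have Ul := solution_operator_Uspace Zl; have Uz := solution_operator_Uspace Zz.
  have Uz' := solution_operator_Uspace Zz'.
  apply/eqP; rewrite eq_le sqrtr_ge0 andbT -(mulr0 (Num.sqrt T)); apply: n2_le => [||t tT].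
  - exact: lexx.
  - by apply: (sn_DB sTn (U_L2t Ul)); exact: (sn_Dlin sTn a (U_L2t Uz) (U_L2t Uz')).
  - have Dd := sn_DB sU (Ul.1 t tT) (sn_Dlin sU a (Uz.1 t tT) (Uz'.1 t tT)).
    by apply: le_trans (HC _ Dd) _; rewrite (solution_operator_lin a Zz Zz' tT) mulr0.
exists (Num.sqrt T * (C * K)) => z Zz; have Uz := solution_operator_Uspace Zz.
rewrite -!mulrA; apply: n2_le => [||t tT].
- by apply: mulr_ge0; [exact: ltW|apply: mulr_ge0; [exact: ltW|exact: (sn_ge0 sZ)]].
- exact: U_L2t.
- by apply: le_trans (HC _ (Uz.1 t tT)) _; apply: (ler_wpM2l (ltW C0)); exact: HK.
Qed.

(** The weights sum to 1, so the copies of [ud] cancel and only the linearity of S up to null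
    elements remains. *)
Let F_affine t z y : Zspace P z -> Zspace P y ->
  n2 (F (t *: z + (1 - t) *: y) - (t *: F z + (1 - t) *: F y)) = 0.
Proof.
move=> Zz Zy; rewrite -[RHS](bounded_linear_comb t (1 - t) sZ sTn S_bounded Zz Zy).
congr (n2 _); rewrite /F !scalerBr addrACA -opprD -scalerDl [t + _]addrC subrK scale1r.
by rewrite opprB addrA subrK.
Qed.

(** Both terms are squared Hilbert norms of affine images of z, so the defect of convexity is
    explicit; convexity, strict convexity and uniform convexity are read off from it. *)
Lemma cost_convex_eq t z y : Zspace P z -> Zspace P y ->
  J (t *: z + (1 - t) *: y) = t * J z + (1 - t) * J y -
    t * (1 - t) * (2^-1 * n2 (F z - F y) ^+ 2 + alpha / 2 * Znorm P (z - y) ^+ 2).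
Proof.
move=> Zz Zy; have Zt := sn_DD sZ (sn_DZ sZ t Zz) (sn_DZ sZ (1 - t) Zy).
have Fz := F_L2t Zz; have Fy := F_L2t Zy; have Ft := F_L2t Zt.
have FF : L2t (t *: F z + (1 - t) *: F y).
  by apply: (sn_DD sTn); apply: (sn_DZ sTn).
have eF : n2 (F (t *: z + (1 - t) *: y)) ^+ 2 = t * n2 (F z) ^+ 2 +
    (1 - t) * n2 (F y) ^+ 2 - t * (1 - t) * n2 (F z - F y) ^+ 2.
  exact: etrans (congr1 (fun x => x ^+ 2) (sn_null sTn Ft FF (F_affine t Zz Zy)))
    (ipnorm_convex sT t Fz Fy).
have eZ : Znorm P (t *: z + (1 - t) *: y) ^+ 2 = t * Znorm P z ^+ 2 +
    (1 - t) * Znorm P y ^+ 2 - t * (1 - t) * Znorm P (z - y) ^+ 2.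
  by rewrite ZnormE; exact: (ipnorm_convex (Zspace_semi_inner P) t Zz Zy).
(* The norms are abstracted to real variables, which reduces the claim to a ring identity. *)
have alg (k l jt jz jy nt nz ny nd mt mz my md : R) : jt = k * nt + l * mt ->
    jz = k * nz + l * mz -> jy = k * ny + l * my ->
    nt = t * nz + (1 - t) * ny - t * (1 - t) * nd ->
    mt = t * mz + (1 - t) * my - t * (1 - t) * md ->
    jt = t * jz + (1 - t) * jy - t * (1 - t) * (k * nd + l * md).
  by move=> -> -> -> -> ->; ring.
exact: alg (costE Zt) (costE Zz) (costE Zy) eF eZ.
Qed.

Lemma cost_ge0 z : Zspace P z -> 0 <= J z.
Proof.
move=> Zz; rewrite (costE Zz) addr_ge0// mulr_ge0 ?sqr_ge0//.
by rewrite divr_ge0// ltW.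
Qed.

Lemma cost_coercive : coercive (Zspace P) (Znorm P) J.
Proof.
(* The summand 1 allows squaring: y > x + 1 with x >= 0 implies y^2 > x, and the control term alone
   then exceeds M. *)
move=> M; exists (2 * (`|M| + 1) / alpha + 1) => z Zz h.
rewrite (costE Zz); have M0 := normr_ge0 M; have := ler_norm M; move=> MM.
have a0 : 0 <= 2 * (`|M| + 1) / alpha by rewrite divr_ge0 ?ltW// mulr_gt0// ltr_wpDl.
have sq : 2 * (`|M| + 1) / alpha < Znorm P z ^+ 2.
  by move: h a0; move: (_ / alpha) (Znorm P z) => x y h a0; nra.
apply: (@lt_le_trans _ _ (alpha / 2 * Znorm P z ^+ 2)); last by rewrite lerDr mulr_ge0// sqr_ge0.
rewrite ltr_pdivrMr// in sq; move: sq; move: (Znorm P z ^+ 2) => x; lra.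
Qed.

Lemma cost_continuous : seminorm_continuous (Zspace P) (Znorm P) J.
Proof.
have [M M0 [_ HM]] := bounded_linear_dist sZ sTn S_bounded.
have FF z y : F z - F y = S z - S y by rewrite /F opprB addrA subrK.
have h20 : 0 <= 2^-1 :> R by rewrite invr_ge0.
have ha0 : 0 <= alpha / 2 by rewrite divr_ge0// ltW.
have M10 : 0 <= M + 1 by rewrite addr_ge0.
apply: (squares_continuous (p := fun z => n2 (F z)) sZ h20 ha0 M10 _ (sn_ge0 sZ) _ _ costE).
- by move=> z _; exact: sqrtr_ge0.
- move=> z y Zz Zy; apply: le_trans (sn_lip sTn (F_L2t Zy) (F_L2t Zz)) _.
  rewrite FF; apply: le_trans (HM _ _ Zy Zz) _; apply: ler_wpM2r; last by rewrite lerDl.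
  exact: (sn_ge0 sZ (sn_DB sZ Zy Zz)).
- move=> z y Zz Zy; apply: le_trans (sn_lip sZ Zy Zz) _.
  by rewrite ler_peMl ?lerDr//; exact: (sn_ge0 sZ (sn_DB sZ Zy Zz)).
Qed.

Lemma cost_convex t z y : Zspace P z -> Zspace P y -> 0 <= t <= 1 ->
  J (t *: z + (1 - t) *: y) <= t * J z + (1 - t) * J y.
Proof.
move=> Zz Zy /andP[t0 t1]; rewrite (cost_convex_eq t Zz Zy) gerBl.
apply: mulr_ge0; first by rewrite mulr_ge0// subr_ge0.
apply: addr_ge0; apply: mulr_ge0; rewrite ?sqr_ge0 ?invr_ge0//.
by rewrite divr_ge0// ltW.
Qed.

Lemma cost_strictly_convex : strictly_convex (Zspace P) (Znorm P) J.
Proof.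
move=> z y t Zz Zy Nzy /andP[t0 t1]; rewrite (cost_convex_eq t Zz Zy) ltrBlDr ltrDl.
apply: mulr_gt0; first by rewrite mulr_gt0// subr_gt0.
have N0 : 0 < Znorm P (z - y) ^+ 2 by rewrite exprn_even_gt0.
apply: ltr_wpDl; first by apply: mulr_ge0; rewrite ?sqr_ge0 ?invr_ge0.
by apply: mulr_gt0 => //; rewrite divr_gt0.
Qed.

Lemma cost_unif_convex z y : Zspace P z -> Zspace P y ->
  alpha / 8 * Znorm P (z - y) ^+ 2 <=
  2^-1 * J z + 2^-1 * J y - J (2^-1 *: z + (1 - 2^-1) *: y).
Proof.
move=> Zz Zy; rewrite (cost_convex_eq 2^-1 Zz Zy).
have := sqr_ge0 (n2 (F z - F y)); move: (n2 _ ^+ 2) (Znorm P _ ^+ 2) (J z) (J y) => a b c e a0.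
(* The factor is t (1 - t) alpha / 2 at t = 1/2. *)
rewrite (_ : alpha / 8 = 2^-1 * (1 - 2^-1) * (alpha / 2)); last by field.
move: (alpha / 2) => k; lra.
Qed.

End cost_functional.
End control_problem.

Theorem theorem3p2 (R : realType) (d : nat) (P : setting R d)
    (S : (R -> 'rV[R]_d -> R) -> (R -> 'rV[R]_d -> 'rV[R]_d))
    (hS : solution_operator P S)
    (za zb : R) (hza : za <= 0) (hzb : 0 <= zb)
    (ud : R -> 'rV[R]_d -> 'rV[R]_d) (hud : Uspace P ud)
    (hud0 : H1normv (Om P) (ud 0) = 0)
    (alpha : R) (halpha : 0 < alpha) :
  [/\ bounded_linear_operator (Zspace P) (Znorm P) (Uspace P) (Unorm P) S,
      [/\ seminorm_closed (Zspace P) (Znorm P) (Zad P za zb),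
          convex_set (Zad P za zb) &
          weakly_closed (Zspace P) (Znorm P) (Zad P za zb)],
      [/\ seminorm_continuous (Zspace P) (Znorm P) (cost P S ud alpha),
          convex_function (Zspace P) (cost P S ud alpha),
          strictly_convex (Zspace P) (Znorm P) (cost P S ud alpha) &
          weakly_lower_semicontinuous (Zspace P) (Znorm P) (cost P S ud alpha)],
      coercive (Zspace P) (Znorm P) (cost P S ud alpha) &
      exists2 z, Zad P za zb z /\
                 (forall y, Zad P za zb y -> cost P S ud alpha z <= cost P S ud alpha y) &
        forall z', Zad P za zb z' ->
          (forall y, Zad P za zb y -> cost P S ud alpha z' <= cost P S ud alpha y) ->
          Znorm P (z' - z) = 0].
Proof.
have cont := cost_continuous hS hud halpha.
have sub : Zad P za zb `<=` Zspace P by move=> z [].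
have cZ := @Zspace_complete R d P; have sZ := Zspace_seminormed P.
split.
- exact: solution_operator_bounded.
- split; first exact: Zad_closed.
    move=> y z k /set_mem Zy /set_mem Zz; apply/mem_set.
    by apply: Zad_convex => //; rewrite ge0 le1.
  (* Mazur's theorem is stated for norms of inner products, so [Znorm] is first recognized as
     one. *)
  move: cZ (@Zad_closed R d P za zb); rewrite ZnormE => cZ cl.
  exact: (closed_convex_weakly_closed (Zspace_semi_inner P) cZ sub cl (@Zad_convex R d P za zb)).
- split => //.
  + move=> t y z /set_mem Zy /set_mem Zz.
    by apply: (cost_convex hS hud halpha Zy Zz); rewrite ge0 le1.
  + exact: cost_strictly_convex.
  + move: cZ cont; rewrite ZnormE => cZ cont.
    apply: (convex_continuous_wlsc (Zspace_semi_inner P) cZ cont) => t y z Zy Zz.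
    exact: cost_convex.
- exact: cost_coercive.
- have a8 : 0 < alpha / 8 by rewrite divr_gt0.
  apply: (unif_convex_min sZ cZ sub _ _ _ _ cont a8).
  + by exists 0; exact: Zad0.
  + exact: Zad_closed.
  + move=> y z Zy Zz; apply: Zad_convex => //; lra.
  + by move=> z /sub; exact: cost_ge0.
  + by move=> y z /sub Zy /sub; exact: cost_unif_convex.
Qed.
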